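(* Let $\mathbf u_0\in\mathbf K$, let $(\underline{\mathbf u}_{h,0},p_{h,0})=((\mathbf u_{h,0},\boldsymbol\omega_{h,0}),p_{h,0})$ be compatible discrete initial data associated with $\mathbf u_0$ (as defined in the context), and let $\mathbf f\in W^{1,1}(0,T;\mathbf H^{-1}(\Omega))$. Then there exists a unique solution $(\underline{\mathbf u}_h,p_h)=((\mathbf u_h,\boldsymbol\omega_h),p_h):[0,T]\to(\mathbf H^{\mathbf u}_h\times\mathbf H^{\boldsymbol\omega}_h)\times H^p_h$, with $\mathbf u_h\in W^{1,\infty}(0,T;\mathbf H^{\mathbf u}_h)$ and $(\mathbf u_h(0),\boldsymbol\omega_h(0))=(\mathbf u_{h,0},\boldsymbol\omega_{h,0})$, of the semidiscrete problem: for a.e. $t\in(0,T)$, $$\frac{\partial}{\partial t}[\mathcal E(\underline{\mathbf u}_h(t)),\underline{\mathbf v}_h]+[\mathcal A_h(\mathbf u_h(t))(\underline{\mathbf u}_h(t)),\underline{\mathbf v}_h]+[\mathcal B(\underline{\mathbf v}_h),p_h(t)]=(\mathbf f(t),\mathbf v_h)_\Omega\quad\forall\,\underline{\mathbf v}_h=(\mathbf v_h,\boldsymbol\psi_h)\in\mathbf H^{\mathbf u}_h\times\mathbf H^{\boldsymbol\omega}_h,$$ $$-[\mathcal B(\underline{\mathbf u}_h(t)),q_h]=0\quad\forall\,q_h\in H^p_h.$$ Moreover, there exists a constant $\widehat C_{\mathtt{KVr}}>0$ depending only on $|\Omega|,\|\mathbf i_\rho\|,\|\mathbf i_4\|,\nu,\mathtt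 D,\mathtt F$ and $\kappa$ such that $$\|\mathbf u_h\|_{L^\infty(0,T;\mathbf H^1(\Omega))}+\|\mathbf u_h\|_{L^2(0,T;\mathbf L^2(\Omega))}+\|\boldsymbol\omega_h\|_{L^2(0,T;\mathbf L^2(\Omega))}\le\widehat C_{\mathtt{KVr}}\sqrt{\exp(T)}\Big(\|\mathbf f\|_{L^2(0,T;\mathbf H^{-1}(\Omega))}+\|\mathbf u_0\|_{\mathbf H^1(\Omega)}+\|\mathbf u_0\|^2_{\mathbf H^1(\Omega)}+\|\mathbf u_0\|^{\rho-1}_{\mathbf H^1(\Omega)}\Big),$$ and a constant $\widehat C_{\mathtt{KVp}}>0$ depending only on $|\Omega|,\|\mathbf i_\rho\|,\|\mathbf i_4\|,\nu,\mathtt D,\mathtt F,\kappa$ and $\beta_{\mathtt d}$ such that $$\|p_h\|_{L^2(0,T;L^2(\Omega))}\le\widehat C_{\mathtt{KVp}}\sum_{j\in\{2,3,\rho\}}\Big\{\sqrt{\exp(T)}\Big(\|\mathbf f\|_{L^2(0,T;\mathbf H^{-1}(\Omega))}+\|\mathbf u_0\|_{\mathbf H^1(\Omega)}+\|\mathbf u_0\|^2_{\mathbf H^1(\Omega)}+\|\mathbf u_0\|^{\rho-1}_{\mathbf H^1(\Omega)}\Big)\Big\}^{j-1}.$$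
   Context: Let $\Omega\subset\mathbb R^d$, $d\in\{2,3\}$, be a bounded domain with Lipschitz boundary, $T>0$, and let $\kappa,\nu,\mathtt D,\mathtt F>0$ and $\rho\in[3,4]$ be given constants. Bold spaces are vector-valued versions of the scalar spaces; for the vorticity variable, $\mathbf L^2(\Omega)$ means $[L^2(\Omega)]^{d(d-1)/2}$. $L^2_0(\Omega)=\{q\in L^2(\Omega):(q,1)_\Omega=0\}$. $\mathbf{curl}(\mathbf v)=\partial_{x_1}v_2-\partial_{x_2}v_1$ if $d=2$ and $\nabla\times\mathbf v$ if $d=3$. $\|\mathbf v\|_{\mathbf H^1(\Omega)}^2=\|\mathbf v\|^2_{\mathbf L^2(\Omega)}+\|\nabla\mathbf v\|^2_{L^2(\Omega)}$; $\mathbf H^{-1}(\Omega)$ is the dual of $\mathbf H^1_0(\Omega)$; $(\cdot,\cdot)_\Omega$ is the $L^2(\Omega)$ inner product, also used for the $\mathbf H^{-1}$–$\mathbf H^1_0$ duality pairing. $(\nabla\mathbf v)_{ij}=\partial v_i/\partial x_j$. $\|\mathbf i_p\|$ is the norm of the continuous injection of $\mathbf H^1(\Omega)$ into $\mathbf L^p(\Omega)$. $\mathbf K:=\{\mathbf v\in\mathbf H^1_0(\Omega):\operatorname{div}(\mathbf v)=0\text{ in }\Omega\}$. Discrete spaces: $\mathcal T_h$ is a shape-regular triangulation of $\Omega$ into triangles ($d=2$) or tetrahedra ($d=3$) $K$ of diameter $h_K$, $h=\max_Kh_K$; $P_l(K)$ denotes polynomials of total degree at most $l$ on $K$; for an integer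 $k\ge1$, $$\mathbf H^{\mathbf u}_h=\{\mathbf v_h\in[C(\overline\Omega)]^d:\mathbf v_h|_K\in[P_{k+1}(K)]^d\ \forall K\in\mathcal T_h\}\cap\mathbf H^1_0(\Omega),\quad H^p_h=\{q_h\in C(\overline\Omega):q_h|_K\in P_k(K)\ \forall K\in\mathcal T_h\}\cap L^2_0(\Omega),$$ $$\mathbf H^{\boldsymbol\omega}_h=\{\boldsymbol\omega_h\in[C(\overline\Omega)]^{d(d-1)/2}:\boldsymbol\omega_h|_K\in[P_k(K)]^{d(d-1)/2}\ \forall K\in\mathcal T_h\}.$$ The pair $(\mathbf H^{\mathbf u}_h,H^p_h)$ satisfies the discrete inf-sup condition with a constant $\beta_{\mathtt d}>0$ independent of $h$: $\sup_{\mathbf 0\ne\mathbf v_h\in\mathbf H^{\mathbf u}_h}\frac{\int_\Omega q_h\operatorname{div}(\mathbf v_h)}{\|\mathbf v_h\|_{\mathbf H^1(\Omega)}}\ge\beta_{\mathtt d}\|q_h\|_{L^2(\Omega)}$ for all $q_h\in H^p_h$. Let $\mathbf K_h=\{\mathbf v_h\in\mathbf H^{\mathbf u}_h:(q_h,\operatorname{div}(\mathbf v_h))_\Omega=0\ \forall q_h\in H^p_h\}$. Operators: for $\underline{\mathbf u}=(\mathbf u,\boldsymbol\omega)$, $\underline{\mathbf v}=(\mathbf v,\boldsymbol\psi)$ and velocity field $\mathbf z$, $$[\mathcal E(\underline{\mathbf u}),\underline{\mathbf v}]:=(\mathbf u,\mathbf v)_\Omega+\kappa^2(\nabla\mathbf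 u,\nabla\mathbf v)_\Omega,\qquad[\mathcal B(\underline{\mathbf v}),q]:=-(q,\operatorname{div}(\mathbf v))_\Omega,$$ $$[\mathcal A_h(\mathbf z)(\underline{\mathbf u}),\underline{\mathbf v}]:=\mathtt D(\mathbf u,\mathbf v)_\Omega+\mathtt F(|\mathbf u|^{\rho-2}\mathbf u,\mathbf v)_\Omega+\nu(\boldsymbol\omega,\boldsymbol\psi)_\Omega+\nu(\boldsymbol\omega,\mathbf{curl}(\mathbf v))_\Omega-\nu(\boldsymbol\psi,\mathbf{curl}(\mathbf u))_\Omega+((\nabla\mathbf u)\mathbf z,\mathbf v)_\Omega+\tfrac12(\operatorname{div}(\mathbf z)\mathbf u,\mathbf v)_\Omega.$$ Compatible discrete initial data: given $\mathbf u_0\in\mathbf K$, let $\mathbf f_0\in\mathbf H^{-1}(\Omega)$ be $(\mathbf f_0,\mathbf v)_\Omega:=\nu(\nabla\mathbf u_0,\nabla\mathbf v)_\Omega+(\mathtt D\mathbf u_0+\mathtt F|\mathbf u_0|^{\rho-2}\mathbf u_0+(\nabla\mathbf u_0)\mathbf u_0,\mathbf v)_\Omega$. Then $\underline{\mathbf u}_{h,0}=(\mathbf u_{h,0},\boldsymbol\omega_{h,0})\in\mathbf K_h\times\mathbf H^{\boldsymbol\omega}_h$ satisfies $$[\mathcal A_h(\mathbf u_{h,0})(\underline{\mathbf u}_{h,0}),\underline{\mathbf v}_h]=(\mathbf f_{h,0},\mathbf v_h)_\Omega\quad\forall\,\underline{\mathbf v}_h=(\mathbf v_h,\boldsymbol\psi_h)\in\mathbf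 K_h\times\mathbf H^{\boldsymbol\omega}_h,$$ where $(\mathbf f_{h,0},\mathbf v_h)_\Omega:=(\mathbf f_0,\mathbf v_h)_\Omega+(\nabla\mathbf u_0,\nabla\mathbf v_h)_\Omega-(\nabla\mathbf u_{h,0},\nabla\mathbf v_h)_\Omega$, and $p_{h,0}\in H^p_h$ is the associated pressure, i.e. $(\nabla\mathbf u_{h,0},\nabla\mathbf v_h)_\Omega+[\mathcal A_h(\mathbf u_{h,0})(\underline{\mathbf u}_{h,0}),\underline{\mathbf v}_h]+[\mathcal B(\underline{\mathbf v}_h),p_{h,0}]=(\mathbf f_0,\mathbf v_h)_\Omega+(\nabla\mathbf u_0,\nabla\mathbf v_h)_\Omega$ for all $\underline{\mathbf v}_h\in\mathbf H^{\mathbf u}_h\times\mathbf H^{\boldsymbol\omega}_h$. *)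

(* Defs.v *)
From HB Require Import structures.
From mathcomp Require Import all_boot all_order all_algebra.
From mathcomp Require Import all_classical all_reals all_analysis.
From mathcomp Require Import measurable_realfun.
Set Implicit Arguments.
Unset Strict Implicit.
Unset Printing Implicit Defensive.
Import Order.TTheory GRing.Theory Num.Theory numFieldNormedType.Exports.
Local Open Scope classical_set_scope.
Local Open Scope ring_scope.

(* Lebesgue measure on 'rV[R]_n. Matrices carry the product (Borel)
   sigma-algebra generated by their coordinates, as n.-tuple does in the
   library; leb is defined by iterated integration (Cavalieri). *)
Fact mx_display : measure_display. Proof. exact: default_measure_display. Qed.

Section measurable_matrix.
Variables (R : realType) (m n : nat).

Definition mx_cylinder : set (set 'M[R]_(m, n)) :=
  [set A | exists i j (B : set (measurableTypeR R)),
     measurable B /\ A = [set M : 'M[R]_(m, n) | B (M i j)]].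

Let mx_meas0 : <<s mx_cylinder >> set0. Proof. exact: sigma_algebra0. Qed.
Let mx_measC A : <<s mx_cylinder >> A -> <<s mx_cylinder >> (~` A).
Proof. exact: sigma_algebraC. Qed.
Let mx_measU (F : (set 'M[R]_(m, n))^nat) :
  (forall i, <<s mx_cylinder >> (F i)) -> <<s mx_cylinder >> (\bigcup_i F i).
Proof. exact: sigma_algebra_bigcup. Qed.

HB.instance Definition _ := @isMeasurable.Build mx_display 'M[R]_(m, n)
  <<s mx_cylinder >> mx_meas0 mx_measC mx_measU.

Lemma measurable_mxcoord i j :
  measurable_fun setT (fun M : 'M[R]_(m, n) => M i j : measurableTypeR R).
Proof.
move=> _ B mB; rewrite setTI; apply: sub_sigma_algebra.
by exists i, j, B.
Qed.

Lemma measurable_fun_mx d (T : measurableType d) (f : T -> 'M[R]_(m, n)) :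
  (forall i j, measurable_fun setT (fun x => f x i j : measurableTypeR R)) ->
  measurable_fun setT f.
Proof.
move=> mf; apply: (@measurability _ _ _ _ setT f mx_cylinder) => //.
move=> _ [_ [i [j [B [mB ->]]]] <-].
exact: (mf i j measurableT B mB).
Qed.

End measurable_matrix.

Section pack_sigma_finite.
Context d (T : measurableType d) (R : realType) (nu : set T -> \bar R).
Hypotheses (nu0 : nu set0 = 0%E) (nu_ge0 : forall A, (0 <= nu A)%E)
  (nu_sigma : semi_sigma_additive nu) (nu_sf : sigma_finite setT nu).
HB.instance Definition _ := isMeasure.Build _ _ _ nu nu0 nu_ge0 nu_sigma.
HB.instance Definition _ := Measure_isSigmaFinite.Build _ _ _ nu nu_sf.

Lemma pack_sigma_finite :
  exists mu : {sigma_finite_measure set T -> \bar R}, nu = mu.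
Proof. by exists nu. Qed.

End pack_sigma_finite.

Section lebesgue_rV.
Variable R : realType.
Local Open Scope ereal_scope.

Fixpoint leb (n : nat) : set 'rV[R]_n -> \bar R :=
  match n with
  | 0%N => fun A => (\1_A 0%R)%:E
  | n'.+1 => fun A => \int[lebesgue_measure]_x
      leb [set y : 'rV[R]_n' | A (row_mx (const_mx x : 'rV[R]_1) y)]
  end.

Let glue n (p : measurableTypeR R * 'rV[R]_n) : 'rV[R]_n.+1 :=
  row_mx (const_mx p.1 : 'rV[R]_1) p.2.
Let cut n (z : 'rV[R]_n.+1) : measurableTypeR R * 'rV[R]_n :=
  (z ord0 ord0, rsubmx (z : 'rV[R]_(1 + n))).

Let measurable_glue n : measurable_fun setT (@glue n).
Proof.
apply: measurable_fun_mx => i j.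
rewrite [X in measurable_fun _ X](_ : _ = fun p : measurableTypeR R * 'rV[R]_n =>
  match fintype.split (j : 'I_(1 + n)) with inl _ => p.1 | inr k => p.2 i k end); last first.
  by apply/funext => p; rewrite /glue mxE; case: fintype.split => k //; rewrite mxE.
case: fintype.split => k; first exact: measurable_fst.
exact: (measurableT_comp (@measurable_mxcoord R _ _ i k) measurable_snd).
Qed.

Let measurable_cut n : measurable_fun setT (@cut n).
Proof.
apply: measurable_fun_pair; first exact: measurable_mxcoord.
apply: measurable_fun_mx => i j.
rewrite [X in measurable_fun _ X](_ : _ = fun z : 'rV[R]_n.+1 => (z : 'rV[R]_(1 + n)) i (rshift 1 j)).
  exact: measurable_mxcoord.
by apply/funext => z; rewrite mxE.
Qed.

Let cutK n : cancel (@glue n) (@cut n).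
Proof.
move=> [x y]; rewrite /cut /glue; congr pair; last by rewrite row_mxKr.
by rewrite mxE; case: splitP => // k; rewrite mxE.
Qed.

Let leb_spec n : exists mu : {sigma_finite_measure set 'rV[R]_n -> \bar R},
  @leb n = mu.
Proof.
elim: n => [|n [mu muE]].
  by exists (\d_(0%R : 'rV[R]_0)); apply/funext => A; rewrite /= diracE indicE.
pose pm : {measure set (measurableTypeR R * 'rV[R]_n)%type -> \bar R} :=
  (lebesgue_measure \x mu).
pose nu : set 'rV[R]_n.+1 -> \bar R := pushforward pm (@glue n).
have nuE : @leb n.+1 = nu.
  apply/funext => A /=; rewrite /nu /pushforward /pm /= /product_measure1.
  apply: eq_integral => x _ /=; rewrite muE; congr (mu _).
  by apply/seteqP; split => y /=; rewrite /xsection /= inE.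
have nu0 : nu set0 = 0 by rewrite /nu /pushforward preimage_set0 measure0.
have nu_ge0 A : 0 <= nu A by exact: (measure_ge0 pm).
have nu_sigma : semi_sigma_additive nu.
  move=> F mF tF mUF; rewrite /nu /pushforward preimage_bigcup.
  have h := @measure_semi_sigma_additive _ _ _ pm (fun i => @glue n @^-1` F i); apply: h.
  - by move=> i; rewrite -[X in measurable X]setTI; exact: measurable_glue.
  - apply/trivIsetP => /= i j _ _ ij; rewrite -preimage_setI.
    by move/trivIsetP : tF => /(_ _ _ _ _ ij) ->//; rewrite preimage_set0.
  - by rewrite -preimage_bigcup -[X in measurable X]setTI; exact: measurable_glue.
have nu_sf : sigma_finite setT nu.
  have /sigma_finiteP[F [TF ndF Foo]] := sigma_finiteT (@lebesgue_measure R).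
  have /sigma_finiteP[G [TG ndG Goo]] := sigma_finiteT mu.
  exists (fun k => @cut n @^-1` (F k `*` G k)).
    apply/esym/seteqP; split => // z _.
    have : (\bigcup_k F k) (@cut n z).1 by rewrite -TF.
    have : (\bigcup_k G k) (@cut n z).2 by rewrite -TG.
    move=> [k _ Gz] [l _ Fz]; exists (maxn l k) => //; split.
    - by move: Fz; exact/subsetPset/ndF/leq_maxl.
    - by move: Gz; exact/subsetPset/ndG/leq_maxr.
  move=> k; have [mF Fk] := Foo k; have [mG Gk] := Goo k; split.
    by rewrite -[X in measurable X]setTI; apply: measurable_cut => //; exact: measurableX.
  rewrite /nu /pushforward -comp_preimage.
  rewrite (_ : @cut n \o @glue n = id) ?preimage_id; last exact/funext/cutK.
  by rewrite /pm /= product_measure1E// lte_mul_pinfty// ge0_fin_numE.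
by rewrite nuE; exact: pack_sigma_finite.
Qed.

Let leb0 n : @leb n set0 = 0.
Proof. by have [mu ->] := leb_spec n; exact: measure0. Qed.
Let leb_ge0 n A : 0 <= @leb n A.
Proof. by have [mu ->] := leb_spec n; exact: measure_ge0. Qed.
Let leb_sigma_additive n : semi_sigma_additive (@leb n).
Proof. by have [mu ->] := leb_spec n; exact: measure_semi_sigma_additive. Qed.

HB.instance Definition _ n :=
  isMeasure.Build _ _ _ (@leb n) (@leb0 n) (@leb_ge0 n) (@leb_sigma_additive n).

Let leb_sigma_finite n : sigma_finite setT (@leb n).
Proof. by have [mu ->] := leb_spec n; exact: sigma_finiteT. Qed.

HB.instance Definition _ n :=
  Measure_isSigmaFinite.Build _ _ _ (@leb n) (@leb_sigma_finite n).

Lemma leb_product n (A : set (measurableTypeR R)) (B : set 'rV[R]_n) :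
  measurable A -> measurable B ->
  leb [set z : 'rV[R]_n.+1 | A (z 0%R 0%R) /\ B (rsubmx (z : 'rV[R]_(1 + n)))]
  = lebesgue_measure A * leb B.
Proof.
move=> mA mB /=.
under eq_integral => x _.
  rewrite (_ : [set y | _] = if x \in A then B else set0); last first.
    apply/seteqP; split => y /=; rewrite row_mxKr mxE; case: splitP => //= k _; rewrite mxE.
      by move=> [Ax By]; rewrite mem_set.
    by case: ifPn => //; rewrite inE.
  rewrite (_ : leb _ = (\1_A x)%:E * leb B); last first.
    by rewrite indicE; case: ifP => _; rewrite ?mul1e ?mul0e ?measure0.
  over.
rewrite ge0_integralZr //; last first.
  by apply/measurable_EFinP; exact: measurable_indic.
by rewrite integral_indic // setIT.
Qed.

End lebesgue_rV.

Section euclidean.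
Variable R : realType.

Definition dot m n (A B : 'M[R]_(m, n)) : R := \sum_i \sum_j A i j * B i j.

(* Euclidean norm of vectors, Frobenius norm of matrices; the library's `|A| is
   the sup norm. *)
Definition enorm m n (A : 'M[R]_(m, n)) : R := Num.sqrt (dot A A).

Definition basis_vec d (j : 'I_d) : 'rV[R]_d := delta_mx 0 j.

(* (curl v)_k = d_{k+1} v_{k+2} - d_{k+2} v_{k+1} (indices mod 3) if d = 3, and
   d_0 v_1 - d_1 v_0 if d = 2, for the gradient G i j = d_j v_i. *)
Definition nvort (d : nat) : nat := (d * d.-1)./2.

Definition entry d (G : 'M[R]_d) (i j : nat) : R :=
  if (insub i, insub j) is (Some i', Some j') then G i' j' else 0.

Definition curl_of_grad d (G : 'M[R]_d) : 'rV[R]_(nvort d) :=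
  \row_k (if (d == 2)%N then entry G 1 0 - entry G 0 1
          else entry G ((k + 2) %% 3)%N ((k + 1) %% 3)%N
               - entry G ((k + 1) %% 3)%N ((k + 2) %% 3)%N).

End euclidean.

Section domains.
Variables (R : realType) (d : nat).
Implicit Types (Omega S : set 'rV[R]_d).

(* Near each boundary point, Omega is the strict epigraph of a Lipschitz
   function in the direction e of some orthonormal frame; gamma does not depend
   on the coordinate along e. *)
Definition lipschitz_boundary Omega : Prop :=
  forall x, closure Omega x -> ~ Omega x ->
  exists (r L : R) (e : 'rV[R]_d) (gamma : 'rV[R]_d -> R),
    [/\ 0 < r, enorm e = 1,
        forall y z, `|gamma y - gamma z| <= L * enorm (y - z),
        forall y s, gamma (y + s *: e) = gamma y &
        forall y, enorm (y - x) < r -> (Omega y <-> gamma y < dot y e)].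

Definition bounded_lipschitz_domain Omega : Prop :=
  [/\ open Omega, connected Omega, Omega !=set0, bounded_set Omega &
      lipschitz_boundary Omega].

Definition volume Omega : R := fine (leb Omega).

(* A d-simplex is given by its d + 1 vertices. *)
Definition vertices := {ffun 'I_d.+1 -> 'rV[R]_d}.
Implicit Types (K L : vertices) (Th : seq vertices).

Definition face K (A : pred 'I_d.+1) : set 'rV[R]_d :=
  [set x | exists lam : 'I_d.+1 -> R,
     [/\ forall i, 0 <= lam i, forall i, ~~ A i -> lam i = 0,
         \sum_i lam i = 1 & x = \sum_i lam i *: K i]].

Definition simplex K : set 'rV[R]_d := face K xpredT.

Definition nondegenerate K : Prop :=
  \det (\matrix_(i < d) (K (lift ord0 i) - K ord0)) != 0.

Definition triangulation Omega Th : Prop :=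
  [/\ uniq Th,
      forall K, K \in Th -> nondegenerate K,
      closure Omega = [set x | exists2 K, K \in Th & simplex K x],
      forall K L, K \in Th -> L \in Th -> K != L ->
        (simplex K)° `&` (simplex L)° = set0 &
      forall K L, K \in Th -> L \in Th ->
        simplex K `&` simplex L = face K (fun i => K i \in codom L)].

Definition ediam S : R :=
  sup [set r | exists x y, [/\ S x, S y & r = enorm (x - y)]].

Definition inball_diam S : R :=
  sup [set s | exists x r,
    [/\ 0 <= r, [set y | enorm (y - x) < r] `<=` S & s = 2 * r]].

Definition shape_regular (sigma : R) Th : Prop :=
  forall K, K \in Th -> ediam (simplex K) <= sigma * inball_diam (simplex K).

Definition poly_le (l : nat) (p : 'rV[R]_d -> R) : Prop :=
  exists c : {ffun 'I_d -> 'I_l.+1} -> R, forall x,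
    p x = \sum_(a : {ffun 'I_d -> 'I_l.+1} | (\sum_i a i <= l)%N)
            c a * \prod_i x 0 i ^+ a i.

Definition piecewise_poly (l : nat) Th (g : 'rV[R]_d -> R) : Prop :=
  forall K, K \in Th -> exists2 p, poly_le l p & {in simplex K, g =1 p}.

End domains.

Section sobolev.
Variables (R : realType) (d : nat) (Omega : set 'rV[R]_d).
Notation pt := 'rV[R]_d.

Fixpoint Ck (n : nat) (phi : pt -> R) : Prop :=
  match n with
  | 0%N => continuous phi
  | n'.+1 => forall j : 'I_d,
      (forall x, derivable phi x (basis_vec R j)) /\
      Ck n' (fun x => 'D_(basis_vec R j) phi x)
  end.

Definition test_fun : set (pt -> R) :=
  [set phi | (forall n, Ck n phi) /\
     exists2 C, compact C /\ C `<=` Omega & forall x, ~ C x -> phi x = 0].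

Definition L2s : set (pt -> R) :=
  [set g | measurable_fun Omega (g : pt -> measurableTypeR R) /\
     (\int[@leb R d]_(x in Omega) (g x ^+ 2)%:E < +oo)%E].

Definition L2 m n : set (pt -> 'M[R]_(m, n)) :=
  [set g | forall i j, L2s (fun x => g x i j)].

Definition ips (f g : pt -> R) : R := \int[@leb R d]_(x in Omega) (f x * g x).

Definition ip m n (f g : pt -> 'M[R]_(m, n)) : R :=
  \int[@leb R d]_(x in Omega) dot (f x) (g x).

Definition norm_L2s (g : pt -> R) : R := Num.sqrt (ips g g).
Definition norm_L2 m n (g : pt -> 'M[R]_(m, n)) : R := Num.sqrt (ip g g).

Definition norm_Lp m n (p : R) (g : pt -> 'M[R]_(m, n)) : \bar R :=
  'N[@leb R d]_(p%:E)[EFin \o ((fun x => enorm (g x)) \_ Omega)].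

(* G i j is the weak derivative d_j u_i *)
Definition weak_grad m (u : pt -> 'rV[R]_m) : set (pt -> 'M[R]_(m, d)) :=
  [set G | L2 G /\ forall i j phi, test_fun phi ->
     ips (fun x => u x 0 i) (fun x => 'D_(basis_vec R j) phi x)
     = - ips (fun x => G x i j) phi].

Definition H1 m : set (pt -> 'rV[R]_m) :=
  [set u | L2 u /\ weak_grad u !=set0].

Definition grad m (u : pt -> 'rV[R]_m) : pt -> 'M[R]_(m, d) :=
  xget (fun=> 0) (weak_grad u).

Definition div (u : pt -> 'rV[R]_d) (x : pt) : R := \tr (grad u x).

Definition curl (u : pt -> 'rV[R]_d) (x : pt) : 'rV[R]_(nvort d) :=
  curl_of_grad (grad u x).

Definition norm_H1 m (u : pt -> 'rV[R]_m) : R :=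
  Num.sqrt (norm_L2 u ^+ 2 + norm_L2 (grad u) ^+ 2).

Definition H10 m : set (pt -> 'rV[R]_m) :=
  [set u | H1 u /\ forall eps, 0 < eps -> exists phi : pt -> 'rV[R]_m,
     (forall i, test_fun (fun x => phi x 0 i)) /\ norm_H1 (u - phi) < eps].

Definition field := pt -> 'rV[R]_d.

(* Functionals are functions on all fields, relevant only on H^1_0. *)
Definition functional := field -> R^o.

Definition Hm1 : set functional :=
  [set F : functional |
     (forall (a : R) (v w : field), H10 v -> H10 w ->
        F (a *: v + w) = a * F v + F w) /\
     exists C : R, forall v : field, H10 v -> `|F v| <= C * norm_H1 v].

Definition norm_Hm1 (F : functional) : R :=
  sup [set `|F v| | v in [set v : field | H10 v /\ norm_H1 v <= 1]].

Definition injection_norm (p : R) : \bar R :=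
  ereal_sup [set norm_Lp p v | v in [set v : field | H1 v /\ norm_H1 v <= 1]].

End sobolev.

(* Functions of time with values in a subspace X of V, seminormed by nrm:
   elements of V at distance 0 are identified. *)
Section bochner.
Variables (R : realType) (T : R) (V : lmodType R) (X : set V) (nrm : V -> R).
Notation mu := (@lebesgue_measure R).
Notation I := (`]0, T[%classic : set (measurableTypeR R)).

Definition norm_LT (q : \bar R) (g : R -> R) : \bar R :=
  'N[mu]_q[(EFin \o (g \_ I) : measurableTypeR R -> \bar R)].

Record stepfun := StepFun {
  step_size : nat;
  step_set : 'I_step_size -> set (measurableTypeR R);
  step_val : 'I_step_size -> V }.

Definition X_step (s : stepfun) : Prop :=
  forall i, measurable (step_set (s := s) i) /\ X (step_val i).

Definition step_eval (s : stepfun) (t : R) : V :=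
  \sum_i (\1_(step_set (s := s) i) t : R) *: step_val i.

Definition step_integral (s : stepfun) : V :=
  \sum_i fine (mu (step_set (s := s) i `&` I)) *: step_val i.

Definition strongly_measurable (g : R -> V) : Prop :=
  exists s : nat -> stepfun, (forall n, X_step (s n)) /\
    {ae mu, forall t : measurableTypeR R, I t ->
       X (g t) /\ nrm (step_eval (s n) t - g t) @[n --> \oo] --> (0 : R)}.

Definition bochner_integral (g : R -> V) (a : V) : Prop :=
  [/\ strongly_measurable g, X a &
      exists s : nat -> stepfun,
        [/\ forall n, X_step (s n),
            (\int[mu]_(t in I) (nrm (step_eval (s n) t - g t))%:E)%E
              @[n --> \oo] --> 0%E &
            nrm (step_integral (s n) - a) @[n --> \oo] --> (0 : R)]].

Definition Lq (q : \bar R) (g : R -> V) : Prop :=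
  strongly_measurable g /\ (norm_LT q (fun t => nrm (g t)) < +oo)%E.

Definition time_test_fun (phi : R -> R) : Prop :=
  (forall n t, derivable (derive1n n (phi : R -> R^o)) t 1) /\
  exists a b, [/\ 0 < a, b < T & forall t, ~ (a <= t <= b) -> phi t = 0].

(* W^{1,q}(0,T;X) *)
Definition W1q (q : \bar R) (g : R -> V) : Prop :=
  Lq q g /\ exists2 g', Lq q g' &
    forall phi, time_test_fun phi -> exists2 a,
      bochner_integral (fun t => (derive1 (phi : R -> R^o) t : R) *: g t) a &
      bochner_integral (fun t => phi t *: g' t) (- a).

End bochner.

Section discrete_spaces.
Variables (R : realType) (d : nat) (Omega : set 'rV[R]_d).
Variables (Th : seq (vertices R d)) (k : nat).
Notation pt := 'rV[R]_d.

Definition Hu : set (field R d) :=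
  [set v : field R d | [/\ {within closure Omega, continuous v},
     forall i, piecewise_poly k.+1 Th (fun x => v x 0 i) & H10 Omega v]].

Definition Hp : set (pt -> R) :=
  [set q : pt -> R | [/\ {within closure Omega, continuous q},
     piecewise_poly k Th q, L2s Omega q & ips Omega q (fun=> 1) = 0]].

Definition Hw : set (pt -> 'rV[R]_(nvort d)) :=
  [set w : pt -> 'rV[R]_(nvort d) | {within closure Omega, continuous w} /\
     forall i, piecewise_poly k Th (fun x => w x 0 i)].

Definition Kh : set (field R d) :=
  [set v | Hu v /\ forall q, Hp q -> ips Omega q (div Omega v) = 0].

Definition inf_sup (beta : R) : Prop :=
  forall q, Hp q ->
    ((beta * norm_L2s Omega q)%:E <=
     ereal_sup [set (ips Omega q (div Omega v) / norm_H1 Omega v)%:E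
       | v in [set v | Hu v /\ norm_H1 Omega v != 0%R]])%E.

End discrete_spaces.

Definition solenoidal (R : realType) d (Omega : set 'rV[R]_d) :
    set (field R d) :=
  [set v | H10 Omega v /\
     {ae @leb R d, forall x, Omega x -> div Omega v x = 0}].

Section problem.
Variables (R : realType) (d : nat) (Omega : set 'rV[R]_d).
Variables (kappa nu D F rho : R).
Notation pt := 'rV[R]_d.
Notation vort := (pt -> 'rV[R]_(nvort d)).
Notation ip := (ip Omega).
Notation ips := (ips Omega).
Notation grad := (grad Omega).
Notation div := (div Omega).
Notation curl := (curl Omega).

Definition forch (u : field R d) : field R d :=
  fun x => (enorm (u x) `^ (rho - 2)) *: u x.

(* (grad u) z, as a row vector *)
Definition convect (u z : field R d) : field R d :=
  fun x => z x *m (grad u x)^T.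

Definition Eop (u v : field R d) : R :=
  ip u v + kappa ^+ 2 * ip (grad u) (grad v).

Definition Bop (v : field R d) (q : pt -> R) : R := - ips q (div v).

Definition Ah (z u : field R d) (w : vort) (v : field R d) (psi : vort) : R :=
  D * ip u v + F * ip (forch u) v + nu * ip w psi
  + nu * ip w (curl v) - nu * ip psi (curl u)
  + ip (convect u z) v + 2^-1 * ip (fun x => div z x *: u x) v.

Definition f0 (u0 v : field R d) : R :=
  nu * ip (grad u0) (grad v)
  + ip (fun x => D *: u0 x + F *: forch u0 x + convect u0 u0 x) v.

Definition fh0 (u0 uh0 v : field R d) : R :=
  f0 u0 v + ip (grad u0) (grad v) - ip (grad uh0) (grad v).

Variables (Th : seq (vertices R d)) (k : nat).
Notation Hu := (Hu Omega Th k).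
Notation Hp := (Hp Omega Th k).
Notation Hw := (Hw Omega Th k).
Notation Kh := (Kh Omega Th k).

Definition compatible_data (u0 uh0 : field R d) (wh0 : vort) (ph0 : pt -> R) :=
  [/\ Kh uh0, Hw wh0, Hp ph0,
      forall v psi, Kh v -> Hw psi ->
        Ah uh0 uh0 wh0 v psi = fh0 u0 uh0 v &
      forall v psi, Hu v -> Hw psi ->
        ip (grad uh0) (grad v) + Ah uh0 uh0 wh0 v psi + Bop v ph0
        = f0 u0 v + ip (grad u0) (grad v)].

(* u is the representative of its class in W^{1,oo}(0,T;H_h^u) that is
   continuous on [0, T], so that u 0 is meaningful. *)
Definition solution (T : R) (f : R -> functional R d)
    (uh0 : field R d) (wh0 : vort)
    (u : R -> field R d) (w : R -> vort) (p : R -> pt -> R) : Prop :=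
  [/\ forall t, 0 <= t <= T -> [/\ Hu (u t), Hw (w t) & Hp (p t)],
      W1q T Hu (@norm_H1 R d Omega d) +oo%E u,
      forall t, 0 <= t <= T -> forall eps, 0 < eps -> exists2 delta, 0 < delta &
        forall s, 0 <= s <= T -> `|s - t| < delta ->
          norm_H1 Omega (u s - u t) < eps,
      forall x, closure Omega x -> u 0 x = uh0 x /\ w 0 x = wh0 x &
      {ae @lebesgue_measure R, forall t : measurableTypeR R, 0 < t < T ->
        (forall v psi, Hu v -> Hw psi ->
           derivable (fun s : R => Eop (u s) v : R^o) t 1 /\
           (derive1 (fun s : R => Eop (u s) v : R^o) t : R)
             + Ah (u t) (u t) (w t) v psi + Bop v (p t) = f t v) /\
        (forall q, Hp q -> - Bop (u t) q = 0)}].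

(* Equality of solutions: u is continuous in time, while w and p are
   determined for almost every time only. *)
Definition same_solution (T : R)
    (u1 : R -> field R d) (w1 : R -> vort) (p1 : R -> pt -> R)
    (u2 : R -> field R d) (w2 : R -> vort) (p2 : R -> pt -> R) : Prop :=
  (forall t x, 0 <= t <= T -> closure Omega x -> u1 t x = u2 t x) /\
  {ae @lebesgue_measure R, forall t : measurableTypeR R, 0 < t < T ->
    forall x, closure Omega x -> w1 t x = w2 t x /\ p1 t x = p2 t x}.

Definition data_size (T : R) (f : R -> functional R d) (u0 : field R d) :
    \bar R :=
  (Num.sqrt (expR T))%:E *
  (norm_LT T 2%:E (fun t => norm_Hm1 Omega (f t)) +
   (norm_H1 Omega u0 + norm_H1 Omega u0 ^+ 2
    + norm_H1 Omega u0 `^ (rho - 1))%:E)%E.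

End problem.

(* Main.v *)
Require Import Defs.
From HB Require Import structures.
From mathcomp Require Import all_boot all_order all_algebra.
From mathcomp Require Import all_classical all_reals all_analysis.
From mathcomp Require Import measurable_realfun ess_sup_inf hoelder ring lra.
Import Order.TTheory GRing.Theory Num.Theory numFieldNormedType.Exports.
Local Open Scope classical_set_scope.
Local Open Scope ring_scope.
Set Implicit Arguments.
Unset Strict Implicit.
Unset Printing Implicit Defensive.

(** In a basis of the discretely divergence-free fields, orthonormal for [Eop], the problem is
    an ordinary differential system [x' = g - Phi x]: the vorticity is the L2 projection of
    [curl u] onto [Hw], and the pressure exists because the residual of the momentum equation
    vanishes on the kernel of the divergence form. The right-hand side [f] enters through
    finitely many scalars [f t h_j] only, which are absolutely continuous by the du Bois-Reymond
    lemma. [Phi] is locally Lipschitz and [x . Phi x >= 0], because the convective form is skew on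
    H^1_0 (by density of test functions) and the two vorticity terms cancel. Hence [|x|^2] is
    bounded by [e^t (|x 0|^2 + int |g|^2)], which gives global existence and the energy estimate;
    the inf-sup condition transfers it to the pressure. Testing the compatibility equation with
    the discrete initial data themselves bounds [uh0] by [u0]. For uniqueness, the coordinates of
    any solution are again absolutely continuous, hence, by continuity of [g - Phi x], solve the
    same system for every [t]. *)

(** * Derivatives and smooth functions of one variable *)

(** The integrals see a function only through its values on [Omega], so every form here is
    semi-definite: fields are compared by [B (u - v) (u - v) = 0], and pointwise equality on the
    closure of [Omega] is recovered from the continuity of discrete functions. The evolution
    argument is therefore carried out over abstract spaces with semi-inner products, where no
    integral over [Omega] appears. A second obstacle is that the measurability of
    [norm_Hm1 Omega (f t)] in [t] is never established. Its integral is handled as a lower integral,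
    and the estimates use instead the continuous function [Gam], the squared norm of [f t] as a
    functional on the discrete velocities, which lies below the squared dual norm for almost every
    [t]. The Lipschitz constants of the differential system depend on the mesh, but they only serve
    existence and uniqueness. The estimates use coercivity, the injections into L4 and L^rho and the
    inf-sup constant. No factor [T] arises, because the integral of exp(k t) over the time interval
    is at most exp(k T) as soon as k >= 1. *)

Section isd.
Variable R : realType.
Implicit Types (f g : R -> R) (t a b : R).

(** Existence and value of the derivative in one proposition, with the codomain cast to [R^o] once
    and for all. *)
Definition isd f t a : Prop := is_derive t (1:R) (f : R -> R^o) a.

Lemma isd_eq f g t a b : isd f t a -> f =1 g -> a = b -> isd g t b.
Proof. by move=> + /funext <- <-. Qed.

Lemma isd_derive1 f t a : isd f t a -> derive1 (f : R -> R^o) t = a.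
Proof. by move=> [_ <-]; rewrite derive1E. Qed.

Lemma isd_near f g t a : {near t, f =1 g} -> isd f t a -> isd g t a.
Proof. by move=> fg; exact: near_eq_is_derive. Qed.

Lemma isd_continuous f t a : isd f t a -> {for t, continuous f}.
Proof. by move=> [df _]; apply/differentiable_continuous/derivable1_diffP. Qed.

Lemma isd_id t : isd (fun x => x) t 1.
Proof. exact: is_derive_id. Qed.

Lemma isd_cst a t : isd (fun=> a) t 0.
Proof. exact: is_derive_cst. Qed.

Lemma isdD f g t a b : isd f t a -> isd g t b -> isd (fun x => f x + g x) t (a + b).
Proof. by move=> df dg; exact: is_deriveD. Qed.

Lemma isdB f g t a b : isd f t a -> isd g t b -> isd (fun x => f x - g x) t (a - b).
Proof. by move=> df dg; exact: is_deriveB. Qed.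

Lemma isdN f t a : isd f t a -> isd (fun x => - f x) t (- a).
Proof. by move=> df; exact: is_deriveN. Qed.

Lemma isdZ (c : R) f t a : isd f t a -> isd (fun x => c * f x) t (c * a).
Proof. by move=> df; exact: is_deriveZ. Qed.

Lemma isdM f g t a b : isd f t a -> isd g t b ->
  isd (fun x => f x * g x) t (a * g t + f t * b).
Proof.
move=> df dg; apply: (@isd_eq _ _ _ _ _ (is_deriveM df dg)) => //.
by rewrite /GRing.scale/= addrC mulrC.
Qed.

Lemma isdV f t a : f t != 0 -> isd f t a -> isd (fun x => (f x)^-1) t (- a / f t ^+ 2).
Proof.
move=> ft df; apply: (@isd_eq _ _ _ _ _ (is_deriveV ft df)) => //.
by rewrite /GRing.scale/= mulrC mulrN mulNr.
Qed.

Lemma isd_comp f g t a b : isd f (g t) a -> isd g t b ->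
  isd (fun x => f (g x)) t (a * b).
Proof. by move=> df dg; exact: (is_derive1_comp df dg). Qed.

Lemma isd_affine (a b t : R) : isd (fun x => a * x + b) t a.
Proof.
apply: (isd_eq (isdD (isdZ a (isd_id t)) (isd_cst b t))) => //.
by rewrite mulr1 addr0.
Qed.

Lemma isd_expR t : isd (@expR R) t (expR t).
Proof. exact: is_derive_expR. Qed.

Lemma isd_sum (I : Type) (s : seq I) (F : I -> R -> R) (a : I -> R) t :
  (forall i, isd (F i) t (a i)) ->
  isd (fun x => \sum_(i <- s) F i x) t (\sum_(i <- s) a i).
Proof.
move=> dF; elim: s => [|i s IH].
  by apply: (isd_eq (isd_cst 0 t)) => [x|]; rewrite big_nil.
by apply: (isd_eq (isdD (dF i) IH)) => [x|]; rewrite big_cons.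
Qed.

End isd.

(** * Smooth functions and bumps on the line *)

Section smooth_real.
Variable R : realType.
Implicit Types f g : R -> R.

Definition smooth f : Prop :=
  forall n t, derivable (derive1n n (f : R -> R^o)) t 1.

(** Coinduction principle: a class of functions closed under derivation is smooth, by induction on
    the order for all its members at once. It replaces formulas for higher derivatives; one only has
    to find a class that is stable. *)
Lemma smooth_coind (P : (R -> R) -> Prop) :
  (forall f, P f -> exists2 f', P f' & forall t, isd f t (f' t)) ->
  forall f, P f -> smooth f.
Proof.
move=> H f Pf n; elim: n f Pf => [|n IH] f Pf t; have [f' Pf' df] := H f Pf.
  by have [] := df t.
rewrite derive1Sn (_ : derive1 (f : R -> R^o) = f'); first exact: IH.
by apply/funext => x; apply: isd_derive1.
Qed.

Lemma smoothW f : smooth f -> exists2 f', smooth f' & forall t, isd f t (f' t).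
Proof.
move=> sf; exists (derive1 (f : R -> R^o)).
  by move=> n t; rewrite -derive1Sn; exact: sf.
by move=> t; rewrite derive1E; apply/derivableP; exact: sf 0%N t.
Qed.

Lemma smooth_continuous f : smooth f -> continuous f.
Proof. by move=> /smoothW[f' _ df] x; exact: isd_continuous (df x). Qed.

Opaque smooth.

Lemma smoothZ f (c : R) : smooth f -> smooth (fun x => c * f x).
Proof.
move=> sf; apply: (@smooth_coind (fun h => exists2 g, smooth g & h = fun x => c * g x)); last by exists f.
move=> _ [g sg ->]; have [g' sg' dg] := smoothW sg.
exists (fun x => c * g' x); first by exists g'.
by move=> t; exact: isdZ.
Qed.

Lemma smooth_affine f (a b : R) : smooth f -> smooth (fun x => f (a * x + b)).
Proof.
move=> sf; apply: (@smooth_coind (fun h => exists2 g, smooth g & h = fun x => g (a * x + b))); last by exists f.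
move=> _ [g sg ->]; have [g' sg' dg] := smoothW sg.
exists (fun x => a * g' (a * x + b)).
  by exists (fun x => a * g' x); [exact: smoothZ|].
by move=> t; apply: (isd_eq (isd_comp (dg _) (isd_affine a b t))) => //; exact: mulrC.
Qed.

(** Single products are not stable under derivation, finite sums of products are. *)
Inductive smooth_prod : (R -> R) -> Prop :=
| Smooth_prodM f g : smooth f -> smooth g -> smooth_prod (fun x => f x * g x)
| Smooth_prodD f g : smooth_prod f -> smooth_prod g -> smooth_prod (fun x => f x + g x).

Lemma smoothM f g : smooth f -> smooth g -> smooth (fun x => f x * g x).
Proof.
move=> sf sg; apply: (smooth_coind (P := smooth_prod)); last exact: Smooth_prodM.
move=> h; elim=> {f g sf sg h}[u v su sv|u v _ [u' pu' du] _ [v' pv' dv]].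
  have [u' su' du] := smoothW su; have [v' sv' dv] := smoothW sv.
  exists (fun x => u' x * v x + u x * v' x).
    by apply: Smooth_prodD; exact: Smooth_prodM.
  by move=> t; exact: isdM.
exists (fun x => u' x + v' x); first exact: Smooth_prodD.
by move=> t; exact: isdD.
Qed.

Lemma smoothB f g : smooth f -> smooth g -> smooth (fun x => f x - g x).
Proof.
move=> sf sg; apply: (@smooth_coind (fun h => exists f g, [/\ smooth f, smooth g & h = fun x => f x - g x])); last by exists f, g.
move=> _ [u [v [su sv ->]]].
have [u' su' du] := smoothW su; have [v' sv' dv] := smoothW sv.
by exists (fun x => u' x - v' x) => [|t]; [exists u', v'|exact: isdB].
Qed.

(** From y / n <= exp(y / n), raised to the power n. *)
Lemma pow_expR_bound n (y : R) : 0 <= y -> y ^+ n * expR (- y) <= n%:R ^+ n.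
Proof.
move=> y0; case: n => [|n]; first by rewrite !expr0 mul1r -expR0 ler_expR oppr_le0.
rewrite expRN ler_pdivrMr ?expR_gt0//.
have n0 : 0 < n.+1%:R :> R by [].
rewrite -[in leRHS](@divfK _ n.+1%:R _ y) ?gt_eqF// mulrC expRM_natr mulrC -exprMn.
rewrite lerXn2r ?nnegrE// ?mulr_ge0 ?expR_ge0//.
rewrite -ler_pdivrMl//; apply: le_trans (expR_ge1Dx _).
by rewrite mulrC lerDr.
Qed.

Lemma poly_expR_bound (p : {poly R}) :
  exists C : R, forall y : R, 0 <= y -> `|p.[y] * expR (- y)| <= C.
Proof.
exists (\sum_(i < size p) `|p`_i| * i%:R ^+ i) => y y0.
rewrite horner_coef mulr_suml; apply: le_trans (ler_norm_sum _ _ _) _.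
apply: ler_sum => i _; rewrite -mulrA normrM ler_wpM2l//.
rewrite ger0_norm ?mulr_ge0 ?exprn_ge0 ?expR_ge0//.
exact: pow_expR_bound.
Qed.

(** The classical germ exp(-1/x), extended by zero. The polynomial factor in 1/x makes the family
    stable under derivation, so that smoothness follows by coinduction. *)
Definition flat (p : {poly R}) (x : R) : R :=
  if 0 < x then p.[x^-1] * expR (- x^-1) else 0.

Lemma isd_flat p (t : R) : isd (flat p) t (flat ('X^2 * (p - p^`())) t).
Proof.
have [t0|t0|t0] := ltgtP 0 t.
- have nt : {near t, (fun x : R => p.[x^-1] * expR (- x^-1)) =1 flat p}.
    near=> x; rewrite /flat ifT//; near: x; exact: lt_nbhsr.
  apply: (isd_near nt); rewrite /flat t0.
  have dV := isdV (lt0r_neq0 t0) (isd_id t).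
  have dp : isd (fun x => p.[x^-1]) t _ := isd_comp (is_derive_poly p t^-1) dV.
  have de : isd (fun x => expR (- x^-1)) t _ := @isd_comp _ _ (fun x => - x^-1) t _ _ (isd_expR (- t^-1)) (isdN dV).
  apply: (isd_eq (isdM dp de)) => //.
  rewrite hornerM hornerXn hornerD hornerN; field; exact: lt0r_neq0.
- have nt : {near t, (fun x : R => 0) =1 flat p}.
    near=> x; rewrite /flat ifF//; apply/negbTE; rewrite -leNgt.
    apply/ltW; near: x; exact: lt_nbhsl.
  apply: (isd_near nt); rewrite /flat ifF; last by apply/negbTE; rewrite -leNgt ltW.
  exact: isd_cst.
- rewrite -{t}t0 /flat ltxx.
  have [C HC] := poly_expR_bound ('X^2 * p).
  have C0 : 0 <= C by apply: le_trans (HC 0 (lexx _)).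
  (* At the origin the difference quotient is [h] times a value of ['X^2 * p] at 1/h damped by the
     exponential, a bounded quantity. *)
  have cv : (fun h : R => h^-1 *: ((flat p (h *: 1 + 0) - flat p 0) : R^o)) @ (0 : R)^' --> (0 : R^o).
    apply/cvgrPdist_le => e e0; near=> h.
    have h0 : h != 0 by near: h; exact: nbhs_dnbhs_neq.
    rewrite sub0r normrN /flat ltxx subr0 addr0 /GRing.scale/= mulr1.
    case: ifPn => [hp|_]; last by rewrite mulr0 normr0 ltW.
    have := HC h^-1; rewrite invr_ge0 (ltW hp) => /(_ isT).
    rewrite hornerM hornerXn => Hb.
    have -> : h^-1 * (p.[h^-1] * expR (- h^-1)) = h * (h^-1 ^+ 2 * p.[h^-1] * expR (- h^-1)).
      by field.
    rewrite normrM; apply: (@le_trans _ _ (`|h| * C)); first by rewrite ler_wpM2l.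
    apply: (@le_trans _ _ (`|h| * (C + 1))); first by rewrite ler_wpM2l// lerDl.
    rewrite -ler_pdivlMr ?ltr_wpDl//.
    near: h; apply: (@dnbhs0_le R R^o); by rewrite divr_gt0// ltr_wpDl.
  split; first by apply/cvg_ex; exists 0.
  exact: (cvg_lim _ cv).
Unshelve. all: by end_near. Qed.

Lemma smooth_flat p : smooth (flat p).
Proof.
apply: (@smooth_coind (fun f => exists p, f = flat p)); last by exists p.
move=> _ [q ->]; exists (flat ('X^2 * (q - q^`()))); first by eexists.
by move=> t; exact: isd_flat.
Qed.

Definition bump0 : R -> R := flat 1.

Lemma bump0E x : bump0 x = if 0 < x then expR (- x^-1) else 0.
Proof. by rewrite /bump0 /flat hornerC mul1r. Qed.

Lemma bump0_ge0 x : 0 <= bump0 x.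
Proof. by rewrite bump0E; case: ifP => // _; exact: expR_ge0. Qed.

Lemma bump0_le1 x : bump0 x <= 1.
Proof.
rewrite bump0E; case: ifP => // x0; rewrite -expR0 ler_expR oppr_le0 invr_ge0.
exact: ltW.
Qed.

Lemma bump0_le0 x : x <= 0 -> bump0 x = 0.
Proof. by rewrite bump0E leNgt => /negbTE ->. Qed.

Lemma bump0_gt0 x : 0 < x -> 0 < bump0 x.
Proof. by rewrite bump0E => ->; exact: expR_gt0. Qed.

Lemma smooth_bump0 : smooth bump0. Proof. exact: smooth_flat. Qed.

(* [ibump a b n] is supported in [a, b] and increases to the indicator of ]a, b[ *)
Definition ibump (a b : R) (n : nat) (x : R) : R :=
  bump0 (n%:R * (x - a)) * bump0 (n%:R * (b - x)).

Lemma smooth_ibump a b n : smooth (ibump a b n).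
Proof.
apply: smoothM.
  rewrite (_ : (fun x => _) = fun x => bump0 (n%:R * x + - n%:R * a)); last first.
    by apply/funext => x; rewrite mulrBr mulNr.
  exact/smooth_affine/smooth_bump0.
rewrite (_ : (fun x => _) = fun x => bump0 (- n%:R * x + n%:R * b)); last first.
  by apply/funext => x; rewrite mulrBr mulNr addrC.
exact/smooth_affine/smooth_bump0.
Qed.

Lemma ibump_ge0 a b n x : 0 <= ibump a b n x.
Proof. by rewrite mulr_ge0 ?bump0_ge0. Qed.

Lemma ibump_le1 a b n x : ibump a b n x <= 1.
Proof. by rewrite mulr_ile1 ?bump0_ge0 ?bump0_le1. Qed.

Lemma ibump_out a b n x : ~ (a <= x <= b) -> ibump a b n x = 0.
Proof.
move=> /negP; rewrite negb_and -!ltNge => /orP[xa|bx]; rewrite /ibump.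
  by rewrite bump0_le0 ?mul0r// mulr_ge0_le0// subr_le0 ltW.
by rewrite [X in _ * X]bump0_le0 ?mulr0// mulr_ge0_le0// subr_le0 ltW.
Qed.

Lemma bump0_cvg (x : R) : 0 < x -> bump0 (n%:R * x) @[n --> \oo] --> (1:R).
Proof.
move=> x0.
have cx : (n%:R * x)^-1 @[n --> \oo] --> (0 : R).
  apply/cvgrPdist_le => e e0; near=> n.
  have n0 : 0 < n%:R :> R by rewrite ltr0n; near: n; exact: nbhs_infty_gt.
  rewrite sub0r normrN ger0_norm; last by rewrite invr_ge0 mulr_ge0// ltW.
  rewrite -[e]invrK lef_pV2 ?posrE ?invr_gt0 ?mulr_gt0// -ler_pdivrMr//.
  near: n; exact: nbhs_infty_ger.
have : expR (- (n%:R * x)^-1) @[n --> \oo] --> expR (- 0 : R).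
  by apply: continuous_cvg; [exact: continuous_expR|exact: cvgN].
rewrite oppr0 expR0; apply: cvg_trans; apply: near_eq_cvg; near=> n.
rewrite bump0E ifT// mulr_gt0// ltr0n; near: n; exact: nbhs_infty_gt.
Unshelve. all: by end_near. Qed.

Lemma ibump_cvg a b x : ibump a b n x @[n --> \oo] --> (\1_(`]a, b[%classic) x : R).
Proof.
rewrite indicE; case: (boolP (x \in _)) => /=.
  rewrite inE/= in_itv/= => /andP[ax xb]; rewrite -[X in _ --> X]mulr1.
  by apply: cvgM; apply: bump0_cvg; rewrite subr_gt0.
rewrite notin_setE/= in_itv/= => xab.
rewrite (_ : (fun n => _) = fun=> 0); first exact: cvg_cst.
apply/funext => n; move/negP : xab; rewrite negb_and -!leNgt /ibump => /orP[xa|bx].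
  by rewrite bump0_le0 ?mul0r// mulr_ge0_le0// subr_le0.
by rewrite [X in _ * X]bump0_le0 ?mulr0// mulr_ge0_le0// subr_le0.
Qed.

End smooth_real.

(** * Lebesgue measure on row vectors *)

Section boxes.
Variable R : realType.

Definition box n (a b : 'rV[R]_n) : set 'rV[R]_n :=
  [set x | forall i, a 0 i < x 0 i < b 0 i].
Definition cbox n (a b : 'rV[R]_n) : set 'rV[R]_n :=
  [set x | forall i, a 0 i <= x 0 i <= b 0 i].

Lemma forall_measurable n (P : 'I_n -> set R) :
  (forall i, measurable (P i : set (measurableTypeR R))) ->
  measurable [set x : 'rV[R]_n | forall i, P i (x 0 i)].
Proof.
move=> mP; rewrite (_ : [set x | _] = \bigcap_(i in [set: 'I_n]) [set x : 'rV[R]_n | P i (x 0 i)]).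
  apply: fin_bigcap_measurable => // i _; rewrite -[X in measurable X]setTI.
  exact: (measurable_mxcoord (0 : 'I_1) i measurableT (mP i)).
by apply/seteqP; split => x /= Px i; [move=> _|]; exact: (Px i).
Qed.

Lemma measurable_box n (a b : 'rV[R]_n) : measurable (box a b).
Proof.
rewrite (_ : box a b = [set x | forall i, (`]a 0 i, b 0 i[%classic : set R) (x 0 i)]).
  by apply: (@forall_measurable n (fun i => `]a 0 i, b 0 i[%classic)) => i; exact: measurable_itv.
by apply/seteqP; split => x /= abx i; have := abx i; rewrite in_itv.
Qed.

Lemma box_setI n (a b c d : 'rV[R]_n) : box a b `&` box c d =
  box (\row_i Num.max (a 0 i) (c 0 i)) (\row_i Num.min (b 0 i) (d 0 i)).
Proof.
apply/seteqP; split => x /=.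
  by move=> [ab cd] i; rewrite !mxE gt_max lt_min; have /andP[-> ->] := ab i; have /andP[-> ->] := cd i.
by move=> abcd; split => i; have := abcd i; rewrite !mxE gt_max lt_min => /andP[/andP[? ?] /andP[? ?]]; apply/andP.
Qed.

Lemma box_sub_cbox n (a b : 'rV[R]_n) : box a b `<=` cbox a b.
Proof. by move=> x abx i; have /andP[/ltW -> /ltW ->] := abx i. Qed.

Lemma compact_cbox n (a b : 'rV[R]_n) : compact (cbox a b).
Proof.
have := @rV_compact R n (fun i => `[a 0 i, b 0 i]%classic) (fun i => @segment_compact R (a 0 i) (b 0 i)).
congr compact; apply/seteqP; split => x /= H i; have := H i; rewrite in_itv/=; by [].
Qed.

Definition rbox n (p : 'rV[rat]_n * 'rV[rat]_n) : set 'rV[R]_n :=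
  box (map_mx ratr p.1) (map_mx ratr p.2).
Definition crbox n (p : 'rV[rat]_n * 'rV[rat]_n) : set 'rV[R]_n :=
  cbox (map_mx ratr p.1) (map_mx ratr p.2).

(** The closed boxes are required to lie in [A], so that the bump of each open box has compact
    support in [A]; rational corners keep the union countable. *)
Lemma open_bigcup_box n (A : set 'rV[R]_n) : open A ->
  A = \bigcup_(p in [set p | crbox p `<=` A]) rbox p.
Proof.
rewrite openE => oA; apply/seteqP; split => [x Ax|x [p pA px]]; last exact/pA/box_sub_cbox.
have /nbhs_ballP[e/= e0 eA] := oA _ Ax.
have P1 (i : 'I_n) : exists q : rat, ratr q \in `]x 0 i - e, x 0 i[.
  have : x 0 i - e < x 0 i by rewrite ltrBlDr ltrDl.
  by move=> /rat_in_itvoo[q qx]; exists q.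
have P2 (i : 'I_n) : exists q : rat, ratr q \in `]x 0 i, x 0 i + e[.
  have : x 0 i < x 0 i + e by rewrite ltrDl.
  by move=> /rat_in_itvoo[q qx]; exists q.
have [a Ha] := choice P1; have [b Hb] := choice P2.
exists (\row_i a i, \row_i b i) => /=.
  move=> y aby; apply: eA; split => // i j; rewrite ord1.
  have := aby j; rewrite !mxE/=; have := Ha j; have := Hb j; rewrite !in_itv/=.
  move=> /andP[b1 b2] /andP[a1 a2] /andP[c1 c2].
  by rewrite /ball/= ltr_norml; apply/andP; split; lra.
by move=> i; rewrite !mxE; have := Ha i; have := Hb i; rewrite !in_itv/= => /andP[-> _] /andP[_ ->].
Qed.

Lemma open_measurable_rV n (A : set 'rV[R]_n) : open A -> measurable A.
Proof.
move=> oA; rewrite (open_bigcup_box oA) bigcup_mkcond.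
apply: countable_bigcupT_measurable; first exact: countableP.
by move=> p; case: ifP => // _; exact: measurable_box.
Qed.

Lemma open_continuous_measurable_rV n (A : set 'rV[R]_n) (f : 'rV[R]_n -> R) :
  open A -> (forall x, A x -> {for x, continuous f}) ->
  measurable_fun A (f : _ -> measurableTypeR R).
Proof.
move=> oA cf; apply: (measurability _ (RGenOpens.measurableE R)).
move=> _ [_ [a [b ->] <-]]; apply: open_measurable_rV.
rewrite openE => x [Ax fx]; apply: filterI.
  by move: oA; rewrite openE => /(_ _ Ax).
by apply: cf => //; apply: open_nbhs_nbhs; split => //; exact: interval_open.
Qed.

Lemma continuous_measurable_rV n (f : 'rV[R]_n -> R) :
  continuous f -> measurable_fun setT (f : _ -> measurableTypeR R).
Proof. by move=> cf; apply: (@open_continuous_measurable_rV n setT) ; [exact: openT|move=> x _; exact: cf]. Qed.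

(** Boxes are stable under intersection; as generators of the sigma-algebra they allow an argument
    by Dynkin systems. *)
Lemma measurable_boxes n :
  @measurable _ 'rV[R]_n = <<s [set A | exists a b : 'rV[R]_n, A = box a b] >>.
Proof.
apply/seteqP; split => A; last first.
  move: A; apply: smallest_sub; first exact: sigma_algebra_measurable.
  by move=> _ [a [b ->]]; exact: measurable_box.
move: A; apply: smallest_sub; first exact: smallest_sigma_algebra.
move=> _ [i [j [B [mB ->]]]].
have -> : [set M : 'rV[R]_n | B (M i j)] = (fun M : 'rV[R]_n => M i j) @^-1` B by [].
have : measurable_fun setT ((fun M => M i j) : g_sigma_algebraType
    [set A | exists a b : 'rV[R]_n, A = box a b] -> measurableTypeR R).
  apply: (measurability _ (RGenOpens.measurableE R)).
  move=> _ [_ [a [b ->] <-]]; rewrite setTI.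
  (* A slab in one coordinate is exhausted by boxes whose other sides are []-k, k[]. *)
  pose F k : set 'rV[R]_n := box (\row_l if l == j then a else - k%:R) (\row_l if l == j then b else k%:R).
  have -> : (fun M : 'rV[R]_n => M i j) @^-1` `]a, b[ = \bigcup_k F k.
    apply/seteqP; split => x /=; rewrite ord1 in_itv/=; last first.
      by move=> [k _ /(_ j)]; rewrite !mxE eqxx.
    move=> abx; pose M := \sum_l `|x 0 l|.
    have [k Hk] : exists k : nat, M < k%:R.
      by exists (Num.truncn M).+1; rewrite truncnS_gt.
    exists k => // l; rewrite !mxE; case: eqP => [->//|_].
    rewrite -ltr_norml; apply: le_lt_trans Hk.
    by rewrite /M (bigD1 l)//= lerDl sumr_ge0.
  apply: bigcupT_measurable => k; apply: sub_sigma_algebra.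
  by rewrite /F; eexists; eexists.
by move=> /(_ measurableT B mB); rewrite setTI.
Qed.

Lemma setI_closed_boxes n : setI_closed [set A | exists a b : 'rV[R]_n, A = box a b].
Proof. by move=> _ _ [a [b ->]] [c [d ->]]; rewrite box_setI; do 2 eexists. Qed.

Lemma leb_box n (a b : 'rV[R]_n) :
  leb (box a b) = (\prod_i Num.max 0 (b 0 i - a 0 i))%:E.
Proof.
elim: n a b => [|n IH] a b.
  rewrite big_ord0 /= indicE mem_set//=; by case.
pose a' : 'rV[R]_n := rsubmx (a : 'rV[R]_(1 + n)).
pose b' : 'rV[R]_n := rsubmx (b : 'rV[R]_(1 + n)).
have -> : box a b = [set z : 'rV[R]_n.+1 | (`]a 0 0, b 0 0[%classic : set (measurableTypeR R)) (z 0 0) /\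
    box a' b' (rsubmx (z : 'rV[R]_(1 + n)))].
  apply/seteqP; split => z /=; rewrite in_itv/=.
    move=> abz; split; first exact: abz.
    by move=> i; rewrite !mxE; exact: abz.
  move=> [z0 zr] i; case: (unliftP ord0 i) => [k ->|-> //].
  have := zr k; rewrite !mxE; suff -> : lift ord0 k = rshift 1 k by [].
  exact/val_inj.
rewrite leb_product//; last exact: measurable_box.
rewrite IH lebesgue_measure_itv/= big_ord_recl lte_fin EFinM; congr (_ * _)%E.
  case: ltP => ab; first by rewrite -EFinB max_r// subr_ge0 ltW.
  by rewrite max_l// subr_le0.
by congr EFin; apply: eq_bigr => i _; rewrite !mxE; congr (Num.max _ (b _ _ - a _ _)); exact/val_inj.
Qed.

Lemma leb_box_fin n (a b : 'rV[R]_n) : (leb (box a b) < +oo)%E.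
Proof. by rewrite leb_box ltry. Qed.

Lemma leb_open_gt0 n (A : set 'rV[R]_n) : open A -> A !=set0 -> (0 < leb A)%E.
Proof.
move=> oA [x Ax]; move: Ax (oA); rewrite {1}(open_bigcup_box oA).
move=> [p /= pA px] _; apply: (@lt_le_trans _ _ (leb (rbox p))); last first.
  apply: le_measure; rewrite ?inE; [exact: measurable_box|exact: open_measurable_rV|].
  exact: subset_trans (@box_sub_cbox _ _ _) pA.
rewrite leb_box lte_fin; apply: prodr_gt0 => i _; rewrite lt_max subr_gt0.
by apply/orP; right; have /andP[] := px i; exact: lt_trans.
Qed.

Lemma bounded_set_box n (A : set 'rV[R]_n) : bounded_set A ->
  exists M : R, A `<=` box (const_mx (- M)) (const_mx M).
Proof.
move=> [M [_ /(_ (M + 1))]]; rewrite ltrDl ltr01 => /(_ isT) AM.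
exists (M + 2) => x /AM; rewrite /= => xM i; rewrite !mxE -ltr_norml.
apply: (@le_lt_trans _ _ `|x|); last by lra.
rewrite /Num.norm/= mx_normE.
exact: (le_bigmax _ (fun ij : 'I_1 * 'I_n => `|x ij.1 ij.2|%:nng) (0 : 'I_1, i)).
Qed.

Lemma leb_bounded_fin n (A : set 'rV[R]_n) : measurable A -> bounded_set A -> (leb A < +oo)%E.
Proof.
move=> mA /bounded_set_box[M AM]; apply: le_lt_trans (leb_box_fin (const_mx (-M)) (const_mx M)).
by apply: le_measure; rewrite ?inE//; exact: measurable_box.
Qed.

Definition tprod n (f : 'I_n -> R -> R) (x : 'rV[R]_n) : R := \prod_i f i (x 0 i).

Lemma dir_is_derive n (f : 'rV[R]_n -> R) (x v : 'rV[R]_n) (a : R) :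
  isd (fun h => f (h *: v + x)) 0 a -> is_derive x v (f : _ -> R^o) a.
Proof.
have E : (fun h : R => h^-1 *: ((f (h *: v + x) : R^o) - f x)) =
    (fun h : R => h^-1 *: (((fun h => f (h *: v + x)) (h *: (1:R) + 0) : R^o) - (fun h => f (h *: v + x)) 0)).
  by apply/funext => h; rewrite addr0 scale0r add0r /GRing.scale/= mulr1.
move=> [df ef]; split; first by rewrite /derivable E.
by rewrite /derive E.
Qed.

Lemma is_derive_dir n (f : 'rV[R]_n -> R) (x v : 'rV[R]_n) (t : R) :
  derivable (f : _ -> R^o) (t *: v + x) v -> isd (fun h => f (h *: v + x)) t ('D_v (f : _ -> R^o) (t *: v + x)).
Proof.
have E : (fun h : R => h^-1 *: ((f (h *: v + (t *: v + x)) : R^o) - f (t *: v + x))) =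
    (fun h : R => h^-1 *: (((fun h => f (h *: v + x)) (h *: (1:R) + t) : R^o) - (fun h => f (h *: v + x)) t)).
  by apply/funext => h; rewrite (mulr1 h : h *: (1:R) = h) scalerDl addrA.
by rewrite /derivable /derive E => df; split.
Qed.

Lemma is_derive_tprod n (f : 'I_n -> R -> R) (j : 'I_n) (f' : R) (x : 'rV[R]_n) :
  isd (f j) (x 0 j) f' ->
  is_derive x (basis_vec R j) (tprod f : _ -> R^o)
    (f' * \prod_(i | i != j) f i (x 0 i)).
Proof.
move=> df; apply: dir_is_derive.
have E : (fun h : R => tprod f (h *: basis_vec R j + x)) =1
   (fun h => f j (1 * h + x 0 j) * \prod_(i | i != j) f i (x 0 i)).
  move=> h; rewrite /tprod (bigD1 j)//=; congr (_ * _).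
    by rewrite !mxE !eqxx /= mulr1 mul1r.
  apply: eq_bigr => i ij; by rewrite !mxE (negbTE ij) mulr0 add0r.
apply: isd_eq (fsym E) erefl.
have df0 : isd (f j) (1 * 0 + x 0 j) f' by rewrite mulr0 add0r.
apply: (isd_eq (isdM (@isd_comp R (f j) (fun h => 1 * h + x 0 j) 0 _ _ df0 (isd_affine 1 (x 0 j) 0)) (isd_cst _ 0))) => //.
by rewrite mulr1 mulr0 addr0.
Qed.

(** A partial derivative of a tensor product is again a tensor product with one factor
    differentiated, so smoothness in several variables reduces to one variable. *)
Lemma Ck_tprod n k (f : 'I_n -> R -> R) : (forall i, smooth (f i)) -> Ck k (tprod f).
Proof.
elim: k f => [|k IH] f sf.
  move=> x; apply: (@cvg_big _ _ _ _ _ _ _ (nbhs x)) => [|i _]; first exact: mul_continuous.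
  apply: (@continuous_comp _ _ _ (fun x : 'rV[R]_n => x 0 i) (f i)).
    exact: coord_continuous.
  exact: smooth_continuous (sf i) _.
move=> j; have [f' sf' df] := smoothW (sf j).
split; first by move=> x; have [] := is_derive_tprod (df (x 0 j)).
have -> : (fun x => 'D_(basis_vec R j) (tprod f : _ -> R^o) x) =
    tprod (fun i => if i == j then f' else f i).
  apply/funext => x; have [_ ->] := is_derive_tprod (df (x 0 j)).
  rewrite /tprod [RHS](bigD1 j)//= eqxx; congr (_ * _).
  by apply: eq_bigr => i /negbTE ->.
by apply: IH => i; case: ifP => _; [exact: sf'|exact: sf].
Qed.

Definition bump_box n (a b : 'rV[R]_n) (m : nat) : 'rV[R]_n -> R :=
  tprod (fun i => ibump (a 0 i) (b 0 i) m).

Lemma test_bump_box n (Omega : set 'rV[R]_n) a b m : cbox a b `<=` Omega ->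
  test_fun Omega (bump_box a b m).
Proof.
move=> abO; split; first by move=> k; apply: Ck_tprod => i; exact: smooth_ibump.
exists (cbox a b); first by split => //; exact: compact_cbox.
move=> x /existsNP[i abx]; rewrite /bump_box /tprod (bigD1 i)//= ibump_out ?mul0r//.
Qed.

Lemma bump_box_ge0 n (a b : 'rV[R]_n) m x : 0 <= bump_box a b m x.
Proof. by apply: prodr_ge0 => i _; exact: ibump_ge0. Qed.

Lemma bump_box_le1 n (a b : 'rV[R]_n) m x : bump_box a b m x <= 1.
Proof.
suff /andP[_ ->] : 0 <= bump_box a b m x <= 1 by [].
rewrite /bump_box /tprod; elim/big_ind: _ => [|u v /andP[u0 u1] /andP[v0 v1]|i _].
- by rewrite ler01 lexx.
- by rewrite mulr_ge0//= mulr_ile1.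
- by rewrite ibump_ge0 ibump_le1.
Qed.

Lemma bump_box_cvg n (a b x : 'rV[R]_n) : bump_box a b m x @[m --> \oo] --> (\1_(box a b) x : R).
Proof.
have -> : \1_(box a b) x = \prod_i \1_(`]a 0 i, b 0 i[%classic) (x 0 i) :> R.
  rewrite indicE; case: (boolP (x \in box a b)) => [|/negP abx].
    rewrite inE => abx; rewrite big1// => i _; rewrite indicE mem_set//= in_itv/=; exact: abx.
  have /existsNP[i Hi] : ~ (box a b x) by move=> H; apply: abx; rewrite inE.
  by rewrite (bigD1 i)//= indicE memNset ?mul0r//= in_itv.
by apply: cvg_big => [|i _]; [exact: mul_continuous|exact: ibump_cvg].
Qed.

Lemma ae_forall_count d (T : measurableType d) (mu : {measure set T -> \bar R}) (I : countType) (P : I -> T -> Prop) :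
  (forall i, {ae mu, forall x, P i x}) -> {ae mu, forall x, forall i, P i x}.
Proof.
move=> H.
have Hn (k : nat) : mu.-negligible [set x | ~ (forall i, unpickle k = Some i -> P i x)].
  case: (unpickle k) => [i|].
    by apply: negligibleS (H i) => x /= Px Pi; apply: Px => j [<-].
  by apply: negligibleS (negligible_set0 mu) => x /=; apply.
apply: negligibleS (negligible_bigcup Hn) => x /= /existsNP[i Pi].
by exists (pickle i) => //=; move/(_ i); rewrite pickleK => /(_ erefl).
Qed.

(** The bumps of the box are test functions, bounded by 1, and converge to its indicator: dominated
    convergence carries the hypothesis to the limit. *)
Lemma integral_box_eq0 n (Omega : set 'rV[R]_n) (g : 'rV[R]_n -> R) (a b : 'rV[R]_n) :
  open Omega -> (@leb R n).-integrable Omega (EFin \o g) ->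
  (forall phi, test_fun Omega phi -> ips Omega g phi = 0) ->
  cbox a b `<=` Omega -> (\int[@leb R n]_(x in box a b) (g x)%:E = 0)%E.
Proof.
move=> oO ig H abO; have mO := open_measurable_rV oO.
have mg : measurable_fun Omega (g : _ -> measurableTypeR R) by apply/measurable_EFinP; case/integrableP : ig.
have mb m : measurable_fun Omega (bump_box a b m : _ -> measurableTypeR R).
  apply: measurable_funTS; apply: continuous_measurable_rV.
  by have [/(_ 0%N)] := @test_bump_box n Omega a b m abO.
have ib m : (@leb R n).-integrable Omega (fun x => (g x * bump_box a b m x)%:E).
  apply: le_integrable ig => //; first have mgb := measurable_funM mg (mb m).
    by apply/measurable_EFinP; exact: mgb.
  move=> x _; rewrite /= lee_fin normrM ler_piMr// ger0_norm ?bump_box_ge0//.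
  exact: bump_box_le1.
have [] := @dominated_convergence _ _ _ (@leb R n) Omega mO
  (fun m x => (g x * bump_box a b m x)%:E) (fun x => (g x * \1_(box a b) x)%:E) (fun x => `|(g x)%:E|%E).
- by move=> m; have /integrableP[] := ib m.
- apply/measurable_EFinP; apply: measurable_funM => //; apply: measurable_funTS.
  by apply: measurable_indic; exact: measurable_box.
- apply: nearW => x _; apply/cvg_EFin; first by exact: nearW.
  by apply: cvgM; [exact: cvg_cst|exact: bump_box_cvg].
- exact: integrable_abse.
- apply: nearW => x m _; rewrite /= lee_fin normrM ler_piMr// ger0_norm ?bump_box_ge0//.
  exact: bump_box_le1.
move=> _ _ C; have : (fun=> 0%E : \bar R) @ \oo --> (\int[@leb R n]_(x in Omega) (g x * \1_(box a b) x)%:E)%E.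
  apply: cvg_trans C; apply: near_eq_cvg; apply: nearW => m /=.
  have := H _ (@test_bump_box n Omega a b m abO); rewrite /ips /Rintegral => E.
  by rewrite -[LHS]fineK ?E//; apply: integrable_fin_num (ib m).
move=> C0; have E0 : 0%E = (\int[@leb R n]_(x in Omega) (g x * \1_(box a b) x)%:E)%E.
  exact: (cvg_unique (@ereal_hausdorff R) (cvg_cst 0%E) C0).
rewrite [RHS]E0.
have bO : box a b `<=` Omega by exact: subset_trans (@box_sub_cbox _ _ _) abO.
rewrite -[in LHS](setIidr bO) integral_mkcondr; apply: eq_integral => x _.
by rewrite patchE indicE; case: ifP => _; rewrite ?mulr1 ?mulr0.
Qed.

(** Fundamental lemma of the calculus of variations. On a rational box the integrals over all
    subboxes vanish, hence over all measurable subsets by Dynkin induction, so [g] vanishes almost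
    everywhere there; countably many such boxes cover [Omega]. *)
Lemma ips_test_eq0 n (Omega : set 'rV[R]_n) (g : 'rV[R]_n -> R) :
  open Omega -> (@leb R n).-integrable Omega (EFin \o g) ->
  (forall phi, test_fun Omega phi -> ips Omega g phi = 0) ->
  {ae @leb R n, forall x, Omega x -> g x = 0}.
Proof.
move=> oO ig H; have mO := open_measurable_rV oO.
have bO (p : 'rV[rat]_n * 'rV[rat]_n) : crbox p `<=` Omega -> rbox p `<=` Omega.
  by move=> pO; exact: subset_trans (@box_sub_cbox _ _ _) pO.
have Hp (p : 'rV[rat]_n * 'rV[rat]_n) : {ae @leb R n, forall x, crbox p `<=` Omega -> rbox p x -> g x = 0}.
  have [pO|pO] := pselect (crbox p `<=` Omega); last exact: nearW.
  have mQ : measurable (rbox p) by exact: measurable_box.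
  have igp (A : set 'rV[R]_n) : measurable A -> (@leb R n).-integrable (A `&` rbox p) (EFin \o g).
    move=> mA; apply: integrableS ig => //; first exact: measurableI.
    by move=> x [_ px]; exact: bO px.
  have Z (A : set 'rV[R]_n) : measurable A -> (\int[@leb R n]_(x in A `&` rbox p) (g x)%:E = 0)%E.
    rewrite {1}measurable_boxes.
    apply: (@dynkin_induction _ _ _ (fun A => \int[@leb R n]_(x in A `&` rbox p) (g x)%:E = 0)%E (measurable_boxes n)) => //.
    - exact: setI_closed_boxes.
    - by rewrite setTI; exact: (integral_box_eq0 oO ig H pO).
    - move=> _ [a [b ->]] /=; rewrite box_setI; apply: (integral_box_eq0 oO ig H).
      apply: subset_trans pO => x; rewrite /cbox /crbox/= => Hx i.
      by have := Hx i; rewrite !mxE ge_max le_min => /andP[/andP[_ ->] /andP[_ ->]].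
    - move=> S mS HS.
      have := @integral_setU_EFin _ _ _ (@leb R n) (S `&` rbox p) (~` S `&` rbox p) g.
      rewrite -setIUl setUv setTI HS add0e => <- //.
      - exact: (integral_box_eq0 oO ig H pO).
      - exact: measurableI.
      - by apply: measurableI => //; exact: measurableC.
      - by apply/measurable_EFinP; have /integrableP[] := igp setT measurableT; rewrite setTI.
      - by apply/disj_setPS => x [[Sx _] [nSx _]]; exact: nSx.
    - move=> F mF tF HF; rewrite setI_bigcupl integral_bigcup.
      + by apply: eseries0 => k _ _; exact: HF.
      + by apply/trivIsetP => i j _ _ ij; rewrite setIACA; move/trivIsetP : tF => ->//; rewrite set0I.
      + by move=> k; exact: measurableI.
      + by rewrite -setI_bigcupl; apply: igp; exact: bigcupT_measurable.
  have : ae_eq (@leb R n) (rbox p) (EFin \o g) (cst 0%E).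
    apply: integral_ae_eq => //.
      by have := igp setT measurableT; rewrite setTI.
    by move=> E Ep mE; rewrite integral0 -(setIidl Ep); exact: Z.
  by apply: filterS => x Hx _ px; have := Hx px; case.
apply: filterS (ae_forall_count Hp) => x Hx Ox; move: (Ox).
by rewrite (open_bigcup_box oO) => -[p /= pO px]; exact: Hx px.
Qed.

Definition glue n (p : measurableTypeR R * 'rV[R]_n) : 'rV[R]_n.+1 :=
  row_mx (const_mx p.1 : 'rV[R]_1) p.2.

Lemma glue0 n (p : measurableTypeR R * 'rV[R]_n) : glue p 0 0 = p.1.
Proof. by rewrite mxE; case: splitP => // k _; rewrite mxE. Qed.

Lemma glueS n (p : measurableTypeR R * 'rV[R]_n) k : glue p 0 (lift ord0 k) = p.2 0 k.
Proof.
rewrite mxE; case: splitP => [l|l] /=; first by rewrite ord1.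
by rewrite /bump leq0n !add1n => -[] /val_inj ->.
Qed.

Lemma measurable_glue n : measurable_fun setT (@glue n).
Proof.
apply: measurable_fun_mx => i j.
rewrite [X in measurable_fun _ X](_ : _ = fun p : measurableTypeR R * 'rV[R]_n =>
  match fintype.split (j : 'I_(1 + n)) with inl _ => p.1 | inr k => p.2 i k end); last first.
  by apply/funext => p; rewrite /glue mxE; case: fintype.split => k //; rewrite mxE.
case: fintype.split => k; first exact: measurable_fst.
exact: (measurableT_comp (@measurable_mxcoord R _ _ i k) measurable_snd).
Qed.

(** Makes Fubini's theorem available for [leb], in both orders of integration. *)
Lemma leb_pushforward n :
  @leb R n.+1 = pushforward ((@lebesgue_measure R) \x (@leb R n))%E (@glue n).
Proof.
apply/funext => A /=; rewrite /pushforward /= /product_measure1.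
apply: eq_integral => x _ /=; congr (leb _).
by apply/seteqP; split => y /=; rewrite /xsection /= inE.
Qed.

Section fubini_leb.
Variables (n : nat) (f : 'rV[R]_n.+1 -> R) (M C : R).
Hypothesis mf : measurable_fun setT (f : _ -> measurableTypeR R).
Hypothesis bf : forall x, `|f x| <= C.
Hypothesis sf : forall x, ~ cbox (const_mx (- M)) (const_mx M) x -> f x = 0.

(** The sides are enlarged by one so that an open box, of finite measure, contains the closed cube
    outside which [f] vanishes. *)
Let Q := `](- (M + 1)), (M + 1)[%classic `*` box (const_mx (- (M + 1))) (const_mx (M + 1)) : set (measurableTypeR R * 'rV[R]_n).

Let mQ : measurable Q.
Proof. by apply: measurableX; [exact: measurable_itv|exact: measurable_box]. Qed.

Let fg0 p : ~ Q p -> f (glue p) = 0.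
Proof.
move=> Qp; apply: sf => H; apply: Qp; split => /=.
  have := H 0; rewrite glue0 !mxE in_itv/= => /andP[h1 h2].
  apply/andP; split; lra.
move=> k; have := H (lift ord0 k); rewrite glueS !mxE => /andP[h1 h2].
apply/andP; split; lra.
Qed.

Lemma integrable_glue : ((@lebesgue_measure R) \x (@leb R n))%E.-integrable setT (EFin \o (f \o @glue n)).
Proof.
have mfg : measurable_fun setT ((f \o @glue n) : _ -> measurableTypeR R) by exact: (measurableT_comp mf (@measurable_glue n)).
have -> : EFin \o (f \o @glue n) = (EFin \o (f \o @glue n)) \_ Q.
  apply/funext => p; rewrite patchE; case: ifPn => //; rewrite notin_setE => /fg0 /=.
  by move=> ->.
apply/(integrable_mkcond _ mQ); apply: measurable_bounded_integrable => //.
- rewrite /= product_measure1E//; last exact: measurable_box.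
  apply: lte_mul_pinfty => //; last exact: leb_box_fin.
  have : (@lebesgue_measure R [set` `](- (M + 1))%R, (M + 1)%R[%R] < +oo)%E.
    by rewrite lebesgue_measure_itv/=; case: ifP => _; rewrite ?ltry// -EFinB ltry.
  by move=> h; rewrite ge0_fin_numE.
- exact: measurable_funTS.
- exists C; split; first exact: num_real.
  by move=> K CK p _; apply: le_trans (bf _) (ltW CK).
Qed.

Lemma integral_leb1 : (\int[@leb R n.+1]_z (f z)%:E =
  \int[@lebesgue_measure R]_x \int[@leb R n]_y (f (glue (x, y)))%:E)%E.
Proof.
transitivity (\int[pushforward ((@lebesgue_measure R) \x (@leb R n)) (@glue n)]_z (f z)%:E)%E.
  by apply: eq_measure_integral => [|mg A mA _]; [exact: measurable_glue|rewrite [LHS](congr1 (fun m => m A) (leb_pushforward n))].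
rewrite integral_pushforward//.
- by rewrite preimage_setT -(integral12_prod_meas1 integrable_glue).
- exact: measurable_glue.
- exact/measurable_EFinP.
- by rewrite preimage_setT; exact: integrable_glue.
Qed.

Lemma integral_leb2 : (\int[@leb R n.+1]_z (f z)%:E =
  \int[@leb R n]_y \int[@lebesgue_measure R]_x (f (glue (x, y)))%:E)%E.
Proof.
rewrite integral_leb1; exact: (Fubini integrable_glue).
Qed.

End fubini_leb.

End boxes.

(** * Integrals of partial derivatives of compactly supported functions *)

Section divergence.
Variable R : realType.

Lemma closed_cbox n (a b : 'rV[R]_n) : closed (cbox a b).
Proof. by apply: compact_closed; [exact: norm_hausdorff|exact: compact_cbox]. Qed.

Lemma continuous_bounded_on n (K : set 'rV[R]_n) (g : 'rV[R]_n -> R) :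
  compact K -> {within K, continuous g} -> exists2 C, 0 <= C & forall x, K x -> `|g x| <= C.
Proof.
move=> cK cg; have := continuous_compact cg cK => /compact_bounded[C [_ HC]].
exists (Num.max 0 (C + 1)); first by rewrite le_max lexx.
move=> x Kx; rewrite le_max; apply/orP; right; apply: HC; first by rewrite ltrDl.
by exists x.
Qed.

Lemma isd_integral0 (f f' : R -> R) (M : R) : 0 <= M ->
  (forall t, isd f t (f' t)) -> continuous f' ->
  (forall t, M < `|t| -> f t = 0) -> (\int[@lebesgue_measure R]_t (f' t)%:E = 0)%E.
Proof.
move=> M0 df cf f0.
have f'0 t : M < `|t| -> f' t = 0.
  move=> Mt; rewrite -(isd_derive1 (df t)).
  apply: isd_derive1; apply: isd_near (isd_cst 0 t).
  near=> s; apply/esym/f0; near: s.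
  have : open [set s : R | M < `|s|].
    rewrite (_ : [set s : R | _] = (fun s : R => `|s|) @^-1` [set x | M < x]) //.
    by apply: open_comp => [x _|]; [exact: norm_continuous|exact: open_gt].
  by rewrite openE => /(_ t Mt).
transitivity (\int[@lebesgue_measure R]_(t in [set` `[(- (M + 1))%R, (M + 1)%R]%R]) (f' t)%:E)%E.
  rewrite [RHS]integral_mkcond; apply: eq_integral => t _; rewrite patchE.
  case: ifPn => //; rewrite notin_setE/= in_itv/= => /negP; rewrite -ler_norml -ltNge => Mt.
  by rewrite f'0//; lra.
have cfd : continuous f by move=> t; exact: isd_continuous (df t).
rewrite (@continuous_FTC2 _ f' f).
- by rewrite !f0 ?subee// ?normrN ger0_norm; lra.
- lra.
- by apply: continuous_subspaceT => x; exact: cf.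
- split; first by move=> x _; have [] := df x.
  + by apply: cvg_at_right_filter; exact: cfd.
  + by apply: cvg_at_left_filter; exact: cfd.
- by move=> x _; exact: isd_derive1.
Unshelve. all: by end_near. Qed.

Lemma glue_shift0 n (h x : R) (y : 'rV[R]_n) :
  glue (h + x : measurableTypeR R, y) = h *: basis_vec R (ord0 : 'I_n.+1) + glue (x : measurableTypeR R, y).
Proof.
apply/rowP => i; rewrite [RHS]mxE [X in _ = X + _]mxE [X in _ = _ * X + _]mxE; case: (unliftP ord0 i) => [k ->|->].
  by rewrite !glueS /= mulr0 add0r.
by rewrite !glue0 /= mulr1.
Qed.

Lemma glue_shiftS n (h : R) (x : measurableTypeR R) (k : 'I_n) (y : 'rV[R]_n) :
  glue (x, h *: basis_vec R k + y) = h *: basis_vec R (lift ord0 k) + glue (x, y).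
Proof.
apply/rowP => i; rewrite [RHS]mxE [X in _ = X + _]mxE [X in _ = _ * X + _]mxE; case: (unliftP ord0 i) => [l ->|->].
  by rewrite !glueS !mxE/= (inj_eq lift_inj).
by rewrite !glue0 /= mulr0 add0r.
Qed.

Lemma rV_le_norm n (x : 'rV[R]_n) i : `|x 0 i| <= `|x|.
Proof.
rewrite [in leRHS]/Num.norm/= mx_normE.
exact: (le_bigmax _ (fun ij : 'I_1 * 'I_n => `|x ij.1 ij.2|%:nng) (0 : 'I_1, i)).
Qed.

Lemma rV_norm_le n (x : 'rV[R]_n) (e : R) : 0 <= e -> (forall i, `|x 0 i| <= e) -> `|x| <= e.
Proof.
move=> e0 xe; rewrite /Num.norm/=; have [->//|/mx_norm_neq0[[i j] ->]] := eqVneq (mx_norm x) 0.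
by rewrite ord1.
Qed.

Lemma continuous_glue n (f : 'rV[R]_n.+1 -> R) : continuous f ->
  (forall y, continuous (fun x : R => f (glue (x : measurableTypeR R, y)))) /\
  (forall x : measurableTypeR R, continuous (fun y => f (glue (x, y)))).
Proof.
move=> cf; split => [y x|x y].
  apply: (@continuous_comp _ _ _ (fun x : R => glue (x : measurableTypeR R, y)) f); last exact: cf.
  have E : (fun x : R => glue (x : measurableTypeR R, y)) = fun x : R => x *: basis_vec R (ord0 : 'I_n.+1) + glue (0 : measurableTypeR R, y).
    by apply/funext => t; rewrite -glue_shift0 addr0.
  rewrite E; apply: cvgD; last exact: cvg_cst.
  exact: cvgZr_tmp.
apply: (@continuous_comp _ _ _ (fun y => glue (x, y)) f); last exact: cf.
apply/(@cvgrPdist_lt _ _ _ (nbhs y)) => e e0; near=> z.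
rewrite (_ : glue (x, y) - glue (x, z) = glue (0 : measurableTypeR R, y - z)); last first.
  apply/rowP => i; rewrite !mxE; case: splitP => k _; rewrite !mxE ?subrr//.
apply: (@le_lt_trans _ _ `|y - z|); last by near: z; exact: cvgr_dist_lt.
apply: rV_norm_le => // j; case: (unliftP ord0 j) => [k ->|->]; last by rewrite glue0 /= normr0.
by rewrite glueS /= rV_le_norm.
Unshelve. all: by end_near. Qed.

(** Induction on the dimension. If the derivative is not along the first coordinate, integrate the
    other coordinates first and use the induction hypothesis on each slice; otherwise exchange the
    order and apply the fundamental theorem of calculus on each line. *)
Lemma integral_deriv0 n (j : 'I_n) (phi : 'rV[R]_n -> R) (M : R) : 0 <= M ->
  (forall x, derivable (phi : _ -> R^o) x (basis_vec R j)) ->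
  continuous (fun x => 'D_(basis_vec R j) (phi : _ -> R^o) x : R) ->
  (forall x, ~ cbox (const_mx (- M)) (const_mx M) x -> phi x = 0) ->
  (\int[@leb R n]_x ('D_(basis_vec R j) (phi : _ -> R^o) x)%:E = 0)%E.
Proof.
move=> M0; elim: n j phi => [[]//|n IH] j phi dphi cphi phi0.
pose g x : R := 'D_(basis_vec R j) (phi : _ -> R^o) x.
have g0 x : ~ cbox (const_mx (- M)) (const_mx M) x -> g x = 0.
  move=> Hx; rewrite /g (@near_eq_derive _ _ _ _ (cst 0)) ?derive_cst//.
  near=> y; apply: phi0; near: y.
  have := closed_openC (@closed_cbox _ (const_mx (- M)) (const_mx M : 'rV[R]_n.+1)).
  by rewrite openE => /(_ x Hx).
have [C C0 bg0] := @continuous_bounded_on _ (cbox (const_mx (- M)) (const_mx M)) g (@compact_cbox _ _ _ _) (continuous_subspaceT cphi).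
have bg x : `|g x| <= C.
  have [/bg0//|/g0 ->] := pselect (cbox (const_mx (- M)) (const_mx M) x).
  by rewrite normr0.
have mg : measurable_fun setT (g : _ -> measurableTypeR R) by exact: continuous_measurable_rV.
have [cg1 cg2] := continuous_glue cphi.
case: (unliftP ord0 j) => [k jk|j0].
  rewrite (integral_leb1 mg bg g0) integral0_eq// => x _.
  have D y : 'D_(basis_vec R k) ((fun y => phi (glue (x, y))) : _ -> R^o) y = g (glue (x, y)) /\
      derivable ((fun y => phi (glue (x, y))) : _ -> R^o) y (basis_vec R k).
    suff H : is_derive y (basis_vec R k) ((fun y => phi (glue (x, y))) : _ -> R^o) (g (glue (x, y))).
      by split; have [] := H.
    apply: dir_is_derive; have := @is_derive_dir _ _ phi (glue (x, y)) (basis_vec R j) 0 (dphi _).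
    move=> H; apply: (isd_eq H) => [h|]; first by rewrite jk -glue_shiftS.
    by rewrite /g scale0r add0r.
  rewrite -[RHS](IH k (fun y => phi (glue (x, y)))).
  - by apply: eq_integral => y _; rewrite (D y).1.
  - by move=> y; exact: (D y).2.
  - have -> : 'D_(basis_vec R k) ((fun y => phi (glue (x, y))) : _ -> R^o) = fun y => g (glue (x, y)).
      by apply/funext => y; rewrite (D y).1.
    exact: cg2.
  - move=> y Hy; apply: phi0 => H; apply: Hy => i.
    by have := H (lift ord0 i); rewrite glueS !mxE.
rewrite (integral_leb2 mg bg g0) integral0_eq// => y _.
apply: (@isd_integral0 (fun t : R => phi (glue (t : measurableTypeR R, y))) _ M) => //.
- move=> t; have := @is_derive_dir _ _ phi (glue (0 : measurableTypeR R, y)) (basis_vec R j) t (dphi _).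
  move=> H; apply: (isd_eq H) => [h|]; first by rewrite j0 -glue_shift0 addr0.
  have -> : t *: basis_vec R j + glue (0 : measurableTypeR R, y) = glue (t : measurableTypeR R, y).
    by rewrite j0 -glue_shift0 addr0.
  by [].
- exact: cg1.
- move=> t Mt; apply: phi0 => /(_ 0); rewrite glue0 !mxE/= -ler_norml leNgt.
  by rewrite Mt.
Unshelve. all: by end_near. Qed.

End divergence.

(** * Semi-inner products and orthonormal bases *)

Section semi_inner_product.
Variables (R : realType) (V : lmodType R).
Implicit Types (X : set V) (B : V -> V -> R).

(** Definiteness is not asked for, since functions equal almost everywhere on [Omega] remain
    distinct elements. The laws are restricted to [X], outside which an integral need not be
    additive. *)
Record sip X B : Prop := Sip {
  sip0 : X 0;
  sipP : forall a x y, X x -> X y -> X (a *: x + y);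
  sip_lin : forall a x y z, X x -> X y -> X z ->
    B (a *: x + y) z = a * B x z + B y z;
  sipC : forall x y, X x -> X y -> B x y = B y x;
  sip_ge0 : forall x, X x -> 0 <= B x x }.

Lemma sip_sub X Y B : sip X B -> Y `<=` X -> Y 0 ->
  (forall a x y, Y x -> Y y -> Y (a *: x + y)) -> sip Y B.
Proof.
move=> S YX Y0 YP; split => //.
- by move=> a x y z /YX Xx /YX Xy /YX Xz; exact: (sip_lin S).
- by move=> x y /YX Xx /YX Xy; exact: (sipC S).
- by move=> x /YX; exact: (sip_ge0 S).
Qed.

Lemma sip_add X B1 B2 (t : R) : 0 <= t -> sip X B1 -> sip X B2 ->
  sip X (fun x y => B1 x y + t * B2 x y).
Proof.
move=> t0 S1 S2; split; first exact: (sip0 S1).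
- exact: (sipP S1).
- by move=> a x y z Xx Xy Xz; rewrite (sip_lin S1)// (sip_lin S2)//; ring.
- by move=> x y Xx Xy; rewrite (sipC S1)// (sipC S2).
- by move=> x Xx; rewrite addr_ge0 ?mulr_ge0// ?(sip_ge0 S1)// (sip_ge0 S2).
Qed.

Section theory.
Variables (X : set V) (B : V -> V -> R) (S : sip X B).

Definition snorm x := Num.sqrt (B x x).

Lemma sipD x y : X x -> X y -> X (x + y).
Proof. by move=> Xx Xy; rewrite -[x]scale1r; exact: (sipP S). Qed.

Lemma sipZ a x : X x -> X (a *: x).
Proof. by move=> Xx; rewrite -[_ *: _]addr0; apply: (sipP S) => //; exact: (sip0 S). Qed.

Lemma sipN x : X x -> X (- x).
Proof. by move=> Xx; rewrite -scaleN1r; exact: sipZ. Qed.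

Lemma sipB x y : X x -> X y -> X (x - y).
Proof. by move=> Xx Xy; apply: sipD => //; exact: sipN. Qed.

Lemma sip_sum (I : Type) (r : seq I) (P : pred I) (F : I -> V) :
  (forall i, X (F i)) -> X (\sum_(i <- r | P i) F i).
Proof. by move=> XF; elim/big_ind: _ => //; [exact: sip0 S|exact: sipD]. Qed.

Lemma sipDl x y z : X x -> X y -> X z -> B (x + y) z = B x z + B y z.
Proof. by move=> *; rewrite -{1}[x]scale1r (sip_lin S)// mul1r. Qed.

Lemma sip0l z : X z -> B 0 z = 0.
Proof.
move=> Xz; have X0 := sip0 S; have := sipDl X0 X0 Xz; rewrite addr0 => /eqP.
by rewrite -subr_eq subrr => /eqP.
Qed.

Lemma sipZl a x z : X x -> X z -> B (a *: x) z = a * B x z.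
Proof.
move=> Xx Xz; rewrite -[a *: x]addr0 (sip_lin S)//; last exact: (sip0 S).
by rewrite sip0l// addr0.
Qed.

Lemma sipNl x z : X x -> X z -> B (- x) z = - B x z.
Proof. by move=> *; rewrite -scaleN1r sipZl// mulN1r. Qed.

Lemma sipBl x y z : X x -> X y -> X z -> B (x - y) z = B x z - B y z.
Proof. by move=> Xx Xy Xz; rewrite sipDl ?sipNl//; exact: sipN. Qed.

Lemma sip_suml (I : Type) (r : seq I) (P : pred I) (F : I -> V) z : X z ->
  (forall i, X (F i)) -> B (\sum_(i <- r | P i) F i) z = \sum_(i <- r | P i) B (F i) z.
Proof.
move=> Xz XF; elim: r => [|i r IH]; first by rewrite !big_nil sip0l.
by rewrite !big_cons; case: ifP => // _; rewrite sipDl// ?IH//; exact: sip_sum.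
Qed.

Lemma sipDr x y z : X x -> X y -> X z -> B z (x + y) = B z x + B z y.
Proof. by move=> Xx Xy Xz; rewrite (sipC S Xz (sipD Xx Xy)) (sipC S Xz Xx) (sipC S Xz Xy) sipDl. Qed.

Lemma sipZr a x z : X x -> X z -> B z (a *: x) = a * B z x.
Proof. by move=> Xx Xz; rewrite (sipC S Xz (sipZ a Xx)) (sipC S Xz Xx) sipZl. Qed.

Lemma sip_sumr (I : Type) (r : seq I) (P : pred I) (F : I -> V) z : X z ->
  (forall i, X (F i)) -> B z (\sum_(i <- r | P i) F i) = \sum_(i <- r | P i) B z (F i).
Proof.
move=> Xz XF; rewrite (sipC S)// ?sip_suml//; last exact: sip_sum.
by apply: eq_bigr => i _; exact: (sipC S).
Qed.

Lemma snorm_ge0 x : 0 <= snorm x. Proof. exact: sqrtr_ge0. Qed.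

Lemma snorm2 x : X x -> snorm x ^+ 2 = B x x.
Proof. by move=> Xx; rewrite sqr_sqrtr// (sip_ge0 S). Qed.

Lemma sip_sqD x y a : X x -> X y ->
  B (a *: x + y) (a *: x + y) = a ^+ 2 * B x x + 2 * a * B x y + B y y.
Proof.
move=> Xx Xy; have Xax := sipZ a Xx.
rewrite sipDl// ?sipDr// ?sipZl// ?sipZr//; try exact: sipD.
by rewrite (sipC S Xy Xx); ring.
Qed.

Lemma cauchy_schwarz2 x y : X x -> X y -> B x y ^+ 2 <= B x x * B y y.
Proof.
move=> Xx Xy; have xx := sip_ge0 S Xx; have yy := sip_ge0 S Xy.
have [x0|x0] := eqVneq (B x x) 0; last first.
  have H := sip_ge0 S (sipP S (- B x y / B x x) Xx Xy).
  have x1 : 0 < B x x by rewrite lt_def x0.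
  rewrite sip_sqD// in H; rewrite -subr_ge0.
  suff -> : B x x * B y y - B x y ^+ 2 = B x x * ((- B x y / B x x) ^+ 2 * B x x + 2 * (- B x y / B x x) * B x y + B y y).
    exact: mulr_ge0.
  by field.
rewrite x0 mul0r; have [->|xy0] := eqVneq (B x y) 0; first by rewrite expr0n.
(* When [B x x] vanishes, the square of [a *: x + y] is affine in [a]; this [a] gives it the value
   -1, which is absurd. *)
have H := sip_ge0 S (sipP S (- (B y y + 1) / (2 * B x y)) Xx Xy).
rewrite sip_sqD// x0 mulr0 add0r in H.
have E : 2 * (- (B y y + 1) / (2 * B x y)) * B x y + B y y = - 1 by field.
by move: H; rewrite E lerNr oppr0 ler10.
Qed.

Lemma cauchy_schwarz x y : X x -> X y -> `|B x y| <= snorm x * snorm y.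
Proof.
move=> Xx Xy; rewrite -(@ler_pXn2r _ 2)// ?nnegrE ?mulr_ge0 ?snorm_ge0//.
by rewrite exprMn !snorm2// real_normK ?num_real//; exact: cauchy_schwarz2.
Qed.

Lemma snormD x y : X x -> X y -> snorm (x + y) <= snorm x + snorm y.
Proof.
move=> Xx Xy; rewrite -(@ler_pXn2r _ 2)// ?nnegrE ?addr_ge0 ?snorm_ge0//.
rewrite snorm2; last exact: sipD.
rewrite -[x in B (x + _)]scale1r -[x in B _ (x + _)]scale1r sip_sqD//.
rewrite sqrrD !snorm2// expr1n mul1r mulr1 lerD2r lerD2l mulr2n mulrDl mul1r.
by have := le_trans (ler_norm _) (cauchy_schwarz Xx Xy) => h; rewrite lerD.
Qed.

Lemma snormZ a x : X x -> snorm (a *: x) = `|a| * snorm x.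
Proof.
move=> Xx; rewrite /snorm sipZl// ?sipZr//; last exact: sipZ.
by rewrite mulrA -expr2 sqrtrM ?sqr_ge0// sqrtr_sqr.
Qed.

Lemma snorm_sum (I : Type) (r : seq I) (P : pred I) (F : I -> V) : (forall i, X (F i)) ->
  snorm (\sum_(i <- r | P i) F i) <= \sum_(i <- r | P i) snorm (F i).
Proof.
move=> XF; elim: r => [|i r IH]; first by rewrite !big_nil /snorm sip0l ?sqrtr0//; exact: (sip0 S).
rewrite !big_cons; case: ifP => // _; apply: le_trans (snormD _ _) _ => //.
  exact: sip_sum.
by rewrite lerD2l.
Qed.

Lemma sip_eq0l x y : X x -> X y -> B x x = 0 -> B x y = 0.
Proof.
move=> Xx Xy x0; have := cauchy_schwarz2 Xx Xy; rewrite x0 mul0r => h.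
by apply/eqP; rewrite -sqrf_eq0 eq_le h sqr_ge0.
Qed.

Lemma snorm_eq0P x : X x -> snorm x = 0 -> B x x = 0.
Proof. by move=> Xx h; rewrite -snorm2// h expr0n. Qed.

Definition orthonormal n (e : 'I_n -> V) : Prop :=
  (forall i, X (e i)) /\ forall i j, B (e i) (e j) = (i == j)%:R.

Definition lincomb n (e : 'I_n -> V) (c : 'I_n -> R) : V := \sum_i c i *: e i.

Lemma lincombP n (e : 'I_n -> V) c : (forall i, X (e i)) -> X (lincomb e c).
Proof. by move=> Xe; apply: sip_sum => i; exact: sipZ. Qed.

Lemma sip_lincombl n (e : 'I_n -> V) c z : (forall i, X (e i)) -> X z ->
  B (lincomb e c) z = \sum_i c i * B (e i) z.
Proof.
move=> Xe Xz; rewrite sip_suml//; last by move=> i; exact: sipZ.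
by apply: eq_bigr => i _; rewrite sipZl.
Qed.

Lemma sip_lincombr n (e : 'I_n -> V) c z : (forall i, X (e i)) -> X z ->
  B z (lincomb e c) = \sum_i c i * B z (e i).
Proof.
move=> Xe Xz; rewrite (sipC S)//; last exact: lincombP.
by rewrite sip_lincombl//; apply: eq_bigr => i _; rewrite (sipC S).
Qed.

Lemma orthonormal_coord n (e : 'I_n -> V) c j : orthonormal e ->
  B (lincomb e c) (e j) = c j.
Proof.
move=> [Xe oe]; rewrite sip_lincombl// (bigD1 j)//= oe eqxx mulr1 big1 ?addr0//.
by move=> i /negbTE ij; rewrite oe ij mulr0.
Qed.

Lemma orthonormal_norm n (e : 'I_n -> V) c : orthonormal e ->
  B (lincomb e c) (lincomb e c) = \sum_i c i ^+ 2.
Proof.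
move=> oe; have [Xe _] := oe; rewrite sip_lincombr//; last exact: lincombP.
by apply: eq_bigr => i _; rewrite orthonormal_coord// expr2.
Qed.

(** The remainder is a null vector rather than zero, since the form is only semi-definite. *)
Definition complete n (e : 'I_n -> V) : Prop :=
  forall v, X v -> let r := v - lincomb e (fun i => B v (e i)) in B r r = 0.

(** Dimension at most [N] modulo null vectors. *)
Definition finite_sdim N : Prop := forall v : 'I_N.+1 -> V, (forall i, X (v i)) ->
  exists2 a : 'I_N.+1 -> R, (exists i, a i != 0) & B (lincomb v a) (lincomb v a) = 0.

(** An orthonormal family has at most [N] elements, so one of maximal size exists. A vector whose
    remainder is not null would, after normalisation, extend it. *)
Lemma orthonormal_basis N : finite_sdim N ->
  exists n (e : 'I_n -> V), orthonormal e /\ complete e.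
Proof.
move=> fd; pose P n := `[< exists e : 'I_n -> V, orthonormal e >].
have P0 : exists n, P n.
  exists 0%N; apply/asboolP; exists (fun=> 0); split; first by case.
  by case.
have PN n : P n -> (n <= N)%N.
  move=> /asboolP[e oe]; rewrite leqNgt; apply/negP => Nn.
  have [Xe _] := oe.
  have oe' : orthonormal (fun i : 'I_N.+1 => e (widen_ord Nn i)).
    by split => [i|i j]; [exact: Xe|rewrite oe.2].
  have [a [i ai0]] := fd _ (oe'.1); rewrite (orthonormal_norm a oe') => /eqP.
  rewrite psumr_eq0; last by move=> j _; exact: sqr_ge0.
  by move=> /allP/(_ i (mem_index_enum i)); rewrite sqrf_eq0 (negbTE ai0).
case: (ex_maxnP P0 PN) => n /asboolP[e oe] nmax; exists n, e; split => // v Xv r.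
have [Xe Oe] := oe.
have Xl : X (lincomb e (fun i => B v (e i))) by exact: lincombP.
have Xr : X r by exact: sipB.
have re i : B r (e i) = 0 by rewrite /r sipBl// orthonormal_coord// subrr.
apply/eqP; apply: contrapT => /negP r0.
have rp : 0 < B r r by rewrite lt_def r0 (sip_ge0 S).
pose w := (snorm r)^-1 *: r.
have Xw : X w by exact: sipZ.
have we i : B w (e i) = 0 by rewrite /w sipZl// re mulr0.
have ww : B w w = 1.
  by rewrite /w sipZl ?sipZr// mulrA -expr2 exprVn snorm2// mulVf.
pose e' (i : 'I_n.+1) := if unlift ord_max i is Some j then e j else w.
suff : P n.+1 by move/nmax; rewrite ltnn.
apply/asboolP; exists e'; split.
  by move=> i; rewrite /e'; case: unliftP.
move=> i j; rewrite /e'; case: (unliftP ord_max i) => [i' ->|->]; case: (unliftP ord_max j) => [j' ->|->].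
- by rewrite Oe (inj_eq lift_inj).
- by rewrite (sipC S)// we eq_sym -[ord_max == _]negbK neq_lift.
- by rewrite we -[ord_max == _]negbK neq_lift.
- by rewrite eqxx.
Qed.

End theory.
End semi_inner_product.

(** * The space L2 *)

Section dot.
Variable R : realType.

Lemma dot_ge0 m n (A : 'M[R]_(m, n)) : 0 <= dot A A.
Proof. by apply: sumr_ge0 => i _; apply: sumr_ge0 => j _; rewrite -expr2 sqr_ge0. Qed.

Lemma dot_eq0 m n (A : 'M[R]_(m, n)) : dot A A = 0 -> A = 0.
Proof.
move=> /eqP; rewrite psumr_eq0 => [/allP H|i _]; last by apply: sumr_ge0 => j _; rewrite -expr2 sqr_ge0.
apply/matrixP => i j; rewrite mxE; have := H i (mem_index_enum i) => /=.
rewrite psumr_eq0 => [/allP/(_ j (mem_index_enum j))/=|k _]; last by rewrite -expr2 sqr_ge0.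
by rewrite mulf_eq0 orbb => /eqP.
Qed.

End dot.

Section lebesgue_spaces.
#[local] Set Default Proof Using "All".
Variables (R : realType) (d : nat) (Omega : set 'rV[R]_d).
Notation pt := 'rV[R]_d.
Notation mu := (@leb R d).
Hypothesis oO : open Omega.
Hypothesis fO : (mu Omega < +oo)%E.
Implicit Types f g h : pt -> R.

Definition msr f : Prop := measurable_fun Omega (f : pt -> measurableTypeR R).
Definition intg f : Prop := mu.-integrable Omega (EFin \o f).

Lemma measurable_Omega : measurable Omega. Proof. exact: open_measurable_rV. Qed.
#[local] Hint Resolve measurable_Omega : core.

Lemma msr_cst (c : R) : msr (fun=> c). Proof. exact: measurable_cst. Qed.
Lemma msrD f g : msr f -> msr g -> msr (fun x => f x + g x).
Proof. exact: measurable_funD. Qed.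

Lemma msrM f g : msr f -> msr g -> msr (fun x => f x * g x).
Proof. exact: measurable_funM. Qed.
Lemma msrZ (c : R) f : msr f -> msr (fun x => c * f x).
Proof. by move=> mf; apply: msrM => //; exact: msr_cst. Qed.
Lemma msrX f n : msr f -> msr (fun x => f x ^+ n).
Proof. exact: measurable_funX. Qed.

Lemma intg_msr f : intg f -> msr f.
Proof. by move=> /integrableP[/measurable_EFinP]. Qed.

Lemma intg_le f g : msr f -> intg g -> (forall x, Omega x -> `|f x| <= g x) -> intg f.
Proof.
move=> mf ig fg; apply: le_integrable ig => //; first exact/measurable_EFinP.
by move=> x Ox /=; rewrite lee_fin (le_trans (fg _ Ox))// ler_norm.
Qed.

Lemma intgD f g : intg f -> intg g -> intg (fun x => f x + g x).
Proof.
move=> ig ih; have := integrableD measurable_Omega ig ih.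
by apply: eq_integrable => // x _ /=; rewrite EFinD.
Qed.

Lemma intgZ (c : R) f : intg f -> intg (fun x => c * f x).
Proof.
move=> ig; have := integrableZl measurable_Omega c ig.
by apply: eq_integrable => // x _ /=; rewrite EFinM.
Qed.

Lemma intg_cst (c : R) : intg (fun=> c).
Proof.
apply: measurable_bounded_integrable => //.
by exists `|c|; split; [exact: num_real|move=> M cM x _ /=; exact: ltW].
Qed.

Lemma intg_sum (I : Type) (s : seq I) (F : I -> pt -> R) : (forall i, intg (F i)) ->
  intg (fun x => \sum_(i <- s) F i x).
Proof.
move=> iF; elim: s => [|i s IH].
  rewrite (_ : (fun x => _) = fun=> 0); first exact: intg_cst.
  by apply/funext => x; rewrite big_nil.
rewrite (_ : (fun x => _) = fun x => F i x + \sum_(j <- s) F j x); first exact: intgD.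
by apply/funext => x; rewrite big_cons.
Qed.

Lemma intg_bounded f (C : R) : msr f -> (forall x, Omega x -> `|f x| <= C) -> intg f.
Proof. by move=> mf; apply: intg_le => //; exact: intg_cst. Qed.

Lemma Rint_sum (I : Type) (s : seq I) (F : I -> pt -> R) : (forall i, intg (F i)) ->
  \int[mu]_(x in Omega) (\sum_(i <- s) F i x) = \sum_(i <- s) \int[mu]_(x in Omega) F i x.
Proof.
move=> iF; elim: s => [|i s IH].
  rewrite big_nil (_ : (fun x => _) = fun=> 0); first by rewrite Rintegral_cst// mul0r.
  by apply/funext => x; rewrite big_nil.
rewrite big_cons -IH -RintegralD//; [|exact: iF|exact: intg_sum].
by congr Rintegral; apply/funext => x; rewrite big_cons.
Qed.

Lemma Rint_ae f g : intg f -> intg g -> {ae mu, forall x, Omega x -> f x = g x} ->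
  \int[mu]_(x in Omega) f x = \int[mu]_(x in Omega) g x.
Proof.
move=> /intg_msr mf /intg_msr mg fg; congr fine; apply: ae_eq_integral => //.
- exact/measurable_EFinP.
- exact/measurable_EFinP.
- by apply: filterS fg => x fgx Ox; rewrite fgx.
Qed.

Lemma Rint_ge0_eq0 f : intg f -> (forall x, Omega x -> 0 <= f x) ->
  \int[mu]_(x in Omega) f x = 0 -> {ae mu, forall x, Omega x -> f x = 0}.
Proof.
move=> jf f0 I0; have mf := intg_msr jf.
have E : (\int[mu]_(x in Omega) `|(f x)%:E| = 0)%E.
  transitivity (\int[mu]_(x in Omega) (f x)%:E)%E.
    by apply: eq_integral => x; rewrite inE => Ox; rewrite gee0_abs// lee_fin f0.
  by rewrite -[LHS]fineK; [congr EFin|exact: integrable_fin_num].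
have := (ae_eq_integral_abs mu measurable_Omega (proj2 (measurable_EFinP _ _) mf)).1 E.
by apply: filterS => x H Ox; have := H Ox; case.
Qed.

Definition fpow (p : nat) f : Prop := msr f /\ intg (fun x => f x ^+ p).

Lemma L2sP f : L2s Omega f <-> fpow 2 f.
Proof.
split=> [[mf If]|[mf If]]; split => //.
  apply/integrableP; split; first by apply/measurable_EFinP; exact: msrX.
  by under eq_integral do rewrite /= ger0_norm ?sqr_ge0//.
move/integrableP: If => [_]; congr (_ < _)%E; apply: eq_integral => x _.
by rewrite /= ger0_norm ?sqr_ge0.
Qed.

Lemma L2s_intgM f g : L2s Omega f -> L2s Omega g -> intg (fun x => f x * g x).
Proof.
move=> /L2sP[mf If] /L2sP[mg Ig]; apply: intg_le (intgD If Ig) _; first exact: msrM.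
move=> x _; rewrite normrM -(real_normK (num_real (f x))) -(real_normK (num_real (g x))).
have := sqr_ge0 (`|f x| - `|g x|); rewrite sqrrB.
by have := normr_ge0 (f x); have := normr_ge0 (g x); nra.
Qed.

Lemma L2s0 : L2s Omega (fun=> 0).
Proof. apply/L2sP; split; [exact: msr_cst|rewrite expr0n; exact: intg_cst]. Qed.

Lemma L2s_cst (c : R) : L2s Omega (fun=> c).
Proof. by apply/L2sP; split; [exact: msr_cst|exact: intg_cst]. Qed.

Lemma L2s_intg f : L2s Omega f -> intg f.
Proof.
move=> L2f; have := L2s_intgM L2f (L2s_cst 1).
by congr intg; apply/funext => x; rewrite mulr1.
Qed.

Lemma L2s_lin (a : R) f g : L2s Omega f -> L2s Omega g -> L2s Omega (fun x => a * f x + g x).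
Proof.
move=> L2f L2g; have [mf If] := (L2sP f).1 L2f; have [mg Ig] := (L2sP g).1 L2g.
apply/L2sP; split; first by apply: msrD => //; exact: msrZ.
rewrite (_ : (fun x => _) = fun x => a ^+ 2 * f x ^+ 2 + (2 * a * (f x * g x) + g x ^+ 2)); last first.
  by apply/funext => x; ring.
by apply: intgD; [exact: intgZ|apply: intgD => //; apply: intgZ; exact: L2s_intgM].
Qed.

Lemma L2sD f g : L2s Omega f -> L2s Omega g -> L2s Omega (fun x => f x + g x).
Proof.
move=> L2f L2g; have := L2s_lin 1 L2f L2g.
by congr L2s; apply/funext => x; rewrite mul1r.
Qed.

Lemma L2s_sum (I : Type) (s : seq I) (F : I -> pt -> R) : (forall i, L2s Omega (F i)) ->
  L2s Omega (fun x => \sum_(i <- s) F i x).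
Proof.
move=> iF; elim: s => [|i s IH].
  rewrite (_ : (fun x => _) = fun=> 0); first exact: L2s_cst.
  by apply/funext => x; rewrite big_nil.
rewrite (_ : (fun x => _) = fun x => F i x + \sum_(j <- s) F j x); first exact: L2sD.
by apply/funext => x; rewrite big_cons.
Qed.

Lemma L2s_bounded f (C : R) : msr f -> (forall x, Omega x -> `|f x| <= C) -> L2s Omega f.
Proof.
move=> mf bf; apply/L2sP; split => //; apply: (@intg_bounded _ (C ^+ 2)); first exact: msrX.
move=> x Ox; rewrite normrX ler_sqr ?nnegrE ?bf//.
by apply: le_trans (bf _ Ox).
Qed.

Lemma sip_ips : @sip R (pt -> R^o) (L2s Omega) (ips Omega).
Proof.
split.
- exact: L2s0.
- by move=> a f g; exact: L2s_lin.
- move=> a f g h L2f L2g L2h; have fh := L2s_intgM L2f L2h; have gh := L2s_intgM L2g L2h.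
  rewrite /ips -RintegralZl// -RintegralD//; last exact: intgZ.
  by congr Rintegral; apply/funext => x; rewrite mulrDl mulrA.
- by move=> f g _ _; rewrite /ips; congr Rintegral; apply/funext => x; rewrite mulrC.
- by move=> f _; apply: Rintegral_ge0 => x _; rewrite -expr2 sqr_ge0.
Qed.

Lemma ips_ae f f' g : L2s Omega f -> L2s Omega f' -> L2s Omega g ->
  {ae mu, forall x, Omega x -> f x = f' x} -> ips Omega f g = ips Omega f' g.
Proof.
move=> Lf Lf' Lg ff'; apply: Rint_ae; [exact: L2s_intgM|exact: L2s_intgM|].
by apply: filterS ff' => x H Ox; rewrite H.
Qed.

Lemma eq_ips f f' g g' : (forall x, Omega x -> f x * g x = f' x * g' x) -> ips Omega f g = ips Omega f' g'.
Proof. by move=> H; apply: eq_Rintegral => x; rewrite inE => /H. Qed.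

Lemma ips_eq0 f : L2s Omega f -> ips Omega f f = 0 -> {ae mu, forall x, Omega x -> f x = 0}.
Proof.
move=> Lf /Rint_ge0_eq0; move=> /(_ (L2s_intgM Lf Lf)) H.
have : {ae mu, forall x, Omega x -> f x * f x = 0} by apply: H => x _; rewrite -expr2 sqr_ge0.
by apply: filterS => x {}H Ox; have /eqP := H Ox; rewrite mulf_eq0 orbb => /eqP.
Qed.

Lemma msr_coord m n (u : pt -> 'M[R]_(m, n)) i j : L2 Omega u -> msr (fun x => u x i j).
Proof. by move=> /(_ i j)[]. Qed.

Lemma ipE m n (u v : pt -> 'M[R]_(m, n)) : L2 Omega u -> L2 Omega v ->
  ip Omega u v = \sum_i \sum_j ips Omega (fun x => u x i j) (fun x => v x i j).
Proof.
move=> Lu Lv; rewrite /ip /dot Rint_sum.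
  by apply: eq_bigr => i _; rewrite Rint_sum// => j; exact: L2s_intgM.
by move=> i; apply: intg_sum => j; exact: L2s_intgM.
Qed.

Lemma intg_dot m n (u v : pt -> 'M[R]_(m, n)) : L2 Omega u -> L2 Omega v -> intg (fun x => dot (u x) (v x)).
Proof. by move=> Lu Lv; apply: intg_sum => i; apply: intg_sum => j; exact: L2s_intgM. Qed.

Lemma L2_lin m n (a : R) (u v : pt -> 'M[R]_(m, n)) : L2 Omega u -> L2 Omega v ->
  L2 Omega (a *: u + v).
Proof.
move=> Lu Lv i j; have := L2s_lin a (Lu i j) (Lv i j).
by congr L2s; apply/funext => x; rewrite !mxE.
Qed.

Lemma L20 m n : L2 Omega (0 : pt -> 'M[R]_(m, n)).
Proof. by move=> i j; have := L2s0; congr L2s; apply/funext => x; rewrite mxE. Qed.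

Lemma sip_ip m n : @sip R (pt -> 'M[R]_(m, n)) (@L2 R d Omega m n) (@ip R d Omega m n).
Proof.
split.
- exact: L20.
- by move=> a f g; exact: L2_lin.
- move=> a f g h Lf Lg Lh; rewrite !ipE//; last exact: L2_lin.
  rewrite mulr_sumr -big_split/=; apply: eq_bigr => i _.
  rewrite mulr_sumr -big_split/=; apply: eq_bigr => j _.
  rewrite -(sip_lin sip_ips)//; try exact: Lf; try exact: Lg; try exact: Lh.
  by apply: eq_ips => x _; rewrite !mxE.
- move=> f g _ _; rewrite /ip; congr Rintegral; apply/funext => x.
  by rewrite /dot; apply: eq_bigr => i _; apply: eq_bigr => j _; rewrite mulrC.
- move=> f _; apply: Rintegral_ge0 => x _; apply: sumr_ge0 => i _; apply: sumr_ge0 => j _.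
  by rewrite -expr2 sqr_ge0.
Qed.

Definition aeq m n (u v : pt -> 'M[R]_(m, n)) : Prop := {ae mu, forall x, Omega x -> u x = v x}.

Lemma ip_ae m n (u u' v : pt -> 'M[R]_(m, n)) : L2 Omega u -> L2 Omega u' -> L2 Omega v ->
  aeq u u' -> ip Omega u v = ip Omega u' v.
Proof.
move=> Lu Lu' Lv uu'; apply: Rint_ae; [exact: intg_dot|exact: intg_dot|].
by apply: filterS uu' => x H Ox; rewrite H.
Qed.

Lemma eq_ip m n (u u' v v' : pt -> 'M[R]_(m, n)) : (forall x, Omega x -> u x = u' x) ->
  (forall x, Omega x -> v x = v' x) -> ip Omega u v = ip Omega u' v'.
Proof. by move=> H1 H2; apply: eq_Rintegral => x; rewrite inE => Ox; rewrite H1// H2. Qed.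

Lemma ip_eq0 m n (u : pt -> 'M[R]_(m, n)) : L2 Omega u -> ip Omega u u = 0 -> aeq u 0.
Proof.
move=> Lu /Rint_ge0_eq0 => /(_ (intg_dot Lu Lu)) H.
have : {ae mu, forall x, Omega x -> dot (u x) (u x) = 0} by apply: H => x _; exact: dot_ge0.
by apply: filterS => x {}H Ox; have := H Ox => /dot_eq0.
Qed.

Lemma fpow4_L2sM f g : fpow 4 f -> fpow 4 g -> L2s Omega (fun x => f x * g x).
Proof.
move=> [mf If] [mg Ig]; apply/L2sP; split; first exact: msrM.
apply: intg_le (intgD If Ig) _; first by apply: msrX; exact: msrM.
move=> x _; rewrite ger0_norm ?sqr_ge0// exprMn.
rewrite (_ : f x ^+ 4 = f x ^+ 2 ^+ 2) 1?(_ : g x ^+ 4 = g x ^+ 2 ^+ 2) -?exprM//.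
by have := sqr_ge0 (f x); have := sqr_ge0 (g x); have := sqr_ge0 (f x ^+ 2 - g x ^+ 2); nra.
Qed.

End lebesgue_spaces.

(** * The spaces H1 and H10 *)

Opaque leb.

Section continuity.
Variables (R : realType) (T : topologicalType).
Implicit Types f g : T -> R.

Lemma cont_cst (c : R) : continuous (fun _ : T => c).
Proof. exact: cst_continuous. Qed.
Lemma contM f g : continuous f -> continuous g -> continuous (fun x => f x * g x).
Proof. by move=> cf cg x; exact: (continuousM (cf x) (cg x)). Qed.
Lemma contD f g : continuous f -> continuous g -> continuous (fun x => f x + g x).
Proof. by move=> cf cg x; exact: (continuousD (cf x) (cg x)). Qed.

End continuity.

(** * Compactly supported C1 functions and test functions *)

Section test_functions.
Variables (R : realType) (d : nat) (Omega : set 'rV[R]_d).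
Notation pt := 'rV[R]_d.
Implicit Types f g phi psi : pt -> R.

Definition pd (j : 'I_d) phi : pt -> R := fun x => 'D_(basis_vec R j) (phi : pt -> R^o) x.

(** Regularity one is what integration by parts uses, and it is stable under products by the Leibniz
    rule alone. *)
Definition C1c phi : Prop :=
  [/\ continuous phi,
      forall j, (forall x, derivable (phi : pt -> R^o) x (basis_vec R j)) /\ continuous (pd j phi) &
      exists2 C, compact C /\ C `<=` Omega & forall x, ~ C x -> phi x = 0].

Lemma test_C1c phi : test_fun Omega phi -> C1c phi.
Proof.
move=> [tphi sphi]; split => //; first exact: (tphi 0%N).
by move=> j; exact: (tphi 1%N j).
Qed.

Lemma C1cM phi psi : C1c phi -> C1c psi -> C1c (fun x => phi x * psi x) /\
  forall j x, pd j (fun x => phi x * psi x) x = pd j phi x * psi x + phi x * pd j psi x.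
Proof.
move=> [c1 d1 [C [cC CO] C0]] [c2 d2 _].
have D j x : is_derive x (basis_vec R j) ((fun x => phi x * psi x) : pt -> R^o) (pd j phi x * psi x + phi x * pd j psi x).
  have := is_deriveM (derivableP ((d1 j).1 x)) (derivableP ((d2 j).1 x)).
  by move=> H; apply: (is_derive_eq (f := phi * psi)); rewrite /pd /GRing.scale/= addrC mulrC.
have E j x : pd j (fun x => phi x * psi x) x = pd j phi x * psi x + phi x * pd j psi x.
  by have [_ <-] := D j x.
split => //; split.
- exact: contM.
- move=> j; split; first by move=> x; have [] := D j x.
  have -> : pd j (fun x => phi x * psi x) = fun x => pd j phi x * psi x + phi x * pd j psi x.
    by apply/funext => x; exact: E.
  by apply: contD; apply: contM => //; [exact: (d1 j).2|exact: (d2 j).2].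
- by exists C => // x Cx; rewrite C0// mul0r.
Qed.

Lemma C1c_supp phi : C1c phi -> exists2 C, compact C /\ C `<=` Omega &
  forall x, ~ C x -> phi x = 0 /\ forall j, pd j phi x = 0.
Proof.
move=> [_ _ [C [cC CO] C0]]; exists C => // x Cx; split; first exact: C0.
move=> j; rewrite /pd (@near_eq_derive _ _ _ _ (cst 0)) ?derive_cst//.
near=> y; apply: C0; near: y.
have := closed_openC (compact_closed (@norm_hausdorff _ _) cC).
by rewrite openE => /(_ x Cx).
Unshelve. all: by end_near. Qed.

Lemma C1c_integral j phi : open Omega -> C1c phi -> \int[@leb R d]_(x in Omega) pd j phi x = 0.
Proof.
move=> oO cphi; have [C [cC CO] C0] := C1c_supp cphi; have [_ dphi _] := cphi.
have [M HM] := bounded_set_box (compact_bounded cC).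
have M0 : 0 <= `|M| by [].
have HM' x : ~ cbox (const_mx (- `|M|)) (const_mx `|M|) x -> phi x = 0.
  move=> Hx; apply: (C0 _ _).1 => /HM Cx; apply: Hx => i; have := Cx i; rewrite !mxE.
  move=> /andP[/ltW h1 /ltW h2]; have MM := ler_norm M.
  by apply/andP; split; [apply: le_trans h1; rewrite lerN2|exact: le_trans MM].
have := integral_deriv0 M0 (dphi j).1 (dphi j).2 HM'.
rewrite /Rintegral => I0; rewrite -[RHS]/(fine 0%E) -[in RHS]I0 [in LHS]integral_mkcond; congr fine.
apply: eq_integral => x _; rewrite patchE; case: ifPn => //; rewrite notin_setE => Ox.
have [_ H] := C0 x (fun Cx => Ox (CO _ Cx)).
by rewrite -/(pd j phi x) H.
Qed.

Lemma C1c_bounded phi : C1c phi -> exists2 C, 0 <= C & forall x, `|phi x| <= C /\ forall j, `|pd j phi x| <= C.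
Proof.
move=> cphi; have [K [cK KO] K0] := C1c_supp cphi; have [c1 d1 _] := cphi.
have [C C0 HC] := continuous_bounded_on cK (continuous_subspaceT c1).
have Hj j : exists D, 0 <= D /\ forall x, K x -> `|pd j phi x| <= D.
  by have [D D0 HD] := continuous_bounded_on cK (continuous_subspaceT (d1 j).2); exists D.
have [D HD] := choice Hj.
have sD : 0 <= \sum_j D j by apply: sumr_ge0 => j _; exact: (HD j).1.
exists (C + \sum_j D j); first exact: addr_ge0.
move=> x; have [Kx|Kx] := pselect (K x); last first.
  have [-> H] := K0 x Kx; split; first by rewrite normr0 addr_ge0.
  by move=> j; rewrite H normr0 addr_ge0.
split; first by rewrite (le_trans (HC _ Kx))// lerDl.
move=> j; apply: le_trans ((HD j).2 _ Kx) _; rewrite (bigD1 j)//= addrCA lerDl addr_ge0//.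
by apply: sumr_ge0 => i _; exact: (HD i).1.
Qed.

Lemma test_fun_lin (a : R) phi psi : test_fun Omega phi -> test_fun Omega psi ->
  test_fun Omega (fun x => a * phi x + psi x).
Proof.
have CkL n : forall f g, Ck n f -> Ck n g -> Ck n (fun x => a * f x + g x).
  elim: n => [|n IH] f g /=.
    by move=> cf cg; apply: contD => //; apply: contM => //; exact: cont_cst.
  move=> Cf Cg j; have [df Cf'] := Cf j; have [dg Cg'] := Cg j.
  have D x : is_derive x (basis_vec R j) ((fun x => a * f x + g x) : pt -> R^o)
      (a * 'D_(basis_vec R j) (f : pt -> R^o) x + 'D_(basis_vec R j) (g : pt -> R^o) x).
    by apply: is_deriveD; [apply: is_deriveZ; exact/derivableP|exact/derivableP].
  split; first by move=> x; have [] := D x.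
  have -> : (fun x => 'D_(basis_vec R j) ((fun x => a * f x + g x) : pt -> R^o) x) = fun x =>
    a * 'D_(basis_vec R j) (f : pt -> R^o) x + 'D_(basis_vec R j) (g : pt -> R^o) x.
    by apply/funext => x; have [_ ->] := D x.
  exact: IH.
move=> [sf [C [cC CO] C0]] [sg [D [cD DO] D0]]; split; first by move=> n; exact: CkL.
exists (C `|` D); first by split; [exact: compactU|move=> x [/CO|/DO]].
by move=> x /not_orP[/C0 -> /D0 ->]; rewrite mulr0 addr0.
Qed.

Lemma test_fun0 : test_fun Omega (fun=> 0).
Proof.
split; last by exists set0 => //; split; [exact: compact0|].
elim=> [|n IH] /=; first exact: cont_cst.
move=> j; split; first by move=> x; exact: derivable_cst.
by rewrite (_ : (fun x => _) = fun=> 0)//; apply/funext => x; exact: derive_cst.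
Qed.

End test_functions.

Section sobolev.
#[local] Set Default Proof Using "All".
Variables (R : realType) (d : nat) (Omega : set 'rV[R]_d).
Notation pt := 'rV[R]_d.
Notation mu := (@leb R d).
Hypothesis oO : open Omega.
Hypothesis fO : (mu Omega < +oo)%E.
Notation H1 := (H1 Omega).
Notation H10 := (H10 Omega).
Notation grad := (grad Omega).
Notation ip := (ip Omega).
Notation ips := (ips Omega).

Lemma C1c_L2s phi : C1c Omega phi -> L2s Omega phi /\ forall j, L2s Omega (pd j phi).
Proof.
move=> cphi; have [C C0 HC] := C1c_bounded cphi; have [c1 d1 _] := cphi.
split; [|move=> j]; apply: (L2s_bounded oO fO (C := C)).
- by apply: measurable_funTS; exact: continuous_measurable_rV.
- by move=> x _; exact: (HC x).1.
- by apply: measurable_funTS; apply: continuous_measurable_rV; exact: (d1 j).2.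
- by move=> x _; exact: (HC x).2.
Qed.

(** Each entry of the difference is orthogonal to all test functions. *)
Lemma weak_grad_unique m (u : pt -> 'rV[R]_m) G G' :
  weak_grad Omega u G -> weak_grad Omega u G' -> aeq Omega G G'.
Proof.
move=> [LG wG] [LG' wG'].
have H (p : 'I_m * 'I_d) : {ae mu, forall x, Omega x -> G x p.1 p.2 - G' x p.1 p.2 = 0}.
  case: p => i j /=; have Lij : L2s Omega (fun x => G x i j - G' x i j).
    exact: (sipB (sip_ips oO fO) (LG i j) (LG' i j)).
  apply: (ips_test_eq0 oO (L2s_intg oO fO Lij)) => phi tphi.
  have [Lphi _] := C1c_L2s (test_C1c tphi).
  rewrite (sipBl (sip_ips oO fO) (LG i j) (LG' i j) Lphi).
  by apply/eqP; rewrite subr_eq0; apply/eqP/oppr_inj; rewrite -wG// -wG'.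
apply: filterS (ae_forall_count H) => x Hx Ox; apply/matrixP => i j.
by apply/eqP; rewrite -subr_eq0; apply/eqP; exact: (Hx (i, j)).
Qed.

Lemma weak_grad_lin m (a : R) (u v : pt -> 'rV[R]_m) G H : L2 Omega u -> L2 Omega v ->
  weak_grad Omega u G -> weak_grad Omega v H -> weak_grad Omega (a *: u + v) (a *: G + H).
Proof.
move=> Lu Lv [LG wG] [LH wH]; split; first exact: (L2_lin oO fO).
move=> i j phi tphi; have [Lphi Ld] := C1c_L2s (test_C1c tphi).
have S := sip_ips oO fO.
transitivity (a * ips (fun x => u x 0 i) (pd j phi) + ips (fun x => v x 0 i) (pd j phi)).
  rewrite -(sip_lin S a (Lu 0 i) (Lv 0 i) (Ld j)).
  by apply: (eq_ips oO fO) => x _; rewrite !mxE.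
rewrite wG// wH// mulrN -opprD; congr (- _).
rewrite -(sip_lin S a (LG i j) (LH i j) Lphi).
by apply: (eq_ips oO fO) => x _; rewrite !mxE.
Qed.

Lemma gradP m (u : pt -> 'rV[R]_m) : H1 u -> weak_grad Omega u (grad u).
Proof. by move=> [_ [G wG]]; apply: xgetPex; exists G. Qed.

Lemma H1_L2 m (u : pt -> 'rV[R]_m) : H1 u -> L2 Omega u. Proof. by case. Qed.
Lemma grad_L2 m (u : pt -> 'rV[R]_m) : H1 u -> L2 Omega (grad u).
Proof. by move=> /gradP[]. Qed.

Lemma H1I m (u : pt -> 'rV[R]_m) G : L2 Omega u -> weak_grad Omega u G -> H1 u.
Proof. by move=> Lu wG; split => //; exists G. Qed.

Lemma weak_gradP m (u : pt -> 'rV[R]_m) G : weak_grad Omega u G <-> L2 Omega G /\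
  forall i j phi, test_fun Omega phi -> ips (fun x => u x 0 i) (pd j phi) = - ips (fun x => G x i j) phi.
Proof. by []. Qed.

Lemma grad_eq m (u v : pt -> 'rV[R]_m) : (forall x, Omega x -> u x = v x) ->
  weak_grad Omega u = weak_grad Omega v.
Proof.
move=> uv; apply/seteqP; split=> G [LG wG]; split=> // i j phi tphi; rewrite -wG//;
  apply: (eq_ips oO fO) => x Ox; by rewrite uv.
Qed.

(** A genuine equality, although [grad] is a choice: fields that agree on [Omega] have the same set
    of weak gradients, hence the same chosen one. *)
Lemma gradE m (u v : pt -> 'rV[R]_m) : (forall x, Omega x -> u x = v x) ->
  grad u = grad v.
Proof. by move=> uv; rewrite /grad (grad_eq uv). Qed.

Opaque Defs.H1 Defs.grad L2s weak_grad.

Lemma H1_lin m (a : R) (u v : pt -> 'rV[R]_m) : H1 u -> H1 v -> H1 (a *: u + v).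
Proof.
move=> Hu Hv; apply: (@H1I _ _ (a *: grad u + grad v)).
  by apply: (L2_lin oO fO); exact: H1_L2.
by apply: weak_grad_lin; [exact: H1_L2|exact: H1_L2|exact: gradP|exact: gradP].
Qed.

(** The chosen gradient is linear only almost everywhere, by uniqueness of weak gradients. *)
Lemma grad_lin m (a : R) (u v : pt -> 'rV[R]_m) : H1 u -> H1 v ->
  aeq Omega (grad (a *: u + v)) (a *: grad u + grad v).
Proof.
move=> Hu Hv; apply: (@weak_grad_unique _ (a *: u + v)); first by apply: gradP; exact: H1_lin.
by apply: weak_grad_lin; [exact: H1_L2|exact: H1_L2|exact: gradP|exact: gradP].
Qed.

Lemma norm_H1_unfold m (u : pt -> 'rV[R]_m) : norm_H1 Omega u = Num.sqrt (norm_L2 Omega u ^+ 2 + norm_L2 Omega (grad u) ^+ 2).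
Proof. by []. Qed.

(** One family for two forms: [theta = 1] is the inner product of H1, [theta = kappa ^+ 2] is
    [Eop]. *)
Definition eH (theta : R) m (u v : pt -> 'rV[R]_m) : R := ip u v + theta * ip (grad u) (grad v).

Lemma ip_grad_lin m (a : R) (u v : pt -> 'rV[R]_m) (G : pt -> 'M[R]_(m, d)) : H1 u -> H1 v -> L2 Omega G ->
  ip (grad (a *: u + v)) G = a * ip (grad u) G + ip (grad v) G.
Proof.
move=> Hu Hv LG; have Lu := grad_L2 Hu; have Lv := grad_L2 Hv.
rewrite -(sip_lin (sip_ip oO fO _ _) a Lu Lv LG).
exact: (ip_ae oO fO (grad_L2 (H1_lin a Hu Hv)) (L2_lin oO fO a Lu Lv) LG (grad_lin a Hu Hv)).
Qed.

Lemma H1_0 m : H1 (0 : pt -> 'rV[R]_m).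
Proof.
apply: (@H1I _ _ 0); first exact: (L20 oO fO).
apply/weak_gradP; split; first exact: (L20 oO fO).
move=> i j phi tphi; have [Lphi Ld] := C1c_L2s (test_C1c tphi).
have Z f : L2s Omega f -> ips (fun=> 0) f = 0 by move=> Lf; exact: (sip0l (sip_ips oO fO) Lf).
transitivity (ips (fun=> 0) (pd j phi)); first by apply: (eq_ips oO fO) => x _; rewrite mxE.
rewrite Z// -[LHS]oppr0; congr (- _); rewrite -(Z _ Lphi).
by apply: (eq_ips oO fO) => x _; rewrite mxE.
Qed.

Lemma sip_ipH1 m : sip (@Defs.H1 R d Omega m) (@Defs.ip R d Omega 1 m).
Proof.
apply: (sip_sub (sip_ip oO fO 1 m)); [exact: H1_L2|exact: H1_0|exact: H1_lin].
Qed.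

Lemma sip_gradH1 m : sip (@Defs.H1 R d Omega m) (fun u v => ip (grad u) (grad v)).
Proof.
have S := sip_ip oO fO m d; split.
- exact: H1_0.
- exact: H1_lin.
- by move=> a u v w Hu Hv Hw; exact: ip_grad_lin (grad_L2 Hw).
- by move=> u v Hu Hv; exact: (sipC S (grad_L2 Hu) (grad_L2 Hv)).
- by move=> u Hu; exact: (sip_ge0 S (grad_L2 Hu)).
Qed.

Lemma sip_eH theta m : 0 <= theta -> sip (@Defs.H1 R d Omega m) (@eH theta m).
Proof. by move=> t0; exact: sip_add t0 (sip_ipH1 m) (sip_gradH1 m). Qed.

Lemma norm_H1E m (u : pt -> 'rV[R]_m) : H1 u -> norm_H1 Omega u = snorm (@eH 1 m) u.
Proof.
move=> Hu; rewrite /norm_H1 /snorm /eH mul1r; congr (Num.sqrt (_ + _)).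
  by rewrite /norm_L2 sqr_sqrtr// (sip_ge0 (sip_ip oO fO _ _))//; exact: H1_L2.
by rewrite /norm_L2 sqr_sqrtr// (sip_ge0 (sip_ip oO fO _ _))//; exact: grad_L2.
Qed.

Lemma norm_H1_sq m (u : pt -> 'rV[R]_m) : H1 u -> norm_H1 Omega u ^+ 2 = ip u u + ip (grad u) (grad u).
Proof. by move=> Hu; rewrite norm_H1E// (snorm2 (sip_eH _ ler01))// /eH mul1r. Qed.

Lemma norm_H1_ge0 m (u : pt -> 'rV[R]_m) : 0 <= norm_H1 Omega u.
Proof. exact: sqrtr_ge0. Qed.

Lemma norm_H1D m (u v : pt -> 'rV[R]_m) : H1 u -> H1 v ->
  norm_H1 Omega (u + v) <= norm_H1 Omega u + norm_H1 Omega v.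
Proof.
have S := sip_eH m ler01 => Hu Hv; have Huv := sipD S Hu Hv.
by rewrite (norm_H1E Hu) (norm_H1E Hv) (norm_H1E Huv) (snormD S Hu Hv).
Qed.

Lemma norm_H1Z m (a : R) (u : pt -> 'rV[R]_m) : H1 u -> norm_H1 Omega (a *: u) = `|a| * norm_H1 Omega u.
Proof.
have S := sip_eH m ler01 => Hu; have Hau := sipZ S a Hu.
by rewrite (norm_H1E Hu) (norm_H1E Hau) (snormZ S a Hu).
Qed.

Lemma norm_L2_le_H1 m (u : pt -> 'rV[R]_m) : H1 u -> norm_L2 Omega u <= norm_H1 Omega u.
Proof. move=> Hu; rewrite norm_H1_unfold -[leLHS]ger0_norm ?sqrtr_ge0// -sqrtr_sqr.
by rewrite ler_sqrt ?lerDl ?addr_ge0 ?sqr_ge0. Qed.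

Lemma norm_grad_le_H1 m (u : pt -> 'rV[R]_m) : H1 u -> norm_L2 Omega (grad u) <= norm_H1 Omega u.
Proof. move=> Hu; rewrite norm_H1_unfold -[leLHS]ger0_norm ?sqrtr_ge0// -sqrtr_sqr.
by rewrite ler_sqrt ?lerDr ?addr_ge0 ?sqr_ge0. Qed.

(** The product of a component with another test function is C1 with compact support, so its
    derivatives have integral zero; this is the integration by parts that makes the classical
    gradient a weak one. *)
Lemma test_H1 m (phi : pt -> 'rV[R]_m) : (forall i, test_fun Omega (fun x => phi x 0 i)) ->
  H1 phi /\ aeq Omega (grad phi) (fun x => \matrix_(i, j) pd j (fun x => phi x 0 i) x).
Proof.
move=> tphi.
have L := fun i => C1c_L2s (test_C1c (tphi i)).
have Lphi : L2 Omega phi by move=> i j; rewrite ord1; exact: (L j).1.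
have W : weak_grad Omega phi (fun x => \matrix_(i, j) pd j (fun x => phi x 0 i) x).
  apply/weak_gradP; split; first by move=> i j; have := (L i).2 j; congr L2s; apply/funext => x; rewrite mxE.
  move=> i j psi tpsi; have [Lpsi Ldpsi] := C1c_L2s (test_C1c tpsi).
  have [cM dM] := C1cM (test_C1c (tphi i)) (test_C1c tpsi).
  have := C1c_integral j oO cM.
  rewrite (_ : pd j _ = fun x => pd j (fun x => phi x 0 i) x * psi x + phi x 0 i * pd j psi x); last exact/funext/dM.
  have I1 := L2s_intgM oO fO ((L i).2 j) Lpsi; have I2 := L2s_intgM oO fO (L i).1 (Ldpsi j).
  rewrite (RintegralD (measurable_Omega oO fO) I1 I2) => /eqP; rewrite addrC addr_eq0 => /eqP E.
  apply: etrans E _; congr (- _); apply: eq_Rintegral => x _; by rewrite mxE.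
have H : H1 phi := H1I Lphi W.
by split => //; apply: weak_grad_unique W; exact: gradP.
Qed.

Lemma H10_H1 m (u : pt -> 'rV[R]_m) : H10 u -> H1 u. Proof. by case. Qed.

Lemma H10_lin m (a : R) (u v : pt -> 'rV[R]_m) : H10 u -> H10 v -> H10 (a *: u + v).
Proof.
move=> [Hu au] [Hv av]; split; first exact: H1_lin.
move=> eps e0; have a1 : 0 < `|a| + 1 by rewrite ltr_wpDl.
have e1 : 0 < eps / 2 / (`|a| + 1) by rewrite !divr_gt0.
have [phi [tphi phiu]] := au _ e1; have e2 : 0 < eps / 2 by rewrite divr_gt0.
have [psi [tpsi psiv]] := av _ e2.
exists (a *: phi + psi); split.
  move=> i; have := test_fun_lin a (tphi i) (tpsi i).
  by congr test_fun; apply/funext => x; rewrite !mxE.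
have [Hphi _] := test_H1 tphi; have [Hpsi _] := test_H1 tpsi.
have S := sip_eH m ler01; have X1 := sipB S Hu Hphi; have X2 := sipB S Hv Hpsi.
have -> : a *: u + v - (a *: phi + psi) = a *: (u - phi) + (v - psi).
  by rewrite scalerBr opprD addrACA.
apply: le_lt_trans (norm_H1D (sipZ S a X1) X2) _; rewrite norm_H1Z// [ltRHS]splitr ler_ltD//.
apply: (@le_trans _ _ ((`|a| + 1) * norm_H1 Omega (u - phi))).
  by rewrite ler_wpM2r ?norm_H1_ge0// lerDl.
by rewrite mulrC -ler_pdivlMr// ltW.
Qed.

Lemma H10_0 m : H10 (0 : pt -> 'rV[R]_m).
Proof.
split; first exact: H1_0.
move=> e e0; exists 0; split.
  by move=> i; have := test_fun0 Omega; congr test_fun; apply/funext => x; rewrite mxE.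
by rewrite subrr (norm_H1E (H1_0 m)) /snorm (sip0l (sip_eH m ler01) (H1_0 m)) sqrtr0.
Qed.

End sobolev.

(** * The trilinear form *)

Section enorm.
Variable R : realType.

Lemma enorm_ge0 m n (A : 'M[R]_(m, n)) : 0 <= enorm A. Proof. exact: sqrtr_ge0. Qed.

Lemma enorm_sq m n (A : 'M[R]_(m, n)) : enorm A ^+ 2 = dot A A.
Proof. by rewrite sqr_sqrtr// dot_ge0. Qed.

Lemma dotZl m n (c : R) (A B : 'M[R]_(m, n)) : dot (c *: A) B = c * dot A B.
Proof.
by rewrite /dot mulr_sumr; apply: eq_bigr => i _; rewrite mulr_sumr; apply: eq_bigr => j _; rewrite mxE mulrA.
Qed.

Lemma sip_dot m n : sip [set: 'M[R]_(m, n)] (@dot R m n).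
Proof.
split => //.
- move=> a x y z _ _ _; rewrite -dotZl /dot -big_split/=; apply: eq_bigr => i _.
  by rewrite -big_split/=; apply: eq_bigr => j _; rewrite !mxE mulrDl.
- by move=> x y _ _; apply: eq_bigr => i _; apply: eq_bigr => j _; rewrite mulrC.
- by move=> x _; exact: dot_ge0.
Qed.

Lemma dot_enorm m n (A B : 'M[R]_(m, n)) : `|dot A B| <= enorm A * enorm B.
Proof. exact: (cauchy_schwarz (sip_dot m n)). Qed.

Lemma enormZ m n (c : R) (A : 'M[R]_(m, n)) : enorm (c *: A) = `|c| * enorm A.
Proof. exact: (snormZ (sip_dot m n)). Qed.

Lemma enormD m n (A B : 'M[R]_(m, n)) : enorm (A + B) <= enorm A + enorm B.
Proof. exact: (snormD (sip_dot m n)). Qed.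

Lemma entry_le_enorm m n (A : 'M[R]_(m, n)) i j : `|A i j| <= enorm A.
Proof.
rewrite -sqrtr_sqr /enorm ler_sqrt ?dot_ge0// /dot (bigD1 i)//= (bigD1 j)//= -expr2.
rewrite -addrA lerDl addr_ge0//; first by apply: sumr_ge0 => k _; rewrite -expr2 sqr_ge0.
by apply: sumr_ge0 => k _; apply: sumr_ge0 => l _; rewrite -expr2 sqr_ge0.
Qed.

Lemma enorm0 m n : enorm (0 : 'M[R]_(m, n)) = 0.
Proof. by rewrite -[0](scale0r 0) enormZ normr0 mul0r. Qed.

Lemma enorm_le_sum m n (A : 'M[R]_(m, n)) : enorm A <= \sum_i \sum_j `|A i j|.
Proof.
rewrite -(@ler_pXn2r _ 2)// ?nnegrE ?enorm_ge0//; last by do 2 (apply: sumr_ge0 => ? _).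
rewrite enorm_sq; set S := \sum_i \sum_j `|A i j|.
have H i j : `|A i j| <= S.
  rewrite /S (bigD1 i)//= (bigD1 j)//= -addrA lerDl addr_ge0//.
    by apply: sumr_ge0.
  by apply: sumr_ge0 => ? _; apply: sumr_ge0.
rewrite expr2 {1}/S mulr_suml; apply: ler_sum => i _; rewrite mulr_suml; apply: ler_sum => j _.
rewrite -expr2 -real_normK ?num_real// expr2; exact: ler_wpM2l.
Qed.

(** Young's inequality with both weights rounded up to 1; it then only takes comparing [a] with
    [b]. *)
Lemma powR_young (a b r : R) : 0 <= a -> 0 <= b -> 1 <= r -> a `^ (r - 1) * b <= a `^ r + b `^ r.
Proof.
move=> a0 b0 r1; have r0 : 0 < r by lra.
have rN : r != 0 by lra.
have E c : 0 <= c -> c `^ (r - 1) * c = c `^ r.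
  move=> c0; rewrite -{2}(powRr1 c0) -powRD ?subrK ?(negbTE rN)//.
have [ab|/ltW ba] := leP a b.
  apply: (@le_trans _ _ (b `^ r)); last by rewrite lerDr powR_ge0.
  by rewrite -(E b b0) ler_wpM2r// ge0_ler_powR// subr_ge0.
apply: (@le_trans _ _ (a `^ r)); last by rewrite lerDl powR_ge0.
by rewrite -(E a a0) ler_wpM2l// powR_ge0.
Qed.

Lemma sum2_const n (k : R) : \sum_(i < n) \sum_(j < n) 2 * k = 2 * n%:R ^+ 2 * k.
Proof.
rewrite !sumr_const !card_ord -[_ *+ n *+ n]mulr_natl -[_ *+ n]mulr_natl; ring.
Qed.

Lemma half_add (p q k : R) : p <= k -> q <= k -> 0 <= k -> p + 2^-1 * q <= 2 * k.
Proof. by move=> pk qk k0; lra. Qed.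

Lemma half_lin (a k x y z p q r : R) : x = a * y + z -> p = a * q + r ->
  x + k * p = a * (y + k * q) + (z + k * r).
Proof. by move=> -> ->; ring. Qed.

End enorm.

(** * Sobolev injections and bounds of the convective form *)

Section injections.
#[local] Set Default Proof Using "All".
Variables (R : realType) (d : nat) (Omega : set 'rV[R]_d).
Notation pt := 'rV[R]_d.
Notation mu := (@leb R d).
Hypothesis oO : open Omega.
Hypothesis fO : (mu Omega < +oo)%E.
Notation H1 := (@Defs.H1 R d Omega d).
Notation nH := (@norm_H1 R d Omega d).
Notation fld := (field R d).
Notation ip := (ip Omega).
Notation ips := (ips Omega).
Notation grad := (grad Omega).

Lemma msr_enorm m n (u : pt -> 'M[R]_(m, n)) : L2 Omega u -> msr Omega (fun x => enorm (u x)).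
Proof.
move=> Lu; rewrite /msr /enorm.
apply: (@measurableT_comp _ _ _ _ _ _ (@Num.sqrt R)); last exact: intg_msr (intg_dot oO fO Lu Lu).
by apply: continuous_measurable_fun; exact: sqrt_continuous.
Qed.

Definition pint (p : R) (v : fld) : \bar R := (\int[mu]_(x in Omega) (enorm (v x) `^ p)%:E)%E.

Lemma norm_LpE (p : R) (v : fld) : 0 < p -> (norm_Lp Omega p v `^ p = pint p v)%E.
Proof.
move=> p0; rewrite /norm_Lp poweR_Lnorm; last by rewrite gt_eqF.
rewrite /pint [RHS]integral_mkcond.
apply: eq_integral => x _; rewrite /= !patchE; case: ifP => _.
  by rewrite ger0_norm ?enorm_ge0// poweR_EFin.
by rewrite /= normr0 powR0// gt_eqF.
Qed.

Lemma pintZ (p : R) (c : R) (v : fld) : 0 < c -> L2 Omega v ->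
  (pint p (c *: v) = (c `^ p)%:E * pint p v)%E.
Proof.
move=> c0 Lv; rewrite /pint -ge0_integralZl//.
- by apply: eq_integral => x _; rewrite /= enormZ gtr0_norm// powRM ?enorm_ge0 ?ltW.
- exact: measurable_Omega.
- by apply/measurable_EFinP; exact: (measurableT_comp (@measurable_powR R p) (msr_enorm Lv)).
- by move=> x _; rewrite lee_fin powR_ge0.
- by rewrite lee_fin powR_ge0.
Qed.

Section injection.
Variables (p c : R).
Hypotheses (p0 : 0 < p) (Hc : injection_norm Omega p = c%:E).

Lemma injection_le1 v : H1 v -> nH v <= 1 -> (pint p v <= (c `^ p)%:E)%E.
Proof.
move=> Hv v1; rewrite -norm_LpE// -poweR_EFin.
have vc : (norm_Lp Omega p v <= c%:E)%E by rewrite -Hc; apply: ereal_sup_ubound; exists v.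
have v0 : (0 <= norm_Lp Omega p v)%E by exact: Lnorm_ge0.
apply: gt0_ler_poweR; rewrite ?in_itv/= ?leey ?andbT//; first exact: ltW.
exact: le_trans v0 vc.
Qed.

Lemma injection_ge0 : 0 <= c.
Proof.
rewrite -lee_fin -Hc; apply: (@le_trans _ _ (norm_Lp Omega p (0 : fld))); first exact: Lnorm_ge0.
apply: ereal_sup_ubound; exists 0 => //; split; first exact: H1_0.
by rewrite -(scale0r (0 : fld)) (norm_H1Z oO fO _ (H1_0 oO fO d)) normr0 mul0r ler01.
Qed.

(** The injection norm is a supremum over the unit ball, so the field is scaled to norm one. A field
    of norm zero cannot be scaled, but it vanishes almost everywhere. *)
Lemma injection_pint v : H1 v -> (pint p v <= ((c * nH v) `^ p)%:E)%E.
Proof.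
move=> Hv; have n0 := norm_H1_ge0 oO fO v; have [v0|v0] := eqVneq (nH v) 0.
  have := norm_H1_sq oO fO Hv; rewrite v0 expr0n /= => /esym/eqP.
  rewrite paddr_eq0; last 2 first.
  - exact: (sip_ge0 (sip_ip oO fO _ _) (H1_L2 oO fO Hv)).
  - exact: (sip_ge0 (sip_ip oO fO _ _) (grad_L2 oO fO Hv)).
  move=> /andP[/eqP/(ip_eq0 oO fO (H1_L2 oO fO Hv)) vz _].
  rewrite mulr0 powR0 ?gt_eqF// /pint.
  rewrite (_ : integral _ _ _ = 0%E)//; rewrite -[RHS](integral0 mu Omega).
  apply: ae_eq_integral.
  - exact: measurable_Omega.
  - by apply/measurable_EFinP; exact: (measurableT_comp (@measurable_powR R p) (msr_enorm (H1_L2 oO fO Hv))).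
  - exact: measurable_cst.
  - by apply: filterS vz => x H Ox; rewrite H// enorm0 powR0// gt_eqF.
have np : 0 < nH v by rewrite lt_def v0.
have Hw : H1 ((nH v)^-1 *: v) by exact: (sipZ (sip_eH oO fO d ler01)).
have := injection_le1 Hw; rewrite (norm_H1Z oO fO _ Hv) ger0_norm ?invr_ge0// mulVf// lexx => /(_ isT).
rewrite pintZ ?invr_gt0//; last exact: H1_L2.
rewrite -(@lee_pmul2l _ (nH v `^ p)%:E)// ?lte_fin ?powR_gt0// muleA -EFinM.
rewrite -powRM ?invr_ge0// divff// powR1 mul1e => H; apply: le_trans H _.
by rewrite -EFinM -powRM ?injection_ge0// mulrC.
Qed.

Lemma injection_intg v : H1 v -> intg Omega (fun x => enorm (v x) `^ p) /\
  \int[mu]_(x in Omega) (enorm (v x) `^ p) <= (c * nH v) `^ p.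
Proof.
move=> Hv; have ms : msr Omega (fun x => enorm (v x) `^ p).
  by exact: (measurableT_comp (@measurable_powR R p) (msr_enorm (H1_L2 oO fO Hv))).
have ii : intg Omega (fun x => enorm (v x) `^ p).
  apply/integrableP; split; first exact/measurable_EFinP.
  apply: le_lt_trans (ltry ((c * nH v) `^ p)); apply: le_trans _ (injection_pint Hv).
  by rewrite le_eqVlt; apply/orP; left; apply/eqP; apply: eq_integral => x _; rewrite /= ger0_norm// powR_ge0.
split => //; rewrite -lee_fin; apply: le_trans _ (injection_pint Hv).
by rewrite /Rintegral (fineK (integrable_fin_num (measurable_Omega oO fO) ii)).
Qed.

End injection.

(** The injection into L4 is used componentwise, where real powers become integer powers. *)
Definition inj4 (c : R) : Prop := 0 <= c /\ forall v : fld, H1 v -> forall i,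
  fpow Omega 4 (fun x => v x 0 i) /\ \int[mu]_(x in Omega) (v x 0 i ^+ 4) <= (c * nH v) ^+ 4.

Lemma injection4 c : injection_norm Omega 4 = c%:E -> inj4 c.
Proof.
move=> Hc; have p4 : (0 : R) < 4 by [].
have c0 := injection_ge0 p4 Hc; split => // v Hv i.
have [I4 B4] := injection_intg p4 Hc Hv.
have mi : msr Omega (fun x => v x 0 i) by exact: (msr_coord oO fO (0 : 'I_1) i (H1_L2 oO fO Hv)).
have E x : enorm (v x) `^ 4 = enorm (v x) ^+ 4 by rewrite -[4]/(4%:R) powR_mulrn ?enorm_ge0.
have L x : v x 0 i ^+ 4 <= enorm (v x) `^ 4.
  rewrite E -[v x 0 i ^+ 4]ger0_norm ?exprn_even_ge0// normrX lerXn2r ?nnegrE ?enorm_ge0//.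
  exact: entry_le_enorm.
have I : intg Omega (fun x => v x 0 i ^+ 4).
  apply: (intg_le oO fO _ I4); first exact: (msrX oO fO).
  by move=> x _; rewrite ger0_norm ?exprn_even_ge0.
split; first by split.
apply: (@le_trans _ _ (\int[mu]_(x in Omega) (enorm (v x) `^ 4))).
  by apply: le_Rintegral => //; exact: measurable_Omega.
by apply: le_trans B4 _; rewrite -[4]/(4%:R) powR_mulrn// mulr_ge0// norm_H1_ge0.
Qed.

(** Hoelder's inequality with exponents 4, 4, 2, by two uses of Cauchy-Schwarz. *)
Lemma fpow4_ips_bound f h g (A B : R) : fpow Omega 4 f -> fpow Omega 4 h -> L2s Omega g ->
  0 <= A -> 0 <= B -> \int[mu]_(x in Omega) (f x ^+ 4) <= A ^+ 4 -> \int[mu]_(x in Omega) (h x ^+ 4) <= B ^+ 4 ->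
  `|ips (fun x => f x * h x) g| <= A * B * norm_L2s Omega g.
Proof.
move=> Ff Fh Lg A0 B0 If Ih; have S := sip_ips oO fO.
have Lfh := fpow4_L2sM oO fO Ff Fh.
apply: le_trans (cauchy_schwarz S Lfh Lg) _; apply: ler_wpM2r; first exact: sqrtr_ge0.
have L2q q : fpow Omega 4 q -> L2s Omega (fun x => q x ^+ 2).
  by move=> Fq; have := fpow4_L2sM oO fO Fq Fq; congr L2s; apply/funext => x; rewrite expr2.
have E q C : fpow Omega 4 q -> 0 <= C -> \int[mu]_(x in Omega) (q x ^+ 4) <= C ^+ 4 ->
    snorm ips (fun x => q x ^+ 2) <= C ^+ 2.
  move=> Fq C0 Iq; rewrite -(@ler_pXn2r _ 2)// ?nnegrE ?exprn_ge0 ?sqrtr_ge0// (snorm2 S); last exact: L2q.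
  by rewrite -exprM; apply: le_trans Iq; rewrite le_eqVlt; apply/orP; left; apply/eqP; apply: eq_Rintegral => x _; rewrite -exprD.
rewrite -(@ler_pXn2r _ 2)// ?nnegrE ?mulr_ge0 ?sqrtr_ge0// (snorm2 S)// exprMn.
rewrite (_ : ips _ _ = ips (fun x => f x ^+ 2) (fun x => h x ^+ 2)); last first.
  by apply: (eq_ips oO fO) => x _; ring.
apply: le_trans (ler_norm _) _; apply: le_trans (cauchy_schwarz S (L2q _ Ff) (L2q _ Fh)) _.
by apply: ler_pM; rewrite ?sqrtr_ge0//; exact: E.
Qed.

Section forms.
Variable c4 : R.
Hypothesis I4 : inj4 c4.

Let S := sip_ips oO fO.
Let comp (v : fld) i : pt -> R := fun x => v x 0 i.
Let gcomp (v : fld) i j : pt -> R := fun x => grad v x i j.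

Let fc v i : H1 v -> fpow Omega 4 (comp v i). Proof. by move=> Hv; exact: (I4.2 v Hv i).1. Qed.
Let gc v i j : H1 v -> L2s Omega (gcomp v i j).
Proof. by move=> Hv; exact: (grad_L2 oO fO Hv). Qed.
Let mc v w i j : H1 v -> H1 w -> L2s Omega (fun x => comp v i x * comp w j x).
Proof. by move=> Hv Hw; exact: (fpow4_L2sM oO fO (fc i Hv) (fc j Hw)). Qed.

Lemma ip_convect (z u v : fld) : H1 z -> H1 u -> H1 v ->
  ip (convect Omega u z) v = \sum_i \sum_j ips (fun x => comp z j x * comp v i x) (gcomp u i j).
Proof.
move=> Hz Hu Hv; have I i j := L2s_intgM oO fO (mc j i Hz Hv) (gc i j Hu).
transitivity (\int[mu]_(x in Omega) \sum_i \sum_j (comp z j x * comp v i x) * gcomp u i j x).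
  apply: eq_Rintegral => x _; rewrite /dot big_ord1; apply: eq_bigr => i _.
  rewrite /convect mxE mulr_suml; apply: eq_bigr => j _; rewrite !mxE /comp /gcomp; ring.
rewrite (Rint_sum oO fO); last by move=> i; exact: (intg_sum oO fO).
by apply: eq_bigr => i _; rewrite (Rint_sum oO fO).
Qed.

Lemma ip_divt (z u v : fld) : H1 z -> H1 u -> H1 v ->
  ip (fun x => div Omega z x *: u x) v = \sum_i \sum_j ips (fun x => comp u i x * comp v i x) (gcomp z j j).
Proof.
move=> Hz Hu Hv; have I i j := L2s_intgM oO fO (mc i i Hu Hv) (gc j j Hz).
transitivity (\int[mu]_(x in Omega) \sum_i \sum_j (comp u i x * comp v i x) * gcomp z j j x).
  apply: eq_Rintegral => x _; rewrite /dot big_ord1; apply: eq_bigr => i _.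
  by rewrite -mulr_sumr !mxE /div /mxtrace /comp; ring.
rewrite (Rint_sum oO fO); last by move=> i; exact: (intg_sum oO fO).
by apply: eq_bigr => i _; rewrite (Rint_sum oO fO).
Qed.

(** With half the divergence added, the convective form vanishes when all its arguments coincide,
    even though discrete velocities are not exactly divergence-free. *)
Definition tri (z u v : fld) : R :=
  ip (convect Omega u z) v + 2^-1 * ip (fun x => div Omega z x *: u x) v.

Let triE z u v : H1 z -> H1 u -> H1 v -> tri z u v = \sum_i \sum_j
  (ips (fun x => comp z j x * comp v i x) (gcomp u i j) + 2^-1 * ips (fun x => comp u i x * comp v i x) (gcomp z j j)).
Proof.
move=> Hz Hu Hv; rewrite /tri ip_convect// ip_divt// mulr_sumr -big_split/=.
by apply: eq_bigr => i _; rewrite mulr_sumr -big_split.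
Qed.

Let t3 f h g := ips (fun x => f x * h x) g.

Let t3_lin1 a u u' v (g : pt -> R) i j : H1 u -> H1 u' -> H1 v -> L2s Omega g ->
  t3 (comp (a *: u + u') i) (comp v j) g = a * t3 (comp u i) (comp v j) g + t3 (comp u' i) (comp v j) g.
Proof.
move=> Hu Hu' Hv Lg; rewrite /t3 -(sip_lin S a (mc i j Hu Hv) (mc i j Hu' Hv) Lg).
by apply: (eq_ips oO fO) => x _; rewrite /comp !mxE !fctE/= /GRing.scale/=; ring.
Qed.

Let t3C f h g : t3 f h g = t3 h f g.
Proof. by apply: (eq_ips oO fO) => x _; rewrite [f x * _]mulrC. Qed.

Let t3_lin2 a u u' v (g : pt -> R) i j : H1 u -> H1 u' -> H1 v -> L2s Omega g ->
  t3 (comp v j) (comp (a *: u + u') i) g = a * t3 (comp v j) (comp u i) g + t3 (comp v j) (comp u' i) g.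
Proof.
move=> Hu Hu' Hv Lg; rewrite (t3C (comp v j)) (t3C _ (comp u i)) (t3C _ (comp u' i)).
exact: (t3_lin1 a i j Hu Hu' Hv Lg).
Qed.

Let t3_lin3 a u u' v w i j k l : H1 u -> H1 u' -> H1 v -> H1 w ->
  t3 (comp v i) (comp w j) (gcomp (a *: u + u') k l) =
  a * t3 (comp v i) (comp w j) (gcomp u k l) + t3 (comp v i) (comp w j) (gcomp u' k l).
Proof.
move=> Hu Hu' Hv Hw; have Hx := H1_lin oO fO a Hu Hu'; have L := mc i j Hv Hw.
have Lg := L2s_lin oO fO a (gc k l Hu) (gc k l Hu').
rewrite /t3 !(sipC S L (gc k l _))// -(sip_lin S a (gc k l Hu) (gc k l Hu') L).
apply: (ips_ae oO fO (gc k l Hx) Lg L).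
by apply: filterS (grad_lin oO fO a Hu Hu') => x H Ox; rewrite /gcomp H// !mxE.
Qed.

Lemma tri_lin1 a z z' u v : H1 z -> H1 z' -> H1 u -> H1 v ->
  tri (a *: z + z') u v = a * tri z u v + tri z' u v.
Proof.
move=> Hz Hz' Hu Hv; have Hx := H1_lin oO fO a Hz Hz'.
rewrite !triE// mulr_sumr -big_split/=; apply: eq_bigr => i _.
rewrite mulr_sumr -big_split/=; apply: eq_bigr => j _.
exact: (half_lin 2^-1 (t3_lin1 a j i Hz Hz' Hv (gc i j Hu)) (t3_lin3 a i i j j Hz Hz' Hu Hv)).
Qed.

Lemma tri_lin2 a z u u' v : H1 z -> H1 u -> H1 u' -> H1 v ->
  tri z (a *: u + u') v = a * tri z u v + tri z u' v.
Proof.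
move=> Hz Hu Hu' Hv; have Hx := H1_lin oO fO a Hu Hu'.
rewrite !triE// mulr_sumr -big_split/=; apply: eq_bigr => i _.
rewrite mulr_sumr -big_split/=; apply: eq_bigr => j _.
exact: (half_lin 2^-1 (t3_lin3 a j i i j Hu Hu' Hz Hv) (t3_lin1 a i i Hu Hu' Hv (gc j j Hz))).
Qed.

Lemma tri_lin3 a z u v v' : H1 z -> H1 u -> H1 v -> H1 v' ->
  tri z u (a *: v + v') = a * tri z u v + tri z u v'.
Proof.
move=> Hz Hu Hv Hv'; have Hx := H1_lin oO fO a Hv Hv'.
rewrite !triE// mulr_sumr -big_split/=; apply: eq_bigr => i _.
rewrite mulr_sumr -big_split/=; apply: eq_bigr => j _.
exact: (half_lin 2^-1 (t3_lin2 a i j Hv Hv' Hz (gc i j Hu)) (t3_lin2 a i i Hv Hv' Hu (gc j j Hz))).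
Qed.

Let norm_gcomp u i j : H1 u -> norm_L2s Omega (gcomp u i j) <= nH u.
Proof.
move=> Hu; apply: le_trans (norm_grad_le_H1 oO fO Hu).
rewrite /norm_L2s /norm_L2; apply: ler_wsqrtr; apply: le_Rintegral.
- exact: measurable_Omega.
- exact: (L2s_intgM oO fO (gc i j Hu) (gc i j Hu)).
- exact: (intg_dot oO fO (grad_L2 oO fO Hu) (grad_L2 oO fO Hu)).
- by move=> x _; rewrite -enorm_sq -expr2 -real_normK ?num_real// lerXn2r ?nnegrE ?enorm_ge0 ?entry_le_enorm.
Qed.

Let t3_bound f g u v w i j k l : H1 u -> H1 v -> H1 w -> f = comp u i -> g = comp v j ->
  `|ips (fun x => f x * g x) (gcomp w k l)| <= c4 ^+ 2 * (nH u * nH v * nH w).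
Proof.
move=> Hu Hv Hw -> ->; have c0 := I4.1.
have nu := norm_H1_ge0 oO fO u; have nv := norm_H1_ge0 oO fO v; have nw := norm_H1_ge0 oO fO w.
apply: le_trans (fpow4_ips_bound (fc i Hu) (fc j Hv) (gc k l Hw) _ _ (I4.2 u Hu i).2 (I4.2 v Hv j).2) _.
- exact: mulr_ge0 c0 nu.
- exact: mulr_ge0 c0 nv.
have -> (x y z : R) : c4 ^+ 2 * (x * y * z) = c4 * x * (c4 * y) * z by ring.
by apply: ler_wpM2l; [exact: (mulr_ge0 (mulr_ge0 c0 nu) (mulr_ge0 c0 nv))|exact: norm_gcomp].
Qed.

(** There are [d ^ 2] pairs of indices, each with two scalar triple products of weights 1 and 1/2;
    the total weight 3/2 is rounded up to 2. *)
Lemma tri_bound z u v : H1 z -> H1 u -> H1 v ->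
  `|tri z u v| <= 2 * d%:R ^+ 2 * c4 ^+ 2 * (nH z * nH u * nH v).
Proof.
move=> Hz Hu Hv; rewrite triE//; set K := c4 ^+ 2 * (nH z * nH u * nH v).
have nz := norm_H1_ge0 oO fO z; have nu := norm_H1_ge0 oO fO u; have nv := norm_H1_ge0 oO fO v.
have K0 : 0 <= K := mulr_ge0 (sqr_ge0 c4) (mulr_ge0 (mulr_ge0 nz nu) nv).
apply: le_trans (ler_norm_sum _ _ _) _.
apply: (@le_trans _ _ (\sum_(i < d) \sum_(j < d) (2 * K))); last first.
  rewrite sum2_const /K; generalize (nH z) (nH u) (nH v) => p q r.
  by rewrite le_eqVlt; apply/orP; left; apply/eqP; ring.
apply: ler_sum => i _; apply: le_trans (ler_norm_sum _ _ _) _; apply: ler_sum => j _.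
apply: le_trans (ler_normD _ _) _; rewrite normrM ger0_norm ?invr_ge0//.
have B1 : `|ips (fun x => comp z j x * comp v i x) (gcomp u i j)| <= K.
  apply: le_trans (t3_bound i j Hz Hv Hu erefl erefl) _.
  rewrite /K; generalize (nH z) (nH u) (nH v) => p q r.
  by rewrite le_eqVlt; apply/orP; left; apply/eqP; ring.
have B2 : `|ips (fun x => comp u i x * comp v i x) (gcomp z j j)| <= K.
  apply: le_trans (t3_bound j j Hu Hv Hz erefl erefl) _.
  rewrite /K; generalize (nH z) (nH u) (nH v) => p q r.
  by rewrite le_eqVlt; apply/orP; left; apply/eqP; ring.
exact: half_add B1 B2 K0.
Qed.

(** For each pair of indices the integrand is half the derivative along [j] of [phi_j] times the
    square of [phi_i], so every summand vanishes separately. *)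
Lemma tri_test (phi : fld) : (forall i, test_fun Omega (fun x => phi x 0 i)) -> tri phi phi phi = 0.
Proof.
move=> tphi; have [H1p gp] := test_H1 oO fO tphi.
have cphi i := test_C1c (tphi i).
have D i j : exists2 psi, C1c Omega psi & forall x, pd j psi x =
    2 * (phi x 0 j * phi x 0 i * pd j (comp phi i) x + 2^-1 * (phi x 0 i * phi x 0 i * pd j (comp phi j) x)).
  have [c1 d1] := C1cM (cphi i) (cphi i); have [c2 d2] := C1cM (cphi j) c1.
  by exists (fun x => phi x 0 j * (phi x 0 i * phi x 0 i)) => // x; rewrite d2 d1; field.
rewrite triE// big1// => i _; rewrite big1// => j _.
have [psi cpsi dpsi] := D i j.
have Lp k l : L2s Omega (pd l (comp phi k)) by exact: (C1c_L2s oO fO (cphi k)).2.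
have E k l m n : ips (fun x => comp phi k x * comp phi l x) (gcomp phi m n) =
    ips (fun x => comp phi k x * comp phi l x) (pd n (comp phi m)).
  rewrite !(sipC S (mc k l H1p H1p) _)//; last exact: gc.
  apply: (ips_ae oO fO (gc m n H1p) (Lp m n) (mc k l H1p H1p)).
  by apply: filterS gp => x H Ox; rewrite /gcomp H// mxE.
have I1 := L2s_intgM oO fO (mc j i H1p H1p) (Lp i j).
have I2 := L2s_intgM oO fO (mc i i H1p H1p) (Lp j j).
have mO := measurable_Omega oO fO.
have Z := C1c_integral j oO cpsi.
have F : \int[mu]_(x in Omega) pd j psi x = 2 * (\int[mu]_(x in Omega) (comp phi j x * comp phi i x * pd j (comp phi i) x) +
    2^-1 * \int[mu]_(x in Omega) (comp phi i x * comp phi i x * pd j (comp phi j) x)).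
  rewrite -(RintegralZl 2^-1 mO I2) -(RintegralD mO I1 (intgZ oO fO 2^-1 I2)).
  rewrite -(RintegralZl 2 mO (intgD oO fO I1 (intgZ oO fO 2^-1 I2))).
  by apply: eq_Rintegral => x _; rewrite dpsi.
move: Z; rewrite F => /eqP; rewrite mulf_eq0 pnatr_eq0 /= => /eqP.
by rewrite (E j i i j) (E i i j j).
Qed.

(** The form is continuous in the H1 norm and vanishes on test fields, which are dense. No trace on
    the boundary is involved. *)
Lemma tri_skew u : H10 Omega u -> tri u u u = 0.
Proof.
move=> Hu0; have Hu := H10_H1 oO fO Hu0; have nu := norm_H1_ge0 oO fO u.
set K := 2 * d%:R ^+ 2 * c4 ^+ 2.
have K0 : 0 <= K by rewrite /K; apply: mulr_ge0 (sqr_ge0 _); exact: mulr_ge0 (sqr_ge0 _).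
have Y := sip_eH oO fO d ler01.
have bnd (e : R) : 0 < e -> e <= 1 -> `|tri u u u| <= e * (K * (3 * (nH u + 1) ^+ 2)).
  move=> e0 e1; have [phi [tphi phiu]] := Hu0.2 e e0.
  have [Hp _] := test_H1 oO fO tphi; have Hw : H1 (u - phi) := sipB Y Hu Hp.
  have np : nH phi <= nH u + 1.
    have -> : phi = u + (-1) *: (u - phi) by rewrite scaleN1r opprB addrCA subrr addr0.
    apply: le_trans (norm_H1D oO fO Hu (sipZ Y _ Hw)) _; rewrite (norm_H1Z oO fO _ Hw) normrN1 mul1r lerD2l.
    exact: le_trans (ltW phiu) e1.
  (* Telescoping: one argument at a time is replaced by [phi], and each difference contains the
     factor [u - phi]. *)
  have -> : tri u u u = tri (u - phi) u u + tri phi (u - phi) u + tri phi phi (u - phi).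
    have L1 := tri_lin1 1 Hw Hp Hu Hu; rewrite scale1r mul1r subrK in L1.
    have L2 := tri_lin2 1 Hp Hw Hp Hu; rewrite scale1r mul1r subrK in L2.
    have L3 := tri_lin3 1 Hp Hp Hw Hp; rewrite scale1r mul1r subrK in L3.
    by rewrite L1 L2 L3 tri_test// addr0 addrA.
  have B1 := tri_bound Hw Hu Hu; have B2 := tri_bound Hp Hw Hu; have B3 := tri_bound Hp Hp Hw.
  apply: le_trans (ler_normD _ _) _; apply: le_trans (lerD (ler_normD _ _) (lexx _)) _.
  apply: le_trans (lerD (lerD B1 B2) B3) _.
  have nw := norm_H1_ge0 oO fO (u - phi); have np0 := norm_H1_ge0 oO fO phi.
  move: nu np phiu nw np0; rewrite -/K; generalize (nH u) (nH phi) (nH (u - phi)) => a b c a0 ba ce c0 b0.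
  rewrite -!mulrDr (_ : e * _ = K * (e * (3 * (a + 1) ^+ 2))); last by ring.
  apply: ler_wpM2l => //; have ce' := ltW ce.
  have a1 : a <= a + 1 by rewrite lerDl.
  have P1 : c * a * a <= e * (a + 1) * (a + 1) by rewrite !ler_pM ?mulr_ge0.
  have P2 : b * c * a <= (a + 1) * e * (a + 1) by rewrite !ler_pM ?mulr_ge0.
  have P3 : b * b * c <= (a + 1) * (a + 1) * e by rewrite !ler_pM ?mulr_ge0.
  apply: le_trans (lerD (lerD P1 P2) P3) _.
  by rewrite le_eqVlt; apply/orP; left; apply/eqP; ring.
set M := K * _ in bnd; have M0 : 0 <= M.
  by apply: mulr_ge0 => //; apply: mulr_ge0 => //; exact: sqr_ge0.
apply/eqP; rewrite -normr_le0; apply/ler_addgt0Pl => e e0; rewrite addr0.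
have M1 : 0 < M + 1 by rewrite ltr_wpDl.
apply: (le_trans (bnd (Num.min 1 (e / (M + 1))) _ _)).
- by rewrite lt_min ltr01 divr_gt0.
- by rewrite ge_min lexx.
apply: (@le_trans _ _ (e / (M + 1) * M)); first by rewrite ler_wpM2r// ge_min lexx orbT.
by rewrite mulrAC ler_pdivrMr// ler_wpM2l ?(ltW e0)// lerDl.
Qed.

End forms.

End injections.

(** * The Forchheimer term *)

Section powR_lipschitz.
Variable R : realType.

Lemma powR_le1D (x t : R) : 0 <= x -> 0 <= t <= 1 -> x `^ t <= 1 + x.
Proof.
move=> x0 /andP[t0 t1]; have [x1|/ltW x1] := leP x 1.
  apply: (@le_trans _ _ 1); last by rewrite lerDl.
  have := @ge0_ler_powR R t t0 x 1; rewrite !nnegrE powR1; exact.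
apply: (@le_trans _ _ (x `^ 1)); first exact: ler_powR.
by rewrite powRr1// lerDr.
Qed.

(** Young's inequality for [a / A] and [b / B]. Integrated with [A] and [B] above the L^r norms of
    two functions, it yields Hoelder's inequality up to a factor 2. *)
Lemma young_scaled (a b A B r : R) : 0 <= a -> 0 <= b -> 0 < A -> 0 < B -> 1 <= r ->
  a `^ (r - 1) * b <= A `^ (r - 1) * B * (A `^ (- r) * a `^ r + B `^ (- r) * b `^ r).
Proof.
move=> a0 b0 A0 B0 r1.
have pM (p X e : R) : 0 < X -> 0 <= e -> (X^-1 * e) `^ p = X `^ (- p) * e `^ p.
  move=> X0 e0; rewrite powRM ?invr_ge0 ?(ltW X0)//; congr (_ * _).
  by rewrite -powR_inv1 ?(ltW X0)// -powRrM mulN1r.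
have Ai : 0 <= A^-1 * a by rewrite mulr_ge0 ?invr_ge0// ltW.
have Bi : 0 <= B^-1 * b by rewrite mulr_ge0 ?invr_ge0// ltW.
have := powR_young Ai Bi r1; rewrite !pM// powRN => Y.
have ApG : 0 < A `^ (r - 1) by exact: powR_gt0.
rewrite -ler_pdivrMl ?mulr_gt0//; apply: le_trans _ Y.
by rewrite le_eqVlt; apply/orP; left; apply/eqP; field; rewrite !gt_eqF.
Qed.

(** An elementary substitute for the mean value theorem: [x ^ s - y ^ s] is split into
    [x ^ (s-1) (x - y)] and [y (x ^ (s-1) - y ^ (s-1))], and the second term is controlled because
    [s - 1 <= 1]. *)
Lemma powR_lip (s M x y : R) : 1 <= s <= 2 -> 0 <= x <= M -> 0 <= y <= M ->
  `|x `^ s - y `^ s| <= 2 * (1 + M) * `|x - y|.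
Proof.
move=> /andP[s1 s2]; wlog yx : x y / y <= x => [H|].
  move=> hx hy; have [yx|/ltW xy] := leP y x; first exact: H.
  by rewrite distrC [`|x - y|]distrC; exact: H.
move=> /andP[x0 xM] /andP[y0 yM].
have t01 : 0 <= s - 1 <= 1 by apply/andP; split; lra.
have E z : 0 <= z -> z `^ s = z * z `^ (s - 1).
  move=> z0; rewrite -{2}(powRr1 z0) -powRD; first by rewrite addrC subrK.
  by rewrite addrC subrK; have -> : (s == 0) = false by apply/negbTE/eqP; lra.
(* Dividing by [y], this is the inequality t ^ (s-1) <= t for the ratio t = x / y >= 1. *)
have H : y * (x `^ (s - 1) - y `^ (s - 1)) <= y `^ (s - 1) * (x - y).
  have [->|yn] := eqVneq y 0; first by rewrite mul0r mulr_ge0 ?powR_ge0// subr0.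
  have yp : 0 < y by rewrite lt_def yn.
  have xy1 : 1 <= x / y by rewrite ler_pdivlMr// mul1r.
  have -> : x = x / y * y by rewrite divfK.
  rewrite powRM ?divr_ge0//.
  have R1 : (x / y) `^ (s - 1) <= x / y.
    have := @ler_powR R (x / y) xy1 (s - 1) 1; rewrite powRr1 ?divr_ge0//; apply; lra.
  rewrite [leLHS](_ : _ = y * y `^ (s - 1) * ((x / y) `^ (s - 1) - 1)); last by ring.
  rewrite [leRHS](_ : _ = y * y `^ (s - 1) * (x / y - 1)); last by field.
  by apply: ler_wpM2l; [rewrite mulr_ge0 ?powR_ge0|rewrite lerD2r].
have xy0 : 0 <= x - y by rewrite subr_ge0.
rewrite ger0_norm ?(ger0_norm xy0); last first.
  rewrite subr_ge0; apply: ge0_ler_powR; rewrite ?nnegrE//; lra.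
rewrite (E x x0) (E y y0).
rewrite (_ : _ - _ = x `^ (s - 1) * (x - y) + y * (x `^ (s - 1) - y `^ (s - 1))); last by ring.
apply: le_trans (lerD (lexx _) H) _; rewrite -mulrDl; apply: ler_wpM2r => //.
rewrite mulr2n mulrDl mul1r; apply: lerD.
  by apply: le_trans (powR_le1D x0 t01) _; rewrite lerD2l.
by apply: le_trans (powR_le1D y0 t01) _; rewrite lerD2l.
Qed.

(** Applied with [s = rho - 2], which lies in [[1, 2]] exactly because [rho] lies in [[3, 4]]. The
    factor 3 collects 1 from the difference of the vectors and 2 from the difference of the
    weights. *)
Lemma forch_lip n (s M : R) (a b : 'rV[R]_n) : 1 <= s <= 2 -> enorm a <= M -> enorm b <= M ->
  enorm (enorm a `^ s *: a - enorm b `^ s *: b) <= 3 * (1 + M) ^+ 2 * enorm (a - b).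
Proof.
move=> s12 aM bM; have a0 := enorm_ge0 a; have b0 := enorm_ge0 b.
have M0 : 0 <= M := le_trans a0 aM.
rewrite (_ : _ - _ = enorm a `^ s *: (a - b) + (enorm a `^ s - enorm b `^ s) *: b); last first.
  by rewrite scalerBr scalerBl addrA subrK.
apply: le_trans (enormD _ _) _; rewrite !enormZ ger0_norm ?powR_ge0//.
have T : `|enorm a - enorm b| <= enorm (a - b).
  rewrite ler_norml lerBlDr lerNl opprB lerBlDr; apply/andP; split.
    have := enormD (b - a) a; rewrite subrK -opprB -scaleN1r enormZ normrN1 mul1r; lra.
  by have := enormD (a - b) b; rewrite subrK.
have P := powR_lip s12 (introT andP (conj a0 aM)) (introT andP (conj b0 bM)).
have Q : enorm a `^ s <= (1 + M) ^+ 2.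
  have M1 : 1 <= 1 + M by rewrite lerDl.
  apply: (@le_trans _ _ ((1 + M) `^ s)).
    apply: ge0_ler_powR; rewrite ?nnegrE//; [by case/andP: s12; lra|lra|lra].
  apply: (@le_trans _ _ ((1 + M) `^ 2)); first by apply: ler_powR => //; case/andP: s12.
  by rewrite -[2%R]/(2%:R) powR_mulrn// addr_ge0.
have d0 := enorm_ge0 (a - b).
have X1 : enorm a `^ s * enorm (a - b) <= (1 + M) ^+ 2 * enorm (a - b) by exact: ler_wpM2r.
have X2 : `|enorm a `^ s - enorm b `^ s| * enorm b <= 2 * (1 + M) ^+ 2 * enorm (a - b).
  apply: (@le_trans _ _ (2 * (1 + M) * enorm (a - b) * (1 + M))); last first.
    by rewrite le_eqVlt; apply/orP; left; apply/eqP; ring.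
  apply: ler_pM => //; last lra.
  apply: le_trans P _; apply: ler_wpM2l T; by rewrite !mulr_ge0// addr_ge0.
apply: le_trans (lerD X1 X2) _.
by rewrite le_eqVlt; apply/orP; left; apply/eqP; ring.
Qed.

End powR_lipschitz.

Section forchheimer.
#[local] Set Default Proof Using "All".
Variables (R : realType) (d : nat) (Omega : set 'rV[R]_d).
Notation pt := 'rV[R]_d.
Notation mu := (@leb R d).
Hypothesis oO : open Omega.
Hypothesis fO : (mu Omega < +oo)%E.
Notation H1 := (@Defs.H1 R d Omega d).
Notation nH := (@norm_H1 R d Omega d).
Notation fld := (field R d).
Notation ip := (ip Omega).
Notation mO := (measurable_Omega oO fO).
Variables (rho ir : R).
Hypothesis rho34 : 3 <= rho <= 4.
Hypothesis Ir : injection_norm Omega rho = ir%:E.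

Let rho3 : 3 <= rho. Proof. by case/andP: rho34. Qed.
Let rho4 : rho <= 4. Proof. by case/andP: rho34. Qed.
Let rho1 : 1 <= rho. Proof. by apply: le_trans rho3; rewrite ler1n. Qed.
Let rho0 : 0 < rho. Proof. by apply: lt_le_trans rho3. Qed.

Let intg_norm f : intg Omega f -> intg Omega (fun x => `|f x|).
Proof. by move=> I; exact: (integrable_abse I). Qed.

Let dotE (u v : fld) x : dot (forch rho u x) (v x) = enorm (u x) `^ (rho - 2) * dot (u x) (v x).
Proof. exact: dotZl. Qed.

Let dot_le (u v : fld) x : `|dot (forch rho u x) (v x)| <= enorm (u x) `^ (rho - 1) * enorm (v x).
Proof.
rewrite dotE normrM ger0_norm ?powR_ge0//.
apply: (@le_trans _ _ (enorm (u x) `^ (rho - 2) * (enorm (u x) * enorm (v x)))).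
  by apply: ler_wpM2l; [exact: powR_ge0|exact: dot_enorm].
rewrite mulrA -[X in _ * X * _](@powRr1 _ (enorm (u x))) ?enorm_ge0// -powRD.
  rewrite le_eqVlt; apply/orP; left; apply/eqP; congr (_ `^ _ * _).
  by lra.
by apply/implyP => /eqP h; exfalso; move: h; have := rho3; lra.
Qed.

Let msr_fd u v : H1 u -> H1 v -> msr Omega (fun x => dot (forch rho u x) (v x)).
Proof.
move=> Hu Hv; have Lu := H1_L2 oO fO Hu; have Lv := H1_L2 oO fO Hv.
have -> : (fun x => dot (forch rho u x) (v x)) = fun x => enorm (u x) `^ (rho - 2) * dot (u x) (v x).
  by apply/funext => x; exact: dotE.
apply: (msrM oO fO); last exact: (intg_msr oO fO (intg_dot oO fO Lu Lv)).
exact: (measurableT_comp (@measurable_powR R (rho - 2)) (msr_enorm oO fO Lu)).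
Qed.

Lemma intg_forch u v : H1 u -> H1 v -> intg Omega (fun x => dot (forch rho u x) (v x)).
Proof.
move=> Hu Hv; have [Iu _] := injection_intg oO fO rho0 Ir Hu; have [Iv _] := injection_intg oO fO rho0 Ir Hv.
apply: (intg_le oO fO (msr_fd Hu Hv) (intgD oO fO Iu Iv)) => x _.
apply: le_trans (dot_le u v x) _; apply: powR_young; rewrite ?enorm_ge0//.
Qed.

Lemma ip_forch_lin u a v w : H1 u -> H1 v -> H1 w ->
  ip (forch rho u) (a *: v + w) = a * ip (forch rho u) v + ip (forch rho u) w.
Proof.
move=> Hu Hv Hw; have Iv := intg_forch Hu Hv; have Iw := intg_forch Hu Hw.
rewrite -(RintegralZl a mO Iv) -(RintegralD mO (intgZ oO fO a Iv) Iw).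
apply: eq_Rintegral => x _.
have S := sip_dot R 1 d.
rewrite (sipC S)// [in RHS](sipC S)// [in X in _ = _ + X](sipC S)//.
by rewrite -(sip_lin S).
Qed.

Lemma ip_forch_ge0 u : 0 <= ip (forch rho u) u.
Proof. by apply: Rintegral_ge0 => x _; rewrite dotE mulr_ge0 ?powR_ge0// dot_ge0. Qed.

Lemma nH_eq0 u : H1 u -> nH u = 0 -> aeq Omega u 0.
Proof.
move=> Hu u0; apply: (ip_eq0 oO fO (H1_L2 oO fO Hu)).
have := norm_H1_sq oO fO Hu; rewrite u0 expr0n /= => /esym/eqP; rewrite paddr_eq0.
- by case/andP => /eqP.
- exact: (sip_ge0 (sip_ip oO fO _ _) (H1_L2 oO fO Hu)).
- exact: (sip_ge0 (sip_ip oO fO _ _) (grad_L2 oO fO Hu)).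
Qed.

(** The pointwise majorant [J] from Young's inequality is normalised so that each of its two terms
    integrates to at most [A ^ (rho-1) B]; hence the factor 2. *)
Lemma ip_forch_hoelder u v (A B a b : R) : H1 u -> H1 v -> 0 < A -> 0 < B ->
  0 <= a <= A -> 0 <= b <= B -> \int[mu]_(x in Omega) (enorm (u x) `^ rho) <= a `^ rho ->
  \int[mu]_(x in Omega) (enorm (v x) `^ rho) <= b `^ rho ->
  `|ip (forch rho u) v| <= 2 * A `^ (rho - 1) * B.
Proof.
move=> Hu Hv A0 B0 /andP[a0 A'] /andP[b0 B'] Bu Bv; have I := intg_forch Hu Hv.
have [Iu _] := injection_intg oO fO rho0 Ir Hu; have [Iv _] := injection_intg oO fO rho0 Ir Hv.
pose J x := A `^ (rho - 1) * B * (A `^ (- rho) * enorm (u x) `^ rho + B `^ (- rho) * enorm (v x) `^ rho).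
have IJ : intg Omega J.
  by apply: (intgZ oO fO); apply: (intgD oO fO); exact: (intgZ oO fO).
have powN (X : R) : 0 < X -> X `^ (- rho) * X `^ rho = 1.
  by move=> X0; rewrite powRN mulVf// gt_eqF// powR_gt0.
have LJ x : `|dot (forch rho u x) (v x)| <= J x.
  apply: le_trans (dot_le u v x) _.
  by apply: young_scaled; rewrite ?enorm_ge0//; exact: rho1.
have ILE : `|ip (forch rho u) v| <= \int[mu]_(x in Omega) J x.
  apply: le_trans (le_normr_Rintegral mO I) _; apply: le_Rintegral => //.
  - exact: mO.
  - exact: intg_norm.
apply: le_trans ILE _; rewrite /J (RintegralZl _ mO); last by apply: (intgD oO fO); exact: (intgZ oO fO).
rewrite (RintegralD mO); [|exact: (intgZ oO fO)|exact: (intgZ oO fO)].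
rewrite (RintegralZl _ mO Iu) (RintegralZl _ mO Iv).
have K (X c I0 : R) : 0 < X -> 0 <= c -> c <= X -> I0 <= c `^ rho -> X `^ (- rho) * I0 <= 1.
  move=> X0 c0 cX Ic; rewrite -(powN X X0); apply: ler_wpM2l; first exact: powR_ge0.
  by apply: le_trans Ic _; apply: ge0_ler_powR; rewrite ?nnegrE// ?(ltW X0)// ltW.
have K1 := K A _ _ A0 a0 A' Bu.
have K2 := K B _ _ B0 b0 B' Bv.
have ge : 0 <= A `^ (rho - 1) * B by apply: mulr_ge0 (powR_ge0 _ _) (ltW B0).
apply: le_trans (ler_wpM2l ge (lerD K1 K2)) _.
by rewrite mulrC mulrA.
Qed.

(** The factor [1 + ir] in place of [ir] keeps the scales of Hoelder's inequality positive. Fields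
    of norm zero, for which the scale would still vanish, are treated apart. *)
Lemma ip_forch_bound u v : H1 u -> H1 v ->
  `|ip (forch rho u) v| <= 2 * ((1 + ir) * nH u) `^ (rho - 1) * ((1 + ir) * nH v).
Proof.
move=> Hu Hv; have I := intg_forch Hu Hv.
have i0 := injection_ge0 oO fO rho0 Ir; have i1 : 0 < 1 + ir by rewrite ltr_wpDr.
have nu := norm_H1_ge0 oO fO u; have nv := norm_H1_ge0 oO fO v.
have Z : {ae mu, forall x, Omega x -> dot (forch rho u x) (v x) = 0} ->
    `|ip (forch rho u) v| <= 2 * ((1 + ir) * nH u) `^ (rho - 1) * ((1 + ir) * nH v).
  move=> H; rewrite [ip _ _](_ : _ = 0); last first.
    transitivity (\int[mu]_(x in Omega) (fun=> 0) x); first exact: (Rint_ae oO fO I (intg_cst oO fO 0) H).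
    by rewrite Rintegral_cst ?mul0r//; exact: mO.
  rewrite normr0; apply: mulr_ge0; last exact: mulr_ge0 (ltW i1) nv.
  by apply: mulr_ge0 => //; exact: powR_ge0.
have [u0|un] := eqVneq (nH u) 0.
  by apply: Z; apply: filterS (nH_eq0 Hu u0) => x H Ox; rewrite dotE H// -[0](scale0r 0) dotZl mul0r mulr0.
have [v0|vn] := eqVneq (nH v) 0.
  apply: Z; apply: filterS (nH_eq0 Hv v0) => x H Ox; rewrite dotE H//.
  by rewrite (sipC (sip_dot R 1 d))// -[0](scale0r 0) dotZl mul0r mulr0.
have [_ Bu] := injection_intg oO fO rho0 Ir Hu; have [_ Bv] := injection_intg oO fO rho0 Ir Hv.
have up : 0 < nH u by rewrite lt_def un nu.
have vp : 0 < nH v by rewrite lt_def vn nv.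
have L x : 0 <= x -> 0 <= ir * x <= (1 + ir) * x.
  by move=> x0; rewrite mulr_ge0//= ler_wpM2r// lerDr.
exact: ip_forch_hoelder Hu Hv (mulr_gt0 i1 up) (mulr_gt0 i1 vp) (L _ nu) (L _ nv) Bu Bv.
Qed.

(** Purely qualitative: the constant involves uniform bounds of the fields, available for discrete
    functions but dependent on the mesh. It serves to solve the differential system and does not
    enter the estimates. *)
Lemma ip_forch_lip u w v (M N e : R) : H1 u -> H1 w -> H1 v -> 0 <= M ->
  (forall x, Omega x -> [/\ enorm (u x) <= M, enorm (w x) <= M, enorm (u x - w x) <= e & enorm (v x) <= N]) ->
  `|ip (forch rho u) v - ip (forch rho w) v| <= 3 * (1 + M) ^+ 2 * e * N * fine (mu Omega).
Proof.
move=> Hu Hw Hv M0 B; have Iu := intg_forch Hu Hv; have Iw := intg_forch Hw Hv.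
rewrite -(RintegralB mO Iu Iw).
have IB : intg Omega (fun x => dot (forch rho u x) (v x) - dot (forch rho w x) (v x)).
  have := intgD oO fO Iu (intgZ oO fO (-1) Iw); congr intg; apply/funext => x; by rewrite mulN1r.
apply: le_trans (le_normr_Rintegral mO IB) _.
rewrite -(Rintegral_cst mu mO); apply: le_Rintegral.
- exact: mO.
- exact: intg_norm.
- exact: (intg_cst oO fO).
move=> x Ox; have [uM wM uw vN] := B x Ox.
have S := sip_dot R 1 d.
rewrite -(sipBl S)//; apply: le_trans (dot_enorm _ _) _.
apply: ler_pM; rewrite ?enorm_ge0//.
have s12 : 1 <= rho - 2 <= 2 by have := rho3; have := rho4; move=> ? ?; apply/andP; split; lra.
apply: le_trans (forch_lip s12 uM wM) _; apply: ler_wpM2l => //.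
by rewrite mulr_ge0// sqr_ge0.
Qed.

End forchheimer.

(** * Absolutely continuous functions of time *)

Section smooth_step.
Variable R : realType.
Implicit Types f g : R -> R.

(** A class that contains the inverse of [f] and is stable under derivation. *)
Inductive smooth_quot f : (R -> R) -> Prop :=
| Smooth_quot g n : smooth g -> smooth_quot f (fun x => g x * ((f x)^-1) ^+ n)
| Smooth_quotD g h : smooth_quot f g -> smooth_quot f h -> smooth_quot f (fun x => g x + h x).

Lemma isdX f t a n : isd f t a -> isd (fun x => f x ^+ n) t (n%:R * f t ^+ n.-1 * a).
Proof.
move=> df; elim: n => [|n IH].
  by apply: (isd_eq (isd_cst 1 t)) => [x|]; rewrite ?expr0 ?mul0r.
apply: (isd_eq (isdM df IH)) => [x|/=]; first by rewrite exprS.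
case: n {IH} => [|n] /=; first by rewrite !expr0; ring.
by rewrite exprS -[in RHS]natr1; ring.
Qed.

Lemma smoothV f : smooth f -> (forall x, 0 < f x) -> smooth (fun x => (f x)^-1).
Proof.
move=> sf f0; have [f' sf' df] := smoothW sf.
apply: (@smooth_coind _ (smooth_quot f)); last first.
  (* The numerator is the constant 1, written as a quotient of equal positive numbers. *)
  rewrite (_ : (fun x => _) = fun x => bump0 1 / bump0 (1:R) * (f x)^-1 ^+ 1).
    apply: Smooth_quot; have := @smooth_affine R (fun=> bump0 1 / bump0 (1 : R)) 0 0.
    by move=> H; apply: (@smooth_coind _ (fun h => exists c, h = fun=> c)) => [_ [c ->]|]; [exists (fun=> 0); [exists 0|move=> t; exact: isd_cst]|eexists].
  by apply/funext => x; rewrite divff ?gt_eqF ?bump0_gt0// mul1r expr1.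
move=> h; elim=> {h}[g n sg|g h _ [g' pg' dg] _ [h' ph' dh]].
  have [g' sg' dg] := smoothW sg.
  exists (fun x => g' x * ((f x)^-1) ^+ n + (- n%:R * (g x * f' x)) * ((f x)^-1) ^+ n.+1).
    apply: Smooth_quotD; apply: Smooth_quot; first exact: sg'.
    by apply: smoothZ; apply: smoothM; [exact: sg|exact: sf'].
  move=> t; have ft : f t != 0 by rewrite gt_eqF.
  apply: (isd_eq (isdM (dg t) (isdX n (isdV ft (df t))))) => //.
  by case: n => [|n] /=; rewrite !exprS ?expr0; field.
exists (fun x => g' x + h' x); first exact: Smooth_quotD.
by move=> t; exact: isdD.
Qed.

(** A smooth Heaviside function. The denominator is positive because [x] and [1 - x] are never both
    nonpositive. Differences of dilated translates are the test functions of the du Bois-Reymond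
    lemma. *)
Definition sstep (x : R) : R := bump0 x / (bump0 x + bump0 (1 - x)).

Let den_gt0 (x : R) : 0 < bump0 x + bump0 (1 - x).
Proof.
have [x0|x0] := ltP 0 x; first by rewrite ltr_pwDl ?bump0_gt0 ?bump0_ge0.
by rewrite ltr_wpDl ?bump0_ge0// bump0_gt0// subr_gt0; lra.
Qed.

Lemma smooth_sstep : smooth sstep.
Proof.
apply: smoothM; first exact: smooth_bump0.
have s1 : smooth (fun x : R => - (-1 * bump0 x - bump0 (1 - x))).
  have := @smoothZ R _ (-1) (smoothB (@smoothZ R _ (-1) (@smooth_bump0 R)) (@smooth_affine R _ (-1) 1 (@smooth_bump0 R))).
  congr smooth; apply/funext => x; have -> : -1 * x + 1 = 1 - x by ring.
  exact: mulN1r.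
apply: smoothV => [|x]; last exact: den_gt0.
by move: s1; congr smooth; apply/funext => x; ring.
Qed.

Lemma sstep_le0 x : x <= 0 -> sstep x = 0.
Proof. by move=> x0; rewrite /sstep bump0_le0// mul0r. Qed.

Lemma sstep_ge1 x : 1 <= x -> sstep x = 1.
Proof.
move=> x1; rewrite /sstep [bump0 (1 - x)]bump0_le0 ?subr_le0// addr0 divff// gt_eqF// bump0_gt0//.
exact: lt_le_trans x1.
Qed.

Lemma sstep_01 x : 0 <= sstep x <= 1.
Proof.
rewrite /sstep divr_ge0 ?bump0_ge0 ?(ltW (den_gt0 _))//=.
by rewrite ler_pdivrMr// mul1r lerDl bump0_ge0.
Qed.

(** The derivative will serve as a one-sided averaging kernel carried by the unit interval; its
    values at 0 and 1 vanish by continuity. *)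
Lemma sstep_derive : exists psi : R -> R, [/\ smooth psi, forall t, isd sstep t (psi t),
  forall t, ~ (0 < t < 1) -> psi t = 0 & exists2 C, 0 <= C & forall t, `|psi t| <= C].
Proof.
have [psi spsi dpsi] := smoothW smooth_sstep.
have cpsi := smooth_continuous spsi.
have p0 t : t < 0 -> psi t = 0.
  move=> t0; rewrite -(isd_derive1 (dpsi t)); apply: isd_derive1.
  apply: (isd_near _ (isd_cst 0 t)); near=> s; rewrite sstep_le0//; apply: ltW; near: s.
  exact: lt_nbhsl.
have p1 t : 1 < t -> psi t = 0.
  move=> t1; rewrite -(isd_derive1 (dpsi t)); apply: isd_derive1.
  apply: (isd_near _ (isd_cst 1 t)); near=> s; rewrite sstep_ge1//; apply: ltW; near: s.
  exact: lt_nbhsr.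
have P0 : psi 0 = 0.
  have : psi x @[x --> (0:R)^'-] --> psi 0 by apply: cvg_at_left_filter; exact: cpsi.
  move=> H; apply: esym; apply: (@cvg_unique _ (@Rhausdorff R) (psi x @[x --> (0:R)^'-]) _ _ _ _ H).
  by apply: cvg_near_cst; near=> x; apply: p0; near: x; exact: nbhs_left_lt.
have P1 : psi 1 = 0.
  have : psi x @[x --> (1:R)^'+] --> psi 1 by apply: cvg_at_right_filter; exact: cpsi.
  move=> H; apply: esym; apply: (@cvg_unique _ (@Rhausdorff R) (psi x @[x --> (1:R)^'+]) _ _ _ _ H).
  by apply: cvg_near_cst; near=> x; apply: p1; near: x; exact: nbhs_right_gt.
have out t : ~ (0 < t < 1) -> psi t = 0.
  move/negP; rewrite negb_and -!leNgt !le_eqVlt => /orP[/orP[/eqP->//|/p0//]|/orP[/eqP<-//|/p1//]].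
exists psi; split => //.
have := @compact_bounded _ _ _ (continuous_compact (continuous_subspaceT cpsi) (@segment_compact R 0 1)).
move=> [C [_ HC]]; exists (Num.max 0 (C + 1)); first by rewrite le_max lexx.
move=> t; have [/andP[t0 t1]|tn] := pselect (0 < t < 1); last by rewrite out// normr0 le_max lexx.
rewrite le_max; apply/orP; right; apply: HC; first by rewrite ltrDl.
by exists t => //=; rewrite in_itv/= !ltW.
Unshelve. all: by end_near. Qed.

End smooth_step.

Section lower_integral.
Local Open Scope ereal_scope.
Context d (T : measurableType d) (R : realType) (mu : {measure set T -> \bar R}).

(* The integral of a nonnegative function is a supremum over simple functions
   below it, so monotonicity needs no measurability. *)
Lemma ge0_le_lower_integral (D : set T) (k K : T -> \bar R) :
  (forall x, D x -> 0 <= k x) -> (forall x, D x -> k x <= K x) ->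
  \int[mu]_(x in D) k x <= \int[mu]_(x in D) K x.
Proof.
move=> k0 kK; have K0 x : D x -> 0 <= K x by move=> Dx; exact: le_trans (k0 _ Dx) (kK _ Dx).
rewrite !ge0_integralE//; apply: le_ereal_sup => _ [h hk <-]; exists h => // x.
apply: le_trans (hk x) _; rewrite !patchE; case: ifPn => // xD; apply: kK.
by move: xD; rewrite inE.
Qed.

(** Only the smaller function is measurable. Removing a null set leaves its integral unchanged and
    can only lower that of the larger one. *)
Lemma ae_le_lower_integral (D : set T) (k K : T -> \bar R) : measurable D ->
  measurable_fun D k -> (forall x, D x -> 0 <= k x) -> (forall x, D x -> 0 <= K x) ->
  {ae mu, forall x, D x -> k x <= K x} ->
  \int[mu]_(x in D) k x <= \int[mu]_(x in D) K x.
Proof.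
move=> mD mk k0 K0 [N [mN N0 kKN]].
rewrite (ge0_negligible_integral mN mD mk k0 N0) integral_mkcondr.
apply: ge0_le_lower_integral => x Dx; rewrite patchE; case: ifPn => xN //.
- exact: k0.
- by apply: contrapT => kK; move: xN; rewrite inE; apply; apply: kKN => H; apply: kK; exact: H.
- exact: K0.
Qed.

(** The constant is moved to the side of the measurable function before it is taken out of the
    integral. *)
Lemma ae_le_lower_integralZ (D : set T) (k K : T -> R) (c : R) : measurable D ->
  measurable_fun D k -> (forall x, 0 <= k x)%R -> (forall x, 0 <= K x)%R -> (0 < c)%R ->
  {ae mu, forall x, D x -> (k x <= c * K x)%R} ->
  \int[mu]_(x in D) (k x)%:E <= c%:E * \int[mu]_(x in D) (K x)%:E.
Proof.
move=> mD mk k0 K0 c0 kK.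
have ck x : (0 <= c^-1 * k x)%R by rewrite mulr_ge0// invr_ge0 ltW.
rewrite -lee_pdivrMl// -ge0_integralZl//; last 3 first.
- by apply/measurable_EFinP.
- by move=> x _; rewrite lee_fin.
- by rewrite lee_fin invr_ge0 ltW.
apply: ae_le_lower_integral => //.
- by apply/measurable_EFinP; apply: measurable_funM.
- by move=> x _; rewrite lee_fin.
- by move=> x _; rewrite lee_fin.
- by apply: filterS kK => x H Dx; rewrite lee_fin ler_pdivrMl// H.
Qed.

End lower_integral.

(** * The du Bois-Reymond lemma *)

Section du_bois_reymond.
Variable R : realType.
Notation mu := (@lebesgue_measure R).
Notation TR := (measurableTypeR R).
Implicit Types (h k : R -> R) (a b t : R).
Definition L1 h := mu.-integrable setT (EFin \o (h : TR -> R)).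
Definition prim h t : R := \int[mu]_(x in `]-oo, t]) h x.

Lemma L1_measurable h : L1 h -> measurable_fun setT (h : TR -> R).
Proof. by move=> /measurable_int/measurable_EFinP. Qed.

Lemma L1_mul h k : L1 h -> measurable_fun setT (k : TR -> R) ->
  (exists C, forall x, `|k x| <= C) -> L1 (fun x => k x * h x).
Proof.
move=> ih mk [C kC].
have := @integrableMl _ _ _ mu _ measurableT (EFin \o h) k ih mk.
rewrite /L1 (_ : (_ \* _)%E = EFin \o (fun x => k x * h x)); last first.
  by apply/funext => x /=; rewrite EFinM muleC.
apply; exists C; split; first exact: num_real.
by move=> M CM x _ /=; apply: le_trans (kC x) (ltW CM).
Qed.

Lemma L1S h (D : set TR) : measurable D -> L1 h -> mu.-integrable D (EFin \o h).
Proof. by move=> mD ih; apply: (integrableS measurableT). Qed.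

Lemma primB h a b : L1 h -> a <= b ->
  prim h b - prim h a = \int[mu]_(x in `]a, b]) h x.
Proof.
move=> ih ab; rewrite /prim Rintegral_itvB//; exact: L1S.
Qed.

Lemma prim_continuous h : L1 h -> continuous (prim h).
Proof.
move=> ih t; have tt : t - 1 < t + 1 by lra.
have tt' : t - 1 <= t + 1 by lra.
have := parameterized_integral_continuous tt' (L1S (measurable_itv _) ih).
move=> /(continuous_within_itvP _ tt) [H _ _].
have cF : (prim h (t - 1) + \int[mu]_(y in `[t - 1, x]) h y) @[x --> t] -->
    prim h (t - 1) + \int[mu]_(y in `[t - 1, t]) h y.
  by apply: cvgD; [exact: cvg_cst|apply: H; rewrite in_itv/=; apply/andP; split; lra].
have E x : t - 1 <= x -> prim h (t - 1) + \int[mu]_(y in `[t - 1, x]) h y = prim h x.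
  move=> tx; rewrite -Rintegral_itv_obnd_cbnd; last exact: L1S.
  by rewrite -(primB ih tx) addrC subrK.
rewrite /continuous_at -(E t); last by lra.
apply: cvg_trans cF; apply: near_eq_cvg; near=> x; apply: E; apply: ltW; near: x.
by apply: lt_nbhsr; lra.
Unshelve. all: by end_near. Qed.

Lemma prim_derive h : L1 h -> {ae mu, forall t : TR, isd (prim h) t (h t)}.
Proof.
move=> ih; have loc : locally_integrable setT h.
  split; [exact: L1_measurable|exact: openT|move=> K _ cK].
  have mK : measurable (K : set TR) by apply: closed_measurable; exact: compact_closed.
  by have /integrableP[_] := L1S mK ih.
have := FTC1Ny (fun y => L1S (measurable_itv _) ih) loc.
apply: filter_app; first exact: (ae_filter_ringOfSetsType mu).
by apply: aeW => t [d1 d2]; split; [exact: d1|rewrite -d2 derive1E].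
Qed.

(** The kernel has mass one, lives in a ball of radius 1/(n+1) and is at most [C] (n+1) high. The
    error is thus at most 2 [C] times the mean of [|h - h a|] over that ball, which tends to zero at
    a Lebesgue point. *)
Lemma kernel_cvg (psi : R -> R) h a : continuous psi -> (exists C, forall t, `|psi t| <= C) ->
  (forall t, ~ (0 < t < 1) -> psi t = 0) -> (forall t, isd (@sstep R) t (psi t)) ->
  L1 h -> lebesgue_pt h a ->
  \int[mu]_y (n.+1%:R * psi (n.+1%:R * (y - a)) * h y) @[n --> \oo] --> h a.
Proof.
move=> cpsi [C psiC] psi0 dpsi ih ha.
have C0 : 0 <= C by apply: le_trans (psiC 0).
pose r n : R := n.+1%:R^-1.
have r0 n : 0 < r n by rewrite invr_gt0.
pose k n y := n.+1%:R * psi (n.+1%:R * (y - a)).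
have ck n : continuous (k n).
  move=> y; apply: cvgM; first exact: cvg_cst.
  apply: (@continuous_comp _ _ _ (fun y => n.+1%:R * (y - a)) psi); last exact: cpsi.
  by apply: cvgM; [exact: cvg_cst|apply: cvgB; [exact: cvg_id|exact: cvg_cst]].
have mk n : measurable_fun setT (k n : TR -> R) by exact: continuous_measurable_fun.
have kC n y : `|k n y| <= n.+1%:R * C by rewrite /k normrM ger0_norm// ler_wpM2l.
have k0 n y : ~ ball a (r n) y -> k n y = 0.
  move=> by_; rewrite /k psi0 ?mulr0// => /andP[y0 y1]; apply: by_.
  have n0 : (0:R) < n.+1%:R by [].
  have ay : 0 < y - a by move: y0; rewrite pmulr_rgt0.
  rewrite /ball/= distrC ger0_norm ?ltW// /r -[ltRHS]mul1r ltr_pdivlMr//.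
  by rewrite mulrC.
have mB n : measurable (ball a (r n) : set TR) by exact: measurable_ball.
have kB n (g : R -> R) : \int[mu]_y (k n y * g y) = \int[mu]_(y in ball a (r n)) (k n y * g y).
  rewrite [RHS]Rintegral_mkcond; congr Rintegral; apply/funext => y; rewrite patchE.
  by case: ifPn => //; rewrite notin_setE => /k0 ->; rewrite mul0r.
have muB n : mu (ball a (r n)) = (r n *+ 2)%:E by rewrite lebesgue_measure_ball ?ltW.
have kint n (D : set TR) : measurable D -> (mu D < +oo)%E -> mu.-integrable D (EFin \o (k n : TR -> R)).
  move=> mD fD; apply: measurable_bounded_integrable => //; first exact: measurable_funTS.
  exists (n.+1%:R * C); split; first exact: num_real.
  by move=> M CM x _ /=; apply: le_trans (kC n x) (ltW CM).
have k1 n : \int[mu]_(y in ball a (r n)) k n y = 1.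
  rewrite ball_itv.
  have fi (c d : bool) : (mu [set` Interval (BSide c (a - r n)%R) (BSide d (a + r n)%R)] < +oo)%E.
    by rewrite lebesgue_measure_itv/=; case: ifP => _; rewrite ltry.
  rewrite Rintegral_itv_bndo_bndc; last exact/kint/fi.
  rewrite Rintegral_itv_obnd_cbnd; last exact/kint/fi.
  have arr : a - r n < a + r n by have := r0 n; lra.
  pose F y := sstep (n.+1%:R * (y - a)).
  have dF y : isd F y (k n y).
    apply: (isd_eq (isd_comp (dpsi _) (isd_affine n.+1%:R (- n.+1%:R * a) y))) => [x|].
      by rewrite /F; congr sstep; ring.
    by rewrite /k mulrC; congr (_ * psi _); ring.
  rewrite /Rintegral (continuous_FTC2 (F := F) arr).
  - rewrite -EFinB/= /F.
    have -> : n.+1%:R * (a + r n - a) = 1 by rewrite /r addrAC subrr add0r divff.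
    have -> : n.+1%:R * (a - r n - a) = -1 by rewrite /r addrAC subrr add0r mulrN divff.
    by rewrite sstep_ge1// sstep_le0 ?subr0.
  - exact/continuous_subspaceT.
  - split; first by move=> y _; exact: (@ex_derive _ _ _ _ _ _ _ (dF y)).
      by apply: cvg_at_right_filter; exact: (isd_continuous (dF _)).
    by apply: cvg_at_left_filter; exact: (isd_continuous (dF _)).
  - by move=> y _; exact: isd_derive1.
have ihB n : mu.-integrable (ball a (r n)) (EFin \o h) by exact: L1S.
have ikh n : mu.-integrable (ball a (r n)) (EFin \o (fun y => k n y * h y)).
  by apply: L1S => //; apply: L1_mul => //; exists (n.+1%:R * C).
have fB n : (mu (ball a (r n)) < +oo)%E by rewrite muB ltry.
have ic n : mu.-integrable (ball a (r n)) (EFin \o cst (h a)).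
  apply: measurable_bounded_integrable; [exact: mB|exact: fB|exact: measurable_cst|].
  exists `|h a|; split; first exact: num_real.
  by move=> M aM x _ /=; exact: ltW.
have idf n : mu.-integrable (ball a (r n)) (EFin \o (fun y => `|h y - h a|)).
  have := integrable_norm (integrableB (mB n) (ihB n) (ic n)).
  by congr (integrable _ _ _); apply/funext.
have davgE n : davg h a (r n) = ((r n *+ 2)^-1 * \int[mu]_(y in ball a (r n)) `|h y - h a|)%:E.
  rewrite /davg /iavg muB inver gt_eqF ?pmulrn_lgt0// EFinM; congr (_ * _)%E.
  rewrite /Rintegral fineK; last exact: (integrable_fin_num _ (idf n)).
  by apply: eq_integral => y _ /=.
have dv0 : (r n *+ 2)^-1 * \int[mu]_(y in ball a (r n)) `|h y - h a| @[n --> \oo] --> 0.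
  have rc : r n @[n --> \oo] --> (0:R) by exact: cvg_harmonic.
  have := (cvge_at_rightP (davg h a) 0 0).1 ha r (conj r0 rc).
  under eq_fun do rewrite davgE.
  by move=> /fine_cvgP[_].
apply/cvgrPdist_le => e e0.
have e2 : 0 < e / (2 * C + 1) by rewrite divr_gt0//; lra.
move/cvgr0Pnorm_le : dv0 => /(_ _ e2); apply: filterS => n.
set I := \int[mu]_(y in _) _ => Ie.
have I0 : 0 <= I by apply: Rintegral_ge0 => y _.
rewrite kB -[X in X - _]mulr1 -(k1 n) mulrC -RintegralZr//; last exact: kint.
rewrite distrC -RintegralB//; last first.
  have := integrableZr (mB n) (h a) (kint n _ (mB n) (fB n)).
  by congr (integrable _ _ _); apply/funext => y /=; rewrite EFinM.
under eq_Rintegral do rewrite -mulrBr.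
have ik : mu.-integrable (ball a (r n)) (EFin \o (fun y => k n y * (h y - h a))).
  have := integrableB (mB n) (ikh n) (integrableZr (mB n) (h a) (kint n _ (mB n) (fB n))).
  by congr (integrable _ _ _); apply/funext => y /=; rewrite mulrBr.
apply: le_trans (le_normr_Rintegral (mB n) ik) _.
apply: (@le_trans _ _ (\int[mu]_(y in ball a (r n)) (n.+1%:R * C * `|h y - h a|))).
  apply: le_Rintegral => //.
  - by have := integrable_norm ik; congr (integrable _ _ _); apply/funext.
  - have := integrableZl (mB n) (n.+1%:R * C) (idf n).
    by congr (integrable _ _ _); apply/funext => y /=; rewrite -EFinM.
  - by move=> y _; rewrite normrM ler_wpM2r.
rewrite RintegralZl// -/I.
move: Ie; rewrite ger0_norm; last by rewrite mulr_ge0// invr_ge0 mulrn_wge0// ltW.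
rewrite ler_pdivlMr; last by lra.
have -> : (r n *+ 2)^-1 * I = n.+1%:R * I / 2.
  rewrite /r; have : (n.+1%:R : R) != 0 by [].
  by move: (n.+1%:R) => x x0; rewrite -mulr_natr; field.
have : 0 <= n.+1%:R * I by rewrite mulr_ge0.
rewrite [_ * C * I]mulrAC; move: (_ * I) => J J0.
have -> : J / 2 * (2 * C + 1) = J * C + J / 2 by field.
lra.
Qed.

(** The test functions are smooth versions of the indicator of []a, b]]: their derivatives average
    [h] near [a] and near [b], so at Lebesgue points the weak identity becomes
    [h b - h a = prim h' b - prim h' a]. Almost every point is a Lebesgue point, and fixing one of
    them gives the constant. *)
Lemma du_bois_reymond T h h' : L1 h -> L1 h' ->
  (forall phi, time_test_fun T phi ->
    \int[mu]_x (derive1 (phi : R -> R^o) x * h x) = - \int[mu]_x (phi x * h' x)) ->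
  exists c, {ae mu, forall t : TR, 0 < t < T -> h t = c + prim h' t}.
Proof.
move=> ih ih' weak.
have [psi [spsi dpsi psi0 [C _ psiC']]] := sstep_derive R.
have psiC : exists C, forall t, `|psi t| <= C by exists C.
have cpsi := smooth_continuous spsi.
have loc : locally_integrable setT h.
  split; [exact: L1_measurable|exact: openT|move=> K _ cK].
  have mK : measurable (K : set TR) by apply: closed_measurable; exact: compact_closed.
  by have /integrableP[_] := L1S mK ih.
have key a b : 0 < a -> a < b -> b < T -> lebesgue_pt h a -> lebesgue_pt h b ->
    h b - h a = prim h' b - prim h' a.
  move=> a0 ab bT /(kernel_cvg cpsi psiC psi0 dpsi ih) ha.
  move=> /(kernel_cvg cpsi psiC psi0 dpsi ih) hb.
  pose N (n : nat) : R := n.+1%:R.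
  have N0 n : 0 < N n by [].
  pose phi n y := sstep (N n * (y - a)) - sstep (N n * (y - b)).
  pose dp n c y := N n * psi (N n * (y - c)).
  have dstep n c y : isd (fun y => sstep (N n * (y - c))) y (dp n c y).
    apply: (isd_eq (isd_comp (dpsi _) (isd_affine (N n) (- N n * c) y))) => [x|].
      by congr sstep; ring.
    by rewrite /dp mulrC; congr (_ * psi _); ring.
  have sphi n : smooth (phi n).
    have S c : smooth (fun y => sstep (N n * (y - c))).
      have := @smooth_affine R _ (N n) (- N n * c) (@smooth_sstep R).
      by congr smooth; apply/funext => x; congr sstep; ring.
    by apply: smoothB; exact: S.
  have phi1 n y : `|phi n y| <= 1.
    have /andP[u0 u1] := sstep_01 (N n * (y - a)).
    have /andP[v0 v1] := sstep_01 (N n * (y - b)).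
    by rewrite /phi ler_norml; apply/andP; split; lra.
  have mphi n : measurable_fun setT (phi n : TR -> R).
    by apply: continuous_measurable_fun => y; exact: (smooth_continuous (sphi n)).
  have mdp n c : measurable_fun setT (dp n c : TR -> R).
    apply: continuous_measurable_fun => y.
    apply: cvgM; first exact: cvg_cst.
    apply: (@continuous_comp _ _ _ (fun y => N n * (y - c)) psi); last exact: cpsi.
    by apply: cvgM; [exact: cvg_cst|apply: cvgB; [exact: cvg_id|exact: cvg_cst]].
  have idp n c : L1 (fun y => dp n c y * h y).
    by apply: L1_mul => //; exists (N n * C) => y; rewrite normrM (ger0_norm (ltW (N0 n))) ler_wpM2l// ltW.
  (* Since the kernel is one-sided, the support is contained in [[a, b + 1/N]], which stays below
     [T] once [N] exceeds [(T - b)^-1]. *)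
  have test n : (T - b)^-1 < N n -> time_test_fun T (phi n).
    move=> nb; split; first exact: sphi.
    have Tb : 0 < T - b by lra.
    have Nb : (N n)^-1 < T - b by rewrite invf_plt ?posrE.
    exists a, (b + (N n)^-1); split; [by []|by rewrite -ltrBrDl|move=> t].
    rewrite /phi => tn; have [ta|ta] := ltP t a.
      by rewrite !sstep_le0 ?subr0// pmulr_rle0// subr_le0 ltW//; exact: lt_trans ta ab.
    have tb : b + (N n)^-1 < t by rewrite ltNge; apply/negP => tb; apply: tn; rewrite ta tb.
    have tb1 : 1 <= N n * (t - b).
      by rewrite mulrC -ler_pdivrMr// mul1r lerBrDr addrC; exact: ltW.
    rewrite !sstep_ge1 ?subrr//; apply: le_trans tb1 _.
    by rewrite ler_pM2l//; lra.
  have lhs : (\int[mu]_y (dp n a y * h y) - \int[mu]_y (dp n b y * h y)) @[n --> \oo] --> h a - h b.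
    by apply: cvgB; [exact: ha|exact: hb].
  have rhs : \int[mu]_x (phi n x * h' x) @[n --> \oo] --> \int[mu]_x (\1_(`]a, b]%classic) x * h' x).
    have mh' := L1_measurable ih'.
    have [] := @dominated_convergence _ _ _ mu _ measurableT (fun n x => (phi n x * h' x)%:E)
      (fun x => (\1_(`]a, b]%classic) x * h' x)%:E) (fun x => `|h' x|%:E).
    - by move=> n; apply/measurable_EFinP; exact: measurable_funM.
    - apply/measurable_EFinP; apply: measurable_funM; last exact: mh'.
      by apply: measurable_indic; exact: measurable_itv.
    - apply: aeW => x _; apply: cvg_EFin; first exact: nearW.
      apply: cvgM; last exact: cvg_cst.
      have big c : c < x -> \forall n \near \oo, 1 <= N n * (x - c).
        move=> cx; near=> n; rewrite -ler_pdivrMr ?subr_gt0// mul1r.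
        by apply: le_trans (_ : n%:R <= _); [near: n; exact: nbhs_infty_ger|rewrite ler_nat].
      have [xa|ax] := leP x a.
        rewrite indicE memNset ?mulr0n; last by rewrite /= in_itv/= => /andP[]; lra.
        apply: cvg_near_cst; apply: nearW => n; rewrite /phi !sstep_le0 ?subr0// pmulr_rle0// subr_le0//; lra.
      have [xb|bx] := leP x b.
        rewrite indicE mem_set ?mulr1n; last by rewrite /= in_itv/= ax.
        apply: cvg_near_cst; near=> n; rewrite /phi sstep_ge1; last by near: n; exact: big.
        by rewrite sstep_le0 ?subr0// pmulr_rle0// subr_le0//; lra.
      rewrite indicE memNset ?mulr0n; last by rewrite /= in_itv/= => /andP[]; lra.
      apply: cvg_near_cst; near=> n; rewrite /phi !sstep_ge1 ?subrr//; near: n; exact: big.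
    - by have := integrable_norm ih'; congr (integrable _ _ _); apply/funext.
    - by apply: aeW => x n _; rewrite lee_fin normrM ler_piMl.
    move=> iI _; rewrite -(fineK (integrable_fin_num measurableT iI)) => /fine_cvgP[_ H].
    exact: H.
  have int1 : \int[mu]_x (\1_(`]a, b]%classic) x * h' x) = prim h' b - prim h' a.
    rewrite (primB ih' (ltW ab)) [RHS]Rintegral_mkcond; congr Rintegral; apply/funext => x.
    by rewrite patchE indicE; case: ifP => _; rewrite ?mul1r ?mul0r.
  suff E : h a - h b + \int[mu]_x (\1_(`]a, b]%classic) x * h' x) = 0.
    by rewrite -int1; apply: (addrI (h a - h b)); rewrite E; ring.
  apply: (@cvg_unique _ (@Rhausdorff R) _ _ _ _ (cvgD lhs rhs)).
  apply: cvg_near_cst; near=> n.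
  have tn : time_test_fun T (phi n) by
    apply: test; apply: (@lt_trans _ _ n%:R); [near: n; exact: nbhs_infty_gtr|rewrite ltr_nat].
  apply/eqP; rewrite addr_eq0 -(weak _ tn) -RintegralB//; last exact: idp; last exact: idp.
  apply/eqP; congr Rintegral; apply/funext => y; rewrite -mulrBl; congr (_ * _).
  by apply/esym; apply: isd_derive1; apply: isdB; exact: dstep.
(* Without a Lebesgue point in []0, T[] the interval is negligible, and any constant will do. *)
have [[a /andP[a0 aT] ha]|na] := pselect (exists2 a, 0 < a < T & lebesgue_pt h a); last first.
  exists 0; have := lebesgue_differentiation loc.
  apply: filter_app; first exact: (ae_filter_ringOfSetsType mu).
  by apply: aeW => t ht t0T; exfalso; apply: na; exists t.
exists (h a - prim h' a); have := lebesgue_differentiation loc.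
apply: filter_app; first exact: (ae_filter_ringOfSetsType mu).
apply: aeW => t ht /andP[t0 tT].
have [ta|at_|->] := ltgtP (t : R) a; last by rewrite subrK.
  by have := key _ _ t0 ta aT ht ha; lra.
by have := key _ _ a0 at_ tT ha ht; lra.
Unshelve. all: by end_near. Qed.

End du_bois_reymond.

(** * Bochner spaces *)

Section L1_sums.
Variables (R : realType) (T : R).
Notation mu := (@lebesgue_measure R).
Notation TR := (measurableTypeR R).
Notation I := (`]0, T[%classic : set TR).

Lemma measurable_timeI : measurable I. Proof. exact: measurable_itv. Qed.

Lemma timeI_fin : (mu I < +oo)%E.
Proof. by rewrite lebesgue_measure_itv/=; case: ifP => _; rewrite ltry. Qed.

Lemma L1_indic (A : set TR) : measurable A -> L1 (\1_(A `&` I) : R -> R).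
Proof.
move=> mA; have mAI : measurable (A `&` I) by exact: measurableI => //; exact: measurable_timeI.
apply/integrableP; split; first by apply/measurable_EFinP; exact: measurable_indic.
under eq_integral do rewrite [`|_|%E]/= ger0_norm//.
rewrite integral_indic// setIT; apply: le_lt_trans timeI_fin.
by apply: le_measure; rewrite ?inE//; exact: subIsetr.
Qed.

Lemma L1_sum n (c : 'I_n -> R -> R) (a : 'I_n -> R) : (forall i, L1 (c i)) ->
  L1 (fun t => \sum_i c i t * a i) /\
  \int[mu]_t (\sum_i c i t * a i) = \sum_i (\int[mu]_t c i t) * a i.
Proof.
elim: n c a => [|n IH] c a Lc.
  split; last by rewrite big_ord0 (_ : (fun=> _) = cst 0) ?Rintegral_cst ?mul0r//; apply/funext => t; rewrite big_ord0.
  by rewrite /L1 (_ : _ \o _ = cst 0%E); [exact: integrable0|apply/funext => t /=; rewrite big_ord0].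
have [L1s IE] := IH (fun i => c (lift ord0 i)) (fun i => a (lift ord0 i)) (fun i => Lc _).
have L0 : L1 (fun t => c ord0 t * a ord0).
  have := integrableZr measurableT (a ord0) (Lc ord0).
  by congr (integrable _ _ _); apply/funext => t /=.
have E : (fun t => \sum_(i < n.+1) c i t * a i) = fun t => c ord0 t * a ord0 + \sum_(i < n) c (lift ord0 i) t * a (lift ord0 i).
  by apply/funext => t; rewrite big_ord_recl.
rewrite E; split; last first.
  rewrite RintegralD// RintegralZr//; last exact: Lc.
  by rewrite big_ord_recl; congr (_ + _); exact: IE.
have := integrableD measurableT L0 L1s.
by congr (integrable _ _ _); apply/funext => t /=; rewrite EFinD.
Qed.

(** The essential supremum norm is defined by cases on whether the whole space has positive measure;
    this selects the case. *)
Lemma muT_gt0 : (0 < mu setT)%E.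
Proof.
apply: (@lt_le_trans _ _ (mu (`]0%R, 1%R[%classic : set TR))).
  by rewrite lebesgue_measure_itv/= lte01 oppr0 adde0 lte01.
by apply: le_measure; rewrite ?inE.
Qed.

End L1_sums.

(** * Images of Bochner functions under a bounded functional *)

Section scalarization.
Variables (R : realType) (T : R) (V : lmodType R) (X : set V) (nrm : V -> R).
Notation mu := (@lebesgue_measure R).
Notation TR := (measurableTypeR R).
Notation I := (`]0, T[%classic : set TR).
Hypotheses (X0 : X 0) (XL : forall a u v, X u -> X v -> X (a *: u + v)).
Hypothesis nrm0 : forall v, 0 <= nrm v.
Variables (l : V -> R) (C : R).
Hypotheses (lL : forall a u v, X u -> X v -> l (a *: u + v) = a * l u + l v)
  (lC : forall v, X v -> `|l v| <= C * nrm v).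

Let l0 : l 0 = 0.
Proof. by have := lL 1 X0 X0; rewrite scale1r addr0 mul1r => /eqP; rewrite -subr_eq0 opprD addrA subrr sub0r oppr_eq0 => /eqP. Qed.

Let lZ a u : X u -> l (a *: u) = a * l u.
Proof. by move=> Xu; rewrite -[a *: u]addr0 lL// l0 addr0. Qed.

Let lB u v : X u -> X v -> l (u - v) = l u - l v.
Proof. by move=> Xu Xv; rewrite addrC -scaleN1r lL// mulN1r addrC. Qed.

Let XZ a u : X u -> X (a *: u).
Proof. by move=> Xu; rewrite -[a *: u]addr0; exact: XL. Qed.

Let XD u v : X u -> X v -> X (u + v).
Proof. by move=> Xu Xv; rewrite -[u]scale1r; exact: XL. Qed.

Let XS n (c : 'I_n -> R) (e : 'I_n -> V) : (forall i, X (e i)) -> X (\sum_i c i *: e i).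
Proof. by move=> Xe; apply: (big_ind X) => // i _; exact: XZ. Qed.

Let lS n (c : 'I_n -> R) (e : 'I_n -> V) : (forall i, X (e i)) ->
  l (\sum_i c i *: e i) = \sum_i c i * l (e i).
Proof.
move=> Xe; suff [] : X (\sum_i c i *: e i) /\ l (\sum_i c i *: e i) = \sum_i c i * l (e i) by [].
apply: (big_ind2 (fun v y => X v /\ l v = y)) => [|u x v y [Xu <-] [Xv <-]|i _]; first by split.
  by split; [exact: XD|rewrite -[u]scale1r lL// mul1r scale1r].
by split; [exact: XZ|exact: lZ].
Qed.

(** The image of a step function under [l], cut off outside []0, T[] so that it is integrable on the
    whole line. *)
Let sc (s : stepfun V) (t : R) : R :=
  \sum_i (\1_(step_set (s := s) i `&` I) t : R) * l (step_val i).

Let scE s t : X_step X s -> I t -> sc s t = l (step_eval s t).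
Proof.
move=> Xs It; rewrite /step_eval lS; last by move=> i; exact: (Xs i).2.
apply: eq_bigr => i _; congr (_ * _); rewrite !indicE; congr (_%:R); congr nat_of_bool.
by apply/idP/idP; rewrite !inE; [case|split].
Qed.

Let mI := @measurable_timeI R T.

Let muI := @timeI_fin R T.

Let L1_sc s : X_step X s -> L1 (sc s) /\ \int[mu]_t sc s t = l (step_integral T s).
Proof.
move=> Xs; have [L1s IE] := L1_sum (fun i => l (step_val i)) (fun i => L1_indic T (Xs i).1).
split; first exact: L1s.
rewrite IE /step_integral lS; last by move=> i; exact: (Xs i).2.
apply: eq_bigr => i _; congr (_ * _); rewrite /Rintegral integral_indic ?setIT//.
by apply: measurableI => //; exact: (Xs i).1.
Qed.

(** Strong measurability provides step functions whose images under [l] converge to [l (g t)] off a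
    null set; the limit, set to zero on that null set and outside the interval, is measurable. *)
Lemma scalar_of g : strongly_measurable T X nrm g -> exists h : R -> R,
  [/\ measurable_fun setT (h : TR -> R), forall t, ~ I t -> h t = 0 &
      {ae mu, forall t : TR, I t -> h t = l (g t)}].
Proof.
move=> [s [Xs [N [mN N0 HN]]]].
exists ((fun t => l (g t)) \_ (I `\` N)); split.
- have mn n : measurable_fun setT (sc (s n) \_ (I `\` N) : TR -> R).
    apply/(measurable_restrictT _ (measurableD mI mN)).
    by apply: measurable_funTS; apply: L1_measurable; exact: (L1_sc (Xs n)).1.
  apply: (@measurable_fun_cvg _ TR R setT (fun n => sc (s n) \_ (I `\` N)) _ mn) => t _.
  have [It_|It_] := boolP (t \in I `\` N); last first.
    by rewrite patchE (negbTE It_); apply: cvg_near_cst; apply: nearW => n; rewrite patchE (negbTE It_).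
  rewrite patchE It_ (_ : (fun n => _) = fun n => sc (s n) t); last by apply/funext => n; rewrite patchE It_.
  move: It_; rewrite inE => -[It Nt].
  have [Xg cg] : X (g t) /\ nrm (step_eval (s n) t - g t) @[n --> \oo] --> (0 : R).
    by apply: contrapT => H; apply: Nt; apply: HN => /(_ It).
  apply/cvgrPdist_le => e e0; have C1 : 0 < `|C| + 1 by have := normr_ge0 C; lra.
  move/cvgr0Pnorm_le : cg => /(_ _ (divr_gt0 e0 C1)); apply: filterS => n.
  have Xst : X (step_eval (s n) t) by apply: XS => i; exact: (Xs n i).2.
  rewrite ger0_norm// ler_pdivlMr// distrC scE// -lB// => H; apply: le_trans (lC _) _.
    by rewrite -scaleN1r addrC; exact: XL.
  apply: le_trans H; rewrite mulrC ler_wpM2l//; have := ler_norm C; lra.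
- by move=> t It; rewrite patchE memNset// => -[].
- exists N; split=> // t /= H; apply: contrapT => Nt; apply: H => It.
  by rewrite patchE mem_set.
Qed.

(** Bochner integration commutes with bounded functionals. The scalar L1 error is dominated by the
    lower integral of the error in norm, whose measurability is not assumed. *)
Lemma scalar_bochner g a h : bochner_integral T X nrm g a ->
  measurable_fun setT (h : TR -> R) -> (forall t, ~ I t -> h t = 0) ->
  {ae mu, forall t : TR, I t -> h t = l (g t)} -> L1 h /\ \int[mu]_t h t = l a.
Proof.
move=> [[s0 [_ Xg]] Xa [s [Xs cs ci]]] mh hI hg.
have C1 : 0 < `|C| + 1 by have := normr_ge0 C; lra.
have C2 : 0 < (`|C| + 1)^-1 by rewrite invr_gt0.
have Xst n t : X (step_eval (s n) t) by apply: XS => i; exact: (Xs n i).2.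
have msc n : measurable_fun setT (sc (s n) : TR -> R) by apply: L1_measurable; exact: (L1_sc (Xs n)).1.
have le n : (\int[mu]_t (`|sc (s n) t - h t|)%:E <= (`|C| + 1)%:E * \int[mu]_(t in I) (nrm (step_eval (s n) t - g t))%:E)%E.
  have mk : measurable_fun setT (fun t : TR => `|sc (s n) t - h t|).
    by apply: measurableT_comp => //; exact: measurable_funB.
  have -> : (\int[mu]_t (`|sc (s n) t - h t|)%:E = \int[mu]_(t in I) (`|sc (s n) t - h t|)%:E)%E.
    rewrite [RHS]integral_mkcond; apply: eq_integral => t _; rewrite patchE.
    case: ifPn => //; rewrite notin_setE => nI; rewrite hI// subr0 /sc big1 ?normr0// => i _.
    by rewrite indicE memNset ?mul0r// => -[].
  apply: ae_le_lower_integralZ => //; first exact: measurable_funTS.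
  apply: filterS2 Xg hg => t Xgt hgt It; have [Xg' _] := Xgt It.
  rewrite hgt// scE// -lB//; apply: le_trans (lC _) _.
    by rewrite -scaleN1r addrC; exact: XL.
  by rewrite ler_wpM2r//; have := ler_norm C; lra.
have c0 : (\int[mu]_t (`|sc (s n) t - h t|)%:E)%E @[n --> \oo] --> 0%E.
  apply: (@squeeze_cvge _ _ _ _ (cst 0%E) _ (fun n => (`|C| + 1)%:E * \int[mu]_(t in I) (nrm (step_eval (s n) t - g t))%:E)%E).
  - by apply: nearW => n; rewrite le integral_ge0.
  - exact: cvg_cst.
  - by rewrite -(mule0 (`|C| + 1)%:E); apply: cvgeZl => //.
have [n fn] : exists n, (\int[mu]_t (`|sc (s n) t - h t|)%:E < +oo)%E.
  move/fine_cvgP : c0 => [[n _ H] _]; exists n.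
  by have := H n (leqnn n); rewrite /= fin_numElt => /andP[].
have id : L1 (fun t => sc (s n) t - h t) -> L1 h.
  move=> H; have := integrableB measurableT (L1_sc (Xs n)).1 H.
  by congr (integrable _ _ _); apply/funext => t /=; rewrite -EFinB; congr EFin; ring.
have L1h : L1 h.
  apply: id; apply/integrableP; split; last exact: fn.
  by apply/measurable_EFinP; exact: measurable_funB.
split=> //; have L1d k : L1 (fun t => sc (s k) t - h t).
  have := integrableB measurableT (L1_sc (Xs k)).1 L1h.
  by congr (integrable _ _ _); apply/funext.
have A1 : \int[mu]_t sc (s k) t @[k --> \oo] --> \int[mu]_t h t.
  apply/cvgrPdist_le => e e0; move/fine_cvgP : c0 => [_ /cvgr0Pnorm_le/(_ _ e0)]; apply: filterS => k H.
  rewrite distrC -RintegralB//; last exact: (L1_sc (Xs k)).1.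
  apply: le_trans (le_normr_Rintegral measurableT (L1d k)) _.
  by apply: le_trans H; exact: ler_norm.
have A2 : \int[mu]_t sc (s k) t @[k --> \oo] --> l a.
  apply/cvgrPdist_le => e e0.
  move/cvgr0Pnorm_le : ci => /(_ _ (divr_gt0 e0 C1)); apply: filterS => k.
  have Xi : X (step_integral T (s k)) by apply: XS => i; exact: (Xs k i).2.
  rewrite ger0_norm// ler_pdivlMr// distrC (L1_sc (Xs k)).2 -lB// => H; apply: le_trans (lC _) _.
    by rewrite -scaleN1r addrC; exact: XL.
  apply: le_trans H; rewrite mulrC ler_wpM2l//; have := ler_norm C; lra.
exact: (@cvg_unique _ (@Rhausdorff R) _ _ _ _ A1 A2).
Qed.

(** The two exponents are those of the data, in W^{1,1}, and of the solution, in W^{1,oo}. On the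
    bounded interval both lead to integrability. *)
Lemma scalar_Lq q g h : q = 1%E \/ q = +oo%E -> Lq T X nrm q g ->
  measurable_fun setT (h : TR -> R) -> (forall t, ~ I t -> h t = 0) ->
  {ae mu, forall t : TR, I t -> h t = l (g t)} -> L1 h.
Proof.
move=> q1 [[s [_ Xg]] fg] mh hI hg.
have C1 : 0 < `|C| + 1 by have := normr_ge0 C; lra.
have C2 : 0 < (`|C| + 1)^-1 by rewrite invr_gt0.
apply/integrableP; split; first exact/measurable_EFinP.
have hle : {ae mu, forall t : TR, I t -> `|h t| <= (`|C| + 1) * nrm (g t)}.
  apply: filterS2 Xg hg => t Xgt hgt It; have [Xg' _] := Xgt It.
  rewrite hgt//; apply: le_trans (lC Xg') _.
  by rewrite ler_wpM2r//; have := ler_norm C; lra.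
have -> : (\int[mu]_t `|(EFin \o h) t| = \int[mu]_(t in I) (`|h t|)%:E)%E.
  rewrite [RHS]integral_mkcond; apply: eq_integral => t _; rewrite patchE.
  by case: ifPn => //; rewrite notin_setE => nI /=; rewrite hI// normr0.
case: q1 => qE; move: fg; rewrite qE /norm_LT.
  rewrite Lnorm1 => fg.
  have H : (\int[mu]_(t in I) (`|h t|)%:E <= (`|C| + 1)%:E * \int[mu]_(t in I) (nrm (g t))%:E)%E.
    apply: ae_le_lower_integralZ => //.
    by apply: measurable_funTS; exact: measurableT_comp.
  apply: le_lt_trans H _; apply: lte_mul_pinfty => //.
  move: fg; congr (_ < _)%E.
  rewrite [RHS]integral_mkcond; apply: eq_integral => t _ /=; rewrite !patchE.
  by case: ifPn => _; rewrite ?normr0 ?ger0_norm.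
rewrite unlock; case: ifPn => [_ fg|]; last by rewrite (@muT_gt0 R).
have [M HM] : exists M : R, {ae mu, forall t : TR, I t -> nrm (g t) <= M}.
  have := ess_sup_ge mu (abse \o (EFin \o ((fun t => nrm (g t)) \_ I) : TR -> \bar R)).
  move: fg; set S := ess_sup _ _; case: S => [M _ H|//|_ H].
    exists M; apply: filterS H => t H It; move: H.
    by rewrite /= patchE mem_set//= lee_fin ger0_norm.
  by exists 0; apply: filterS H => t.
apply: (@le_lt_trans _ _ ((`|C| + 1)%:E * \int[mu]_(t in I) (`|M|)%:E)%E).
  apply: ae_le_lower_integralZ => //.
    by apply: measurable_funTS; exact: measurableT_comp.
  apply: filterS2 hle HM => t H1 H2 It; apply: le_trans (H1 It) _.
  by rewrite ler_wpM2l ?(ltW C1)//; apply: le_trans (H2 It) (ler_norm _).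
by rewrite integral_cst// lte_mul_pinfty// lte_mul_pinfty.
Qed.

(** Used twice: with the evaluation of [f t] at a basis field, and with the [E]-coordinates of a
    solution. *)
Lemma W1q_scalar q g : q = 1%E \/ q = +oo%E -> W1q T X nrm q g ->
  exists h' c, [/\ L1 h', forall t, ~ I t -> h' t = 0 &
    {ae mu, forall t : TR, 0 < t < T -> l (g t) = c + prim h' t}].
Proof.
move=> q1 [Lg [g' Lg' weak]].
have [h [mh h0 hg]] := scalar_of Lg.1.
have [h' [mh' h'0 hg']] := scalar_of Lg'.1.
have L1h := scalar_Lq q1 Lg mh h0 hg; have L1h' := scalar_Lq q1 Lg' mh' h'0 hg'.
have Xg : {ae mu, forall t : TR, I t -> X (g t)}.
  by have [s [_]] := Lg.1; apply: filterS => t H It; have [] := H It.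
have Xg' : {ae mu, forall t : TR, I t -> X (g' t)}.
  by have [s [_]] := Lg'.1; apply: filterS => t H It; have [] := H It.
have [|c hc] := @du_bois_reymond R T h h' L1h L1h'.
  move=> phi tphi; have [a B1 B2] := weak _ tphi.
  have smooth_phi : smooth phi by case: tphi.
  have [phi' sphi' dphi] := smoothW smooth_phi.
  have phi'E t : derive1 (phi : R -> R^o) t = phi' t by exact: isd_derive1.
  have Xa : X a by case: B1.
  have [|||_ ->] := @scalar_bochner _ _ (fun t => derive1 (phi : R -> R^o) t * h t) B1.
  - apply: measurable_funM => //; rewrite (funext phi'E : _ = phi').
    by apply: continuous_measurable_fun; exact: smooth_continuous.
  - by move=> t It; rewrite h0// mulr0.
  - by apply: filterS2 hg Xg => t H1 H2 It; rewrite H1// lZ//; exact: H2.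
  have [|||_ ->] := @scalar_bochner _ _ (fun t => phi t * h' t) B2.
  - apply: measurable_funM => //.
    by apply: continuous_measurable_fun; exact: smooth_continuous.
  - by move=> t It; rewrite h'0// mulr0.
  - by apply: filterS2 hg' Xg' => t H1 H2 It; rewrite H1// lZ//; exact: H2.
  by rewrite -scaleN1r lZ// mulN1r opprK.
exists h', c; split => //.
apply: filterS2 hg hc => t H1 H2 t0T; by rewrite -H2// H1//=.
Qed.

End scalarization.

Section norm_LT_bounds.
Variables (R : realType) (T : R).
Notation mu := (@lebesgue_measure R).
Notation TR := (measurableTypeR R).
Notation I := (`]0, T[%classic : set TR).
Implicit Types g : R -> R.

Lemma norm_LToo_le g (K : R) : (forall t, 0 < t < T -> `|g t| <= K) -> 0 <= K ->
  (norm_LT T +oo g <= K%:E)%E.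
Proof.
move=> gK K0; rewrite /norm_LT unlock (@muT_gt0 R); apply/ess_supP; apply: aeW => t /=.
rewrite patchE; case: ifPn; last by rewrite normr0.
by rewrite inE /= in_itv/= => /gK; rewrite lee_fin.
Qed.

Lemma norm_LT2_sq g : (norm_LT T 2%:E g `^ 2 = \int[mu]_(t in I) (g t ^+ 2)%:E)%E.
Proof.
rewrite /norm_LT poweR_Lnorm// [RHS]integral_mkcond; apply: eq_integral => t _ /=.
rewrite !patchE; case: ifPn => _; last by rewrite normr0 powR0.
by rewrite powR_mulrn// real_normK// num_real.
Qed.

Lemma norm_LT2_ge0 g : (0 <= norm_LT T 2%:E g)%E.
Proof. exact: Lnorm_ge0. Qed.

Lemma norm_LT2_le g (psi : R -> R) (B : R) : 0 <= B ->
  (forall t, 0 < t < T -> g t ^+ 2 <= psi t) ->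
  (\int[mu]_(t in I) (psi t)%:E <= (B ^+ 2)%:E)%E -> (norm_LT T 2%:E g <= B%:E)%E.
Proof.
move=> B0 gpsi ipsi; have H : (norm_LT T 2%:E g `^ 2 <= (B%:E) `^ 2)%E.
  rewrite norm_LT2_sq poweR_EFin powR_mulrn//; apply: le_trans ipsi.
  apply: (@ge0_le_lower_integral _ TR R mu I) => t It; rewrite lee_fin ?sqr_ge0//.
  by apply: gpsi; move: It; rewrite /= in_itv.
rewrite leNgt; apply/negP => Bn; move: H; apply/negP; rewrite -ltNge.
move: Bn (norm_LT2_ge0 g); case: (norm_LT _ _ _) => [x||]//.
  rewrite lte_fin lee_fin => Bx x0; rewrite !poweR_EFin lte_fin !powR_mulrn//.
  by rewrite ltr_pXn2r// nnegrE.
by move=> _ _; rewrite poweR_EFin poweRyr ?ltry.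
Qed.

End norm_LT_bounds.

(** * Curves with values in a finite-dimensional span *)

Section curves.
Variables (R : realType) (T : R) (V : lmodType R) (X : set V) (nrm : V -> R).
Notation mu := (@lebesgue_measure R).
Notation TR := (measurableTypeR R).
Notation I := (`]0, T[%classic : set TR).
Hypothesis T0 : 0 < T.
Hypotheses (X0 : X 0) (XL : forall a u v, X u -> X v -> X (a *: u + v)).
Hypothesis nrm0 : forall v, 0 <= nrm v.
Variables (m : nat) (e : 'I_m -> V) (M : R).
Hypotheses (Xe : forall i, X (e i))
  (nrme : forall a : 'I_m -> R, nrm (\sum_i a i *: e i) <= M * \sum_i `|a i|).

Let M0 : 0 <= `|M|. Proof. exact: normr_ge0. Qed.

Let nrme' (a : 'I_m -> R) : nrm (\sum_i a i *: e i) <= `|M| * \sum_i `|a i|.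
Proof. by apply: le_trans (nrme a) _; rewrite ler_wpM2r ?ler_norm// sumr_ge0. Qed.

Let XS n (c : 'I_n -> R) (w : 'I_n -> V) : (forall i, X (w i)) -> X (\sum_i c i *: w i).
Proof.
move=> Xw; apply: (big_ind X) => // [u v Xu Xv|i _].
  by rewrite -[u]scale1r; exact: XL.
by rewrite -[c i *: _]addr0; exact: XL.
Qed.

Let mI := @measurable_timeI R T.

Let muI : mu I = T%:E.
Proof. by rewrite lebesgue_measure_itv/= lte_fin T0 oppr0 adde0. Qed.

Let N (n : nat) : R := n.+1%:R.
Let pt (n i : nat) : R := i%:R * T / N n.
Let cell (n : nat) (i : 'I_n.+1) : set TR := `[pt n i, pt n i.+1[%classic.

(** The half-open cells of a uniform grid partition the interval; the one containing [t] is found by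
    truncating [t * N n / T]. *)
Let cell_ex n t : 0 < t < T -> exists i : 'I_n.+1, [/\ forall j, (\1_(cell j) t : R) = (j == i)%:R & `|pt n i - t| <= T / N n].
Proof.
move=> /andP[t0 tT]; have N0 : 0 < N n by [].
have x0 : 0 <= t * N n / T by rewrite divr_ge0 ?mulr_ge0 ?ltW.
have /andP[k1 k2] := truncn_itv x0; set k := Num.truncn _ in k1 k2.
have p1 : pt n k <= t.
  by rewrite /pt ler_pdivrMr// -ler_pdivlMr.
have p2 : t < pt n k.+1.
  by rewrite /pt ltr_pdivlMr// -ltr_pdivrMr.
have kn : (k < n.+1)%N.
  rewrite -(ltr_nat R); apply: le_lt_trans k1 _.
  by rewrite ltr_pdivrMr// mulrC ltr_pM2l.
have ptS j : pt n j.+1 = pt n j + T / N n by rewrite /pt -natr1; field; rewrite gt_eqF.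
have pt_le i j : (i <= j)%N -> pt n i <= pt n j.
  by move=> ij; rewrite /pt ler_pM2r ?invr_gt0// ler_pM2r// ler_nat.
exists (Ordinal kn); split; last first.
  by move: p2; rewrite ptS /= => p2; rewrite ler0_norm ?subr_le0// opprB lerBlDl; exact: ltW.
move=> j; rewrite indicE; congr (_%:R); congr nat_of_bool; apply/idP/eqP.
  rewrite inE /cell/= in_itv/= => /andP[j1 j2]; apply/val_inj => /=; apply/eqP; rewrite eqn_leq.
  apply/andP; split; rewrite leqNgt; apply/negP => jk.
    by have := pt_le _ _ jk; have := p2; have := j1; lra.
  by have := pt_le _ _ jk; have := p1; have := j2; lra.
by move=> ->; rewrite inE /cell/= in_itv/= p1.
Qed.

(** Samples the coefficients at the left end of each cell. *)
Let stp (c : 'I_m -> R -> R) (n : nat) : stepfun V :=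
  @StepFun R V n.+1 (@cell n) (fun i => \sum_j c j (pt n i) *: e j).

Let sj (c : R -> R) n (t : R) : R := \sum_(i < n.+1) (\1_(@cell n i) t : R) * c (pt n i).

Let sj_cvg (c : R -> R) : continuous c -> forall t, 0 < t < T -> sj c n t @[n --> \oo] --> c t.
Proof.
move=> cc t t0T; have S n : exists2 i : nat, `|pt n i - t| <= T / N n & sj c n t = c (pt n i).
  have [i [H1 H2]] := cell_ex n t0T; exists i => //.
  rewrite /sj (bigD1 i)//= H1 eqxx mul1r big1 ?addr0// => j /negbTE ji.
  by rewrite H1 ji mul0r.
pose k n := projT1 (cid2 (S n)).
have k1 n : `|pt n (k n) - t| <= T / N n by rewrite /k; case: cid2.
have k2 n : sj c n t = c (pt n (k n)) by rewrite /k; case: cid2.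
rewrite (_ : (fun n => _) = c \o (fun n => pt n (k n))); last by apply/funext => n; rewrite k2.
apply: (@continuous_cvg _ _ _ _ _ _ c); first exact: cc.
apply/cvgrPdist_le => eps e0.
have : T * (n.+1%:R)^-1 @[n --> \oo] --> (0 : R).
  by rewrite -(mulr0 T); apply: cvgM; [exact: cvg_cst|exact: cvg_harmonic].
move/cvgr0Pnorm_le => /(_ _ e0); apply: filterS => n H; rewrite distrC.
apply: le_trans (k1 n) _; apply: le_trans H; exact: ler_norm.
Qed.

Let sj_bound (c : R -> R) : continuous c ->
  exists B, forall t, 0 < t < T -> `|c t| <= B /\ forall n, `|sj c n t| <= B.
Proof.
move=> cc.
have [B [_ HB]] := @compact_bounded _ _ _ (continuous_compact (continuous_subspaceT cc) (@segment_compact R 0 T)).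
have {}HB t : 0 <= t <= T -> `|c t| <= B + 1.
  by move=> tT; apply: HB; [rewrite ltrDl|exists t => //=; rewrite in_itv].
exists (B + 1) => t t0T; have /andP[t0 tT] := t0T.
split=> [|n]; first by apply: HB; rewrite !ltW.
have [i [K1 K2]] := cell_ex n t0T.
rewrite /sj (bigD1 i)//= K1 eqxx mul1r big1 ?addr0; last first.
  by move=> j /negbTE ji; rewrite K1 ji mul0r.
apply: HB; rewrite /pt; apply/andP; split.
  by rewrite divr_ge0// mulr_ge0// ltW.
by rewrite ler_pdivrMr// mulrC ler_wpM2l ?(ltW T0)// ler_nat ltnW.
Qed.

Let m_sj (c : R -> R) n : measurable_fun setT (sj c n : TR -> R).
Proof.
apply: measurable_sum => i; apply: measurable_funM => //.
by apply: measurable_indic; exact: measurable_itv.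
Qed.

Let I_cst (B : R) : mu.-integrable I (fun=> B%:E).
Proof.
apply: measurable_bounded_integrable; [exact: mI|by rewrite [X in (X < _)%E]muI ltry|exact: measurable_cst|].
by exists `|B|; split => // x H t _; exact: ltW.
Qed.

Let sj_int (c : R -> R) : continuous c ->
  \int[mu]_(t in I) sj c n t @[n --> \oo] --> \int[mu]_(t in I) c t.
Proof.
move=> cc; have [B HB] := sj_bound cc.
have [|||||H1 _] := @dominated_convergence _ TR R mu I mI (fun n t => (sj c n t)%:E) (fun t => (c t)%:E) (fun=> B%:E).
- by move=> n; apply/measurable_EFinP; exact: measurable_funTS.
- by apply/measurable_EFinP; apply: measurable_funTS; exact: continuous_measurable_fun.
- apply: aeW => t It; apply: cvg_EFin; first exact: nearW.
  by apply: sj_cvg => //; move: It; rewrite /= in_itv.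
- exact: I_cst.
- apply: aeW => t n It; rewrite lee_fin.
  by have [|_ ->] := HB t; first by move: It; rewrite /= in_itv.
by rewrite -(fineK (integrable_fin_num mI H1)) => /fine_cvgP[].
Qed.

Let stpE c n t : step_eval (stp c n) t = \sum_j sj (c j) n t *: e j.
Proof.
rewrite /step_eval /= /sj; under eq_bigr do rewrite scaler_sumr.
rewrite exchange_big/=; apply: eq_bigr => j _; rewrite scaler_suml.
by apply: eq_bigr => i _; rewrite scalerA.
Qed.

Let nrm_diff (a b : 'I_m -> R) :
  nrm (\sum_j a j *: e j - \sum_j b j *: e j) <= `|M| * \sum_j `|a j - b j|.
Proof.
rewrite -sumrB; under eq_bigr do rewrite -scalerBl; exact: nrme'.
Qed.

Let X_stp c n : X_step X (stp c n).
Proof. by move=> i; split; [exact: measurable_itv|exact: XS]. Qed.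

Let cvg_sum0 (a : nat -> R) (A : 'I_m -> nat -> R) (b : 'I_m -> R) :
  (forall j, A j n @[n --> \oo] --> b j) ->
  (forall n, 0 <= a n <= `|M| * \sum_j `|A j n - b j|) -> a n @[n --> \oo] --> (0 : R).
Proof.
move=> cA ha; apply/cvgr0Pnorm_le => eps e0.
have d0 : 0 < (`|M| + 1) * m.+1%:R by rewrite mulr_gt0// ltr_wpDl.
have : \forall n \near \oo, forall j, `|A j n - b j| <= eps / ((`|M| + 1) * m.+1%:R).
  apply: filter_forall => j; have /cvgrPdist_le/(_ _ (divr_gt0 e0 d0)) := cA j.
  by apply: filterS => n; rewrite distrC.
apply: filterS => n H; have /andP[a0 a1] := ha n; rewrite ger0_norm//.
apply: le_trans a1 _; apply: (@le_trans _ _ (`|M| * \sum_(j < m) eps / ((`|M| + 1) * m.+1%:R))).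
  by rewrite ler_wpM2l//; apply: ler_sum => j _.
rewrite sumr_const card_ord; have : (m%:R : R) <= m.+1%:R by rewrite ler_nat.
have : 0 < (m.+1%:R : R) by []; have : 0 <= (m%:R : R) by [].
rewrite -(mulr_natr (eps / _)); move: (m%:R : R) (m.+1%:R : R) => x y x0 y0 xy.
rewrite (_ : `|M| * _ = eps * ((`|M| / (`|M| + 1)) * (x / y))); last first.
  by field; rewrite !gt_eqF// ltr_wpDl.
have M1 : 0 < `|M| + 1 by rewrite ltr_wpDl.
rewrite ger_pMr//; apply: mulr_ile1.
- by rewrite divr_ge0// ltW.
- by rewrite divr_ge0// ltW.
- by rewrite ler_pdivrMr// mul1r lerDl.
- by rewrite ler_pdivrMr// mul1r.
Qed.

Lemma curve_strongly_measurable (c : 'I_m -> R -> R) : (forall j, continuous (c j)) ->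
  strongly_measurable T X nrm (fun t => \sum_j c j t *: e j).
Proof.
move=> cc; exists (stp c); split => [n|]; first exact: X_stp.
apply: aeW => t It; split; first exact: XS.
have t0T : 0 < t < T by move: It; rewrite /= in_itv.
apply: (@cvg_sum0 _ (fun j n => sj (c j) n t) (fun j => c j t)) => [j|n]; first exact: sj_cvg.
by rewrite nrm0 stpE nrm_diff.
Qed.

(** The coefficients converge boundedly, so dominated convergence applies to each of them, and the
    norm of a combination is bounded by the sum of the coefficients. *)
Lemma curve_bochner (c : 'I_m -> R -> R) : (forall j, continuous (c j)) ->
  bochner_integral T X nrm (fun t => \sum_j c j t *: e j)
    (\sum_j (\int[mu]_(t in I) c j t) *: e j).
Proof.
move=> cc; split; [exact: curve_strongly_measurable|exact: XS|].
exists (stp c); split => [n||]; first exact: X_stp.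
  have [B HB] : exists B : 'I_m -> R, forall j t, 0 < t < T -> `|c j t| <= B j /\ forall n, `|sj (c j) n t| <= B j.
    by exists (fun j => projT1 (cid (sj_bound (cc j)))) => j; case: cid.
  pose d n t := `|M| * \sum_j `|sj (c j) n t - c j t|.
  have md n : measurable_fun setT (d n : TR -> R).
    apply: measurable_funM => //; apply: measurable_sum => j; apply: measurableT_comp => //.
    by apply: measurable_funB => //; apply: continuous_measurable_fun; exact: cc.
  have [|||||_ _] := @dominated_convergence _ TR R mu I mI (fun n t => (d n t)%:E) (cst 0%E) (fun=> (`|M| * \sum_j (B j + B j))%:E).
  - by move=> n; apply/measurable_EFinP; exact: measurable_funTS.
  - exact: measurable_cst.
  - apply: aeW => t It; apply: cvg_EFin; first exact: nearW.
    apply: (@cvg_sum0 _ (fun j n => sj (c j) n t) (fun j => c j t)) => [j|n].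
      by apply: sj_cvg => //; move: It; rewrite /= in_itv.
    by rewrite lexx andbT mulr_ge0// sumr_ge0.
  - exact: I_cst.
  - apply: aeW => t n It; rewrite lee_fin ger0_norm ?mulr_ge0 ?sumr_ge0//.
    rewrite ler_wpM2l//; apply: ler_sum => j _; apply: le_trans (ler_normB _ _) _.
    have [|H1 H2] := HB j t; first by move: It; rewrite /= in_itv.
    by rewrite lerD.
  rewrite integral0 => H.
  (* The norm of the error may fail to be measurable; its lower integral is squeezed below that of
     the measurable majorant [d]. *)
  apply: (@squeeze_cvge _ _ _ _ (cst 0%E) _ (fun n => \int[mu]_(t in I) (d n t)%:E)%E ); last 2 first.
  - exact: cvg_cst.
  - exact: H.
  apply: nearW => n; apply/andP; split; first by apply: integral_ge0 => t _; rewrite lee_fin.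
  apply: (@ge0_le_lower_integral _ TR R mu I) => t It; first by rewrite lee_fin.
  by rewrite lee_fin stpE nrm_diff.
have E n : step_integral T (stp c n) = \sum_j (\int[mu]_(t in I) sj (c j) n t) *: e j.
  rewrite /step_integral /=; under eq_bigr do rewrite scaler_sumr.
  rewrite exchange_big/=; apply: eq_bigr => j _.
  have [_ IE] := L1_sum (fun i => c j (pt n i)) (fun i : 'I_n.+1 => L1_indic T (measurable_itv `[pt n i, pt n i.+1[)).
  have -> : \int[mu]_(t in I) sj (c j) n t = \sum_(i < n.+1) (\int[mu]_t (\1_(@cell n i `&` I) t : R)) * c j (pt n i).
    rewrite -IE Rintegral_mkcond; congr Rintegral; apply/funext => t; rewrite patchE.
    case: ifPn => [It|nIt].
      apply: eq_bigr => i _; congr (_ * _); rewrite !indicE in_setI.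
      by rewrite It andbT.
    by rewrite big1// => i _; rewrite indicE in_setI (negbTE nIt) andbF mul0r.
  rewrite scaler_suml; apply: eq_bigr => i _; rewrite scalerA; congr (_ * _ *: _).
  rewrite /Rintegral integral_indic ?setIT//; apply: measurableI => //.
  exact: measurable_itv.
apply: (@cvg_sum0 _ (fun j n => \int[mu]_(t in I) sj (c j) n t) (fun j => \int[mu]_(t in I) c j t)) => [j|n].
  exact: sj_int.
by rewrite nrm0 E nrm_diff.
Qed.

(** The weak derivative is the classical one: for each coefficient, integrate the derivative of
    [phi t * c j t] over [[0, T]]; [phi] vanishes at both ends. *)
Lemma W1q_curve (c c' : 'I_m -> R -> R) : (forall j, continuous (c j)) ->
  (forall j, continuous (c' j)) -> (forall j t, 0 < t < T -> isd (c j) t (c' j t)) ->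
  W1q T X nrm +oo%E (fun t => \sum_j c j t *: e j).
Proof.
have Lqc (a : 'I_m -> R -> R) : (forall j, continuous (a j)) -> Lq T X nrm +oo%E (fun t => \sum_j a j t *: e j).
  move=> ca; split; first exact: curve_strongly_measurable.
  have [B HB] : exists B : 'I_m -> R, forall j t, 0 < t < T -> `|a j t| <= B j /\ forall n, `|sj (a j) n t| <= B j.
    by exists (fun j => projT1 (cid (sj_bound (ca j)))) => j; case: cid.
  apply: (@le_lt_trans _ _ (`|M| * \sum_j `|B j|)%:E); last by rewrite ltry.
  apply: norm_LToo_le; last by rewrite mulr_ge0// sumr_ge0.
  move=> t t0T; rewrite ger0_norm//; apply: le_trans (nrme' _) _.
  rewrite ler_wpM2l//; apply: ler_sum => j _; have [H _] := HB j t t0T.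
  exact: le_trans H (ler_norm _).
move=> cc cc' dc; split; first exact: Lqc.
exists (fun t => \sum_j c' j t *: e j); first exact: Lqc.
move=> phi tphi; have smooth_phi : smooth phi by case: tphi.
have [phi' sphi' dphi] := smoothW smooth_phi.
have cphi := smooth_continuous smooth_phi; have cphi' := smooth_continuous sphi'.
have phi'E : derive1 (phi : R -> R^o) = phi' by apply/funext => t; exact: isd_derive1.
rewrite phi'E.
have cM (f h : R -> R) : continuous f -> continuous h -> continuous (fun t => f t * h t).
  by move=> cf ch t; apply: cvgM; [exact: cf|exact: ch].
have B1 := curve_bochner (fun j => cM _ _ cphi' (cc j)).
have B2 := curve_bochner (fun j => cM _ _ cphi (cc' j)).
exists (\sum_j (\int[mu]_(t in I) (phi' t * c j t)) *: e j).
  by move: B1; congr bochner_integral; apply/funext => t; rewrite scaler_sumr; apply: eq_bigr => j _; rewrite scalerA.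
move: B2; congr bochner_integral.
  by apply/funext => t; rewrite scaler_sumr; apply: eq_bigr => j _; rewrite scalerA.
rewrite -sumrN; apply: eq_bigr => j _; rewrite -scaleNr; congr (_ *: _).
have ci (f : R -> R) : continuous f -> mu.-integrable I (EFin \o f).
  move=> cf; apply: (@integrableS _ TR R mu (`[0, T]%classic : set TR) I) => //.
    by move=> t /=; rewrite !in_itv/= => /andP[/ltW -> /ltW ->].
  apply: continuous_compact_integrable; first exact: segment_compact.
  exact: continuous_subspaceT.
apply/eqP; rewrite -addr_eq0 -RintegralD//; last 2 first.
- exact: ci (cM _ _ cphi (cc' j)).
- exact: ci (cM _ _ cphi' (cc j)).
have cs : continuous (fun t => phi t * c' j t + phi' t * c j t).
  by move=> t; apply: cvgD; [exact: cM|exact: cM].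
have [_ [a [b [a0 bT phi0]]]] := tphi.
rewrite Rintegral_itv_bndo_bndc; last exact: ci.
rewrite Rintegral_itv_obnd_cbnd; last first.
  apply: integrableS (continuous_compact_integrable (@segment_compact R 0 T) (continuous_subspaceT cs)) => //.
  by move=> t /=; rewrite !in_itv/= => /andP[/ltW -> ->].
rewrite /Rintegral (continuous_FTC2 (F := fun t => phi t * c j t) T0).
- rewrite phi0; last by move=> /andP[]; lra.
  rewrite phi0 ?mul0r -?EFinB ?subrr/= ?mul0r ?subrr//; last by move=> /andP[]; lra.
- exact: continuous_subspaceT.
- split.
  + move=> t; rewrite in_itv/= => tT; exact: (@ex_derive _ _ _ _ _ _ _ (isdM (dphi t) (dc j t tT))).
  + by apply: cvg_at_right_filter; exact: cM.
  + by apply: cvg_at_left_filter; exact: cM.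
- move=> t; rewrite in_itv/= => tT; rewrite (isd_derive1 (isdM (dphi t) (dc j t tT))).
  by rewrite addrC mulrC.
Qed.

End curves.

(** * Ordinary differential equations *)

Section prim_patch.
Variables (R : realType) (T : R).
Notation mu := (@lebesgue_measure R).
Notation TR := (measurableTypeR R).
Implicit Types f : R -> R.

Lemma L1_patch f a b : continuous f -> L1 (f \_ `[a, b]).
Proof.
move=> cf; have : mu.-integrable `[a, b] (EFin \o f).
  by apply: continuous_compact_integrable; [exact: segment_compact|exact: continuous_subspaceT].
move=> ifab; have := (@integrable_mkcond _ TR R mu (`[a, b]%classic : set TR) (EFin \o f) (measurable_itv _)).1 ifab.
by rewrite /L1; congr (integrable _ _ _); apply/funext => t; rewrite /= !patchE; case: ifP.
Qed.

Lemma prim_patch0 f : prim (f \_ `[0, T]) 0 = 0.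
Proof.
rewrite -[RHS](Rintegral_set1 (f \_ `[0, T]) 0) /prim Rintegral_mkcond [RHS]Rintegral_mkcond.
congr Rintegral; apply/funext => s; rewrite !patchE.
case: ifPn => [|nO]; last first.
  by rewrite memNset// => /= s0; move: nO; rewrite notin_setE /= in_itv/= s0 lexx.
rewrite inE /= in_itv/= le_eqVlt => /orP[/eqP ->|s0]; first by rewrite [in RHS]mem_set.
rewrite memNset ?memNset//=; first by move=> s0'; move: s0; rewrite s0' ltxx.
by rewrite in_itv/= => /andP[]; lra.
Qed.

Lemma prim_patchT f : prim (f \_ `[0, T]) T = \int[mu]_(s in `[0, T]) f s.
Proof.
rewrite /prim Rintegral_mkcond [RHS]Rintegral_mkcond; congr Rintegral; apply/funext => s.
rewrite !patchE; case: ifPn => [|nO] //; rewrite memNset//= in_itv/= => /andP[_ sT].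
by move: nO; rewrite notin_setE /= in_itv/= sT.
Qed.

Lemma prim_patch_le f a b : continuous f -> (forall t, 0 <= f t) -> a <= b ->
  prim (f \_ `[0, T]) a <= prim (f \_ `[0, T]) b.
Proof.
move=> cf f0 ab; rewrite -subr_ge0 primB//; last exact: L1_patch.
by apply: Rintegral_ge0 => t _; rewrite patchE; case: ifP.
Qed.

Lemma prim_patch_derive f t : {for t, continuous f} -> L1 (f \_ `[0, T]) -> 0 < t < T -> isd (prim (f \_ `[0, T])) t (f t).
Proof.
move=> cf Lf /andP[t0 tT]; set h := f \_ `[0, T].
have ht : h t = f t by rewrite /h patchE mem_set//= in_itv/= !ltW.
have loc : {for t, continuous h}.
  rewrite /prop_for /continuous_at ht.
  apply: cvg_trans cf; apply: near_eq_cvg; near=> s.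
  rewrite /h patchE mem_set//= in_itv/=; apply/andP; split; apply: ltW; near: s.
    exact: lt_nbhsr.
  exact: lt_nbhsl.
have [||d1 d2] := @continuous_FTC1 R h -oo%O t T tT _ _ loc.
- exact: (L1S (measurable_itv _) Lf).
- by rewrite ltNyr.
by split; [exact: d1|rewrite -derive1E d2].
Unshelve. all: by end_near. Qed.

Lemma isd_le0_decr (Y dY : R -> R) : (forall s, 0 < s < T -> isd Y s (dY s)) ->
  (forall s, 0 < s < T -> dY s <= 0) -> continuous Y -> forall t, 0 <= t <= T -> Y t <= Y 0.
Proof.
move=> dYs dY0 cY t tT; have T0 : 0 <= T by have /andP[] := tT; exact: le_trans.
apply: (@ler0_derive1_le_cc _ Y 0 T).
- by move=> s; rewrite in_itv/= => sT; exact: (@ex_derive _ _ _ _ _ _ _ (dYs s sT)).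
- by move=> s; rewrite in_itv/= => sT; rewrite (isd_derive1 (dYs s sT)); exact: dY0.
- exact: continuous_subspaceT.
- by rewrite in_itv.
- by rewrite in_itv/= lexx.
- by have /andP[] := tT.
Qed.

End prim_patch.

(** * Picard iteration for a globally Lipschitz right-hand side *)

Section picard.
Variables (R : realType) (T : R) (n : nat).
Notation mu := (@lebesgue_measure R).
Notation TR := (measurableTypeR R).
Hypothesis T0 : 0 < T.
Implicit Types (x y : 'I_n -> R -> R).

(** Nested intervals: the lower ends [u m t - 2 K / 2 ^+ m] increase with [m] and stay below all
    upper ends, so their supremum is the limit. The rate is uniform in [t], whence continuity. *)
Lemma geometric_limit (u : nat -> R -> R) (K : R) :
  (forall m t, `|u m.+1 t - u m t| <= K / 2 ^+ m) -> (forall m, continuous (u m)) ->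
  exists2 v, continuous v & forall m t, `|v t - u m t| <= 2 * K / 2 ^+ m.
Proof.
move=> du cu.
have p0 m : 0 < (2 : R) ^+ m by exact: exprn_gt0.
have K0 : 0 <= K by have := du 0%N 0; rewrite expr0 divr1; apply: le_trans.
have half m : 2 * K / 2 ^+ m.+1 = K / 2 ^+ m by rewrite exprS; field; rewrite gt_eqF.
have dbl m : 2 * K / 2 ^+ m = K / 2 ^+ m + K / 2 ^+ m by rewrite -mulrA; ring.
have A t m k : (m <= k)%N -> u k t + 2 * K / 2 ^+ k <= u m t + 2 * K / 2 ^+ m.
  move=> /subnKC <-; elim: (k - m)%N => [|j IH]; first by rewrite addn0.
  apply: le_trans IH; rewrite addnS half dbl.
  by have := du (m + j)%N t; rewrite ler_norml => /andP[_]; lra.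
have B t m k : (m <= k)%N -> u m t - 2 * K / 2 ^+ m <= u k t - 2 * K / 2 ^+ k.
  move=> /subnKC <-; elim: (k - m)%N => [|j IH]; first by rewrite addn0.
  apply: le_trans IH _; rewrite addnS half dbl.
  by have := du (m + j)%N t; rewrite ler_norml => /andP[]; lra.
have K2 m : 0 <= 2 * K / 2 ^+ m by rewrite divr_ge0 ?mulr_ge0// ltW.
have AB t m k : u m t - 2 * K / 2 ^+ m <= u k t + 2 * K / 2 ^+ k.
  apply: (le_trans (B t _ _ (leq_maxl m k))); apply: le_trans (A t _ _ (leq_maxr m k)).
  by have := K2 (maxn m k); lra.
pose S t := [set u m t - 2 * K / 2 ^+ m | m in setT].
have supS t : has_sup (S t).
  by split; [exists (u 0%N t - 2 * K / 2 ^+ 0), 0%N|exists (u 0%N t + 2 * K / 2 ^+ 0) => _ [m _ <-]].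
exists (fun t => sup (S t)) => [t|m t]; last first.
  rewrite ler_distl; apply/andP; split.
    by apply: (ub_le_sup (supS t).2); exists m.
  by apply: ge_sup; [exact: (supS t).1|move=> _ [k _ <-]].
have H m s : `|sup (S s) - u m s| <= 2 * K / 2 ^+ m.
  rewrite ler_distl; apply/andP; split.
    by apply: (ub_le_sup (supS s).2); exists m.
  by apply: ge_sup; [exact: (supS s).1|move=> _ [k _ <-]].
apply/cvgrPdist_le => e e0.
have [m Hm] : exists m, 2 * K / 2 ^+ m <= e / 3.
  have : 2 * K / 2 ^+ m @[m --> \oo] --> (0 : R).
    under eq_fun do rewrite -exprVn.
    by rewrite -(mulr0 (2 * K)); apply: cvgM; [exact: cvg_cst|apply: cvg_expr; rewrite ger0_norm ?invf_lt1//; lra].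
  move/cvgr0Pnorm_le => /(_ (e / 3)) []; first by lra.
  by move=> m _ Hm; exists m; have := Hm m (leqnn m); apply: le_trans; exact: ler_norm.
have e3 : 0 < e / 3 by lra.
have /cvgrPdist_le/(_ _ e3) := cu m t; apply: filterS => s Hs.
have H1 := H m t; have H2 := H m s.
have -> : sup (S t) - sup (S s) = (sup (S t) - u m t) + (u m t - u m s) - (sup (S s) - u m s) by ring.
apply: le_trans (ler_normB _ _) _; apply: le_trans (lerD (ler_normD _ _) (lexx _)) _.
by move: H1 H2 Hs Hm; lra.
Qed.

Definition row_at x t : 'rV[R]_n := \row_i x i t.

Variables (G : 'I_n -> R -> 'rV[R]_n -> R) (L : R) (x0 : 'I_n -> R).
Hypotheses (L0 : 0 < L)
  (GL : forall i t u v, `|G i t u - G i t v| <= L * `|u - v|)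
  (cG : forall i x, (forall j, continuous (x j)) -> continuous (fun t => G i t (row_at x t))).

Let rhs x i : R -> R := (fun t => G i t (row_at x t)) \_ `[0, T].
(** The right-hand side is cut off outside [[0, T]], so that iterates are continuous functions on
    the whole line, constant on either side of the interval. *)
Let step x i t : R := x0 i + prim (rhs x i) t.

Let L1_rhs x i : (forall j, continuous (x j)) -> L1 (rhs x i).
Proof. by move=> cx; apply: L1_patch; exact: cG. Qed.

Let c_step x i : (forall j, continuous (x j)) -> continuous (step x i).
Proof.
by move=> cx t; apply: cvgD; [exact: cvg_cst|exact: (prim_continuous (L1_rhs i cx))].
Qed.

(* The weight exp (2 L t) turns the integral operator into a contraction of ratio 1/2. *)
Let step_contr x y (K : R) : (forall j, continuous (x j)) -> (forall j, continuous (y j)) -> 0 <= K ->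
  (forall j t, 0 <= t <= T -> `|x j t - y j t| <= K * expR (2 * L * t)) ->
  forall i t, `|step x i t - step y i t| <= K / 2 * expR (2 * L * Num.max 0 (Num.min t T)).
Proof.
move=> cx cy K0 xy i t.
have mO : measurable (`]-oo, t]%classic : set TR) by exact: measurable_itv.
have ix := L1S mO (L1_rhs i cx); have iy := L1S mO (L1_rhs i cy).
rewrite /step addrAC opprD addrA subrr add0r addrC /prim -RintegralB//.
have id : mu.-integrable `]-oo, t] (EFin \o (fun s => rhs x i s - rhs y i s)).
  by have := integrableB mO ix iy; congr (integrable _ _ _); apply/funext.
apply: le_trans (le_normr_Rintegral mO id) _.
pose w s := (K * L * expR (2 * L * s)).
pose W : R -> R := w \_ `[0, T].
have cw : continuous w.
  move=> s; apply: cvgM; first exact: cvg_cst.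
  apply: (@continuous_comp _ _ _ (fun s => 2 * L * s) expR); last exact: continuous_expR.
  by apply: cvgM; [exact: cvg_cst|exact: cvg_id].
have L1W : L1 W by exact: L1_patch.
apply: (@le_trans _ _ (\int[mu]_(s in `]-oo, t]) W s)).
  apply: le_Rintegral => //.
  - by have := integrable_norm id; congr (integrable _ _ _); apply/funext.
  - exact: L1S.
  - move=> s _; rewrite /W /rhs !patchE; case: ifPn; last by rewrite subrr normr0.
    rewrite inE /= in_itv/= => sT; apply: le_trans (GL _ _ _ _) _.
    apply: (@le_trans _ _ (L * (K * expR (2 * L * s)))); last by rewrite mulrA [L * K]mulrC.
    rewrite ler_wpM2l ?(ltW L0)//.
    apply: rV_norm_le => [|j]; first by rewrite mulr_ge0// expR_ge0.
    by rewrite !mxE; exact: xy.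
set t' := Num.max 0 (Num.min t T).
have WI : \int[mu]_(s in `]-oo, t]) W s <= \int[mu]_(s in `[0, t']) w s.
  rewrite Rintegral_mkcond [leRHS]Rintegral_mkcond.
  apply: le_Rintegral => //; last 2 first.
  - exact: L1_patch.
  - move=> s _; rewrite !patchE /W patchE; have w0 : 0 <= w s by rewrite /w !mulr_ge0 ?expR_ge0 ?(ltW L0).
    case: ifPn => [|_]; last by case: ifP.
    rewrite inE /= in_itv/= => st; case: ifPn => [|_]; last by case: ifP.
    rewrite inE /= in_itv/= => /andP[s0 sT]; rewrite mem_set//= in_itv/= s0/=.
    by rewrite /t' le_max le_min st sT orbT.
  - have := (@integrable_mkcond _ TR R mu _ (EFin \o W) mO).1 (L1S mO L1W).
    by congr (integrable _ _ _); apply/funext => s; rewrite /= !patchE; case: ifP.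
apply: le_trans WI _.
have t0' : 0 <= t' by rewrite /t' le_max lexx.
move: t0'; rewrite le_eqVlt => /orP[/eqP <-|t0'].
  by rewrite set_itv1 Rintegral_set1 mulr_ge0 ?expR_ge0// divr_ge0.
pose F s := K / 2 * expR (2 * L * s).
have dF s : isd F s (w s).
  apply: (isd_eq (isdZ (K / 2) (@isd_comp _ expR (fun s => 2 * L * s + 0) s _ _ (isd_expR _) (isd_affine (2 * L) 0 s)))) => [r|].
    by rewrite /F addr0.
  by rewrite /w addr0; field.
rewrite /Rintegral (continuous_FTC2 (F := F) t0').
- by rewrite -EFinB/= lerBlDr lerDl mulr_ge0 ?expR_ge0// divr_ge0.
- exact: continuous_subspaceT.
- split; first by move=> s _; exact: (@ex_derive _ _ _ _ _ _ _ (dF s)).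
    by apply: cvg_at_right_filter; exact: (isd_continuous (dF _)).
  by apply: cvg_at_left_filter; exact: (isd_continuous (dF _)).
- by move=> s _; exact: isd_derive1.
Qed.

Lemma picard : exists x, [/\ forall i, continuous (x i), forall i, x i 0 = x0 i &
  forall i t, 0 < t < T -> isd (x i) t (G i t (row_at x t))].
Proof.
pose u m : 'I_n -> R -> R := iter m step (fun i => cst (x0 i)).
have cu m i : continuous (u m i).
  elim: m i => [|m IH] i; first by move=> t; exact: cvg_cst.
  exact: c_step.
have xT t : 0 <= Num.max 0 (Num.min t T) <= T by rewrite le_max lexx/= ge_max ltW//= ge_min lexx orbT.
have [K K0 HK] : exists2 K, 0 <= K & forall i t, 0 <= t <= T -> `|u 1%N i t - u 0%N i t| <= K * expR (2 * L * t).
  have bd i : exists2 B, 0 <= B & forall t, 0 <= t <= T -> `|u 1%N i t - u 0%N i t| <= B.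
    have cd : continuous (fun t => u 1%N i t - u 0%N i t) by move=> t; apply: cvgB; exact: cu.
    have [B [_ HB]] := @compact_bounded _ _ _ (continuous_compact (continuous_subspaceT cd) (@segment_compact R 0 T)).
    exists `|B + 1| => // t tT; apply: le_trans (ler_norm (B + 1)); apply: HB; first by rewrite ltrDl.
    by exists t => //=; rewrite in_itv.
  pose B i := projT1 (cid2 (bd i)).
  have B0 i : 0 <= B i by rewrite /B; case: cid2.
  have BH i t : 0 <= t <= T -> `|u 1%N i t - u 0%N i t| <= B i by rewrite /B; case: cid2 => b ? /= H; exact: H.
  exists (\sum_i B i) => [|i t tT]; first by rewrite sumr_ge0.
  apply: (@le_trans _ _ (\sum_i B i)).
    by apply: le_trans (BH i t tT) _; rewrite (bigD1 i)//= lerDl sumr_ge0.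
  rewrite ler_peMr ?sumr_ge0// -expR0 ler_expR.
  by have /andP[t0 _] := tT; rewrite !mulr_ge0// ltW.
have p0 m : 0 < (2 : R) ^+ m by exact: exprn_gt0.
have dK m i t : 0 <= t <= T -> `|u m.+1 i t - u m i t| <= K / 2 ^+ m * expR (2 * L * t).
  elim: m i t => [|m IH] i t tT; first by rewrite expr0 divr1; exact: HK.
  have := @step_contr (u m.+1) (u m) (K / 2 ^+ m) (cu _) (cu _) (divr_ge0 K0 (ltW (p0 m))) IH i t.
  have /andP[t0 tT'] := tT.
  rewrite (_ : Num.max 0 (Num.min t T) = t); last by rewrite min_l// max_r.
  by rewrite (_ : K / 2 ^+ m.+1 = K / 2 ^+ m / 2)// exprS invfM; ring.
pose K' := K * expR (2 * L * T).
(* After one more application of [step] the bound holds for every real [t], because [step] only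
   reads its argument on [[0, T]]; hence the shift of the index by one. *)
have dK' i m t : `|u m.+2 i t - u m.+1 i t| <= K' / 2 ^+ m.
  apply: le_trans (step_contr (cu _) (cu _) (divr_ge0 K0 (ltW (p0 m))) (dK m) i t) _.
  have /andP[_ tT] := xT t; have D : K / 2 ^+ m / 2 <= K / 2 ^+ m.
    by have : 0 <= K / 2 ^+ m by [rewrite divr_ge0// ltW]; lra.
  have -> : K' / 2 ^+ m = K / 2 ^+ m * expR (2 * L * T) by rewrite /K' mulrAC.
  apply: ler_pM; [by rewrite !divr_ge0// ltW|exact: expR_ge0|exact: D|].
  by rewrite ler_expR ler_wpM2l// mulr_ge0// ltW.
have lim i : exists2 v, continuous v & forall m t, `|v t - u m.+1 i t| <= 2 * K' / 2 ^+ m.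
  exact: (geometric_limit (fun m t => dK' i m t) (fun m => cu _ i)).
pose x i := projT1 (cid2 (lim i)).
have cx i : continuous (x i) by rewrite /x; case: cid2.
have xu i m t : `|x i t - u m.+1 i t| <= 2 * K' / 2 ^+ m by rewrite /x; case: cid2 => v ? /= H; exact: H.
(* Compare [x] with the iterate of index [m + 2]: the first error is geometric, and the contraction
   estimate carries the error of index [m + 1] over to the images under [step]. *)
have fix_ i t : x i t = step x i t.
  apply/eqP; rewrite -subr_eq0 -normr_le0; apply/ler_addgt0Pr => e e0; rewrite add0r.
  have K'0 : 0 <= K' by rewrite mulr_ge0// expR_ge0.
  have E0 : 0 < 1 + expR (2 * L * T) by rewrite ltr_wpDr// expR_ge0.
  have [m Hm] : exists m, 2 * K' / 2 ^+ m * (1 + expR (2 * L * T)) <= e.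
    have : 2 * K' / 2 ^+ m * (1 + expR (2 * L * T)) @[m --> \oo] --> (0 : R).
      rewrite -(mul0r (1 + expR (2 * L * T))); apply: cvgM; last exact: cvg_cst.
      under eq_fun do rewrite -exprVn.
      by rewrite -(mulr0 (2 * K')); apply: cvgM; [exact: cvg_cst|apply: cvg_expr; rewrite ger0_norm ?invf_lt1//; lra].
    move/cvgr0Pnorm_le => /(_ e e0) [m _ Hm]; exists m.+1; have := Hm m.+1 (leqnSn m).
    by apply: le_trans; exact: ler_norm.
  have q0 : 0 <= 2 * K' / 2 ^+ m by rewrite divr_ge0 ?mulr_ge0// ltW.
  have H1 := xu i m.+1 t.
  have := @step_contr (u m.+1) x (2 * K' / 2 ^+ m) (cu _) cx q0 _ i t.
  have -> : x i t - step x i t = (x i t - u m.+2 i t) + (step (u m.+1) i t - step x i t) by rewrite /=; ring.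
  move=> H2; apply: le_trans (ler_normD _ _) _; apply: le_trans Hm; rewrite mulrDr mulr1.
  apply: lerD; first by apply: le_trans H1 _; rewrite ler_wpM2l ?mulr_ge0// lef_pV2 ?posrE// exprS ler_peMl ?ler1n// ?ltW//; lra.
  apply: le_trans (H2 _) _.
    move=> j s /andP[s0 _]; rewrite distrC; apply: le_trans (xu j m s) _.
    by rewrite ler_peMr// -expR0 ler_expR !mulr_ge0// ltW.
  have /andP[_ tT] := xT t; apply: ler_pM; rewrite ?expR_ge0//; first by rewrite divr_ge0.
    by rewrite ler_pdivrMr// ler_peMr// ler1n.
  by rewrite ler_expR ler_wpM2l// mulr_ge0// ltW.
have rcx i : continuous (fun t => G i t (row_at x t)) by exact: cG.
exists x; split => // i.
- by rewrite fix_ /step prim_patch0 addr0.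
- move=> t tT; have dp := prim_patch_derive (rcx i t) (L1_rhs i cx) tT.
  apply: (isd_eq (isdD (isd_cst (x0 i) t) dp)) => [s|]; last by rewrite add0r.
  by rewrite fix_.
Qed.

End picard.

Lemma continuous_fsum (R : realType) (I : Type) (r : seq I) (h : I -> R -> R) :
  (forall i, continuous (h i)) -> continuous (fun t => \sum_(i <- r) h i t).
Proof.
move=> ch; rewrite (_ : (fun t => _) = \sum_(i <- r) h i); last by apply/funext => t; rewrite fct_sumE.
apply: (big_ind (fun f : R -> R => continuous f)) => [t|f k cf ck t|i _]; [exact: cvg_cst| |exact: ch].
by apply: cvgD; [exact: cf|exact: ck].
Qed.

Lemma continuous_sqr (R : realType) (h : R -> R) : continuous h -> continuous (fun t => h t ^+ 2).
Proof. by move=> ch t; apply: cvgM; exact: ch. Qed.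

(** * Global solutions of dissipative, locally Lipschitz systems *)

Section ode.
Variables (R : realType) (T : R) (n : nat).
Notation mu := (@lebesgue_measure R).
Notation TR := (measurableTypeR R).
Hypothesis T0 : 0 < T.
Implicit Types (f g : 'rV[R]_n -> R) (u v : 'rV[R]_n).

Definition loclip f : Prop := forall M, exists2 L, 0 <= L &
  forall u v, `|u| <= M -> `|v| <= M -> `|f u - f v| <= L * `|u - v|.

Lemma loclip_bounded f : loclip f -> forall M, exists2 K, 0 <= K & forall u, `|u| <= M -> `|f u| <= K.
Proof.
move=> lf M; have [L L0 H] := lf `|M|; exists (`|f 0| + L * `|M|) => [|u uM]; first by rewrite addr_ge0// mulr_ge0.
have uM' := le_trans uM (ler_norm M).
have := H u 0 uM'; rewrite normr0 subr0 => /(_ (normr_ge0 _)) {}H.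
rewrite -[f u](subrK (f 0)) addrC; apply: le_trans (ler_normD _ _) _.
by rewrite lerD2l; apply: le_trans H _; rewrite ler_wpM2l.
Qed.

Lemma loclip_cst (a : R) : loclip (fun=> a).
Proof. by move=> M; exists 0 => // u v _ _; rewrite subrr normr0 mul0r. Qed.

Lemma loclip_coord i : loclip (fun u => u 0 i).
Proof.
by move=> M; exists 1 => // u v _ _; rewrite mul1r; have := rV_le_norm (u - v) i; rewrite !mxE.
Qed.

Lemma loclipD f g : loclip f -> loclip g -> loclip (fun u => f u + g u).
Proof.
move=> lf lg M; have [L L0 Hf] := lf M; have [K K0 Hg] := lg M.
exists (L + K) => [|u v uM vM]; first exact: addr_ge0.
rewrite opprD addrACA mulrDl; apply: le_trans (ler_normD _ _) _.
by apply: lerD; [exact: Hf|exact: Hg].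
Qed.

Lemma loclipM f g : loclip f -> loclip g -> loclip (fun u => f u * g u).
Proof.
move=> lf lg M; have [L L0 Hf] := lf M; have [K K0 Hg] := lg M.
have [A A0 Bf] := loclip_bounded lf M; have [B B0 Bg] := loclip_bounded lg M.
exists (L * B + A * K) => [|u v uM vM]; first by rewrite addr_ge0// mulr_ge0.
have -> : f u * g u - f v * g v = (f u - f v) * g u + f v * (g u - g v) by ring.
apply: le_trans (ler_normD _ _) _; rewrite !normrM mulrDl; apply: lerD.
  by rewrite mulrAC; apply: ler_pM => //; [exact: Hf|exact: Bg].
by rewrite -mulrA; apply: ler_pM => //; [exact: Bf|exact: Hg].
Qed.

Lemma loclip_sum m (F : 'I_m -> 'rV[R]_n -> R) : (forall i, loclip (F i)) ->
  loclip (fun u => \sum_i F i u).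
Proof.
move=> lF M; pose L i := projT1 (cid2 (lF i M)).
have L0 i : 0 <= L i by rewrite /L; case: cid2.
have H i u v : `|u| <= M -> `|v| <= M -> `|F i u - F i v| <= L i * `|u - v|.
  by rewrite /L; case: cid2 => l ? /= H; exact: H.
exists (\sum_i L i) => [|u v uM vM]; first exact: sumr_ge0.
rewrite -sumrB mulr_suml; apply: le_trans (ler_norm_sum _ _ _) _.
by apply: ler_sum => i _; exact: H.
Qed.

Lemma loclip_curve f (x : 'I_n -> R -> R) : loclip f -> (forall j, continuous (x j)) ->
  continuous (fun t => f (row_at x t)).
Proof.
move=> lf cx t; have [L L0 H] := lf (`|row_at x t| + 1).
have K0 : 0 < L + 1 by lra.
apply/cvgrPdist_le => e e0.
have d0 : 0 < Num.min 1 (e / (L + 1)) by rewrite lt_min ltr01 divr_gt0.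
have : \forall s \near t, forall j, `|x j t - x j s| <= Num.min 1 (e / (L + 1)).
  have Hj j : \forall s \near t, `|x j t - x j s| <= Num.min 1 (e / (L + 1)).
    by have /cvgrPdist_le/(_ _ d0) := cx j t.
  exact: (filter_forall _ Hj).
apply: filterS => s Hs.
have Hn : `|row_at x t - row_at x s| <= Num.min 1 (e / (L + 1)).
  by apply: rV_norm_le => [|j]; [exact: ltW|rewrite !mxE; exact: Hs].
have Hs1 : `|row_at x s| <= `|row_at x t| + 1.
  rewrite -[row_at x s](subKr (row_at x t)); apply: le_trans (ler_normB _ _) _.
  by rewrite lerD2l; apply: le_trans Hn _; rewrite ge_min lexx.
apply: le_trans (H _ _ _ Hs1) _; first by rewrite lerDl.
move: Hn; rewrite le_min ler_pdivlMr// => /andP[_]; apply: le_trans.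
by rewrite mulrC ler_wpM2l//; lra.
Qed.

Definition clamp01 (a : R) : R := Num.max 0 (Num.min 1 a).

Lemma clamp01_lip a b : `|clamp01 a - clamp01 b| <= `|a - b|.
Proof.
rewrite /clamp01 ler_norml; have := ler_norm (a - b); have := ler_norm (b - a); rewrite distrC.
move: (`|a - b|) => d H1 H2.
have [?|?] := leP 1 a; have [?|?] := leP 1 b; have [?|?] := leP 0 a; have [?|?] := leP 0 b;
  rewrite ?max_r ?max_l ?ler01 ?subrr//; try lra; apply/andP; split; lra.
Qed.

Lemma clamp01_bound a : 0 <= clamp01 a <= 1.
Proof. by rewrite /clamp01 le_max lexx/= ge_max ler01 ge_min lexx. Qed.

(* Cut off outside the ball of radius 2 M. *)
Let cut (M : R) f u : R := clamp01 (2 - `|u| / M) * f u.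

Let cut_lip M f : 0 < M -> loclip f -> exists2 L, 0 <= L & forall u v, `|cut M f u - cut M f v| <= L * `|u - v|.
Proof.
move=> M0 lf; have [L L0 H] := lf (2 * M); have [K K0 B] := loclip_bounded lf (2 * M).
exists (K / M + L) => [|]; first by rewrite addr_ge0// divr_ge0// ltW.
have out u : 2 * M < `|u| -> clamp01 (2 - `|u| / M) = 0.
  move=> uM; rewrite /clamp01 max_l// ge_min; apply/orP; right.
  by rewrite subr_le0 ler_pdivlMr// ltW.
have eta u v : `|clamp01 (2 - `|u| / M) - clamp01 (2 - `|v| / M)| <= `|u - v| / M.
  apply: le_trans (clamp01_lip _ _) _.
  rewrite (_ : 2 - _ - _ = (`|v| - `|u|) / M); last by ring.
  have M1 : 0 <= M^-1 by rewrite invr_ge0 ltW.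
  rewrite normrM (ger0_norm M1) ler_wpM2r// distrC.
  exact: ler_dist_dist.
have half u v : `|u| <= 2 * M -> `|cut M f u - cut M f v| <= (K / M + L) * `|u - v|.
  move=> uM; rewrite /cut.
  rewrite (_ : _ - _ = (clamp01 (2 - `|u| / M) - clamp01 (2 - `|v| / M)) * f u
    + clamp01 (2 - `|v| / M) * (f u - f v)); last by ring.
  apply: le_trans (ler_normD _ _) _; rewrite !normrM mulrDl; apply: lerD.
    rewrite mulrC (_ : K / M * _ = K * (`|u - v| / M)); last by ring.
    by apply: ler_pM => //; exact: B.
  have /andP[c0 c1] := clamp01_bound (2 - `|v| / M); rewrite (ger0_norm c0).
  have [vM|vM] := leP `|v| (2 * M); last by rewrite out// mul0r mulr_ge0.
  by apply: le_trans (H _ _ uM vM); rewrite ler_piMl.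
move=> u v; have [uM|uM] := leP `|u| (2 * M); first exact: half.
have [vM|vM] := leP `|v| (2 * M); first by rewrite distrC [`|u - v|]distrC; exact: half.
by rewrite /cut !out// !mul0r subrr normr0 mulr_ge0// addr_ge0// divr_ge0// ltW.
Qed.

(** The cut-off multiplies [F] by a nonnegative factor and thus preserves its sign condition. The
    energy bound therefore already holds for the truncated system, confines its solution to the ball
    where the cut-off equals 1, and shows that it solves the original system. *)
Lemma ode_exists (F : 'I_n -> 'rV[R]_n -> R) (g : 'I_n -> R -> R) (x0 : 'I_n -> R) :
  (forall i, loclip (F i)) -> (forall u, 0 <= \sum_i u 0 i * F i u) ->
  (forall i, continuous (g i)) ->
  exists x : 'I_n -> R -> R, [/\ forall i, continuous (x i), forall i, x i 0 = x0 i,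
    forall i t, 0 < t < T -> isd (x i) t (g i t - F i (row_at x t)) &
    forall t, 0 <= t <= T -> \sum_i x i t ^+ 2 <=
      expR t * (\sum_i x0 i ^+ 2 + \int[mu]_(s in `[0, T]) \sum_i g i s ^+ 2)].
Proof.
move=> lF F0 cg.
pose g2 s := \sum_i g i s ^+ 2.
have cg2 : continuous g2.
  by apply: continuous_fsum => i; apply: continuous_sqr; exact: cg.
set B := \sum_i x0 i ^+ 2 + \int[mu]_(s in `[0, T]) g2 s.
have B0 : 0 <= B.
  by rewrite addr_ge0 ?sumr_ge0 ?Rintegral_ge0// => [i _|s _]; rewrite ?sqr_ge0 ?sumr_ge0// => i _; exact: sqr_ge0.
(* The bound controls squares of coordinates by [expR T * B], and [(b + 1) ^+ 2 >= b] for
   [b >= 0]. *)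
pose M := expR T * B + 1.
have M0 : 0 < M by rewrite ltr_wpDl// mulr_ge0// expR_ge0.
have [L L0 HL] : exists2 L, 0 < L & forall i u v, `|cut M (F i) u - cut M (F i) v| <= L * `|u - v|.
  pose L i := projT1 (cid2 (cut_lip M0 (lF i))).
  have L0 i : 0 <= L i by rewrite /L; case: cid2.
  exists (\sum_i L i + 1) => [|i u v]; first by rewrite ltr_wpDl// sumr_ge0.
  apply: (@le_trans _ _ (L i * `|u - v|)); first by rewrite /L; case: cid2 => l ? /= H; exact: H.
  by rewrite ler_wpM2r// (bigD1 i)//= -addrA lerDl addr_ge0// sumr_ge0.
have lcut i : loclip (cut M (F i)) by move=> N; exists L; [exact: ltW|move=> u v _ _; exact: HL].
have [||x [cx xx0 dx]] := @picard R T n T0 (fun i t u => g i t - cut M (F i) u) L x0 L0.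
- move=> i t u v; rewrite (_ : _ - _ = cut M (F i) v - cut M (F i) u); last by ring.
  by rewrite distrC; exact: HL.
- by move=> i y cy t; apply: cvgB; [exact: cg|exact: (loclip_curve (lcut i) cy)].
pose X t := \sum_i x i t ^+ 2.
have cX : continuous X by apply: continuous_fsum => i; apply: continuous_sqr; exact: cx.
have g20 t : 0 <= g2 t by apply: sumr_ge0 => i _; exact: sqr_ge0.
have en t : 0 <= t <= T -> X t <= expR t * B.
  move=> /andP[t0 tT].
  pose dX s := \sum_i (2%:R * x i s ^+ 1 * (g i s - cut M (F i) (row_at x s))).
  have dXd s : 0 < s < T -> isd X s (dX s).
    by move=> sT; apply: isd_sum => i; exact: isdX (dx i s sT).
  have dXle s : dX s <= X s + g2 s.
    (* Add the nonnegative dissipation, which cancels the term in [F]; what remains is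
       [2 x g <= x ^+ 2 + g ^+ 2], coordinate by coordinate. *)
    rewrite /X /g2 -big_split/=; apply: (@le_trans _ _ (dX s + 2 * clamp01 (2 - `|row_at x s| / M) * \sum_i (row_at x s) 0 i * F i (row_at x s))).
      rewrite lerDl mulr_ge0// mulr_ge0//.
      by have /andP[] := clamp01_bound (2 - `|row_at x s| / M).
    rewrite /dX mulr_sumr -big_split/=; apply: ler_sum => i _.
    rewrite /cut !mxE expr1; move: (clamp01 _) (F i _) => c f.
    have := sqr_ge0 (x i s - g i s); rewrite sqrrB; move: (x i s) (g i s) => a b.
    rewrite !expr2; lra.
  (* Gronwall's inequality in differential form: [Y] is nonincreasing. *)
  pose Y s := expR (- s) * X s - prim (g2 \_ `[0, T]) s.
  have dY s : 0 < s < T -> isd Y s (- expR (- s) * X s + expR (- s) * dX s - g2 s).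
    move=> sT; have dp := prim_patch_derive (cg2 s) (L1_patch 0 T cg2) sT.
    have de : isd (fun s => expR (- s)) s (- expR (- s)).
      have := @isd_comp _ expR (fun s => - s) s _ _ (isd_expR _) (isdN (isd_id s)).
      by rewrite mulrN1.
    apply: (isd_eq (isdB (isdM de (dXd s sT)) dp)) => //.
  have cY : continuous Y.
    move=> s; apply: cvgB; last exact: (prim_continuous (L1_patch 0 T cg2)).
    apply: cvgM; last exact: cX.
    by apply: (@continuous_comp _ _ _ (fun s => - s) expR); [exact: opp_continuous|exact: continuous_expR].
  have YY : Y t <= Y 0.
    apply: (isd_le0_decr dY _ cY); last by rewrite t0 tT.
    move=> s sT; have e1 : expR (- s) <= 1.
      by rewrite -expR0 ler_expR oppr_le0; have /andP[/ltW] := sT.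
    have := ler_wpM2l (expR_ge0 (- s)) (dXle s); rewrite mulrDr.
    have : expR (- s) * g2 s <= g2 s by rewrite ler_piMl.
    move: (expR (- s)) (X s) (dX s) (g2 s) => e p q r; lra.
  move: YY; rewrite /Y prim_patch0 subr0 oppr0 expR0 mul1r => YY.
  have X0E : X 0 = \sum_i x0 i ^+ 2 by apply: eq_bigr => i _; rewrite xx0.
  have : expR (- t) * X t <= B.
    apply: (@le_trans _ _ (X 0 + prim (g2 \_ `[0, T]) t)); first by rewrite -lerBlDr.
    by rewrite X0E lerD2l -prim_patchT; exact: prim_patch_le.
  by rewrite expRN ler_pdivrMl ?expR_gt0.
have small t : 0 <= t <= T -> `|row_at x t| <= M.
  move=> tT; apply: rV_norm_le => [|i]; first exact: ltW.
  rewrite !mxE -ler_sqr ?nnegrE ?(ltW M0)// real_normK ?num_real//.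
  have XM : x i t ^+ 2 <= expR T * B.
    apply: (@le_trans _ _ (X t)).
      by rewrite /X (bigD1 i)//= lerDl sumr_ge0// => j _; exact: sqr_ge0.
    by apply: le_trans (en t tT) _; rewrite ler_wpM2r// ler_expR; have /andP[] := tT.
  apply: le_trans XM _; rewrite /M; have : 0 <= expR T * B by rewrite mulr_ge0// expR_ge0.
  by move: (expR T * B) => b b0; nra.
exists x; split => //.
move=> i t tT; have := dx i t tT; rewrite /cut (_ : clamp01 _ = 1) ?mul1r//.
have /small : 0 <= t <= T by have /andP[/ltW -> /ltW ->] := tT.
move=> H; have : `|row_at x t| / M <= 1 by rewrite ler_pdivrMr// mul1r.
move=> H1; rewrite /clamp01 min_l ?max_r ?ler01//; lra.
Qed.

(** Both curves are bounded on [[0, T]], so one Lipschitz constant serves for both, and Gronwall's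
    inequality applies to the squared distance. *)
Lemma ode_unique (F : 'I_n -> 'rV[R]_n -> R) (g : 'I_n -> R -> R) (x y : 'I_n -> R -> R) :
  (forall i, loclip (F i)) ->
  (forall i, continuous (x i)) -> (forall i, continuous (y i)) -> (forall i, x i 0 = y i 0) ->
  (forall i t, 0 < t < T -> isd (x i) t (g i t - F i (row_at x t))) ->
  (forall i t, 0 < t < T -> isd (y i) t (g i t - F i (row_at y t))) ->
  forall i t, 0 <= t <= T -> x i t = y i t.
Proof.
move=> lF cx cy xy0 dx dy.
have bd (z : 'I_n -> R -> R) : (forall i, continuous (z i)) -> exists2 B, 0 <= B & forall t, 0 <= t <= T -> `|row_at z t| <= B.
  move=> cz; have bi i : exists2 B, 0 <= B & forall t, 0 <= t <= T -> `|z i t| <= B.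
    have [B [_ HB]] := @compact_bounded _ _ _ (continuous_compact (continuous_subspaceT (cz i)) (@segment_compact R 0 T)).
    exists `|B + 1| => // t tT; apply: le_trans (ler_norm (B + 1)); apply: HB; first by rewrite ltrDl.
    by exists t => //=; rewrite in_itv.
  pose B i := projT1 (cid2 (bi i)).
  have B0 i : 0 <= B i by rewrite /B; case: cid2.
  have HB i t : 0 <= t <= T -> `|z i t| <= B i by rewrite /B; case: cid2 => b ? /= H; exact: H.
  exists (\sum_i B i) => [|t tT]; first exact: sumr_ge0.
  apply: rV_norm_le => [|i]; first exact: sumr_ge0.
  by rewrite !mxE; apply: le_trans (HB i t tT) _; rewrite (bigD1 i)//= lerDl sumr_ge0.
have [A A0 HA] := bd x cx; have [B B0 HB] := bd y cy.
have [L L0 HL] : exists2 L, 0 <= L & forall i u v, `|u| <= Num.max A B -> `|v| <= Num.max A B -> `|F i u - F i v| <= L * `|u - v|.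
  pose L i := projT1 (cid2 (lF i (Num.max A B))).
  have L0 i : 0 <= L i by rewrite /L; case: cid2.
  exists (\sum_i L i) => [|i u v uM vM]; first by rewrite sumr_ge0.
  apply: (@le_trans _ _ (L i * `|u - v|)); first by rewrite /L; case: cid2 => l ? /= H; exact: H.
  by rewrite ler_wpM2r// (bigD1 i)//= lerDl sumr_ge0.
pose X t := \sum_i (x i t - y i t) ^+ 2.
pose dX t := \sum_i (2%:R * (x i t - y i t) ^+ 1 * (F i (row_at y t) - F i (row_at x t))).
have cX : continuous X.
  apply: continuous_fsum => i; apply: continuous_sqr => t.
  by apply: cvgB; [exact: cx|exact: cy].
have X0 t : 0 <= X t by apply: sumr_ge0 => i _; exact: sqr_ge0.
have dXd t : 0 < t < T -> isd X t (dX t).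
  move=> tT; apply: isd_sum => i; apply: isdX; apply: (isd_eq (isdB (dx i t tT) (dy i t tT))) => //.
  by ring.
(* The sup norm of the difference is at most the square root of [X]; the factor [n] comes from
   summing over the coordinates. *)
pose K := 2 * n%:R * L.
have dXle t : 0 < t < T -> dX t <= K * X t.
  move=> tT; have tT' : 0 <= t <= T by have /andP[/ltW -> /ltW ->] := tT.
  have nX : `|row_at x t - row_at y t| <= Num.sqrt (X t).
    apply: rV_norm_le => [|i]; first exact: sqrtr_ge0.
    rewrite !mxE -sqrtr_sqr ler_wsqrtr// /X (bigD1 i)//= lerDl.
    by apply: sumr_ge0 => j _; exact: sqr_ge0.
  rewrite (_ : K * X t = \sum_(i < n) (2 * Num.sqrt (X t) * (L * Num.sqrt (X t)))); last first.
    by rewrite sumr_const card_ord -[in RHS]mulr_natr -{1}(sqr_sqrtr (X0 t)) /K; ring.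
  apply: ler_sum => i _; apply: le_trans (ler_norm _) _; rewrite !normrM (ger0_norm (ler0n _ 2)) expr1.
  apply: (@ler_pM _ (2 * `|x i t - y i t|) (2 * Num.sqrt (X t)) `|F i (row_at y t) - F i (row_at x t)| (L * Num.sqrt (X t))) => //.
    rewrite ler_wpM2l//; apply: le_trans nX; have := rV_le_norm (row_at x t - row_at y t) i.
    by rewrite !mxE.
  rewrite distrC; apply: le_trans (HL _ _ _ _ _) _; rewrite ?le_max ?HA ?HB ?orbT//.
  by rewrite ler_wpM2l.
pose Y s := expR (- K * s) * X s.
have dY s : 0 < s < T -> isd Y s (expR (- K * s) * (dX s - K * X s)).
  move=> sT.
  have de := @isd_comp _ expR (fun s => - K * s + 0) s _ _ (isd_expR _) (isd_affine (- K) 0 s).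
  apply: (isd_eq (isdM de (dXd s sT))) => [r|]; first by rewrite /Y addr0.
  by rewrite addr0; ring.
have cY : continuous Y.
  move=> s; apply: cvgM; last exact: cX.
  apply: (@continuous_comp _ _ _ (fun s => - K * s) expR); last exact: continuous_expR.
  by apply: cvgM; [exact: cvg_cst|exact: cvg_id].
have Xz t : 0 <= t <= T -> X t = 0.
  move=> /andP[t0 tT]; have YY : Y t <= Y 0.
    apply: (isd_le0_decr dY _ cY); last by rewrite t0 tT.
    by move=> s sT; rewrite mulr_ge0_le0 ?expR_ge0// subr_le0; exact: dXle.
  have Y0 : Y 0 = 0 by rewrite /Y /X big1 ?mulr0// => i _; rewrite xy0 subrr expr0n.
  apply/eqP; rewrite eq_le X0 andbT -(pmulr_rle0 _ (expR_gt0 (- K * t))).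
  by rewrite -Y0.
move=> i t tT; apply/eqP; rewrite -subr_eq0 -sqrf_eq0; apply/eqP.
have /eqP := Xz t tT; rewrite /X psumr_eq0; last by move=> j _; exact: sqr_ge0.
by move=> /allP/(_ i (mem_index_enum i))/eqP.
Qed.

End ode.

(** * Discrete spaces *)

Section finite_dimension.
Variables (R : realType) (d : nat).
Notation pt := 'rV[R]_d.

Lemma dependent_rows (J : finType) (N : nat) (c : 'I_N.+1 -> J -> R) : (#|J| <= N)%N ->
  exists2 a : 'I_N.+1 -> R, (exists i, a i != 0) & forall j, \sum_i a i * c i j = 0.
Proof.
move=> JN; pose C : 'M[R]_(N.+1, #|J|) := \matrix_(i, j) c i (enum_val j).
have /rowV0Pn[a /sub_kermxP aC a0] : kermx C != 0.
  rewrite kermx_eq0 /row_free neq_ltn; apply/orP; left.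
  by apply: leq_ltn_trans (rank_leq_col _) _; rewrite ltnS.
exists (fun i => a 0 i); last first.
  move=> j; have /matrixP/(_ 0 (enum_rank j)) := aC; rewrite !mxE => aj; rewrite -[RHS]aj.
  by apply: eq_bigr => i _; rewrite !mxE enum_rankK.
apply: contrapT => H; move/negP: a0; apply; apply/eqP/rowP => i; rewrite mxE.
by apply/eqP/negPn/negP => ai; apply: H; exists i.
Qed.

Lemma poly_le_lin l (a : R) (p q : pt -> R) : poly_le l p -> poly_le l q -> poly_le l (fun x => a * p x + q x).
Proof.
move=> [c pE] [c' qE]; exists (fun i => a * c i + c' i) => x.
rewrite pE qE mulr_sumr -big_split/=; apply: eq_bigr => i _; ring.
Qed.

Lemma poly_le0 l : poly_le l (fun _ : pt => 0 : R).
Proof. by exists (fun=> 0) => x; rewrite big1// => i _; rewrite mul0r. Qed.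

Lemma piecewise_poly_lin l (Th : seq (vertices R d)) (a : R) (p q : pt -> R) :
  piecewise_poly l Th p -> piecewise_poly l Th q -> piecewise_poly l Th (fun x => a * p x + q x).
Proof.
move=> hp hq K KT; have [p' pp' pE] := hp K KT; have [q' qq' qE] := hq K KT.
exists (fun x => a * p' x + q' x); first exact: poly_le_lin.
by move=> x xK /=; rewrite pE// qE.
Qed.

Lemma piecewise_poly0 l (Th : seq (vertices R d)) : piecewise_poly l Th (fun=> 0).
Proof. by move=> K _; exists (fun=> 0); [exact: poly_le0|]. Qed.

(** A piecewise polynomial is described by finitely many coefficients, indexed by simplex, component
    and multi-index. Among more than [#|J|] elements some nontrivial combination has all
    coefficients zero, hence vanishes on [C] and is null. *)
Lemma piecewise_finite_sdim (V : lmodType R) (X : set V) (B : V -> V -> R) (m l : nat)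
    (ev : 'I_m -> V -> pt -> R) (Th : seq (vertices R d)) (C : set pt) :
  C `<=` [set x | exists2 K, K \in Th & simplex K x] ->
  (forall N (v : 'I_N -> V) (a : 'I_N -> R) i x, ev i (lincomb v a) x = \sum_j a j * ev i (v j) x) ->
  (forall v i, X v -> piecewise_poly l Th (ev i v)) ->
  (forall v, (forall i x, C x -> ev i v x = 0) -> B v v = 0) ->
  exists N, finite_sdim X B N.
Proof.
move=> CT evL Xp B0.
pose J : finType := ('I_(size Th) * 'I_m * {ffun 'I_d -> 'I_l.+1})%type.
exists #|J| => v Xv.
have co i j K : K \in Th -> exists c : {ffun 'I_d -> 'I_l.+1} -> R, forall x, simplex K x ->
    ev i (v j) x = \sum_(a : {ffun 'I_d -> 'I_l.+1} | (\sum_i a i <= l)%N) c a * \prod_i x 0 i ^+ a i.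
  move=> KT; have [p [c pE] vp] := Xp _ i (Xv j) K KT; exists c => x xK.
  by rewrite vp ?inE// pE.
(* Coefficients are chosen for the given vectors only, and combined linearly afterwards; no linear
   choice on the whole space is made. *)
have [c cE] : exists c : 'I_#|J|.+1 -> J -> R, forall i j K x (KT : K \in Th), simplex K x ->
    ev i (v j) x = \sum_(a : {ffun 'I_d -> 'I_l.+1} | (\sum_i a i <= l)%N)
      c j (Ordinal (etrans (index_mem K Th) KT), i, a) * \prod_i x 0 i ^+ a i.
  have cn K : K \in Th -> nth K Th (index K Th) = K by move=> KT; exact: nth_index.
  have [K0|T0] := pselect (exists K0, K0 \in Th); last first.
    by exists (fun _ _ => 0) => i j K x KT; exfalso; apply: T0; exists K.
  case: K0 => K0 K0T.
  have ct (s : 'I_(size Th)) : nth K0 Th s \in Th by exact: mem_nth.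
  exists (fun j s => projT1 (cid (co s.1.2 j _ (ct s.1.1))) s.2) => i j K x KT xK /=.
  case: cid => c /= H; apply: H; rewrite nth_index//.
have [a a0 aE] := dependent_rows c (leqnn _).
exists a => //; apply: B0 => i x /CT[K KT xK].
rewrite evL; under eq_bigr => j _ do rewrite (cE i j K x KT xK) mulr_sumr.
rewrite exchange_big/= big1// => b _.
under eq_bigr => j _ do rewrite mulrA.
by rewrite -mulr_suml aE mul0r.
Qed.

End finite_dimension.

(** * Functions continuous on the closure of the domain *)

Section closure_continuity.
Variables (R : realType) (d : nat) (Omega : set 'rV[R]_d).
Notation pt := 'rV[R]_d.
Hypotheses (oO : open Omega) (bO : bounded_set Omega).
Implicit Types g : pt -> R.

Lemma bounded_open_fin : (@leb R d Omega < +oo)%E.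
Proof. by apply: leb_bounded_fin => //; exact: open_measurable_rV. Qed.

Lemma compact_closure_bounded : compact (closure Omega).
Proof.
have [M OM] := bounded_set_box bO.
apply: (subclosed_compact (@closed_closure _ _) (@compact_cbox _ _ (const_mx (- M)) (const_mx M))).
have : closure Omega `<=` closure (cbox (const_mx (- M)) (const_mx M)).
  by apply: closure_subset => x /OM; exact: box_sub_cbox.
by rewrite -((closure_id (cbox (const_mx (- M)) (const_mx M))).1 (@closed_cbox _ _ _ _)).
Qed.

Lemma within_continuous_open (U : topologicalType) (g : pt -> U) : {within closure Omega, continuous g} ->
  forall x, Omega x -> {for x, continuous g}.
Proof.
move=> cg x Ox; have := continuous_subspaceW (@subset_closure _ Omega) cg.
by rewrite continuous_open_subspace// => /(_ x); rewrite inE; exact.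
Qed.

Lemma within_bounded g : {within closure Omega, continuous g} ->
  exists2 C, 0 <= C & forall x, closure Omega x -> `|g x| <= C.
Proof. exact: continuous_bounded_on compact_closure_bounded. Qed.

Lemma within_msr g : {within closure Omega, continuous g} -> msr Omega g.
Proof. by move=> cg; apply: open_continuous_measurable_rV => //; exact: within_continuous_open. Qed.

Lemma within_L2s g : {within closure Omega, continuous g} -> L2s Omega g.
Proof.
move=> cg; have [C C0 gC] := within_bounded cg.
apply: (L2s_bounded oO bounded_open_fin (C := C)); first exact: within_msr.
by move=> x Ox; apply: gC; exact: subset_closure.
Qed.

(** A nonzero value inside [Omega] would persist on a nonempty open set, which has positive measure;
    boundary points follow by density. *)
Lemma within_eq0 g : {within closure Omega, continuous g} ->
  {ae @leb R d, forall x, Omega x -> g x = 0} -> forall x, closure Omega x -> g x = 0.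
Proof.
move=> cg [N [mN N0 gN]].
have oN : open [set z : R | z != 0] by exact: open_neq.
have gO x : Omega x -> g x = 0.
  move=> Ox; apply/eqP/negPn/negP => gx.
  have : \forall y \near x, Omega y /\ g y != 0.
    near=> y; split; first by near: y; exact: open_nbhs_nbhs.
    near: y; have /(within_continuous_open cg) := Ox.
    move=> /(_ [set z | z != 0]); apply; by apply: open_nbhs_nbhs; split.
  move=> nx; pose A := [set y | Omega y /\ g y != 0]°; have : (0 < @leb R d A)%E.
    by apply: leb_open_gt0; [exact: open_interior|exists x].
  rewrite lt_neqAle => /andP[/negP + _]; apply; rewrite eq_sym.
  have mi : measurable A by apply: open_measurable_rV; exact: open_interior.
  rewrite -measure_le0 -N0; apply: le_measure; rewrite ?inE//.
  move=> y /interior_subset [Oy gy]; apply: gN => /= H.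
  by move: gy; rewrite H ?eqxx.
move=> x cx; apply/eqP/negPn/negP => gx.
have /(_ x) cgx := cg; have : nbhs (g x) [set z | z != 0].
  by apply: open_nbhs_nbhs; split.
move=> /cgx; rewrite /nbhs /= /nbhs_subspace mem_set//= => H.
have [y [Oy Hy]] := cx _ H.
have : g y != 0 := Hy (subset_closure Oy).
by rewrite gO ?eqxx.
Unshelve. all: by end_near. Qed.

Lemma within_lin (U : normedModType R) (a : R) (u v : pt -> U) : {within closure Omega, continuous u} ->
  {within closure Omega, continuous v} -> {within closure Omega, continuous (a *: u + v)}.
Proof.
move=> cu cv x; apply: cvgD; last exact: cv.
by apply: cvgZr; exact: cu.
Qed.

Lemma within_coord m (u : pt -> 'rV[R]_m) i : {within closure Omega, continuous u} ->
  {within closure Omega, continuous (fun x => u x 0 i)}.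
Proof.
move=> cu x.
exact: (@continuous_comp (subspace (closure Omega)) _ _ u (fun M : 'rV[R]_m => M 0 i) x (cu x) (@coord_continuous _ _ _ _ _ _)).
Qed.

Lemma within_L2 m (u : pt -> 'rV[R]_m) : {within closure Omega, continuous u} -> L2 Omega u.
Proof. by move=> cu i j; rewrite ord1; apply: within_L2s; exact: within_coord. Qed.

Lemma within_ip_eq0 m (u : pt -> 'rV[R]_m) : {within closure Omega, continuous u} -> ip Omega u u = 0 ->
  forall x, closure Omega x -> u x = 0.
Proof.
move=> cu u0 x cx; have H := ip_eq0 oO bounded_open_fin (within_L2 cu) u0.
apply/rowP => i; rewrite mxE.
have H' : {ae @leb R d, forall y, Omega y -> u y 0 i = 0}.
  by apply: filterS H => y Hy Oy; rewrite Hy// mxE.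
exact: (within_eq0 (within_coord (i := i) cu) H' cx).
Qed.

Lemma within_ips_eq0 g : {within closure Omega, continuous g} -> ips Omega g g = 0 ->
  forall x, closure Omega x -> g x = 0.
Proof.
move=> cu u0; apply: within_eq0 => //.
exact: (ips_eq0 oO bounded_open_fin (within_L2s cu) u0).
Qed.

End closure_continuity.

Section discrete.
Variables (R : realType) (d : nat) (Omega : set 'rV[R]_d) (Th : seq (vertices R d)) (k : nat).
Notation pt := 'rV[R]_d.
Notation Hu := (Hu Omega Th k).
Notation Hp := (Hp Omega Th k : set (pt -> R^o)).
Notation Hw := (Hw Omega Th k).
Notation Kh := (Kh Omega Th k).
Hypotheses (oO : open Omega) (bO : bounded_set Omega) (tT : triangulation Omega Th).
Let fO := bounded_open_fin oO bO.

Lemma Hu_H10 v : Hu v -> H10 Omega v. Proof. by case. Qed.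
Lemma Hu_H1 v : Hu v -> Defs.H1 Omega v. Proof. by move=> /Hu_H10; exact: H10_H1. Qed.

Lemma Hu0 : Hu 0.
Proof.
split; [by move=> x; exact: cvg_cst| |exact: H10_0].
by move=> i; rewrite (_ : (fun x => _) = fun=> 0); [exact: piecewise_poly0|apply/funext => x; rewrite mxE].
Qed.

Lemma Hu_lin (a : R) u v : Hu u -> Hu v -> Hu (a *: u + v).
Proof.
move=> [cu pu hu] [cv pv hv]; split; [exact: within_lin| |exact: H10_lin].
by move=> i; have := piecewise_poly_lin a (pu i) (pv i); congr piecewise_poly; apply/funext => x; rewrite !mxE.
Qed.

Lemma Hw_L2 w : Hw w -> L2 Omega w. Proof. by move=> [cw _]; exact: within_L2. Qed.

Lemma Hw0 : Hw 0.
Proof.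
split; first by move=> x; exact: cvg_cst.
by move=> i; rewrite (_ : (fun x => _) = fun=> 0); [exact: piecewise_poly0|apply/funext => x; rewrite mxE].
Qed.

Lemma Hw_lin (a : R) u v : Hw u -> Hw v -> Hw (a *: u + v).
Proof.
move=> [cu pu] [cv pv]; split; first exact: within_lin.
by move=> i; have := piecewise_poly_lin a (pu i) (pv i); congr piecewise_poly; apply/funext => x; rewrite !mxE.
Qed.

Lemma Hp_L2s q : Hp q -> L2s Omega q. Proof. by case. Qed.

Lemma Hp0 : Hp 0.
Proof.
split; [by move=> x; exact: cvg_cst|exact: piecewise_poly0|exact: L2s0|].
by apply: (sip0l (sip_ips oO fO)); exact: L2s_cst.
Qed.

Lemma Hp_lin (a : R) p q : Hp p -> Hp q -> Hp (a *: (p : pt -> R^o) + q).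
Proof.
move=> [cp pp hp p0] [cq pq hq q0]; split.
- exact: (@within_lin _ _ _ R^o).
- exact: piecewise_poly_lin.
- exact: L2s_lin.
- by rewrite (sip_lin (sip_ips oO fO))// ?p0 ?q0 ?mulr0 ?addr0//; exact: L2s_cst.
Qed.

Lemma sip_Hu B : sip (Defs.H1 Omega (m := d)) B -> sip Hu B.
Proof. by move=> S; apply: (sip_sub S); [by move=> v; exact: Hu_H1|exact: Hu0|exact: Hu_lin]. Qed.

Lemma sip_Hw : sip Hw (@Defs.ip R d Omega 1 (nvort d)).
Proof. by apply: (sip_sub (sip_ip oO fO _ _)); [by move=> w; exact: Hw_L2|exact: Hw0|exact: Hw_lin]. Qed.

Lemma sip_Hp : @sip R (pt -> R^o) Hp (ips Omega).
Proof. by apply: (sip_sub (sip_ips oO fO)); [by move=> q; exact: Hp_L2s|exact: Hp0|exact: Hp_lin]. Qed.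

Let clT : closure Omega `<=` [set x | exists2 K, K \in Th & simplex K x].
Proof. by case: tT => _ _ -> _ _. Qed.

Lemma lincomb_row N m (v : 'I_N -> pt -> 'rV[R]_m) (a : 'I_N -> R) i x :
  (lincomb v a) x 0 i = \sum_j a j * v j x 0 i.
Proof. by rewrite /lincomb fct_sumE summxE; apply: eq_bigr => j _; rewrite mxE. Qed.

Lemma Hu_finite_sdim (X : set (field R d)) theta : 0 <= theta -> X `<=` Hu ->
  exists N, finite_sdim X (@eH R d Omega theta d) N.
Proof.
move=> t0 XH; have S := sip_eH oO fO d t0.
apply: (@piecewise_finite_sdim _ _ (field R d) X _ d k.+1 (fun i u x => u x 0 i) Th _ clT).
- by move=> N v a i x; exact: lincomb_row.
- by move=> u i /XH[].
- move=> u u0; have u0' x : Omega x -> u x = (0 : field R d) x.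
    by move=> Ox; apply/rowP => i; rewrite u0 ?mxE//; exact: subset_closure.
  have <- : @eH R d Omega theta d 0 0 = 0 by apply: (sip0l S); exact: (sip0 S).
  by rewrite /eH (gradE oO fO u0') (eq_ip oO fO u0' u0').
Qed.

Lemma Hw_finite_sdim : exists N, finite_sdim Hw (@Defs.ip R d Omega 1 (nvort d)) N.
Proof.
apply: (@piecewise_finite_sdim _ _ (pt -> 'rV[R]_(nvort d)) _ _ (nvort d) k (fun i w x => w x 0 i) Th _ clT).
- by move=> N v a i x; exact: lincomb_row.
- by move=> w i [].
- move=> w w0; have w0' x : Omega x -> w x = (0 : pt -> 'rV[R]_(nvort d)) x.
    by move=> Ox; apply/rowP => i; rewrite w0 ?mxE//; exact: subset_closure.
  rewrite (eq_ip oO fO w0' w0'); apply: (sip0l (sip_ip oO fO _ _)); exact: L20.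
Qed.

Lemma Hp_finite_sdim : exists N, @finite_sdim R (pt -> R^o) Hp (ips Omega) N.
Proof.
apply: (@piecewise_finite_sdim _ _ (pt -> R^o) _ _ 1 k (fun (i : 'I_1) q => q) Th _ clT) => [N v a i x|q i []//|q q0].
- by rewrite /lincomb fct_sumE.
- rewrite (eq_ips oO fO (f' := fun=> 0) (g' := fun=> 0)).
    by apply: (sip0l (sip_ips oO fO)); exact: L2s0.
  by move=> x Ox; rewrite (q0 ord0) ?mul0r//; exact: subset_closure.
Qed.

End discrete.

(** * An abstract semidiscrete problem *)

Section bounded_functionals.
Variables (R : realType) (V : lmodType R) (X : set V) (B : V -> V -> R) (S : sip X B).
Implicit Types l : V -> R.

Definition lin l : Prop := forall a u v, X u -> X v -> l (a *: u + v) = a * l u + l v.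

Lemma lin0 l : lin l -> l 0 = 0.
Proof.
move=> L; have := L 1 0 0 (sip0 S) (sip0 S); rewrite scale1r addr0 mul1r => /eqP.
by rewrite -subr_eq0 opprD addrA subrr sub0r oppr_eq0 => /eqP.
Qed.

Lemma linB l u v : lin l -> X u -> X v -> l (u - v) = l u - l v.
Proof. by move=> L Xu Xv; rewrite addrC -scaleN1r L// mulN1r addrC. Qed.

Lemma lin_lincomb l n (e : 'I_n -> V) c : lin l -> (forall i, X (e i)) ->
  l (lincomb e c) = \sum_i c i * l (e i).
Proof.
move=> L Xe; rewrite /lincomb; suff [] : X (\sum_i c i *: e i) /\ l (\sum_i c i *: e i) = \sum_i c i * l (e i) by [].
apply: (big_ind2 (fun v y => X v /\ l v = y)) => [|u x v y [Xu <-] [Xv <-]|i _].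
- by split; [exact: (sip0 S)|exact: lin0].
- by split; [exact: (sipD S)|rewrite -[u]scale1r L// mul1r scale1r].
- split; first exact: (sipZ S).
  by have := L (c i) _ _ (Xe i) (sip0 S); rewrite addr0 (lin0 L) addr0.
Qed.

(** Bounded functionals do not see null vectors; this is how identities hold although bases only
    span modulo null vectors. *)
Lemma bounded_lin_eq l M u v : lin l -> (forall v, X v -> `|l v| <= M * snorm B v) ->
  X u -> X v -> B (u - v) (u - v) = 0 -> l u = l v.
Proof.
move=> L lM Xu Xv uv; apply/eqP; rewrite -subr_eq0 -linB// -normr_le0.
by apply: le_trans (lM _ (sipB S Xu Xv)) _; rewrite /snorm uv sqrtr0 mulr0.
Qed.

Variables (n : nat) (e : 'I_n -> V).
Hypotheses (oe : orthonormal X B e) (ce : complete X B e).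

Lemma bounded_lin_complete l M v : lin l -> (forall v, X v -> `|l v| <= M * snorm B v) ->
  X v -> l v = \sum_i B v (e i) * l (e i).
Proof.
move=> L lM Xv; rewrite -lin_lincomb//; last by case: oe.
apply: (bounded_lin_eq L lM) => //; last exact: ce.
by apply: (lincombP S); case: oe.
Qed.

(** Test [l] with its own Riesz representative, the combination of the basis with coefficients
    [l (e i)]. *)
Lemma dual_norm_le l M : 0 <= M -> lin l -> (forall v, X v -> `|l v| <= M * snorm B v) ->
  \sum_i l (e i) ^+ 2 <= M ^+ 2.
Proof.
move=> M0 L lM; have [Xe _] := oe; set s := \sum_i _.
have s0 : 0 <= s by apply: sumr_ge0 => i _; exact: sqr_ge0.
have E : l (lincomb e (fun i => l (e i))) = s.
  by rewrite lin_lincomb//; apply: eq_bigr => i _; rewrite expr2.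
have := lM _ (lincombP S (fun i => l (e i)) Xe).
rewrite E /snorm (orthonormal_norm S _ oe) -/s ger0_norm// => H.
have q0 := sqrtr_ge0 s; have : Num.sqrt s <= M.
  have [->//|sn] := eqVneq (Num.sqrt s) 0.
  have sp : 0 < Num.sqrt s by rewrite lt_neqAle eq_sym sn.
  by move: H; rewrite -{1}(sqr_sqrtr s0) expr2 ler_pM2r.
by move=> sM; rewrite -(sqr_sqrtr s0) ler_sqr ?nnegrE.
Qed.

Lemma lin_coord_ub c v : X v -> `|\sum_i c i * B v (e i)| <= Num.sqrt (\sum_i c i ^+ 2) * snorm B v.
Proof.
move=> Xv; have [Xe _] := oe.
have -> : \sum_i c i * B v (e i) = B v (lincomb e c) by rewrite (sip_lincombr S).
rewrite mulrC -(orthonormal_norm S c oe); apply: (cauchy_schwarz S) => //.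
exact: (lincombP S).
Qed.

End bounded_functionals.

Section null_vectors.
Variables (R : realType) (V : lmodType R) (X : set V) (B : V -> V -> R) (S : sip X B).

Lemma sip0r z : X z -> B z 0 = 0.
Proof. by move=> Xz; rewrite (sipC S Xz (sip0 S)) (sip0l S Xz). Qed.

Lemma null_trans x y z : X x -> X y -> X z -> B (x - z) (x - z) = 0 -> B (y - z) (y - z) = 0 ->
  B (x - y) (x - y) = 0.
Proof.
move=> Xx Xy Xz xz yz; have Xxy := sipB S Xx Xy; have Xxz := sipB S Xx Xz; have Xyz := sipB S Xy Xz.
have -> : B (x - y) (x - y) = B ((x - z) - (y - z)) (x - y) by rewrite opprB addrA subrK.
by rewrite (sipBl S Xxz Xyz Xxy) (sip_eq0l S Xxz Xxy xz) (sip_eq0l S Xyz Xxy yz) subrr.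
Qed.

End null_vectors.

(** * The evolution problem over abstract spaces *)

Section semidiscrete.
Variables (R : realType) (T : R).
Notation mu := (@lebesgue_measure R).
Notation TR := (measurableTypeR R).
Hypothesis T0 : 0 < T.
Variables V W P : lmodType R.
Variables (Hu : set V) (Hw : set W) (Hp : set P).
Variables (H E : V -> V -> R) (LW : W -> W -> R) (LP : P -> P -> R).
Hypotheses (SH : sip Hu H) (SE : sip Hu E) (SW : sip Hw LW) (SP : sip Hp LP).
Notation nH := (snorm H).
Variables (nrm : V -> R).
Hypotheses (nrm0 : forall v, 0 <= nrm v) (nrmE : forall v, Hu v -> nrm v = nH v).
Variables (a b : R).
Hypotheses (a0 : 0 <= a) (b0 : 0 <= b).
Hypothesis EH : forall v, Hu v -> snorm E v <= a * nH v.
Hypothesis HE : forall v, Hu v -> nH v <= b * snorm E v.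
Variables (bb : V -> P -> R) (cw : W -> V -> R) (cb cc : R).
Hypotheses (bl : forall q, Hp q -> lin Hu (bb^~ q)) (br : forall v, Hu v -> lin Hp (bb v)).
Hypothesis bM : forall v q, Hu v -> Hp q -> `|bb v q| <= cb * nH v * snorm LP q.
Hypotheses (cl : forall w, Hw w -> lin Hu (cw w)) (cr : forall v, Hu v -> lin Hw (cw^~ v)).
Hypotheses (cc0 : 0 <= cc) (cM : forall w v, Hw w -> Hu v -> `|cw w v| <= cc * snorm LW w * nH v).
Definition divfree : set V := [set v | Hu v /\ forall q, Hp q -> bb v q = 0].
Notation Kh := divfree.
Variables (Nf : V -> V -> R) (nu c1 c2 c3 r : R).
Hypothesis nu_gt0 : 0 < nu.
Hypotheses (c10 : 0 <= c1) (c20 : 0 <= c2) (c30 : 0 <= c3).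
Hypothesis Nl : forall u, Hu u -> lin Hu (Nf u).
Hypothesis N_ge0 : forall u, Hu u -> 0 <= Nf u u.
(** In the application the three terms bound the linear drag, the convection and the Forchheimer
    term, with [r = rho - 1]. *)
Definition growth (s : R) : R := c1 * s + c2 * s ^+ 2 + c3 * s `^ r.
Hypothesis N_le : forall u v, Hu u -> Hu v -> `|Nf u v| <= growth (nH u) * nH v.
Hypothesis N_lip : forall n (e : 'I_n -> V), (forall i, Hu (e i)) -> forall v, Hu v ->
  loclip (fun c : 'rV[R]_n => Nf (lincomb e (fun i => c 0 i)) v).
Hypothesis N_eq : forall u u' v, Hu u -> Hu u' -> Hu v -> H (u - u') (u - u') = 0 -> Nf u v = Nf u' v.
Variables (nh nk nw np : nat) (h : 'I_nh -> V) (k : 'I_nk -> V) (hw : 'I_nw -> W) (hp : 'I_np -> P).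
Hypotheses (oh : orthonormal Hu H h) (ch : complete Hu H h).
Hypotheses (ok : orthonormal Kh E k) (ck : complete Kh E k).
Hypotheses (ow : orthonormal Hw LW hw) (cow : complete Hw LW hw).
Hypotheses (op : orthonormal Hp LP hp) (cp : complete Hp LP hp).

Let nu0 : 0 <= nu. Proof. exact: ltW. Qed.
Let KH : Kh `<=` Hu. Proof. by move=> v []. Qed.

Let SK : sip Kh E.
Proof.
apply: (sip_sub SE) => //.
  by split => [|q Hq]; [exact: (sip0 SH)|exact: (lin0 SH (bl Hq))].
move=> c x y [Hx bx] [Hy by_]; split; first exact: (sipP SH).
by move=> q Hq; rewrite (bl Hq)// bx// by_// mulr0 addr0.
Qed.

Let Hh j : Hu (h j). Proof. by case: oh. Qed.
Let Kk j : Kh (k j). Proof. by case: ok. Qed.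
Let Hk j : Hu (k j). Proof. exact: KH. Qed.

(** The Riesz representative in [Hw] of [psi |-> cw psi u]. Testing the weak equation with a zero
    velocity forces the vorticity to equal it up to a null vector. *)
Definition wproj (u : V) : W := lincomb hw (fun i => cw (hw i) u).

Lemma wprojP u : Hw (wproj u).
Proof. by apply: (lincombP SW); case: ow. Qed.

Lemma wproj_spec u psi : Hu u -> Hw psi -> LW (wproj u) psi = cw psi u.
Proof.
move=> Hu_ Hpsi; rewrite (bounded_lin_complete SW ow cow (cr Hu_) (M := cc * nH u) _ Hpsi); last first.
  by move=> v Hv; apply: le_trans (cM Hv Hu_) _; rewrite mulrAC.
have [Hhw _] := ow; rewrite (sip_lincombl SW)//; apply: eq_bigr => i _.
by rewrite mulrC (sipC SW).
Qed.

Lemma snorm_wproj u : Hu u -> snorm LW (wproj u) <= cc * nH u.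
Proof.
move=> Hu_; have HP := wprojP u.
have [->|n0] := eqVneq (snorm LW (wproj u)) 0; first by rewrite mulr_ge0// sqrtr_ge0.
have np_ : 0 < snorm LW (wproj u) by rewrite lt_neqAle eq_sym n0 sqrtr_ge0.
rewrite -(ler_pM2l np_) -expr2 (snorm2 SW)// wproj_spec//.
apply: le_trans (ler_norm _) _; apply: le_trans (cM HP Hu_) _.
by rewrite mulrCA mulrA [cc * _]mulrC.
Qed.

Lemma wproj_cw u v : Hu u -> Hu v -> `|cw (wproj u) v| <= cc ^+ 2 * nH u * nH v.
Proof.
move=> Hu_ Hv; apply: le_trans (cM (wprojP u) Hv) _.
rewrite ler_wpM2r ?sqrtr_ge0// expr2 -mulrA ler_wpM2l//; exact: snorm_wproj.
Qed.

Lemma wproj_unique u w : Hu u -> Hw w -> (forall psi, Hw psi -> LW w psi = cw psi u) ->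
  LW (w - wproj u) (w - wproj u) = 0.
Proof.
move=> Hu_ Hw_ wP; have Hd := sipB SW Hw_ (wprojP u).
by rewrite (sipBl SW)//; [rewrite wP// wproj_spec// subrr|exact: wprojP].
Qed.

(** A rank argument: the row of values [l (h j)] is in the row space of the divergence matrix if it
    is annihilated by the cokernel. The inf-sup condition enters later, for the bound and the
    uniqueness of the pressure. *)
Lemma pressure_exists l M : lin Hu l -> (forall v, Hu v -> `|l v| <= M * nH v) ->
  (forall v, Kh v -> l v = 0) -> exists2 p, Hp p & forall v, Hu v -> bb v p = l v.
Proof.
move=> L lM lK; have [Hhp _] := op.
pose Bm : 'M[R]_(np, nh) := \matrix_(i, j) bb (h j) (hp i).
pose lr : 'rV[R]_nh := \row_j l (h j).
have sub : (lr <= Bm)%MS.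
  (* Each column of the cokernel holds the coordinates of a discretely divergence-free field, on
     which [l] vanishes. *)
  rewrite submxE; apply/eqP/matrixP => i m; rewrite mxE [RHS]mxE.
  set cok := cokermx Bm; have Kv : Kh (lincomb h (cok^~ m)).
    have Hv : Hu (lincomb h (cok^~ m)) by exact: (lincombP SH).
    split=> // q Hq; rewrite (bounded_lin_complete SP op cp (br Hv) (M := cb * nH (lincomb h (cok^~ m))) _ Hq); last first.
      by move=> q' Hq'; exact: bM.
    rewrite big1// => i' _; rewrite (lin_lincomb SH _ (bl (Hhp i')))//.
    have := mulmx_coker Bm => /matrixP/(_ i' m); rewrite !mxE -/cok => B0.
    rewrite (_ : \sum_i0 _ = 0) ?mulr0// -[RHS]B0; apply: eq_bigr => j _.
    by rewrite [Bm i' j]mxE mulrC.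
  have := lK _ Kv; rewrite (lin_lincomb SH _ L)// => L0; rewrite -[RHS]L0.
  by apply: eq_bigr => j _; rewrite [lr i j]mxE mulrC.
have [y yE] := submxP sub.
pose p := lincomb hp (fun i => y 0 i).
have Hpp : Hp p by exact: (lincombP SP).
exists p => // v Hv.
have E1 : bb v p = \sum_j H v (h j) * bb (h j) p.
  apply: (bounded_lin_complete SH oh ch (bl Hpp) (M := cb * snorm LP p)) => // u Hu_.
  by apply: le_trans (bM Hu_ Hpp) _; rewrite mulrAC.
rewrite E1 (bounded_lin_complete SH oh ch L lM Hv); apply: eq_bigr => j _; congr (_ * _).
rewrite (lin_lincomb SP _ (br (Hh j)))//; have /rowP/(_ j) := yE; rewrite !mxE => ->.
by apply: eq_bigr => i _; rewrite mxE.
Qed.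

Variables (f : R -> V -> R) (Nn : R -> R) (gH : 'I_nh -> R -> R).
Hypotheses (cgH : forall j, continuous (gH j)) (Nn0 : forall t, 0 <= Nn t).
Hypothesis fl : {ae mu, forall t : TR, 0 < t < T ->
  lin Hu (f t) /\ forall v, Hu v -> `|f t v| <= Nn t * nH v}.
Hypothesis fg : forall j, {ae mu, forall t : TR, 0 < t < T -> f t (h j) = gH j t}.

Definition load t v : R := \sum_j gH j t * H v (h j).
(** The squared norm of [load t] as a functional on [Hu], since [h] is orthonormal for [H]. Unlike
    [Nn], it is continuous. *)
Definition Gam t : R := \sum_j gH j t ^+ 2.

Lemma Gam_ge0 t : 0 <= Gam t. Proof. by apply: sumr_ge0 => j _; exact: sqr_ge0. Qed.

Lemma Gam_continuous : continuous Gam.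
Proof. by apply: continuous_fsum => j; apply: continuous_sqr; exact: cgH. Qed.

Lemma load_lin t : lin Hu (load t).
Proof.
move=> c u v Hu_ Hv; rewrite mulr_sumr -big_split/=; apply: eq_bigr => j _.
by rewrite (sip_lin SH)//; ring.
Qed.

Lemma load_le t v : Hu v -> `|load t v| <= Num.sqrt (Gam t) * nH v.
Proof. exact: (lin_coord_ub SH oh). Qed.

Lemma load_continuous v : continuous (load^~ v).
Proof.
apply: continuous_fsum => j t; apply: cvgM; [exact: cgH|exact: cvg_cst].
Qed.

Lemma fg_all : {ae mu, forall t : TR, 0 < t < T -> forall j, f t (h j) = gH j t}.
Proof.
have : {ae mu, forall t : TR, forall j, 0 < t < T -> f t (h j) = gH j t}.
  have := @filter_forall TR _ (fun j t => 0 < t < T -> f t (h j) = gH j t) (almost_everywhere mu) _ fg.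
  by apply.
by apply: filterS => t Ht tT j; exact: Ht.
Qed.

(** A single null set of times serves all [v], because finitely many basis fields determine the
    functional on [Hu]. *)
Lemma load_ae : {ae mu, forall t : TR, 0 < t < T -> forall v, Hu v -> f t v = load t v}.
Proof.
apply: filterS2 fl fg_all => t H1 H2 tT v Hv; have [fL fB] := H1 tT.
rewrite (bounded_lin_complete SH oh ch fL fB Hv); apply: eq_bigr => j _.
by rewrite (H2 tT) mulrC.
Qed.

Lemma Gam_ae : {ae mu, forall t : TR, 0 < t < T -> Gam t <= Nn t ^+ 2}.
Proof.
apply: filterS2 fl fg_all => t H1 H2 tT; have [fL fB] := H1 tT.
rewrite /Gam; under eq_bigr do rewrite -(H2 tT).
exact: (dual_norm_le SH oh).
Qed.

Definition Uc (c : 'rV[R]_nk) : V := lincomb k (fun j => c 0 j).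
Definition field_c (i : 'I_nk) (c : 'rV[R]_nk) : R := Nf (Uc c) (k i) + nu * cw (wproj (Uc c)) (k i).

Lemma KUc c : Kh (Uc c). Proof. exact: (lincombP SK). Qed.
Lemma HUc c : Hu (Uc c). Proof. exact/KH/KUc. Qed.

Lemma loclip_cwproj v : Hu v -> loclip (fun c => cw (wproj (Uc c)) v).
Proof.
move=> Hv; have [Hhw _] := ow.
have -> : (fun c => cw (wproj (Uc c)) v) =
    fun c : 'rV[R]_nk => \sum_l (\sum_j (c 0 j * cw (hw l) (k j))) * cw (hw l) v.
  apply/funext => c; rewrite (lin_lincomb SW _ (cr Hv))//; apply: eq_bigr => l _.
  by rewrite (lin_lincomb SH _ (cl (Hhw l))).
apply: loclip_sum => l; apply: loclipM; last exact: loclip_cst.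
by apply: loclip_sum => j; apply: loclipM; [exact: loclip_coord|exact: loclip_cst].
Qed.

Lemma loclip_field i : loclip (field_c i).
Proof.
apply: loclipD; first exact: N_lip.
by apply: loclipM; [exact: loclip_cst|exact: loclip_cwproj].
Qed.

(** Paired with its argument, the projected vorticity contributes [nu] times its own squared norm,
    by [wproj_spec]. *)
Lemma field_ge0 (c : 'rV[R]_nk) : 0 <= \sum_i c 0 i * field_c i c.
Proof.
have HU := HUc c; have -> : \sum_i c 0 i * field_c i c = Nf (Uc c) (Uc c) + nu * LW (wproj (Uc c)) (wproj (Uc c)).
  rewrite (wproj_spec HU (wprojP _)) [in Nf _ (Uc c)]/Uc [in cw _ (Uc c)]/Uc.
  rewrite (lin_lincomb SH _ (Nl HU))// (lin_lincomb SH _ (cl (wprojP _)))// mulr_sumr -big_split/=.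
  by apply: eq_bigr => i _; rewrite /field_c; ring.
by rewrite addr_ge0 ?N_ge0// mulr_ge0// (sip_ge0 SW)//; exact: wprojP.
Qed.

Lemma growth_ge0 s : 0 <= s -> 0 <= growth s.
Proof. by move=> s0; rewrite /growth !addr_ge0// mulr_ge0// ?sqr_ge0 ?powR_ge0. Qed.

Definition rate (s : R) : R := growth s + nu * cc ^+ 2 * s.

Lemma rate_ge0 s : 0 <= s -> 0 <= rate s.
Proof. by move=> s0; rewrite addr_ge0 ?growth_ge0// !mulr_ge0// sqr_ge0. Qed.

Let N_cw_le u v : Hu u -> Hu v -> `|Nf u v + nu * cw (wproj u) v| <= rate (nH u) * nH v.
Proof.
move=> Hu_ Hv; apply: le_trans (ler_normD _ _) _; rewrite /rate mulrDl; apply: lerD; first exact: N_le.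
rewrite normrM (ger0_norm nu0) (_ : _ * nH v = nu * (cc ^+ 2 * nH u * nH v)); last by ring.
by rewrite ler_wpM2l//; exact: wproj_cw.
Qed.

Let N_cw_lin u : Hu u -> lin Hu (fun v => Nf u v + nu * cw (wproj u) v).
Proof. by move=> Hu_ c v w Hv Hw_; rewrite (Nl Hu_)// (cl (wprojP u))//; ring. Qed.

Variables (beta : R) (uh0 : V).
Hypothesis infsup : forall q M, Hp q -> 0 <= M -> (forall v, Hu v -> `|bb v q| <= M * nH v) ->
  beta * snorm LP q <= M.
Hypothesis Kuh0 : Kh uh0.

(** The estimates are stated with the equivalence constants [a], [b] between [H] and [E], and with
    [Gam]; nothing in them depends on the chosen bases except through [Gam], which is later bounded
    by the dual norm of the data. *)
Theorem semidiscrete_exists : exists (u : R -> V) (p : R -> P), [/\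
  forall t, Kh (u t) /\ Hp (p t),
  [/\ W1q T Hu nrm +oo%E u, E (u 0 - uh0) (u 0 - uh0) = 0 &
    forall t eps, 0 < eps -> exists2 delta, 0 < delta & forall s, `|s - t| < delta -> nH (u s - u t) < eps],
  forall t, 0 < t < T -> exists2 du, Hu du & forall v, Hu v -> isd (fun s => E (u s) v) t (E du v) /\
    E du v + Nf (u t) v + nu * cw (wproj (u t)) v + bb v (p t) = load t v,
  forall t, 0 <= t <= T -> nH (u t) ^+ 2 <= b ^+ 2 * (expR t * (E uh0 uh0 + b ^+ 2 * \int[mu]_(s in `[0, T]) Gam s)) &
  forall t, beta * snorm LP (p t) <= (1 + a * b) * (Num.sqrt (Gam t) + rate (nH (u t)))].
Proof.
have lfield i := loclip_field i.
have cload i : continuous (fun t => load t (k i)) by exact: load_continuous.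
have [x [cx x0 dx xle]] := ode_exists T0 (fun i => E uh0 (k i)) lfield field_ge0 cload.
pose u t := Uc (row_at x t).
have uE t : u t = lincomb k (x^~ t) by rewrite /u /Uc; congr lincomb; apply/funext => j; rewrite mxE.
pose dxc i t := load t (k i) - field_c i (row_at x t).
have cdx i : continuous (dxc i).
  by move=> t; apply: cvgB; [exact: load_continuous|exact: (loclip_curve (lfield i) cx)].
pose K t := Num.sqrt (Gam t) + rate (nH (u t)).
have K0 t : 0 <= K t by rewrite addr_ge0 ?sqrtr_ge0// rate_ge0// sqrtr_ge0.
pose l t v := load t v - (Nf (u t) v + nu * cw (wproj (u t)) v).
have Ku t : Kh (u t) by exact: KUc.
have Hut t : Hu (u t) by exact: HUc.
have ll t : lin Hu (l t).
  by move=> c v w Hv Hw_; rewrite /l (load_lin t)// (N_cw_lin (Hut t))//; ring.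
have lK t v : Hu v -> `|l t v| <= K t * nH v.
  move=> Hv; apply: le_trans (ler_normB _ _) _; rewrite mulrDl; apply: lerD; first exact: load_le.
  exact: N_cw_le.
have llK t : lin Kh (l t) by move=> c v w [Hv _] [Hw_ _]; exact: ll.
have lKK t v : Kh v -> `|l t v| <= K t * b * snorm E v.
  move=> [Hv _]; apply: le_trans (lK t v Hv) _; rewrite -mulrA ler_wpM2l//; exact: HE.
have dxcE i t : dxc i t = l t (k i) by [].
(* The time derivative is the [E]-representative of the residual [l t] on [Kh], so its [E]-norm is
   at most [K t * b]. *)
pose du t := lincomb k (dxc^~ t).
have Kdu t : Kh (du t) by exact: (lincombP SK).
have Hdu t : Hu (du t) by exact: KH.
have ndu t : snorm E (du t) <= K t * b.
  have Kb : 0 <= K t * b by rewrite mulr_ge0.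
  rewrite /snorm (orthonormal_norm SK _ ok) -(ger0_norm Kb) -sqrtr_sqr; apply: ler_wsqrtr.
  exact: (dual_norm_le SK ok Kb (llK t) (lKK t)).
(* The 1 bounds the residual itself; [a * b] bounds the time derivative, through [b] on the solution
   side and [a] on the test side. *)
have lE t v : Hu v -> `|l t v - E (du t) v| <= (1 + a * b) * K t * nH v.
  move=> Hv; apply: le_trans (ler_normB _ _) _.
  rewrite (_ : (1 + a * b) * K t * nH v = K t * nH v + K t * b * (a * nH v)); last by ring.
  apply: lerD; first exact: lK.
  apply: le_trans (cauchy_schwarz SE (Hdu t) Hv) _.
  by apply: ler_pM; rewrite ?sqrtr_ge0//; exact: EH.
have pex t : exists2 q, Hp q & forall v, Hu v -> bb v q = l t v - E (du t) v.
  apply: (@pressure_exists _ ((1 + a * b) * K t)) => [c v w Hv Hw_|v|v Kv]; last 2 first.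
  - exact: lE.
  - have [Hv _] := Kv; apply/eqP; rewrite subr_eq0 (sipC SE)//; apply/eqP.
    rewrite (bounded_lin_complete SK ok ck (llK t) (lKK t) Kv) /du (sip_lincombr SE)//.
    by apply: eq_bigr => i _; rewrite mulrC.
  - rewrite (ll t)// (sipDr SE)//; last exact: (sipZ SE).
    by rewrite (sipZr SE)//; ring.
pose p t := projT1 (cid2 (pex t)).
have Hpt t : Hp (p t) by rewrite /p; case: cid2.
have bp t v : Hu v -> bb v (p t) = l t v - E (du t) v.
  by rewrite /p; case: cid2 => q ? /= Hq; exact: Hq.
exists u, p; split => //.
- split.
  + have uE' : u = fun t => \sum_i x i t *: k i by apply/funext => t; rewrite uE.
    rewrite uE'; apply: (@W1q_curve _ T V Hu nrm T0 (sip0 SH) (sipP SH) nrm0 _ k (\sum_i nH (k i)) Hk _ x dxc cx cdx dx) => c.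
    rewrite nrmE; last exact: (lincombP SH).
    have H1 := snorm_sum SH (index_enum _) xpredT (F := fun i => c i *: k i) (fun i => sipZ SH (c i) (Hk i)).
    apply: le_trans H1 _; rewrite mulrC mulr_suml; apply: ler_sum => i _; rewrite (snormZ SH)// ler_wpM2l//.
    by rewrite (bigD1 i)//= lerDl sumr_ge0// => j _; exact: sqrtr_ge0.
  + have := ck Kuh0; rewrite /= uE => H0.
    have Kl : Hu (lincomb k (fun i => E uh0 (k i))) by exact: (lincombP SE).
    have Hd := sipB SE (KH Kuh0) Kl.
    have -> : lincomb k (x^~ 0) - uh0 = - (uh0 - lincomb k (fun i => E uh0 (k i))).
      by rewrite opprB; congr (lincomb k _ - _); apply/funext => i; exact: x0.
    by rewrite (sipNl SE Hd (sipN SE Hd)) (sipC SE Hd (sipN SE Hd)) (sipNl SE Hd Hd) opprK; exact: H0.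
  + move=> t eps e0; pose S s := \sum_i `|x i s - x i t| * nH (k i).
    have cS : continuous S.
      apply: continuous_fsum => i s; apply: cvgM; last exact: cvg_cst.
      by apply: cvg_norm; apply: cvgB; [exact: cx|exact: cvg_cst].
    have St : S t = 0 by rewrite /S big1// => i _; rewrite subrr normr0 mul0r.
    have /cvgrPdist_lt/(_ _ e0) := cS t; rewrite St => /nbhs_ballP[delta d0 Hd].
    exists delta => // s st.
    have := Hd s; rewrite /ball/= distrC => /(_ st); rewrite sub0r normrN ger0_norm; last first.
      by apply: sumr_ge0 => i _; rewrite mulr_ge0// sqrtr_ge0.
    apply: le_lt_trans; rewrite !uE /lincomb -sumrB; under eq_bigr do rewrite -scalerBl.
    have H1 := snorm_sum SH (index_enum _) xpredT (F := fun i => (x i s - x i t) *: k i) (fun i => sipZ SH _ (Hk i)).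
    apply: le_trans H1 _; by apply: ler_sum => i _; rewrite (snormZ SH).
- move=> t tT; exists (du t) => // v Hv; split.
    have E1 s : E (u s) v = \sum_i x i s * E (k i) v by rewrite uE (sip_lincombl SE).
    have E2 : E (du t) v = \sum_i dxc i t * E (k i) v by rewrite (sip_lincombl SE).
    rewrite E2; apply: (isd_eq (isd_sum _ _)) => [i|s|]; last by [].
      by apply: (isd_eq (isdM (dx i t tT) (isd_cst (E (k i) v) t))) => //; rewrite mulr0 addr0 mulrC.
    by rewrite E1.
  by rewrite bp// /l; ring.
- move=> t tT; apply: (@le_trans _ _ ((b * snorm E (u t)) ^+ 2)).
    by rewrite ler_sqr ?nnegrE ?mulr_ge0// ?sqrtr_ge0//; exact: HE.
  rewrite exprMn (snorm2 SE)// uE (orthonormal_norm SK _ ok) ler_wpM2l ?sqr_ge0//.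
  apply: le_trans (xle t tT) _; rewrite ler_wpM2l ?expR_ge0//; apply: lerD.
    rewrite -(snorm2 SK Kuh0); apply: (dual_norm_le SK ok (l := E uh0)); first exact: sqrtr_ge0.
      move=> c v w Kv Kw; rewrite (sipDr SK)//; last exact: (sipZ SK).
      by rewrite (sipZr SK).
    by move=> v Kv; exact: (cauchy_schwarz SK).
  have cI (g : R -> R) : continuous g -> mu.-integrable `[0, T] (EFin \o g).
    by move=> cg; apply: continuous_compact_integrable; [exact: segment_compact|exact: continuous_subspaceT].
  rewrite -RintegralZl//; last exact: (cI _ Gam_continuous).
  apply: le_Rintegral => //.
  + by apply: cI; apply: continuous_fsum => i; apply: continuous_sqr; exact: load_continuous.
  + by apply: cI => s; apply: cvgM; [exact: cvg_cst|exact: Gam_continuous].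
  (* On [Kh] with the [E]-norm the functional [load s] has norm at most [b] times its [H]-norm,
     which explains the inner [b ^+ 2]. *)
  + move=> s _; have -> : b ^+ 2 * Gam s = (Num.sqrt (Gam s) * b) ^+ 2.
      by rewrite exprMn sqr_sqrtr ?Gam_ge0// mulrC.
    apply: (dual_norm_le SK ok); first by rewrite mulr_ge0// sqrtr_ge0.
      by move=> c v w [Hv _] [Hw_ _]; exact: load_lin.
    move=> v [Hv _]; apply: le_trans (load_le s Hv) _.
    by rewrite -mulrA ler_wpM2l ?sqrtr_ge0//; exact: HE.
- move=> t; apply: (infsup (Hpt t)); first exact: (mulr_ge0 (addr_ge0 ler01 (mulr_ge0 a0 b0)) (K0 t)).
  by move=> v Hv; rewrite bp//; exact: lE.
Qed.

Definition weak_solution (u : R -> V) (w : R -> W) (p : R -> P) : Prop := [/\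
  forall t, 0 <= t <= T -> [/\ Hu (u t), Hw (w t) & Hp (p t)],
  W1q T Hu nrm +oo%E u,
  forall t, 0 <= t <= T -> forall eps, 0 < eps -> exists2 delta, 0 < delta &
    forall s, 0 <= s <= T -> `|s - t| < delta -> nH (u s - u t) < eps,
  E (u 0 - uh0) (u 0 - uh0) = 0 &
  {ae mu, forall t : TR, 0 < t < T ->
    (forall v psi, Hu v -> Hw psi -> derivable (fun s : R => E (u s) v : R^o) t 1 /\
      derive1 (fun s : R => E (u s) v : R^o) t + Nf (u t) v + nu * LW (w t) psi + nu * cw (w t) v
        - nu * cw psi (u t) + bb v (p t) = f t v) /\
    (forall q, Hp q -> bb (u t) q = 0)}].

Lemma E_null_H u v : Hu u -> Hu v -> E (u - v) (u - v) = 0 -> H (u - v) (u - v) = 0.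
Proof.
move=> Hu_ Hv e; have Hd := sipB SE Hu_ Hv.
apply: (snorm_eq0P SH Hd); apply/eqP; rewrite eq_le sqrtr_ge0 andbT.
by apply: le_trans (HE Hd) _; rewrite /snorm e sqrtr0 mulr0.
Qed.

Lemma E_null_eq u v z : Hu u -> Hu v -> Hu z -> E (u - v) (u - v) = 0 -> E u z = E v z.
Proof.
move=> Hu_ Hv Hz e; apply/eqP; rewrite -subr_eq0 -(sipBl SE)//; apply/eqP.
by apply: (sip_eq0l SE) => //; exact: (sipB SE).
Qed.

Lemma wproj_null u v : Hu u -> Hu v -> E (u - v) (u - v) = 0 -> wproj u = wproj v.
Proof.
move=> Hu_ Hv e; have [Hhw _] := ow; congr lincomb; apply/funext => i.
apply: (bounded_lin_eq SH (cl (Hhw i)) (M := cc * snorm LW (hw i)) _ Hu_ Hv) => [z Hz|].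
  exact: cM.
exact: E_null_H.
Qed.

Lemma cw_null w w' v : Hw w -> Hw w' -> Hu v -> LW (w - w') (w - w') = 0 -> cw w v = cw w' v.
Proof.
move=> Hw_ Hw' Hv e; apply: (bounded_lin_eq SW (cr Hv) (M := cc * nH v) _ Hw_ Hw' e) => z Hz.
by apply: le_trans (cM Hz Hv) _; rewrite mulrAC.
Qed.

(** Extends curves on [[0, T]] by constants, so that continuity can be stated on the whole line. *)
Let clampT (t : R) : R := Num.max 0 (Num.min t T).
Let clampT_in t : 0 <= clampT t <= T.
Proof. by rewrite /clampT le_max lexx/= ge_max (ltW T0)/= ge_min lexx orbT. Qed.
Let clampT_id t : 0 <= t <= T -> clampT t = t.
Proof. by move=> /andP[t0 tT]; rewrite /clampT min_l// max_r. Qed.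
Let clampT_lip s t : `|clampT s - clampT t| <= `|s - t|.
Proof.
rewrite /clampT ler_norml; have := ler_norm (s - t); have := ler_norm (t - s); rewrite distrC.
move: (`|s - t|) => d; have := T0.
by have [?|?] := leP s T; have [?|?] := leP t T; [have [?|?] := leP 0 s|have [?|?] := leP 0 s|have [?|?] := leP 0 t|];
  rewrite ?(max_r (ltW T0)); try have [?|?] := leP 0 t; move=> *; apply/andP; split; lra.
Qed.

Lemma weak_continuous u l C : (forall t, 0 <= t <= T -> Hu (u t)) ->
  (forall t, 0 <= t <= T -> forall eps, 0 < eps -> exists2 delta, 0 < delta &
    forall s, 0 <= s <= T -> `|s - t| < delta -> nH (u s - u t) < eps) ->
  lin Hu l -> (forall v, Hu v -> `|l v| <= C * nH v) -> continuous (fun t => l (u (clampT t))).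
Proof.
move=> Hu_ cu L lC t; apply/cvgrPdist_lt => e e0.
have C0 : 0 < `|C| + 1 by rewrite ltr_wpDl.
have [delta d0 Hd] := cu _ (clampT_in t) _ (divr_gt0 e0 C0).
near=> s.
have st : `|clampT s - clampT t| < delta.
  apply: le_lt_trans (clampT_lip s t) _; near: s.
  by apply/nbhs_ballP; exists delta => // y; rewrite /ball/= distrC.
have HH := sipB SH (Hu_ _ (clampT_in s)) (Hu_ _ (clampT_in t)).
rewrite distrC -(linB L)//; [|exact: Hu_|exact: Hu_].
apply: le_lt_trans (lC _ HH) _.
apply: (@le_lt_trans _ _ ((`|C| + 1) * nH (u (clampT s) - u (clampT t)))).
  by rewrite ler_wpM2r ?sqrtr_ge0//; have := ler_norm C; lra.
by rewrite -ltr_pdivlMl// mulrC; exact: (Hd _ (clampT_in s) st).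
Unshelve. all: by end_near. Qed.

(** A difference at one point, even an endpoint, would persist on a subinterval of positive
    length. *)
Lemma continuous_ae_eq (z1 z2 : R -> R) : continuous z1 -> continuous z2 ->
  {ae mu, forall t : TR, 0 < t < T -> z1 t = z2 t} -> forall t, 0 <= t <= T -> z1 t = z2 t.
Proof.
move=> cz1 cz2 [N [mN N0 HN]] t /andP[t0 tT]; apply/eqP; rewrite -subr_eq0; apply/negPn/negP => zt.
have cz : continuous (fun s => z1 s - z2 s) by move=> s; apply: cvgB; [exact: cz1|exact: cz2].
have /cvgrPdist_lt/(_ `|z1 t - z2 t|) := cz t; rewrite normr_gt0 => /(_ zt) /nbhs_ballP[delta d0 Hd].
pose lo := Num.max 0 (t - delta); pose hi := Num.min T (t + delta).
have d0' : 0 < delta := d0.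
have lohi : lo < hi.
  have A1 : t - delta < T by lra. have A2 : 0 < t + delta by lra. have A3 : t - delta < t + delta by lra.
  by rewrite /lo /hi gt_max !lt_min T0 A1 A2 A3.
have sub : `]lo, hi[%classic `<=` N.
  move=> s /=; rewrite in_itv/= /lo /hi gt_max lt_min => /andP[/andP[s0 s1] /andP[s2 s3]].
  apply: HN => /= H1; have st : ball t delta s by rewrite /ball/= ltr_distlC; apply/andP; split; lra.
  have := Hd s st; rewrite /= H1 ?s0// subrr subr0 ltxx//.
have : (0 < mu `]lo, hi[%classic)%E by rewrite lebesgue_measure_itv/= lte_fin lohi -EFinB lte_fin subr_gt0.
rewrite lt_neqAle => /andP[/negP + _]; apply; rewrite eq_sym -measure_le0 -N0.
by apply: le_measure; rewrite ?inE.
Qed.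

Lemma prim_ae (g1 g2 : R -> R) t : L1 g1 -> L1 g2 -> {ae mu, forall s : TR, g1 s = g2 s} -> prim g1 t = prim g2 t.
Proof.
move=> L1g L2g eg; rewrite /prim /Rintegral; congr fine; apply: ae_eq_integral => //.
- exact: measurable_int (L1S (measurable_itv _) L1g).
- exact: measurable_int (L1S (measurable_itv _) L2g).
- by apply: filterS eg => s -> _.
Qed.

(** Subtracting the instance [psi = 0] leaves [nu] times the identity that characterises
    [wproj u]. *)
Lemma weak_vort u w A B C c : Hu u -> Hw w ->
  (forall psi, Hw psi -> A + B + nu * LW w psi + nu * cw w 0 - nu * cw psi u + C = c) ->
  LW (w - wproj u) (w - wproj u) = 0.
Proof.
move=> Hu_ Hw_ eq; apply: wproj_unique => // psi Hpsi; apply: (mulfI (lt0r_neq0 nu_gt0)).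
have := eq psi Hpsi; have := eq 0 (sip0 SW).
rewrite (lin0 SW (cr Hu_)) (sip0r SW Hw_) !mulr0 addr0 subr0 => <-.
move: (nu * LW _ _) (nu * cw w 0) (nu * cw psi _) => q1 q2 q3; lra.
Qed.

Lemma ae_neq (c : R) : {ae mu, forall t : TR, t != c}.
Proof.
exists [set c]; split => //=; first by rewrite lebesgue_measure_set1.
by move=> t /= /negP/negbNE/eqP.
Qed.

(** The equation holds only for almost every time, but the coordinates are primitives of an
    integrable function that coincides almost everywhere with the continuous right-hand side; so
    they are differentiable at every interior time. *)
Lemma weak_ode u w p : weak_solution u w p -> exists y : 'I_nk -> R -> R, [/\
  forall i, continuous (y i), forall i, y i 0 = E uh0 (k i),
  forall i t, 0 < t < T -> isd (y i) t (load t (k i) - field_c i (row_at y t)) &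
  forall t, 0 <= t <= T -> E (u t - Uc (row_at y t)) (u t - Uc (row_at y t)) = 0].
Proof.
move=> [sp Wu cu u0 eq].
have Hut t : 0 <= t <= T -> Hu (u t) by move=> /sp[].
have oo : 0 <= (0 : R) <= T by rewrite lexx ltW.
pose y i t := E (u (clampT t)) (k i).
have El v : Hu v -> lin Hu (E^~ v) by move=> Hv c x z Hx Hz; exact: (sip_lin SE).
have EC v z : Hu v -> Hu z -> `|E z v| <= a * snorm E v * nH z.
  move=> Hv Hz; apply: le_trans (cauchy_schwarz SE Hz Hv) _.
  by rewrite [_ * nH z]mulrAC ler_wpM2r ?sqrtr_ge0//; exact: EH.
have EC' i v : Hu v -> `|E v (k i)| <= a * snorm E (k i) * nrm v.
  by move=> Hv; rewrite nrmE//; exact: EC.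
have cy i : continuous (y i) by exact: (weak_continuous Hut cu (El _ (Hk i)) (fun v Hv => EC _ _ (Hk i) Hv)).
(* The divergence constraint holds almost everywhere, and by continuity at every time. *)
have Ku t : 0 <= t <= T -> Kh (u t).
  move=> tT; split=> [|q Hq]; first exact: Hut.
  have cz : continuous (fun t => bb (u (clampT t)) q).
    apply: (weak_continuous Hut cu (bl Hq) (C := cb * snorm LP q)) => v Hv.
    by apply: le_trans (bM Hv Hq) _; rewrite mulrAC.
  rewrite -{1}(clampT_id tT); apply: (continuous_ae_eq cz (z2 := cst 0)) => //.
    by move=> s; exact: cvg_cst.
  apply: filterS eq => s Hs sT; have [_ H0] := Hs sT.
  by rewrite clampT_id ?H0//; have /andP[/ltW -> /ltW ->] := sT.
have null t : 0 <= t <= T -> E (u t - Uc (row_at y t)) (u t - Uc (row_at y t)) = 0.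
  move=> tT; have := ck (Ku t tT); rewrite /= (_ : lincomb k _ = Uc (row_at y t))//.
  by congr lincomb; apply/funext => i; rewrite mxE /y clampT_id.
exists y; split => //.
- move=> i; rewrite /y clampT_id//; apply: E_null_eq => //; [exact: Hut|exact: KH].
- move=> i; have q1 : (+oo%E : \bar R) = 1%E \/ (+oo%E : \bar R) = +oo%E by right.
  have [h' [c [Lh' h'0 hy]]] := W1q_scalar (sip0 SH) (sipP SH) nrm0 (El _ (Hk i)) (EC' i) q1 Wu.
  have yE t : 0 <= t <= T -> y i t = c + prim h' t.
    apply: (continuous_ae_eq (z1 := y i) (z2 := fun s => c + prim h' s)) => //.
      by move=> s; apply: cvgD; [exact: cvg_cst|exact: prim_continuous].
    by apply: filterS hy => s Hs sT; rewrite /y clampT_id ?Hs//; have /andP[/ltW -> /ltW ->] := sT.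
  pose g t := load t (k i) - field_c i (row_at y t).
  have cg : continuous g by move=> t; apply: cvgB; [exact: load_continuous|exact: (loclip_curve (loclip_field i) cy)].
  have hg : {ae mu, forall t : TR, 0 < t < T -> h' t = g t}.
    apply: filterS3 eq (prim_derive Lh') load_ae => t Heq dt lt tT.
    have tT' : 0 <= t <= T by have /andP[/ltW -> /ltW ->] := tT.
    have [HU HW HP] := sp t tT'; have [eq1 _] := Heq tT.
    have [_ e1] := eq1 (k i) 0 (Hk i) (sip0 SW).
    have sw : LW (w t - wproj (u t)) (w t - wproj (u t)) = 0.
      by apply: weak_vort => // psi Hpsi; have [_] := eq1 0 psi (sip0 SH) Hpsi; exact.
    have Nu : Nf (u t) (k i) = Nf (Uc (row_at y t)) (k i).
      by apply: N_eq => //; [exact: HUc|apply: E_null_H => //; [exact: HUc|exact: null]].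
    have wu : cw (w t) (k i) = cw (wproj (Uc (row_at y t))) (k i).
      by rewrite (cw_null HW (wprojP _) (Hk i) sw) (wproj_null HU (HUc _) (null t tT')).
    have d1 : derive1 (fun s : R => E (u s) (k i) : R^o) t = h' t.
      apply: isd_derive1; apply: isd_near (isd_eq (isdD (isd_cst c t) dt) (fun=> erefl) (add0r _)).
      near=> s; have sT : 0 <= s <= T.
        by apply/andP; split; apply: ltW; near: s; [apply: lt_nbhsr; have /andP[] := tT|apply: lt_nbhsl; have /andP[] := tT].
      by rewrite -(yE s sT) /y clampT_id.
    have b0_ : bb (k i) (p t) = 0 by have [_ Hb] := Kk i; exact: Hb.
    have l0 : LW (w t) 0 = 0 by rewrite (sip0r SW).
    have c0 : cw 0 (u t) = 0 by rewrite (lin0 SW (cr HU)).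
    move: e1; rewrite d1 Nu wu b0_ l0 c0 (lt tT _ (Hk i)) /g /field_c.
    move: (Nf _ _) (nu * cw (wproj _) _) (load _ _) (h' t) => q1' q2 q3 q4; rewrite !mulr0; lra.
  (* Replacing [h'] by the continuous [g] under the integral lets the fundamental theorem of
     calculus apply at each point. *)
  have hp_ s : prim h' s = prim (g \_ `[0, T]) s.
    apply: prim_ae => //; first exact: L1_patch.
    (* [h'] vanishes off the open interval while [g] is cut off on the closed one; the two endpoints
       are discarded. *)
    have mT : {ae mu, forall t : TR, t != 0 /\ t != T}.
      by apply: filterS2 (ae_neq 0) (ae_neq T) => t A1 A2.
    apply: filterS2 hg mT => t Ht [t0 tT]; rewrite patchE.
    have [tT'|tn] := boolP (0 < t < T).
      by rewrite Ht// mem_set//= in_itv/=; have /andP[/ltW -> /ltW ->] := tT'.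
    rewrite h'0; last by rewrite /= in_itv/=; exact/negP.
    case: ifP => //; rewrite inE/= in_itv/= => /andP[t1 t2]; case/negP: tn.
    by rewrite !lt_neqAle eq_sym t0 t1 tT t2.
  move=> t tT; apply: isd_near (isd_eq (isdD (isd_cst c t) (prim_patch_derive (cg t) (L1_patch 0 T cg) tT)) (fun=> erefl) (add0r _)).
  near=> s; have sT : 0 <= s <= T.
    by apply/andP; split; apply: ltW; near: s; [apply: lt_nbhsr; have /andP[] := tT|apply: lt_nbhsl; have /andP[] := tT].
  by rewrite yE// hp_.
Unshelve. all: by end_near. Qed.

(** Equal coordinates give equal velocities up to null vectors; the vorticities are then the same
    projection, and the momentum equations leave no difference of pressures on any discrete
    velocity. *)
Theorem semidiscrete_unique u1 w1 p1 u2 w2 p2 : 0 < beta ->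
  weak_solution u1 w1 p1 -> weak_solution u2 w2 p2 ->
  (forall t, 0 <= t <= T -> E (u1 t - u2 t) (u1 t - u2 t) = 0) /\
  {ae mu, forall t : TR, 0 < t < T ->
    LW (w1 t - w2 t) (w1 t - w2 t) = 0 /\ LP (p1 t - p2 t) (p1 t - p2 t) = 0}.
Proof.
move=> be0 s1 s2; have [y1 [cy1 y10 dy1 uy1]] := weak_ode s1; have [y2 [cy2 y20 dy2 uy2]] := weak_ode s2.
have [sp1 _ _ _ eq1] := s1; have [sp2 _ _ _ eq2] := s2.
have yy i t : 0 <= t <= T -> y1 i t = y2 i t.
  have H0 : forall j, y1 j 0 = y2 j 0 by move=> j; rewrite y10 y20.
  exact: (ode_unique (F := field_c) (g := fun i t => load t (k i)) loclip_field cy1 cy2 H0 dy1 dy2).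
have uu t : 0 <= t <= T -> E (u1 t - u2 t) (u1 t - u2 t) = 0.
  move=> tT; have [U1 _ _] := sp1 t tT; have [U2 _ _] := sp2 t tT.
  apply: (null_trans SE U1 U2 (HUc (row_at y1 t))); first exact: uy1.
  by rewrite (_ : row_at y1 t = row_at y2 t) ?uy2//; apply/rowP => i; rewrite !mxE yy.
split=> //; apply: filterS2 eq1 eq2 => t H1 H2 tT; have [{}H1 _] := H1 tT; have [{}H2 _] := H2 tT.
have tT' : 0 <= t <= T by have /andP[/ltW -> /ltW ->] := tT.
have [U1 W1 P1] := sp1 t tT'; have [U2 W2 P2] := sp2 t tT'.
have sw1 : LW (w1 t - wproj (u1 t)) (w1 t - wproj (u1 t)) = 0.
  by apply: weak_vort => // psi Hpsi; have [_] := H1 0 psi (sip0 SH) Hpsi; exact.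
have sw2 : LW (w2 t - wproj (u2 t)) (w2 t - wproj (u2 t)) = 0.
  by apply: weak_vort => // psi Hpsi; have [_] := H2 0 psi (sip0 SH) Hpsi; exact.
have ww : LW (w1 t - w2 t) (w1 t - w2 t) = 0.
  apply: (null_trans SW W1 W2 (wprojP (u1 t)) sw1).
  by rewrite (wproj_null U1 U2 (uu t tT')).
split=> //; have Hp12 := sipB SP P1 P2; apply: (snorm_eq0P SP Hp12).
(* The inf-sup condition with bound 0. *)
apply/eqP; rewrite eq_le sqrtr_ge0 andbT -(ler_pM2l be0) mulr0.
apply: infsup => // v Hv; rewrite mul0r normr_le0 (linB (br Hv))// subr_eq0; apply/eqP.
have [D1 e1] := H1 v 0 Hv (sip0 SW); have [D2 e2] := H2 v 0 Hv (sip0 SW).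
have dd : derive1 (fun s : R => E (u1 s) v : R^o) t = derive1 (fun s : R => E (u2 s) v : R^o) t.
  apply/esym/isd_derive1; rewrite derive1E; apply: isd_near (derivableP D1).
  near=> s; have sT : 0 <= s <= T.
    by apply/andP; split; apply: ltW; near: s; [apply: lt_nbhsr; have /andP[] := tT|apply: lt_nbhsl; have /andP[] := tT].
  have [U1s _ _] := sp1 s sT; have [U2s _ _] := sp2 s sT.
  by apply: E_null_eq => //; exact: uu.
have NN : Nf (u1 t) v = Nf (u2 t) v by apply: N_eq => //; apply: E_null_H => //; exact: uu.
move: e1 e2; rewrite -dd -NN (cw_null W1 W2 Hv ww) (sip0r SW W1) (sip0r SW W2).
rewrite (lin0 SW (cr U1)) (lin0 SW (cr U2)).
move: (derive1 _ _) (Nf _ _) (nu * cw _ v) (bb v (p1 t)) (bb v (p2 t)) (f t v) => q1 q2 q3 q4 q5 q6.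
by rewrite mulr0 => h1 h2; apply: (addrI (q1 + q2 + 0 + q3 - 0)); rewrite h1 h2.
Unshelve. all: by end_near. Qed.

Lemma weak_solution_exists u p : (forall t, Kh (u t) /\ Hp (p t)) -> W1q T Hu nrm +oo%E u ->
  E (u 0 - uh0) (u 0 - uh0) = 0 ->
  (forall t eps, 0 < eps -> exists2 delta, 0 < delta & forall s, `|s - t| < delta -> nH (u s - u t) < eps) ->
  (forall t, 0 < t < T -> exists2 du, Hu du & forall v, Hu v -> isd (fun s => E (u s) v) t (E du v) /\
    E du v + Nf (u t) v + nu * cw (wproj (u t)) v + bb v (p t) = load t v) ->
  weak_solution u (wproj \o u) p.
Proof.
move=> up Wu u0 cu eq; split=> //.
- by move=> t _; have [[Hu_ _] Hp_] := up t; split=> //; exact: wprojP.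
- by move=> t _ eps /(cu t)[delta d0 Hd]; exists delta => // s _; exact: Hd.
apply: filterS load_ae => t lt tT; have [[Hut Kut] Hpt] := up t; split=> // v psi Hv Hpsi.
have [du Hdu H1] := eq t tT; have [D1 e1] := H1 v Hv; split; first exact: (@ex_derive _ _ _ _ _ _ _ D1).
rewrite (isd_derive1 D1) /= (wproj_spec Hut Hpsi) lt// -e1.
move: (E _ _) (Nf _ _) (nu * cw psi _) (nu * cw _ v) (bb _ _) => q1 q2 q3 q4 q5; lra.
Qed.

End semidiscrete.

(** * Curl and divergence *)

Section curl_div.
Context (R : realType) (d : nat) (Omega : set 'rV[R]_d).
Notation pt := 'rV[R]_d.
Notation mu := (@leb R d).
Hypothesis oO : open Omega.
Hypothesis fO : (mu Omega < +oo)%E.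
Notation H1 := (@Defs.H1 R d Omega d).
Notation nH := (@norm_H1 R d Omega d).
Notation fld := (field R d).
Notation vort := (pt -> 'rV[R]_(nvort d)).
Notation ip := (ip Omega).
Notation ips := (ips Omega).
Notation grad := (grad Omega).
Notation curl := (curl Omega).
Notation div := (div Omega).

Lemma entry_lin a (G G' : 'M[R]_d) i j : entry (a *: G + G') i j = a * entry G i j + entry G' i j.
Proof.
rewrite /entry; case: (insub i) => [i'|]; last by rewrite mulr0 addr0.
by case: (insub j) => [j'|]; rewrite ?mulr0 ?addr0// !mxE.
Qed.

Lemma entry_le (G : 'M[R]_d) i j : `|entry G i j| <= enorm G.
Proof.
rewrite /entry; case: (insub i) => [i'|]; last by rewrite normr0 enorm_ge0.
by case: (insub j) => [j'|]; rewrite ?normr0 ?enorm_ge0//; exact: entry_le_enorm.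
Qed.

Lemma curl_of_grad_lin a (G G' : 'M[R]_d) :
  curl_of_grad (a *: G + G') = a *: curl_of_grad G + curl_of_grad G'.
Proof. by apply/rowP => l; rewrite !mxE; case: ifP => _; rewrite !entry_lin; ring. Qed.

Lemma curl_of_grad_le (G : 'M[R]_d) l : `|curl_of_grad G 0 l| <= 2 * enorm G.
Proof.
rewrite mxE (_ : 2 * enorm G = enorm G + enorm G); last by ring.
by case: ifP => _; apply: le_trans (ler_normB _ _) _; apply: lerD; exact: entry_le.
Qed.

(** Each component of the curl is a difference of two entries, at most twice the Frobenius norm. *)
Lemma dot_curl_le (G : 'M[R]_d) :
  dot (curl_of_grad G) (curl_of_grad G) <= (2 * (nvort d)%:R) ^+ 2 * dot G G.
Proof.
rewrite -[dot G G]enorm_sq /dot big_ord1; apply: (@le_trans _ _ (\sum_(l < nvort d) (2 * enorm G) ^+ 2)).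
  apply: ler_sum => l _; rewrite -expr2 -real_normK ?num_real// ler_sqr ?nnegrE ?mulr_ge0 ?enorm_ge0//.
  exact: curl_of_grad_le.
rewrite sumr_const card_ord [X in _ <= X * _]exprMn -mulrA mulrCA exprMn -[leLHS]mulr_natl.
apply: ler_wpM2r; first by rewrite mulr_ge0 ?sqr_ge0.
by rewrite -natrX ler_nat; case: (nvort d) => // n; rewrite expnS expn1 leq_pmulr.
Qed.

Lemma dot_tr_le (G : 'M[R]_d) : (\tr G) ^+ 2 <= d%:R ^+ 2 * dot G G.
Proof.
rewrite -enorm_sq -exprMn -real_normK ?num_real// ler_sqr ?nnegrE ?mulr_ge0 ?enorm_ge0//.
apply: le_trans (ler_norm_sum _ _ _) _; apply: (@le_trans _ _ (\sum_(l < d) enorm G)).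
  by apply: ler_sum => l _; exact: entry_le_enorm.
by rewrite sumr_const card_ord mulr_natl.
Qed.

Lemma msr_entry (u : fld) i j : H1 u -> L2s Omega (fun x => entry (grad u x) i j).
Proof.
move=> Hu; rewrite /entry; case: (insub i) => [i'|]; last exact: L2s_cst.
by case: (insub j) => [j'|]; [exact: grad_L2|exact: L2s_cst].
Qed.

Lemma curl_L2 (u : fld) : H1 u -> L2 Omega (curl u).
Proof.
move=> Hu i l; have E a b a' b' : L2s Omega (fun x => entry (grad u x) a b - entry (grad u x) a' b').
  have := L2s_lin oO fO (-1) (msr_entry a' b' Hu) (msr_entry a b Hu).
  by congr L2s; apply/funext => x; rewrite mulN1r addrC.
case: (boolP (d == 2)%N) => d2.
  by have := E 1%N 0%N 0%N 1%N; congr L2s; apply/funext => x; rewrite mxE d2.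
have := E ((l + 2) %% 3)%N ((l + 1) %% 3)%N ((l + 1) %% 3)%N ((l + 2) %% 3)%N.
by congr L2s; apply/funext => x; rewrite mxE (negbTE d2).
Qed.

Lemma div_L2s (u : fld) : H1 u -> L2s Omega (div u).
Proof. by move=> Hu; apply: (L2s_sum oO fO) => i; exact: grad_L2. Qed.

Lemma curl_lin (a : R) (u v : fld) : H1 u -> H1 v ->
  aeq Omega (curl (a *: u + v)) (a *: curl u + curl v).
Proof.
move=> Hu Hv; apply: filterS (grad_lin oO fO a Hu Hv) => x E Ox.
by rewrite /Defs.curl E// !fctE curl_of_grad_lin.
Qed.

Lemma div_lin (a : R) (u v : fld) : H1 u -> H1 v ->
  {ae mu, forall x, Omega x -> div (a *: u + v) x = a * div u x + div v x}.
Proof.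
move=> Hu Hv; apply: filterS (grad_lin oO fO a Hu Hv) => x E Ox.
by rewrite /Defs.div E// !fctE linearP.
Qed.

Lemma norm_curl_le (u : fld) : H1 u -> norm_L2 Omega (curl u) <= 2 * (nvort d)%:R * norm_L2 Omega (grad u).
Proof.
move=> Hu; have Lc := curl_L2 Hu; have Lg := grad_L2 oO fO Hu.
have c0 : 0 <= 2 * (nvort d)%:R :> R by rewrite mulr_ge0.
rewrite /norm_L2 -[X in _ <= X * _](ger0_norm c0) -sqrtr_sqr -sqrtrM ?sqr_ge0//; apply: ler_wsqrtr.
rewrite -(RintegralZl _ (measurable_Omega oO fO) (intg_dot oO fO Lg Lg)).
apply: le_Rintegral; first exact: (measurable_Omega oO fO).
- exact: (intg_dot oO fO Lc Lc).
- exact: (intgZ oO fO _ (intg_dot oO fO Lg Lg)).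
- by move=> x _; exact: dot_curl_le.
Qed.

Lemma norm_div_le (u : fld) : H1 u -> norm_L2s Omega (div u) <= d%:R * norm_L2 Omega (grad u).
Proof.
move=> Hu; have Lc := div_L2s Hu; have Lg := grad_L2 oO fO Hu.
have c0 : 0 <= d%:R :> R by [].
rewrite /norm_L2 /norm_L2s -[X in _ <= X * _](ger0_norm c0) -sqrtr_sqr -sqrtrM ?sqr_ge0//; apply: ler_wsqrtr.
rewrite -(RintegralZl _ (measurable_Omega oO fO) (intg_dot oO fO Lg Lg)).
apply: le_Rintegral; first exact: (measurable_Omega oO fO).
- exact: (L2s_intgM oO fO Lc Lc).
- exact: (intgZ oO fO _ (intg_dot oO fO Lg Lg)).
- by move=> x _; rewrite -expr2; exact: dot_tr_le.
Qed.

Lemma ip_curl_linr (w : vort) a (u v : fld) : L2 Omega w -> H1 u -> H1 v ->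
  ip w (curl (a *: u + v)) = a * ip w (curl u) + ip w (curl v).
Proof.
move=> Lw Hu Hv; have S := sip_ip oO fO 1 (nvort d).
have Lu := curl_L2 Hu; have Lv := curl_L2 Hv; have Luv := curl_L2 (H1_lin oO fO a Hu Hv).
have E1 := sipC S Lw Luv; have E2 := ip_ae oO fO Luv (sipP S a Lu Lv) Lw (curl_lin a Hu Hv).
have E3 := sipC S (sipP S a Lu Lv) Lw; have E4 := sipDr S (sipZ S a Lu) Lv Lw.
exact: (etrans E1 (etrans E2 (etrans E3 (etrans E4 (f_equal (+%R^~ _) (sipZr S a Lu Lw)))))).
Qed.

Lemma ip_curl_linl (w w' : vort) a (u : fld) : L2 Omega w -> L2 Omega w' -> H1 u ->
  ip (a *: w + w') (curl u) = a * ip w (curl u) + ip w' (curl u).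
Proof. by move=> Lw Lw' Hu; exact: (sip_lin (sip_ip oO fO 1 (nvort d)) a Lw Lw' (curl_L2 Hu)). Qed.

Lemma ip_curl_le (w : vort) (u : fld) : L2 Omega w -> H1 u ->
  `|ip w (curl u)| <= 2 * (nvort d)%:R * norm_L2 Omega w * nH u.
Proof.
move=> Lw Hu; apply: le_trans (cauchy_schwarz (sip_ip oO fO 1 (nvort d)) Lw (curl_L2 Hu)) _.
rewrite [leRHS]mulrAC [leRHS]mulrC; apply: ler_wpM2l; first exact: sqrtr_ge0.
apply: le_trans (norm_curl_le Hu) _; apply: ler_wpM2l; first by rewrite mulr_ge0.
exact: (norm_grad_le_H1 oO fO Hu).
Qed.

Lemma ips_div_lin (q : pt -> R) a (u v : fld) : L2s Omega q -> H1 u -> H1 v ->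
  ips q (div (a *: u + v)) = a * ips q (div u) + ips q (div v).
Proof.
move=> Lq Hu Hv; have S := sip_ips oO fO.
have Lu := div_L2s Hu; have Lv := div_L2s Hv; have Luv := div_L2s (H1_lin oO fO a Hu Hv).
rewrite (sipC S Lq Luv) (sipC S Lq Lu) (sipC S Lq Lv) -(sip_lin S a Lu Lv Lq).
exact: (ips_ae oO fO Luv (sipP S a Lu Lv) Lq (div_lin a Hu Hv)).
Qed.

Lemma ips_div_le (q : pt -> R) (u : fld) : L2s Omega q -> H1 u ->
  `|ips q (div u)| <= d%:R * nH u * norm_L2s Omega q.
Proof.
move=> Lq Hu; apply: le_trans (cauchy_schwarz (sip_ips oO fO) Lq (div_L2s Hu)) _.
rewrite [leRHS]mulrC; apply: ler_wpM2l; first exact: sqrtr_ge0.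
apply: le_trans (norm_div_le Hu) _; apply: ler_wpM2l; first by [].
exact: (norm_grad_le_H1 oO fO Hu).
Qed.

End curl_div.

(** * The nonlinear form *)

Section nonlinearity.
Context (R : realType) (d : nat) (Omega : set 'rV[R]_d).
Notation pt := 'rV[R]_d.
Notation mu := (@leb R d).
Hypotheses (oO : open Omega) (bO : bounded_set Omega).
Let fO := bounded_open_fin oO bO.
Notation H1 := (@Defs.H1 R d Omega d).
Notation nH := (@norm_H1 R d Omega d).
Notation fld := (field R d).
Notation vort := (pt -> 'rV[R]_(nvort d)).
Notation ip := (ip Omega).
Notation grad := (grad Omega).
Notation curl := (curl Omega).
Variables (rho ir i4 D F : R).
Hypotheses (rho34 : 3 <= rho <= 4) (Ir : injection_norm Omega rho = ir%:E).
Hypotheses (I4 : injection_norm Omega 4 = i4%:E) (D0 : 0 <= D) (F0 : 0 <= F) (d3 : (d <= 3)%N).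
Let I4' := injection4 oO fO I4.

Definition nform (u v : fld) : R := D * ip u v + F * ip (forch rho u) v + tri Omega u u v.

Lemma Ah_nform nu (u v : fld) (w psi : vort) : Ah Omega nu D F rho u u w v psi =
  nform u v + nu * ip w psi + nu * ip w (curl v) - nu * ip psi (curl u).
Proof.
have K (x1 x2 x3 x4 x5 x6 x7 : R) : x1 + x2 + x3 + x4 - x5 + x6 + x7 = x1 + x2 + (x6 + x7) + x3 + x4 - x5 by ring.
exact: K.
Qed.

Lemma nform_lin u a v w : H1 u -> H1 v -> H1 w -> nform u (a *: v + w) = a * nform u v + nform u w.
Proof.
move=> Hu Hv Hw; have S := sip_ip oO fO 1 d.
have E1 := sipDr S (sipZ S a (H1_L2 oO fO Hv)) (H1_L2 oO fO Hw) (H1_L2 oO fO Hu); rewrite (sipZr S a (H1_L2 oO fO Hv) (H1_L2 oO fO Hu)) in E1.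
rewrite /nform E1 (ip_forch_lin oO fO rho34 Ir a Hu Hv Hw) (tri_lin3 oO fO I4' a Hu Hu Hv Hw).
move: (ip u v) (ip u w) (ip (forch _ _) v) (ip (forch _ _) w) (tri _ _ _ v) (tri _ _ _ w) => x1 x2 x3 x4 x5 x6.
ring.
Qed.

Lemma nform_ge0 u : H10 Omega u -> 0 <= nform u u.
Proof.
move=> Hu; rewrite /nform (tri_skew oO fO I4' Hu) addr0 addr_ge0// mulr_ge0//.
  exact: (sip_ge0 (sip_ip oO fO 1 d) (H1_L2 oO fO (H10_H1 oO fO Hu))).
exact: (ip_forch_ge0 oO fO rho34 Ir).
Qed.

Lemma nform_eq (u u' v : fld) : (forall x, Omega x -> u x = u' x) -> nform u v = nform u' v.
Proof.
move=> uu; have g := gradE oO fO uu.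
have E1 : ip u v = ip u' v by exact: (eq_ip oO fO uu).
have E2 : ip (forch rho u) v = ip (forch rho u') v.
  by apply: (eq_ip oO fO) => [x Ox|x Ox]; [rewrite /forch uu|].
have E3 : ip (convect Omega u u) v = ip (convect Omega u' u') v.
  by apply: (eq_ip oO fO) => [x Ox|x Ox]; [rewrite /convect uu// g|].
have E4 : ip (fun x => div Omega u x *: u x) v = ip (fun x => div Omega u' x *: u' x) v.
  by apply: (eq_ip oO fO) => [x Ox|x Ox]; [rewrite /Defs.div g (uu x Ox)|].
by rewrite /nform /tri E1 E2 E3 E4.
Qed.

(** The constants absorb [d] and [rho]: 18 is 2 times 3 squared for [d <= 3], and the exponent 4
    replaces [rho <= 4] because the base [1 + ir] is at least 1. *)
Lemma nform_bound u v : H1 u -> H1 v ->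
  `|nform u v| <= growth D (18 * i4 ^+ 2) (2 * F * (1 + ir) ^+ 4) (rho - 1) (nH u) * nH v.
Proof.
move=> Hu Hv; have [r3 r4] : 3 <= rho /\ rho <= 4 by apply/andP.
have r0 : 0 < rho by lra.
have ir0 := injection_ge0 oO fO r0 Ir.
have B1 : `|ip u v| <= nH u * nH v.
  apply: le_trans (cauchy_schwarz (sip_ip oO fO 1 d) (H1_L2 oO fO Hu) (H1_L2 oO fO Hv)) _.
  by apply: ler_pM; rewrite ?sqrtr_ge0//; exact: (norm_L2_le_H1 oO fO).
have B2 := ip_forch_bound oO fO rho34 Ir Hu Hv.
have B3 := tri_bound oO fO I4' Hu Hu Hv.
have P : ((1 + ir) * nH u) `^ (rho - 1) * ((1 + ir) * nH v) <= (1 + ir) ^+ 4 * nH u `^ (rho - 1) * nH v.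
  have nu0 := norm_H1_ge0 oO fO u; have nv0 := norm_H1_ge0 oO fO v.
  move: (nH u) (nH v) nu0 nv0 => x y x0 y0; have i0 : 0 <= 1 + ir by rewrite addr_ge0.
  have i1 : 1 <= 1 + ir by rewrite lerDl.
  rewrite powRM// (_ : _ * _ * _ = (1 + ir) `^ (rho - 1) * (1 + ir) * (x `^ (rho - 1) * y)); last by ring.
  rewrite -[leRHS]mulrA; apply: ler_wpM2r; first by rewrite mulr_ge0// powR_ge0.
  have -> : (1 + ir) `^ (rho - 1) * (1 + ir) = (1 + ir) `^ rho.
    by rewrite -{2}(powRr1 i0) -powRD ?subrK//; apply/implyP => _; rewrite gt_eqF// (lt_le_trans ltr01 i1).
  by rewrite -powR_mulrn//; exact: ler_powR.
have d9 : 2 * d%:R ^+ 2 <= 18 :> R.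
  by rewrite (_ : 18 = 2 * 3%:R ^+ 2) ?ler_wpM2l// ?ler_sqr ?nnegrE ?ler_nat//; ring.
rewrite /nform /growth; apply: le_trans (ler_normD _ _) _; apply: (le_trans (lerD (ler_normD _ _) (lexx _))).
rewrite !normrM (ger0_norm D0) (ger0_norm F0).
have nu0 := norm_H1_ge0 oO fO u; have nv0 := norm_H1_ge0 oO fO v.
move: (nH u) (nH v) nu0 nv0 B1 B2 B3 P => x y x0 y0 B1 B2 B3 P.
move: (`|ip u v|) (`|ip (forch _ _) _|) (`|tri _ _ _ _|) B1 B2 B3 => z1 z2 z3 B1 B2 B3.
rewrite 2![in leRHS]mulrDl addrAC; apply: lerD; [apply: lerD|].
- by rewrite -[leRHS]mulrA ler_wpM2l.
- apply: le_trans B3 _; rewrite (_ : x * x * y = x ^+ 2 * y); last by rewrite expr2.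
  rewrite [leRHS]mulrAC -[leRHS]mulrA -[leLHS]mulrA.
  have q : 0 <= i4 ^+ 2 * (x ^+ 2 * y) by exact: (mulr_ge0 (sqr_ge0 _) (mulr_ge0 (sqr_ge0 _) y0)).
  have := ler_wpM2r q d9; move: (2 * d%:R ^+ 2) (i4 ^+ 2) (x ^+ 2) => *; lra.
- have := ler_wpM2l F0 (le_trans B2 _); move=> /(_ (2 * ((1 + ir) ^+ 4 * x `^ (rho - 1) * y))).
  move=> H; apply: le_trans (H _) _; first by rewrite -mulrA ler_wpM2l.
  by rewrite !mulrA [F * 2]mulrC lexx.
Qed.

Lemma enorm_lincomb n (e : 'I_n -> fld) (c : 'rV[R]_n) (B : 'I_n -> R) x :
  (forall i, enorm (e i x) <= B i) -> enorm (lincomb e (fun i => c 0 i) x) <= `|c| * \sum_i B i.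
Proof.
move=> eB; rewrite /lincomb fct_sumE.
have S := sip_dot R 1 d; have := snorm_sum S (index_enum _) xpredT (F := fun i => c 0 i *: e i x) (fun=> I).
move=> /le_trans; apply; rewrite mulr_sumr; apply: ler_sum => i _.
rewrite (_ : snorm _ _ = `|c 0 i| * enorm (e i x)); last by rewrite (snormZ S).
by apply: ler_pM => //; [exact: enorm_ge0|exact: rV_le_norm].
Qed.

Lemma within_enorm_bounded (v : fld) : {within closure Omega, continuous v} ->
  exists2 C, 0 <= C & forall x, Omega x -> enorm (v x) <= C.
Proof.
move=> cv; have H i := within_bounded bO (within_coord (i := i) cv).
pose C i := projT1 (cid2 (H i)).
have C0 i : 0 <= C i by rewrite /C; case: cid2.
have HC i x : Omega x -> `|v x 0 i| <= C i.
  by rewrite /C; case: cid2 => c ? /= Hc Ox; apply: Hc; exact: subset_closure.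
exists (\sum_i C i) => [|x Ox]; first exact: sumr_ge0.
apply: le_trans (enorm_le_sum _) _; rewrite big_ord1; apply: ler_sum => i _; exact: HC.
Qed.

(** In coordinates the drag is linear and the convection a quadratic polynomial. Only the
    Forchheimer term needs an estimate, for which the basis fields are bounded on [Omega]. *)
Lemma nform_loclip n (e : 'I_n -> fld) v : (forall i, H1 (e i)) -> (forall i, {within closure Omega, continuous (e i)}) ->
  H1 v -> {within closure Omega, continuous v} ->
  loclip (fun c : 'rV[R]_n => nform (lincomb e (fun i => c 0 i)) v).
Proof.
move=> He ce Hv cv; have S1 := sip_ipH1 oO fO d.
have HL (c : 'rV[R]_n) : H1 (lincomb e (fun i => c 0 i)) by exact: (lincombP S1).
apply: loclipD; first apply: loclipD.
- apply: loclipM; first exact: loclip_cst.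
  have -> : (fun c : 'rV[R]_n => ip (lincomb e (fun i => c 0 i)) v) = fun c => \sum_i c 0 i * ip (e i) v.
    by apply/funext => c; rewrite (sip_lincombl S1).
  by apply: loclip_sum => i; apply: loclipM; [exact: loclip_coord|exact: loclip_cst].
- apply: loclipM; first exact: loclip_cst.
  have [N N0 vN] := within_enorm_bounded cv.
  pose B i := projT1 (cid2 (within_enorm_bounded (ce i))).
  have B0 i : 0 <= B i by rewrite /B; case: cid2.
  have HB i x : Omega x -> enorm (e i x) <= B i by rewrite /B; case: cid2 => c ? /= Hc; exact: Hc.
  have Bs : 0 <= \sum_i B i by exact: sumr_ge0.
  move=> M; pose M' := `|M| * \sum_i B i.
  have M'0 : 0 <= M' by rewrite mulr_ge0.
  exists (3 * (1 + M') ^+ 2 * (\sum_i B i) * N * fine (mu Omega)) => [|a c aM cM].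
    apply: mulr_ge0; last by rewrite fine_ge0.
    by apply: mulr_ge0 => //; apply: mulr_ge0 => //; rewrite mulr_ge0 ?sqr_ge0.
  have H (b : 'rV[R]_n) x : `|b| <= M -> Omega x -> enorm (lincomb e (fun i => b 0 i) x) <= M'.
    move=> bM Ox; apply: le_trans (enorm_lincomb (B := B) _ _) _; first by move=> i; exact: HB.
    by rewrite ler_wpM2r// (le_trans bM)// ler_norm.
  have H2 x : Omega x -> enorm (lincomb e (fun i => a 0 i) x - lincomb e (fun i => c 0 i) x) <= `|a - c| * \sum_i B i.
    move=> Ox; have -> : lincomb e (fun i => a 0 i) x - lincomb e (fun i => c 0 i) x = lincomb e (fun i => (a - c) 0 i) x.
      by rewrite /lincomb !fct_sumE -sumrB; apply: eq_bigr => i _; rewrite !mxE scalerBl.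
    by apply: enorm_lincomb => i; exact: HB.
  have := ip_forch_lip oO fO rho34 Ir (HL a) (HL c) Hv M'0 (N := N) (e := `|a - c| * \sum_i B i).
  move=> /(_ (fun x Ox => And4 (H a x aM Ox) (H c x cM Ox) (H2 x Ox) (vN x Ox))) /le_trans; apply.
  by move: (fine _) (\sum_i B i) (`|a - c|) => x1 x2 x3; rewrite le_eqVlt; apply/orP; left; apply/eqP; ring.
- have -> : (fun c : 'rV[R]_n => tri Omega (lincomb e (fun i => c 0 i)) (lincomb e (fun i => c 0 i)) v) =
      fun c => \sum_i (c 0 i * \sum_j (c 0 j * tri Omega (e i) (e j) v)).
    apply/funext => c; have T1 : lin H1 (fun z => tri Omega z (lincomb e (fun i => c 0 i)) v).
      by move=> a z z' Hz Hz'; exact: (tri_lin1 oO fO I4').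
    rewrite (lin_lincomb S1 _ T1)//; apply: eq_bigr => i _; congr (_ * _).
    have T2 : lin H1 (fun z => tri Omega (e i) z v).
      by move=> a z z' Hz Hz'; exact: (tri_lin2 oO fO I4').
    by rewrite (lin_lincomb S1 _ T2).
  apply: loclip_sum => i; apply: loclipM; first exact: loclip_coord.
  by apply: loclip_sum => j; apply: loclipM; [exact: loclip_coord|exact: loclip_cst].
Qed.

End nonlinearity.

(** * The discrete setting *)

Section dual_norm.
Context (R : realType) (d : nat) (Omega : set 'rV[R]_d).
Hypothesis oO : open Omega.
Hypothesis fO : (@leb R d Omega < +oo)%E.
Notation nH := (@norm_H1 R d Omega d).
Implicit Types G : functional R d.

Lemma norm_Hm1_ge0 G : 0 <= norm_Hm1 Omega G.
Proof.
rewrite /norm_Hm1; set S := [set _ | _ in _].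
(* [sup] takes the value 0 on a set without a supremum. *)
have [hS|nS] := pselect (has_sup S); last by rewrite sup_out.
have [x Sx] := hS.1; apply: le_trans (ub_le_sup hS.2 Sx).
by case: Sx => v _ <-.
Qed.

Lemma Hm1_0 : Hm1 Omega 0.
Proof.
split=> [a v w _ _|]; first by rewrite /= !fctE mulr0 addr0.
by exists 0 => v _; rewrite (_ : (0 : functional R d) v = 0)// normr0 mul0r.
Qed.

Lemma Hm1_lin a G G' : Hm1 Omega G -> Hm1 Omega G' -> Hm1 Omega (a *: G + G').
Proof.
move=> [LG [C HC]] [LG' [C' HC']]; split=> [b v w Hv Hw|].
  by rewrite /= !fctE LG// LG'// scalerDr; rewrite /GRing.scale /=; ring.
exists (`|a| * C + C') => v Hv; rewrite !fctE; apply: le_trans (ler_normD _ _) _.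
by rewrite mulrDl; apply: lerD; [rewrite normrM -mulrA ler_wpM2l// HC|exact: HC'].
Qed.

(** Scaling to the unit ball. When the norm of [v] is zero, the boundedness constant of [G] already
    forces [G v = 0]. *)
Lemma Hm1_le G v : Hm1 Omega G -> H10 Omega v -> `|G v| <= norm_Hm1 Omega G * nH v.
Proof.
move=> [LG [C HC]] Hv; have n0 := norm_H1_ge0 oO fO v.
have [v0|vn] := eqVneq (nH v) 0; first by have := HC v Hv; rewrite v0 !mulr0.
have vp : 0 < nH v by rewrite lt_neqAle eq_sym vn.
have H0 := H10_0 oO fO d.
have G0 : G 0 = 0.
  have := LG 1 0 0 H0 H0; rewrite scale1r addr0 mul1r => /eqP.
  by rewrite -subr_eq0 opprD addrA subrr sub0r oppr_eq0 => /eqP.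
have Hw : H10 Omega ((nH v)^-1 *: v) by have := H10_lin oO fO (nH v)^-1 Hv H0; rewrite addr0.
have nw : nH ((nH v)^-1 *: v) <= 1.
  by rewrite (norm_H1Z oO fO _ (H10_H1 oO fO Hv)) ger0_norm ?invr_ge0// mulVf.
have Gw : G ((nH v)^-1 *: v) = (nH v)^-1 * G v.
  by have := LG (nH v)^-1 v 0 Hv H0; rewrite !addr0 G0 addr0.
rewrite -ler_pdivrMr// mulrC -[X in X * _]ger0_norm ?invr_ge0// -normrM -Gw.
apply: ub_le_sup; last by exists ((nH v)^-1 *: v).
exists `|C| => _ [z [Hz z1] <-]; apply: le_trans (HC z Hz) _.
by apply: le_trans (ler_wpM2r (norm_H1_ge0 oO fO z) (ler_norm C)) _; rewrite ler_piMr.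
Qed.

End dual_norm.

Section discrete_setting.
Context (R : realType) (d : nat) (Omega : set 'rV[R]_d) (Th : seq (vertices R d)) (k : nat).
Notation pt := 'rV[R]_d.
Notation mu := (@lebesgue_measure R).
Notation TR := (measurableTypeR R).
Notation fld := (field R d).
Notation vort := (pt -> 'rV[R]_(nvort d)).
Notation prs := (pt -> R^o).
Notation Hu := (Hu Omega Th k : set fld).
Notation Hw := (Hw Omega Th k : set vort).
Notation Hp := (Hp Omega Th k : set prs).
Notation nH := (@norm_H1 R d Omega d).
Notation H := (@eH R d Omega 1 d : fld -> fld -> R).
Notation LW := (@ip R d Omega 1 (nvort d) : vort -> vort -> R).
Notation LP := (@ips R d Omega : prs -> prs -> R).
Notation bb := (@Bop R d Omega : fld -> prs -> R).
Hypotheses (oO : open Omega) (bO : bounded_set Omega) (tT : triangulation Omega Th).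
Hypothesis d3 : (d <= 3)%N.
Let fO := bounded_open_fin oO bO.
Variable kappa : R.
Hypothesis kappa0 : 0 < kappa.
Notation E := (@eH R d Omega (kappa ^+ 2) d : fld -> fld -> R).

Definition cw (w : vort) (v : fld) : R := ip Omega w (curl Omega v).

Lemma sip_HuH : sip Hu H. Proof. exact: (sip_Hu Th k oO bO (sip_eH oO fO d ler01)). Qed.
Lemma sip_HuE : sip Hu E. Proof. exact: (sip_Hu Th k oO bO (sip_eH oO fO d (sqr_ge0 kappa))). Qed.

Lemma norm_HuE v : Hu v -> nH v = snorm H v.
Proof. by move=> Hv; exact: (norm_H1E oO fO (Hu_H1 oO bO Hv)). Qed.

Lemma snormE_le v : Hu v -> snorm E v <= (1 + kappa) * snorm H v.
Proof.
move=> /(Hu_H1 oO bO) Hv; have a0 : 0 <= 1 + kappa by rewrite addr_ge0// ltW.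
rewrite /snorm -[X in _ <= X * _](ger0_norm a0) -sqrtr_sqr -sqrtrM ?sqr_ge0//; apply: ler_wsqrtr; rewrite /eH.
have A0 := sip_ge0 (sip_ip oO fO 1 d) (H1_L2 oO fO Hv); have G0 := sip_ge0 (sip_ip oO fO d d) (grad_L2 oO fO Hv).
have aux (x y : R) : 0 <= x -> 0 <= y -> x + kappa ^+ 2 * y <= (1 + kappa) ^+ 2 * (x + 1 * y).
  by move=> x0 y0; have k0 := ltW kappa0; nra.
exact: (aux _ _ A0 G0).
Qed.

(** Together with [snormE_le] this fixes the equivalence constants [a = 1 + kappa] and
    [b = 1 + kappa^-1] of the abstract problem. *)
Lemma snormH_le v : Hu v -> snorm H v <= (1 + kappa^-1) * snorm E v.
Proof.
move=> /(Hu_H1 oO bO) Hv; have k0 : 0 < kappa^-1 by rewrite invr_gt0.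
have a0 : 0 <= 1 + kappa^-1 by rewrite addr_ge0// ltW.
rewrite /snorm -[X in _ <= X * _](ger0_norm a0) -sqrtr_sqr -sqrtrM ?sqr_ge0//; apply: ler_wsqrtr; rewrite /eH.
have A0 := sip_ge0 (sip_ip oO fO 1 d) (H1_L2 oO fO Hv); have G0 := sip_ge0 (sip_ip oO fO d d) (grad_L2 oO fO Hv).
suff aux (x y : R) : 0 <= x -> 0 <= y -> x + 1 * y <= (1 + kappa^-1) ^+ 2 * (x + kappa ^+ 2 * y).
  exact: (aux _ _ A0 G0).
move=> x0 y0; have -> : (1 + kappa^-1) ^+ 2 * (x + kappa ^+ 2 * y) = (1 + kappa^-1) ^+ 2 * x + (kappa + 1) ^+ 2 * y.
  by field; exact: lt0r_neq0.
apply: lerD; rewrite ?mul1r.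
  by rewrite ler_peMl// expr_ge1// ?lerDl ?(ltW k0).
by rewrite ler_peMl// expr_ge1// ?lerDr ?(ltW kappa0)// addr_ge0 ?(ltW kappa0).
Qed.

Lemma Bop_linl (q : prs) : Hp q -> lin Hu (bb^~ q).
Proof.
move=> Hq a u v Hu_ Hv; rewrite /Bop (ips_div_lin oO fO a (Hp_L2s Hq) (Hu_H1 oO bO Hu_) (Hu_H1 oO bO Hv)).
by move: (ips _ _ _) (ips _ _ _) => x y; ring.
Qed.

Lemma Bop_linr (v : fld) : Hu v -> lin Hp (bb v).
Proof.
move=> Hv a p q Hp_ Hq; have S := sip_ips oO fO.
rewrite /Bop (sip_lin S a (Hp_L2s Hp_) (Hp_L2s Hq) (div_L2s oO fO (Hu_H1 oO bO Hv))).
by move: (ips _ _ _) (ips _ _ _) => x y; ring.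
Qed.

Lemma Bop_le (v : fld) (q : prs) : Hu v -> Hp q -> `|bb v q| <= d%:R * snorm H v * snorm LP q.
Proof.
move=> Hv Hq; rewrite /Bop normrN -norm_HuE//.
exact: (ips_div_le oO fO (Hp_L2s Hq) (Hu_H1 oO bO Hv)).
Qed.

Lemma cw_linr (w : vort) : Hw w -> lin Hu (cw w).
Proof. by move=> Hw_ a u v Hu_ Hv; exact: (ip_curl_linr oO fO a (Hw_L2 oO bO Hw_) (Hu_H1 oO bO Hu_) (Hu_H1 oO bO Hv)). Qed.

Lemma cw_linl (v : fld) : Hu v -> lin Hw (cw^~ v).
Proof. by move=> Hv a w w' Hw_ Hw'; exact: (ip_curl_linl oO fO a (Hw_L2 oO bO Hw_) (Hw_L2 oO bO Hw') (Hu_H1 oO bO Hv)). Qed.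

(** The constant 6 is 2 times the largest number of vorticity components, three for [d <= 3]. *)
Lemma cw_le (w : vort) (v : fld) : Hw w -> Hu v -> `|cw w v| <= 6 * snorm LW w * snorm H v.
Proof.
move=> Hw_ Hv; apply: le_trans (ip_curl_le oO fO (Hw_L2 oO bO Hw_) (Hu_H1 oO bO Hv)) _.
rewrite norm_HuE//; apply: ler_wpM2r; first exact: sqrtr_ge0.
apply: ler_wpM2r; first exact: sqrtr_ge0.
have n3 : (nvort d <= 3)%N by move: d3; clear; case: d => [|[|[|[|]]]].
by have : (nvort d)%:R <= 3 :> R; [rewrite ler_nat|lra].
Qed.

Lemma inf_sup_le beta (q : prs) M : inf_sup Omega Th k beta -> Hp q -> 0 <= M ->
  (forall v, Hu v -> `|bb v q| <= M * snorm H v) -> beta * snorm LP q <= M.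
Proof.
move=> IS Hq M0 HM; rewrite -lee_fin; apply: le_trans (IS q Hq) _.
apply: ge_ereal_sup => _ [v [Hv vn] <-]; rewrite lee_fin.
have vp : 0 < nH v by rewrite lt_neqAle eq_sym vn (norm_H1_ge0 oO fO).
rewrite ler_pdivrMr//; have := HM v Hv; rewrite -norm_HuE// /Bop normrN => HH.
exact: le_trans (ler_norm _) HH.
Qed.

Lemma divfreeP v : divfree Hu Hp bb v <-> Kh Omega Th k v.
Proof.
split=> -[Hv H0]; split=> // q Hq; have := H0 q Hq; rewrite /Bop.
  by move/eqP; rewrite oppr_eq0 => /eqP.
by move->; rewrite oppr0.
Qed.

Lemma eq_on_null (u v : fld) : (forall x, Omega x -> u x = v x) -> E (u - v) (u - v) = 0.
Proof.
move=> uv; have z x : Omega x -> (u - v) x = (0 : fld) x by move=> Ox; rewrite !fctE uv// subrr.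
rewrite /eH (gradE oO fO z) (eq_ip oO fO z z).
exact: (sip0l (sip_eH oO fO d (sqr_ge0 kappa)) (H1_0 oO fO d)).
Qed.

(** Discrete fields are continuous on the closure, so a null difference vanishes there at every
    point. *)
Lemma null_eq_on (u v : fld) : Hu u -> Hu v -> E (u - v) (u - v) = 0 -> forall x, closure Omega x -> u x = v x.
Proof.
move=> Hu_ Hv e; have Huv := sipB sip_HuE Hu_ Hv; have H1uv := Hu_H1 oO bO Huv.
have e0 : ip Omega (u - v) (u - v) = 0.
  have A0 := sip_ge0 (sip_ip oO fO 1 d) (H1_L2 oO fO H1uv); have G0 := sip_ge0 (sip_ip oO fO d d) (grad_L2 oO fO H1uv).
  have aux (x y : R) : 0 <= x -> 0 <= y -> x + kappa ^+ 2 * y = 0 -> x = 0.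
    by move=> x0 y0 /eqP; rewrite paddr_eq0// ?(mulr_ge0 (sqr_ge0 _) y0)// => /andP[/eqP->].
  exact: (aux _ _ A0 G0 e).
case: (Huv) => cuv _ _ x Ox; have := within_ip_eq0 oO bO cuv e0 Ox.
by rewrite !fctE => /eqP; rewrite subr_eq0 => /eqP.
Qed.

End discrete_setting.

(** * Well-posedness of the discrete problem *)

Section well_posedness.
Context (R : realType) (d : nat) (Omega : set 'rV[R]_d) (Th : seq (vertices R d)) (k : nat).
Notation pt := 'rV[R]_d.
Notation mu := (@lebesgue_measure R).
Notation TR := (measurableTypeR R).
Notation fld := (field R d).
Notation vort := (pt -> 'rV[R]_(nvort d)).
Notation prs := (pt -> R^o).
Notation Hu := (Hu Omega Th k : set fld).
Notation Hw := (Hw Omega Th k : set vort).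
Notation Hp := (Hp Omega Th k : set prs).
Notation nH := (@norm_H1 R d Omega d).
Notation H := (@eH R d Omega 1 d : fld -> fld -> R).
Notation LW := (@ip R d Omega 1 (nvort d) : vort -> vort -> R).
Notation LP := (@ips R d Omega : prs -> prs -> R).
Notation bb := (@Bop R d Omega : fld -> prs -> R).
Notation cw := (@cw R d Omega : vort -> fld -> R).
Hypotheses (oO : open Omega) (bO : bounded_set Omega) (tT : triangulation Omega Th).
Hypothesis d3 : (d <= 3)%N.
Let fO := bounded_open_fin oO bO.
Variables (T kappa nu D F rho ir i4 beta : R).
Hypotheses (T0 : 0 < T) (kappa0 : 0 < kappa) (nu0 : 0 < nu) (D0 : 0 < D) (F0 : 0 < F) (rho34 : 3 <= rho <= 4).
Hypotheses (Ir : injection_norm Omega rho = ir%:E) (I4 : injection_norm Omega 4 = i4%:E).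
Hypotheses (beta0 : 0 < beta) (IS : inf_sup Omega Th k beta).
Notation E := (@eH R d Omega (kappa ^+ 2) d : fld -> fld -> R).
Notation Nf := (@nform R d Omega rho D F : fld -> fld -> R).
Variables (u0 uh0 : fld) (wh0 : vort) (ph0 : prs) (f : R -> functional R d).
Hypothesis compat : compatible_data Omega nu D F rho Th k u0 uh0 wh0 ph0.
Hypothesis Wf : W1q T (Hm1 Omega) (norm_Hm1 Omega) 1%:E f.

Notation weak := (weak_solution T Hu Hw Hp H E LW nH bb cw Nf nu (f : R -> fld -> R) uh0).
Notation sol := (solution Omega kappa nu D F rho Th k T f uh0 wh0).

Lemma solution_weak u w p : sol u w p -> weak u w p.
Proof.
move=> [sp Wu cu u0E eq]; split=> //.
- move=> t tT' eps e0; have [delta dl0 Hd] := cu t tT' eps e0; exists delta => // s sT st.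
  have [Us _ _] := sp s sT; have [Ut _ _] := sp t tT'.
  by rewrite -(norm_HuE oO bO (sipB (sip_HuH Th k oO bO) Us Ut)); exact: Hd.
- by apply: (eq_on_null oO bO) => x Ox; have [] := u0E x (subset_closure Ox).
apply: filterS eq => t H1 tT'; have [H2 H3] := H1 tT'; split=> [v psi Hv Hpsi|q Hq].
  have [D1 e1] := H2 v psi Hv Hpsi; split; first exact: D1.
  by rewrite -e1 Ah_nform !addrA.
by have := H3 q Hq => /eqP; rewrite oppr_eq0 => /eqP.
Qed.

Lemma weak_solution_solution u w p : weak u w p -> (forall x, closure Omega x -> w 0 x = wh0 x) -> sol u w p.
Proof.
move=> [sp Wu cu u0E eq] w0; have [[Huh0 _] _ _ _ _] := compat; split=> //.
- move=> t tT' eps e0; have [delta dl0 Hd] := cu t tT' eps e0; exists delta => // s sT st.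
  have [Us _ _] := sp s sT; have [Ut _ _] := sp t tT'.
  by rewrite (norm_HuE oO bO (sipB (sip_HuH Th k oO bO) Us Ut)); exact: Hd.
- move=> x cx; split; last exact: w0.
  have [U0 _ _] : [/\ Hu (u 0), Hw (w 0) & Hp (p 0)] by apply: sp; rewrite lexx ltW.
  exact: (null_eq_on oO bO U0 Huh0 u0E).
apply: filterS eq => t H1 tT'; have [H2 H3] := H1 tT'; split=> [v psi Hv Hpsi|q Hq].
  have [D1 e1] := H2 v psi Hv Hpsi; split; first exact: D1.
  by rewrite -e1 Ah_nform !addrA.
by have := H3 q Hq; rewrite /= => ->; rewrite oppr0.
Qed.

(** Evaluation at [v] is a functional on H^{-1} bounded by the H1 norm of [v], so W^{1,1} regularity
    in time passes to the scalar [f t v]. *)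
Lemma load_continuous_rep (v : fld) : H10 Omega v ->
  exists2 g : R -> R, continuous g & {ae mu, forall t : TR, 0 < t < T -> f t v = g t}.
Proof.
move=> Hv; have q1 : (1%:E : \bar R) = 1%E \/ (1%:E : \bar R) = +oo%E by left.
have lC (G : functional R d) : Hm1 Omega G -> `|G v| <= nH v * norm_Hm1 Omega G.
  by move=> HG; rewrite mulrC; exact: (Hm1_le oO fO).
have lL a (G G' : functional R d) : Hm1 Omega G -> Hm1 Omega G' -> (a *: G + G') v = a * G v + G' v by [].
have [h' [c [Lh' _ hy]]] := W1q_scalar (Hm1_0 Omega) (@Hm1_lin _ _ _) (@norm_Hm1_ge0 _ _ Omega) lL lC q1 Wf.
exists (fun t => c + prim h' t) => // t.
by apply: cvgD; [exact: cvg_cst|exact: prim_continuous].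
Qed.

Theorem discrete_well_posed : exists u w p (Gam : R -> R), [/\ sol u w p,
  forall u' w' p', sol u' w' p' -> same_solution Omega T u w p u' w' p',
  [/\ continuous Gam, forall t, 0 <= Gam t &
    {ae mu, forall t : TR, 0 < t < T -> Gam t <= norm_Hm1 Omega (f t) ^+ 2}],
  forall t, 0 <= t <= T -> nH (u t) ^+ 2 <=
    (1 + kappa^-1) ^+ 2 * (expR t * (Eop Omega kappa uh0 uh0 + (1 + kappa^-1) ^+ 2 * \int[mu]_(s in `[0, T]) Gam s)) &
  (forall t, 0 <= t <= T -> norm_L2 Omega (w t) <= 6 * nH (u t)) /\
  forall t, 0 <= t <= T -> beta * norm_L2s Omega (p t) <= (1 + (1 + kappa) * (1 + kappa^-1)) *
    (Num.sqrt (Gam t) + rate 6 nu D (18 * i4 ^+ 2) (2 * F * (1 + ir) ^+ 4) (rho - 1) (nH (u t)))].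
Proof.
have SH := sip_HuH Th k oO bO; have SE := sip_HuE Th k oO bO kappa.
have SW := sip_Hw Th k oO bO; have SP := sip_Hp Th k oO bO.
have nrm0 (v : fld) : 0 <= nH v by exact: (norm_H1_ge0 oO fO).
have nrmE (v : fld) : Hu v -> nH v = snorm H v by exact: norm_HuE.
have a0 : 0 <= 1 + kappa by rewrite addr_ge0// ltW.
have b0 : 0 <= 1 + kappa^-1 by rewrite addr_ge0// invr_ge0 ltW.
have EH := @snormE_le R d Omega Th k oO bO kappa kappa0.
have HE := @snormH_le R d Omega Th k oO bO kappa kappa0.
have bl := @Bop_linl R d Omega Th k oO bO.
have br := @Bop_linr R d Omega Th k oO bO.
have bM := @Bop_le R d Omega Th k oO bO.
have cl := @cw_linr R d Omega Th k oO bO.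
have cr := @cw_linl R d Omega Th k oO bO.
have cc0 : 0 <= 6 :> R by [].
have cM := @cw_le R d Omega Th k oO bO d3.
have c10 := ltW D0.
have c20 : 0 <= 18 * i4 ^+ 2 by rewrite mulr_ge0// sqr_ge0.
have ir0 : 0 <= ir.
  have r0 : 0 < rho by have [r3 _] := andP rho34; apply: lt_le_trans r3.
  exact: (injection_ge0 oO fO r0 Ir).
have c30 : 0 <= 2 * F * (1 + ir) ^+ 4.
  by apply: mulr_ge0; [rewrite mulr_ge0// ltW|rewrite exprn_ge0// addr_ge0].
have H1 v : Hu v -> Defs.H1 Omega v by exact: Hu_H1.
have Nl (u : fld) : Hu u -> lin Hu (Nf u).
  by move=> Hu_ c v w Hv Hw_; exact: (nform_lin oO bO D F rho34 Ir I4 c (H1 _ Hu_) (H1 _ Hv) (H1 _ Hw_)).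
have Nge (u : fld) : Hu u -> 0 <= Nf u u.
  by move=> Hu_; exact: (nform_ge0 oO bO rho34 Ir I4 c10 (ltW F0) (Hu_H10 Hu_)).
have Nle (u v : fld) : Hu u -> Hu v ->
    `|Nf u v| <= growth D (18 * i4 ^+ 2) (2 * F * (1 + ir) ^+ 4) (rho - 1) (snorm H u) * snorm H v.
  move=> Hu_ Hv; rewrite -(nrmE u Hu_) -(nrmE v Hv).
  exact: (nform_bound oO bO rho34 Ir I4 c10 (ltW F0) d3 (H1 _ Hu_) (H1 _ Hv)).
have Nlip n (e : 'I_n -> fld) : (forall i, Hu (e i)) -> forall v, Hu v ->
    loclip (fun c : 'rV[R]_n => Nf (lincomb e (fun i => c 0 i)) v).
  move=> He v Hv; apply: (nform_loclip oO bO D F rho34 Ir I4).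
  - by move=> i; exact: (H1 _ (He i)).
  - by move=> i; case: (He i).
  - exact: (H1 _ Hv).
  - by case: Hv.
have Neq (u u' v : fld) : Hu u -> Hu u' -> Hu v -> H (u - u') (u - u') = 0 -> Nf u v = Nf u' v.
  move=> Hu_ Hu' Hv e; apply: (nform_eq oO bO) => x Ox.
  (* The inner product of H1 is the energy form with [kappa] equal to 1. *)
  have e' : (@eH R d Omega (1 ^+ 2) d : fld -> fld -> R) (u - u') (u - u') = 0 by rewrite expr1n.
  exact: (null_eq_on oO bO Hu_ Hu' e' (subset_closure Ox)).
have KH : divfree Hu Hp bb `<=` Hu by move=> v [].
have [Nh fh] := Hu_finite_sdim oO bO tT ler01 (@subset_refl _ Hu).
have [Nk fk] := Hu_finite_sdim oO bO tT (sqr_ge0 kappa) KH.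
have [Nw fw] := Hw_finite_sdim k oO bO tT.
have [Np fp] := Hp_finite_sdim k oO bO tT.
have SK : sip (divfree Hu Hp bb) E.
  apply: (sip_sub SE KH).
    by split=> [|q Hq]; [exact: (sip0 SH)|exact: (lin0 SH (bl q Hq))].
  move=> c x y [Hx bx] [Hy by_]; split; first exact: (sipP SH).
  by move=> q Hq; rewrite (bl q Hq c x y Hx Hy) bx// by_// mulr0 addr0.
have [nh [h [oh ch]]] := orthonormal_basis SH fh.
have [nk [kk [ok ck]]] := orthonormal_basis SK fk.
have [nw [hw [ow cow]]] := orthonormal_basis SW fw.
have [np [hp [op cp]]] := orthonormal_basis SP fp.
have Hh j : H10 Omega (h j) by apply: (@Hu_H10 _ _ _ Th k); case: oh.
pose gH j := projT1 (cid2 (load_continuous_rep (Hh j))).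
have cgH j : continuous (gH j) by rewrite /gH; case: cid2.
have fg j : {ae mu, forall t : TR, 0 < t < T -> f t (h j) = gH j t} by rewrite /gH; case: cid2.
have fl : {ae mu, forall t : TR, 0 < t < T ->
    lin Hu (f t) /\ forall v, Hu v -> `|f t v| <= norm_Hm1 Omega (f t) * snorm H v}.
  have [[[s [_ Hs]] _] _] := Wf; apply: filterS Hs => t Ht tT'.
  have tI : (`]0, T[%classic : set TR) t by rewrite /= in_itv.
  have [Xf _] := Ht tI.
  split=> [c v w Hv Hw_|v Hv].
    by have [L _] := Xf; apply: L; exact: (@Hu_H10 _ _ _ Th k).
  by rewrite -(nrmE v Hv); apply: (Hm1_le oO fO Xf); exact: (@Hu_H10 _ _ _ Th k).
have infsup (q : prs) M : Hp q -> 0 <= M -> (forall v, Hu v -> `|bb v q| <= M * snorm H v) -> beta * snorm LP q <= M.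
  by move=> Hq M0 HM; exact: (inf_sup_le oO bO IS Hq M0 HM).
have [Kc Wc Pc cmp _] := compat.
have Kuh0 : divfree Hu Hp bb uh0 by apply/divfreeP.
have Huh0 := KH _ Kuh0.
have Nn0 t : 0 <= norm_Hm1 Omega (f t) by exact: norm_Hm1_ge0.
have [u [p [up [Wu uu0 cu] eq nb pb]]] := semidiscrete_exists T0 SH SE SW SP nrm0 nrmE a0 b0 EH HE bl br bM cl cr cc0 cM
  nu0 c10 c20 c30 Nl Nge Nle Nlip oh ch ok ck ow cow op cp cgH infsup Kuh0.
have wk := weak_solution_exists SH SW cr cM oh ch ow cow fl fg up Wu uu0 cu eq.
exists u, (wproj cw hw \o u), p, (Gam gH).
have sl : sol u (wproj cw hw \o u) p.
  apply: weak_solution_solution => // x cx /=.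
  have [Hu0 _] := up 0; have Hu0' := KH _ Hu0.
  rewrite (wproj_null SH SE HE cl cM ow Hu0' Huh0 uu0).
  (* The compatibility condition tested with a zero velocity says that [wh0] is the projection of
     the curl of [uh0]; this is why the initial vorticity can be prescribed at all. *)
  have nul : LW (wh0 - wproj cw hw uh0) (wh0 - wproj cw hw uh0) = 0.
    have H00 : Kh Omega Th k 0 by apply/divfreeP; exact: (sip0 SK).
    apply: (weak_vort SW cr cM nu0 ow cow (A := Nf uh0 0) (B := 0) (C := 0) (c := fh0 Omega nu D F rho u0 uh0 0) Huh0 Wc) => psi Hpsi.
    by have := cmp 0 psi H00 Hpsi; rewrite Ah_nform => <-; rewrite addr0 addr0.
  have Hd := sipB SW Wc (wprojP SW cw ow uh0).
  have [cd _] := Hd; have := within_ip_eq0 oO bO cd nul cx.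
  by rewrite !fctE => /eqP; rewrite subr_eq0 => /eqP.
have ub (t : R) : Hu (u t) by apply: KH; case: (up t).
split=> //.
- move=> u' w' p' /solution_weak wk'.
  have [uu ww] := semidiscrete_unique T0 SH SE SW SP nrm0 nrmE EH HE bl br bM cl cr cM nu0 Nlip Neq oh ch ok ck ow cow cgH fl fg infsup Kuh0 beta0 wk wk'.
  have [sp _ _ _ _] := wk; have [sp' _ _ _ _] := wk'; split.
    move=> t x tT' cx; have [U _ _] := sp t tT'; have [U' _ _] := sp' t tT'.
    exact: (null_eq_on oO bO U U' (uu t tT')).
  apply: filterS ww => t H1' tT' x cx; have [e1 e2] := H1' tT'.
  have tT'' : 0 <= t <= T by have /andP[/ltW -> /ltW ->] := tT'.
  have [_ W1 P1] := sp t tT''; have [_ W2 P2] := sp' t tT''.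
  have [cd _] := sipB SW W1 W2; have [cp' _ _ _] := sipB SP P1 P2.
  have := within_ip_eq0 oO bO cd e1 cx; have := within_ips_eq0 oO bO cp' e2 cx.
  by rewrite !fctE => /eqP + /eqP; rewrite !subr_eq0 => /eqP -> /eqP ->.
- split; first exact: Gam_continuous.
    by move=> t; exact: Gam_ge0.
  exact: (Gam_ae SH oh Nn0 fl fg).
- by move=> t tT'; rewrite (nrmE _ (ub t)); exact: nb.
- split=> t tT'; rewrite (nrmE _ (ub t)); last exact: pb.
  exact: (snorm_wproj SW cr cc0 cM ow cow (ub t)).
Qed.

End well_posedness.

(** * Initial data *)

Section initial_arithmetic.
Variable R : realType.

(** The sum collects [nu + 1] from the two gradient pairings and the three constants of
    [nform_bound]. The factor [1 + D^-1] turns control of [D] times the squared L2 norm plus the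
    squared gradient norm into control of the full H1 norm. *)
Definition init_const (nu D F ir i4 : R) : R :=
  (1 + D^-1) * (nu + 1 + D + 18 * i4 ^+ 2 + 2 * F * (1 + ir) ^+ 4).

(** Here [n] and [m] are the H1 norms of [u0] and [uh0], [A] and [G] the squared L2 norms of [uh0]
    and of its gradient, [fo] the Forchheimer term, [w] the squared vorticity norm, [cr] the pairing
    of the two gradients, and [nf0] the form at [u0] tested with [uh0]. The terms in [fo] and [w]
    are dropped by sign, and one factor [m] is divided out. *)
Lemma init_arith (nu D F ir i4 rho n m A G fo w cr nf nf0 : R) : 0 < nu -> 0 < D -> 0 < F -> 0 <= ir ->
  nf + nu * w = nu * cr + nf0 + cr - G ->
  0 <= fo -> 0 <= w -> nf = D * A + F * fo -> `|cr| <= n * m ->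
  `|nf0| <= growth D (18 * i4 ^+ 2) (2 * F * (1 + ir) ^+ 4) (rho - 1) n * m -> m ^+ 2 = A + G ->
  0 <= A -> 0 <= G -> 0 <= n -> 0 <= m -> m <= init_const nu D F ir i4 * (n + n ^+ 2 + n `^ (rho - 1)).
Proof.
move=> nu0 D0 F0 ir0; rewrite /growth /init_const; have := powR_ge0 n (rho - 1); have := sqr_ge0 i4.
have c30 : 0 <= 2 * F * (1 + ir) ^+ 4.
  by apply: mulr_ge0; [rewrite mulr_ge0// ltW|rewrite exprn_ge0// addr_ge0].
have Di : 0 < D^-1 by rewrite invr_gt0.
have DD : D^-1 * D = 1 by rewrite mulVf// lt0r_neq0.
move: (n `^ _) (2 * F * _) (D^-1) c30 Di DD (i4 ^+ 2) => q c3 Dv c30 Di DD i42 i420 q0 e fo0 w0 nfe crb nfb me a0 g0 n0 m0.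
have [mz|mn] := eqVneq m 0.
  have P1 : 0 <= nu + 1 + D + 18 * i42 + c3 by lra.
  have P2 : 0 <= n + n ^+ 2 + q by have := sqr_ge0 n; lra.
  by rewrite mz mulr_ge0// mulr_ge0// addr_ge0// ltW.
have mp : 0 < m by rewrite lt_neqAle eq_sym mn.
have h1 : cr <= n * m by apply: le_trans (ler_norm _) crb.
have h2 := le_trans (ler_norm _) nfb.
have h3 : D * A + G <= (nu + 1) * (n * m) + (D * n + 18 * i42 * n ^+ 2 + c3 * q) * m.
  have h4 : (nu + 1) * cr <= (nu + 1) * (n * m) by rewrite ler_wpM2l// addr_ge0// ltW.
  have h5 : 0 <= F * fo by rewrite mulr_ge0// ltW.
  have h6 : 0 <= nu * w by rewrite mulr_ge0// ltW.
  have h7 : (nu + 1) * cr = nu * cr + cr by ring.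
  by clear -nfe e h2 h4 h5 h6 h7; lra.
have h8 : A + G <= (1 + Dv) * (D * A + G).
  have -> : (1 + Dv) * (D * A + G) = Dv * D * A + G + (D * A + Dv * G) by ring.
  by rewrite DD mul1r lerDl addr_ge0// mulr_ge0// ltW.
rewrite -(ler_pM2r mp) -expr2 me; apply: le_trans h8 _.
have D1 : 0 <= 1 + Dv by rewrite addr_ge0// ltW.
apply: le_trans (ler_wpM2l D1 h3) _; rewrite -2![in leRHS]mulrA ler_wpM2l//.
have -> : (nu + 1) * (n * m) + (D * n + 18 * i42 * n ^+ 2 + c3 * q) * m =
   ((nu + 1 + D) * n + 18 * i42 * n ^+ 2 + c3 * q) * m by ring.
rewrite [leRHS]mulrA; apply: ler_wpM2r => //.
have t1 : 0 <= nu + 1 + D by lra.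
have t2 : 0 <= 18 * i42 by rewrite mulr_ge0.
have p1 := sqr_ge0 n; clear -t1 t2 c30 p1 n0 q0.
move: (nu + 1 + D) (18 * i42) (n ^+ 2) t1 t2 p1 => x1 x2 x3 t1 t2 p1; nra.
Qed.

End initial_arithmetic.

Section initial_data.
Context (R : realType) (d : nat) (Omega : set 'rV[R]_d) (Th : seq (vertices R d)) (k : nat).
Notation pt := 'rV[R]_d.
Notation fld := (field R d).
Notation vort := (pt -> 'rV[R]_(nvort d)).
Notation nH := (@norm_H1 R d Omega d).
Notation H1 := (@Defs.H1 R d Omega d).
Notation ip := (ip Omega).
Notation ips := (ips Omega).
Notation grad := (grad Omega).
Hypotheses (oO : open Omega) (bO : bounded_set Omega).
Hypothesis d3 : (d <= 3)%N.
Let fO := bounded_open_fin oO bO.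
Variables (nu D F rho ir i4 : R).
Hypotheses (nu0 : 0 < nu) (D0 : 0 < D) (F0 : 0 < F) (rho34 : 3 <= rho <= 4).
Hypotheses (Ir : injection_norm Omega rho = ir%:E) (I4 : injection_norm Omega 4 = i4%:E).
Notation Nf := (@nform R d Omega rho D F : fld -> fld -> R).
Let I4' := injection4 oO fO I4.

Let mc v w i j : H1 v -> H1 w -> L2s Omega (fun x => v x 0 i * w x 0 j).
Proof. by move=> Hv Hw; exact: (fpow4_L2sM oO fO (I4'.2 v Hv i).1 (I4'.2 w Hw j).1). Qed.

Lemma intg_convect (z u v : fld) : H1 z -> H1 u -> H1 v -> intg Omega (fun x => dot (convect Omega u z x) (v x)).
Proof.
move=> Hz Hu Hv.
have I : intg Omega (fun x => \sum_i \sum_j (z x 0 j * v x 0 i) * grad u x i j).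
  apply: (intg_sum oO fO) => i; apply: (intg_sum oO fO) => j.
  exact: (L2s_intgM oO fO (mc j i Hz Hv) (grad_L2 oO fO Hu i j)).
congr (intg _ _): I; apply/funext => x; rewrite /dot big_ord1; apply: eq_bigr => i _.
by rewrite /convect mxE mulr_suml; apply: eq_bigr => j _; rewrite !mxE; ring.
Qed.

(** The continuous datum has zero divergence, so the stabilising term, absent from [f0], may be
    inserted there at no cost. *)
Lemma ip_div_solenoidal (z u v : fld) : solenoidal Omega z -> H1 u -> H1 v ->
  ip (fun x => div Omega z x *: u x) v = 0.
Proof.
move=> [Hz0 z0] Hu Hv; have Hz := H10_H1 oO fO Hz0; rewrite (ip_divt oO fO I4' Hz Hu Hv).
apply: big1 => i _; have S := sip_ips oO fO; have Luv := mc i i Hu Hv.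
have Lz j : L2s Omega (fun x => grad z x j j) := grad_L2 oO fO Hz j j.
transitivity (ips (fun x => u x 0 i * v x 0 i) (div Omega z)).
  rewrite -(sip_sumr S _ _ Luv)//; congr Defs.ips; apply/funext => x; by rewrite fct_sumE.
have Ld : L2s Omega (div Omega z) := div_L2s oO fO Hz.
rewrite (sipC S Luv Ld) (ips_ae oO fO Ld (L2s0 oO fO) Luv z0).
exact: (sip0l S Luv).
Qed.

Lemma f0_nform (u v : fld) : solenoidal Omega u -> H1 v ->
  f0 Omega nu D F rho u v = nu * ip (grad u) (grad v) + Nf u v.
Proof.
move=> su Hv; have Hu := H10_H1 oO fO su.1; have S := sip_dot R 1 d.
have Iu := intg_dot oO fO (H1_L2 oO fO Hu) (H1_L2 oO fO Hv).
have If := intg_forch oO fO rho34 Ir Hu Hv.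
have Ic := intg_convect Hu Hu Hv.
rewrite /f0 /nform /tri (ip_div_solenoidal su Hu Hv) mulr0 addr0; congr (_ + _).
have mO := measurable_Omega oO fO.
have IDu := intgZ oO fO D Iu; have IFf := intgZ oO fO F If.
rewrite /Defs.ip -(RintegralZl D mO Iu) -(RintegralZl F mO If) -(RintegralD mO IDu IFf).
rewrite -(RintegralD mO (intgD oO fO IDu IFf) Ic); apply: eq_Rintegral => x _.
by rewrite (sipDl S)// (sipDl S)// (sipZl S)// (sipZl S).
Qed.

(** Testing with [(uh0, wh0)] makes the two curl terms cancel, and skew-symmetry removes the
    convection. *)
Lemma init_bound (u0 uh0 : fld) (wh0 : vort) ph0 : solenoidal Omega u0 ->
  compatible_data Omega nu D F rho Th k u0 uh0 wh0 ph0 ->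
  nH uh0 <= init_const nu D F ir i4 * (nH u0 + nH u0 ^+ 2 + nH u0 `^ (rho - 1)).
Proof.
move=> su [Kuh0 Hwh0 _ cmp _]; have Hh : Hu Omega Th k uh0 := Kuh0.1.
have Hu_ := Hu_H1 oO bO Hh; have H0 := H10_H1 oO fO su.1.
have eq := cmp uh0 wh0 Kuh0 Hwh0; rewrite Ah_nform /fh0 (f0_nform su Hu_) addrK in eq.
have skew := tri_skew oO fO I4' (Hu_H10 Hh).
have ff := ip_forch_ge0 oO fO rho34 Ir uh0.
have ww := sip_ge0 (sip_ip oO fO 1 (nvort d)) (Hw_L2 oO bO Hwh0).
have nfE : Nf uh0 uh0 = D * ip uh0 uh0 + F * ip (forch rho uh0) uh0 + tri Omega uh0 uh0 uh0 by [].
rewrite skew addr0 in nfE.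
have gg : `|ip (grad u0) (grad uh0)| <= nH u0 * nH uh0.
  apply: le_trans (cauchy_schwarz (sip_ip oO fO d d) (grad_L2 oO fO H0) (grad_L2 oO fO Hu_)) _.
  by apply: ler_pM; rewrite ?sqrtr_ge0//; exact: (norm_grad_le_H1 oO fO).
have nb := nform_bound oO bO rho34 Ir I4 (ltW D0) (ltW F0) d3 H0 Hu_.
have sq := norm_H1_sq oO fO Hu_.
have A0 := sip_ge0 (sip_ip oO fO 1 d) (H1_L2 oO fO Hu_).
have G0 := sip_ge0 (sip_ip oO fO d d) (grad_L2 oO fO Hu_).
have n0 := norm_H1_ge0 oO fO u0; have m0 := norm_H1_ge0 oO fO uh0.
have ir0 : 0 <= ir.
  have r0 : 0 < rho by have [r3 _] := andP rho34; apply: lt_le_trans r3.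
  exact: (injection_ge0 oO fO r0 Ir).
exact: (init_arith nu0 D0 F0 ir0 eq ff ww nfE gg nb sq A0 G0 n0 m0).
Qed.

End initial_data.

(** * A priori bounds *)

Section time_bounds.
Variables (R : realType) (T : R).
Notation mu := (@lebesgue_measure R).
Notation TR := (measurableTypeR R).
Notation I := (`]0, T[%classic : set TR).
Hypothesis T0 : 0 < T.

(** The primitive carries the factor 1/k, at most 1; no power of [T] is lost. *)
Lemma integral_expR_powR k : 1 <= k ->
  (\int[mu]_(t in I) (expR t `^ k)%:E <= (expR T `^ k)%:E)%E.
Proof.
move=> k1; have k0 : k != 0 by rewrite gt_eqF// (lt_le_trans ltr01 k1).
have dE t : isd (fun t => k^-1 * expR (k * t + 0)) t (expR t `^ k).
  have := isdZ k^-1 (@isd_comp _ expR (fun t => k * t + 0) t _ _ (isd_expR _) (isd_affine k 0 t)).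
  by move/isd_eq; apply=> //; rewrite addr0 [expR _ * k]mulrC mulrA mulVf// mul1r mulrC expRM.
have cF : continuous (fun t => k^-1 * expR (k * t + 0)) by move=> t; exact: isd_continuous (dE t).
have cf : continuous (fun t : R => expR t `^ k).
  move=> t; rewrite (_ : (fun t : R => _) = fun t => expR (k * t + 0)).
    apply: (@isd_continuous _ _ _ (expR (k * t + 0) * k)).
    exact: (@isd_comp _ expR (fun t => k * t + 0) t _ _ (isd_expR _) (isd_affine k 0 t)).
  by apply/funext => s; rewrite addr0 mulrC expRM.
apply: (@le_trans _ _ (\int[mu]_(t in `[0%R, T]) (expR t `^ k)%:E)%E).
  apply: ge0_subset_integral => //.
  - by apply/measurable_EFinP; apply: measurable_funTS; exact: continuous_measurable_fun.
  - exact: subset_itv_oo_cc.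
rewrite (continuous_FTC2 (F := fun t => k^-1 * expR (k * t + 0)) T0).
- rewrite -EFinB lee_fin -mulrBr; apply: (@le_trans _ _ (k^-1 * expR (k * T + 0))).
    by rewrite ler_wpM2l ?invr_ge0 ?(le_trans ler01 k1)// gerBl expR_ge0.
  by rewrite addr0 [k * T]mulrC expRM ler_piMl ?powR_ge0// invf_le1// (lt_le_trans ltr01 k1).
- exact: continuous_subspaceT.
- split.
  + by move=> t _; exact: (@ex_derive _ _ _ _ _ _ _ (dE t)).
  + exact/cvg_at_right_filter/cF.
  + exact/cvg_at_left_filter/cF.
- by move=> t _; exact: isd_derive1 (dE t).
Qed.

Definition int_le (g : R -> R) (B : R) : Prop :=
  [/\ measurable_fun I (EFin \o g : TR -> \bar R), forall t, 0 <= g t &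
      (\int[mu]_(t in I) (g t)%:E <= B%:E)%E].

Lemma int_leD g1 g2 B1 B2 : int_le g1 B1 -> int_le g2 B2 -> int_le (fun t => g1 t + g2 t) (B1 + B2).
Proof.
move=> [m1 p1 h1] [m2 p2 h2]; split.
- by apply/measurable_EFinP; apply: measurable_funD; exact/measurable_EFinP.
- by move=> t; rewrite addr_ge0.
under eq_integral do rewrite EFinD.
rewrite ge0_integralD//; last 2 first.
- by move=> t _; rewrite lee_fin.
- by move=> t _; rewrite lee_fin.
by rewrite EFinD leeD.
Qed.

Lemma int_leZ c g B : 0 <= c -> int_le g B -> int_le (fun t => c * g t) (c * B).
Proof.
move=> c0 [m1 p1 h1]; split.
- by apply/measurable_EFinP; apply: measurable_funM => //; exact/measurable_EFinP.
- by move=> t; rewrite mulr_ge0.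
under eq_integral do rewrite EFinM.
rewrite ge0_integralZl// ?lee_fin//; last by move=> t _; rewrite lee_fin.
by rewrite EFinM lee_wpmul2l ?lee_fin.
Qed.

Lemma int_le_expR k : 1 <= k -> int_le (fun t => expR t `^ k) (expR T `^ k).
Proof.
move=> k1; split; [|by move=> t; exact: powR_ge0|exact: integral_expR_powR].
apply/measurable_EFinP; apply: measurable_funTS.
exact: (measurableT_comp (@measurable_powR R k) (@measurable_expR R)).
Qed.

End time_bounds.

(** * Constants of the estimates *)

Section constants.
Variable R : realType.

(** The part [b * (a * C0)] comes from the initial data, where [C0] bounds [uh0] by [u0]; the part
    [b * b] comes from the load. *)
Definition energy_const (a b C0 : R) : R := b * (a * C0 + b).

(** The 2 is the square root of the 4 in [sqr_sum4]; [36 * nu] is [nu] times the square of the curl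
    constant 6; the exponent 3 bounds [rho - 1]. *)
Definition pressure_const (a b beta nu D c2 c3 K : R) : R :=
  2 * ((1 + a * b) / beta) * (1 + (D + 36 * nu) * K + c2 * K ^+ 2 + c3 * (1 + K) ^+ 3).

Lemma sqr_sum4 (x1 x2 x3 x4 : R) : (x1 + x2 + x3 + x4) ^+ 2 <= 4 * (x1 ^+ 2 + x2 ^+ 2 + x3 ^+ 2 + x4 ^+ 2).
Proof.
rewrite -subr_ge0 (_ : _ - _ = (x1 - x2) ^+ 2 + (x1 - x3) ^+ 2 + (x1 - x4) ^+ 2 + (x2 - x3) ^+ 2 + (x2 - x4) ^+ 2 + (x3 - x4) ^+ 2).
  by rewrite !addr_ge0// sqr_ge0.
by ring.
Qed.

Lemma sqr_sum4_le (x1 x2 x3 x4 : R) : 0 <= x1 -> 0 <= x2 -> 0 <= x3 -> 0 <= x4 ->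
  x1 ^+ 2 + x2 ^+ 2 + x3 ^+ 2 + x4 ^+ 2 <= (x1 + x2 + x3 + x4) ^+ 2.
Proof.
move=> h1 h2 h3 h4; rewrite -subr_ge0 (_ : _ - _ = 2 * (x1 * x2 + x1 * x3 + x1 * x4 + x2 * x3 + x2 * x4 + x3 * x4)).
  by rewrite mulr_ge0// !addr_ge0// mulr_ge0.
by ring.
Qed.

(** All summands are nonnegative, so a sum of squares is at most the square of the sum, and each
    power of [K] is absorbed in the constant factor. *)
Lemma pressure_arith (X K delta D' c2 c3 r : R) : 0 <= X -> 0 <= K -> 0 <= D' -> 0 <= c2 -> 0 <= c3 -> 0 <= r <= 3 ->
  X <= delta ->
  X ^+ 2 + (D' * (K * delta)) ^+ 2 + (c2 * (K * delta) ^+ 2) ^+ 2 + (c3 * (K * delta) `^ r) ^+ 2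
  <= ((1 + D' * K + c2 * K ^+ 2 + c3 * (1 + K) ^+ 3) * (delta + delta ^+ 2 + delta `^ r)) ^+ 2.
Proof.
move=> X0 K0 D'0 c20 c30 /andP[r0 r3] Xd; have d0 : 0 <= delta by apply: le_trans Xd.
have Kd0 : 0 <= K * delta by rewrite mulr_ge0.
have K10 : 0 <= 1 + K by rewrite addr_ge0.
have dr0 : 0 <= delta `^ r by exact: powR_ge0.
have h2 : 0 <= D' * (K * delta) by rewrite mulr_ge0.
have h3 : 0 <= c2 * (K * delta) ^+ 2 by rewrite mulr_ge0// sqr_ge0.
have h4 : 0 <= c3 * (K * delta) `^ r by rewrite mulr_ge0// powR_ge0.
apply: le_trans (sqr_sum4_le X0 h2 h3 h4) _.
have Kr : (K * delta) `^ r <= (1 + K) ^+ 3 * delta `^ r.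
  rewrite powRM//; apply: ler_wpM2r => //; apply: (@le_trans _ _ ((1 + K) `^ r)).
    by apply: ge0_ler_powR; rewrite ?nnegrE// lerDr.
  by rewrite -powR_mulrn//; apply: ler_powR => //; rewrite lerDl.
have Kc : c3 * (K * delta) `^ r <= c3 * (1 + K) ^+ 3 * delta `^ r by rewrite -mulrA; exact: ler_wpM2l.
have t1 : 0 <= D' * K by rewrite mulr_ge0.
have t2 : 0 <= c2 * K ^+ 2 by rewrite mulr_ge0// sqr_ge0.
have t3 : 0 <= c3 * (1 + K) ^+ 3 by rewrite mulr_ge0// exprn_ge0.
have d20 := sqr_ge0 delta.
rewrite ler_sqr ?nnegrE; last 2 first.
- by apply: addr_ge0 => //; apply: addr_ge0 => //; exact: addr_ge0.
- apply: mulr_ge0; last by apply: addr_ge0 => //; exact: addr_ge0.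
  by apply: addr_ge0 => //; apply: addr_ge0 => //; exact: addr_ge0.
rewrite exprMn; move: Kc; clear -Xd t1 t2 t3 d0 d20 dr0.
rewrite (mulrA D') (mulrA c2).
move: t1 t2 t3 d0 d20 dr0 Xd.
move: (c3 * (K * delta) `^ r) (c3 * (1 + K) ^+ 3) (D' * K) (c2 * K ^+ 2) => x1 y3 y1 y2.
move: (delta `^ r) (delta ^+ 2) => x2 x5 t1 t2 t3 d0 d20 dr0 Xd Kc; move: d0 Xd; move: delta => x4 d0 Xd.
rewrite (_ : (1 + y1 + y2 + y3) * (x4 + x5 + x2) = x4 + y1 * x4 + y2 * x5 + y3 * x2
  + (x5 + x2 + y1 * (x5 + x2) + y2 * (x4 + x2) + y3 * (x4 + x5))); last by ring.
have : 0 <= x5 + x2 + y1 * (x5 + x2) + y2 * (x4 + x2) + y3 * (x4 + x5).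
  by do 4?[apply: addr_ge0 => //]; apply: mulr_ge0 => //; exact: addr_ge0.
lra.
Qed.

End constants.

Section a_priori.
Variables (R : realType) (T : R).
Notation mu := (@lebesgue_measure R).
Notation TR := (measurableTypeR R).
Hypothesis T0 : 0 < T.
Variables (a b C0 beta nu D c2 c3 r S E0 X : R) (Nn Gam n l w p : R -> R).
Hypotheses (a0 : 0 <= a) (b0 : 0 <= b) (C00 : 0 <= C0) (beta0 : 0 < beta) (nu0 : 0 <= nu) (D0 : 0 <= D).
Hypotheses (c20 : 0 <= c2) (c30 : 0 <= c3) (r23 : 2 <= r <= 3) (S0 : 0 <= S).
Hypotheses (E0le : E0 <= (a * C0 * S) ^+ 2).
Hypotheses (cGam : continuous Gam) (Gam0 : forall t, 0 <= Gam t).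
Hypothesis Gam_le : {ae mu, forall t : TR, 0 < t < T -> Gam t <= Nn t ^+ 2}.
Hypothesis HX : norm_LT T 2 Nn = X%:E.
Hypothesis n0 : forall t, 0 <= n t.
Hypothesis energy : forall t, 0 <= t <= T ->
  n t ^+ 2 <= b ^+ 2 * (expR t * (E0 + b ^+ 2 * \int[mu]_(s in `[0, T]) Gam s)).
Hypotheses (l0 : forall t, 0 <= l t) (ln : forall t, 0 < t < T -> l t <= n t).
Hypotheses (w0 : forall t, 0 <= w t) (wn : forall t, 0 <= t <= T -> w t <= 6 * n t).
Hypotheses (p0 : forall t, 0 <= p t).
Hypothesis pn : forall t, 0 <= t <= T ->
  beta * p t <= (1 + a * b) * (Num.sqrt (Gam t) + rate 6 nu D c2 c3 r (n t)).

Variables (s delta M K : R).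
Hypotheses (KE : K = energy_const a b C0) (sE : s = Num.sqrt (expR T)) (deltaE : delta = s * (X + S)) (ME : M = K * (X + S)).

Let K0 : 0 <= K. Proof. by rewrite KE mulr_ge0// addr_ge0// mulr_ge0. Qed.
Let X0 : 0 <= X. Proof. by rewrite -lee_fin -HX norm_LT2_ge0. Qed.
Let XS0 : 0 <= X + S. Proof. exact: addr_ge0. Qed.
Let M0 : 0 <= M. Proof. by rewrite ME mulr_ge0. Qed.
Let s0 : 0 <= s. Proof. by rewrite sE sqrtr_ge0. Qed.
Let s2 : s ^+ 2 = expR T. Proof. by rewrite sE sqr_sqrtr// expR_ge0. Qed.
Let s1 : 1 <= s. Proof. by rewrite sE -sqrtr1 ler_wsqrtr// -expR0 ler_expR ltW. Qed.
Let delta0 : 0 <= delta. Proof. by rewrite deltaE mulr_ge0. Qed.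
Let sM : s * M = K * delta. Proof. by rewrite ME deltaE mulrCA. Qed.
Let Tin t : 0 < t < T -> 0 <= t <= T. Proof. by move=> /andP[/ltW -> /ltW ->]. Qed.

(** The comparison goes from the continuous [Gam] up to the lower integral of [Nn ^+ 2], which is
    the square of the norm of the data. *)
Let GamI : int_le T Gam (X ^+ 2).
Proof.
have mG : measurable_fun (`]0, T[%classic : set TR) (Gam : TR -> R).
  by apply: measurable_funTS; exact: continuous_measurable_fun.
split=> //; first exact/measurable_EFinP.
have -> : (X ^+ 2)%:E = (1%:E * \int[mu]_(t in (`]0%R, T[%classic : set TR)) (Nn t ^+ 2)%:E)%E.
  by rewrite mul1e -norm_LT2_sq HX poweR_EFin powR_mulrn.
apply: (ae_le_lower_integralZ _ mG) => //.
  by move=> t; exact: sqr_ge0.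
by apply: filterS Gam_le => t H tI; rewrite mul1r; apply: H; move: tI; rewrite /= in_itv.
Qed.

Let GamR : \int[mu]_(t in `[0, T]) Gam t <= X ^+ 2.
Proof.
have [mG _ IG] := GamI; rewrite -lee_fin; apply: le_trans IG.
have ig : mu.-integrable (`[0, T]%classic : set TR) (EFin \o Gam).
  by apply: continuous_compact_integrable; [exact: segment_compact|exact: continuous_subspaceT].
have mD : measurable (`[0, T]%classic : set TR) by exact: measurable_itv.
rewrite /Rintegral (fineK (integrable_fin_num mD ig)).
by rewrite (integral_itv_bndoo _ _ mG).
Qed.

(** Here [n] stands for the H1 norm of the velocity, [X] for the L2-in-time norm of [f] and [S] for
    the polynomial in the norm of [u0]. Keeping [expR t] instead of [expR T] is what allows
    integration in time without a factor [T]. *)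
Let n2 t : 0 <= t <= T -> n t ^+ 2 <= expR t * M ^+ 2.
Proof.
move=> tT; apply: le_trans (energy tT) _; rewrite mulrCA ler_wpM2l ?expR_ge0//.
have G := GamR; apply: (@le_trans _ _ (b ^+ 2 * ((a * C0 * S) ^+ 2 + b ^+ 2 * X ^+ 2))).
  by rewrite ler_wpM2l ?sqr_ge0// lerD// ler_wpM2l ?sqr_ge0.
have aC : 0 <= a * C0 by rewrite mulr_ge0.
rewrite ME KE /energy_const -[X in _ <= X ^+ 2]mulrA [leRHS]exprMn; apply: ler_wpM2l; first exact: sqr_ge0.
move: (a * C0) aC => y y0; rewrite -exprMn.
have h1 : 0 <= y * S by rewrite mulr_ge0.
have h2 : 0 <= b * X by rewrite mulr_ge0.
apply: (@le_trans _ _ ((y * S + b * X) ^+ 2)).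
  by rewrite sqrrD addrAC lerDl mulrn_wge0// mulr_ge0.
rewrite ler_sqr ?nnegrE ?addr_ge0// ?mulr_ge0 ?addr_ge0//.
have h3 : 0 <= y * X by rewrite mulr_ge0.
have h4 : 0 <= b * S by rewrite mulr_ge0.
by rewrite mulrDl !mulrDr; lra.
Qed.

Let nle t : 0 <= t <= T -> n t <= K * delta.
Proof.
move=> tT; rewrite -sM -ler_sqr ?nnegrE; [|exact: n0|exact: mulr_ge0].
apply: le_trans (n2 tT) _.
by rewrite exprMn s2 ler_wpM2r ?sqr_ge0// ler_expR; case/andP: tT.
Qed.

Lemma a_priori_Loo : (norm_LT T +oo n <= (K * delta)%:E)%E.
Proof.
apply: norm_LToo_le; last by rewrite mulr_ge0.
by move=> t tT; rewrite ger0_norm//; apply: nle; exact: Tin.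
Qed.

(** Integrating [expR t * M ^+ 2] gives at most [(s * M) ^+ 2], the same size as the uniform
    bound. *)
Let L2_le (g : R -> R) c : 0 <= c -> (forall t, 0 <= g t) -> (forall t, 0 < t < T -> g t <= c * n t) ->
  (norm_LT T 2 g <= (c * (K * delta))%:E)%E.
Proof.
move=> c0 g0 gn; apply: (@norm_LT2_le _ _ _ (fun t => (c ^+ 2 * M ^+ 2) * expR t `^ 1)).
- by rewrite mulr_ge0// mulr_ge0.
- move=> t tT; rewrite powRr1 ?expR_ge0//; apply: (@le_trans _ _ ((c * n t) ^+ 2)).
    by rewrite ler_sqr ?nnegrE ?mulr_ge0//; exact: gn.
  by rewrite exprMn -mulrA ler_wpM2l ?sqr_ge0// mulrC; apply: n2; exact: Tin.
have cM : 0 <= c ^+ 2 * M ^+ 2 by rewrite mulr_ge0 ?sqr_ge0.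
have [_ _ H] := int_leZ cM (int_le_expR T0 (lexx 1)); apply: le_trans H _.
by rewrite lee_fin powRr1 ?expR_ge0// -s2 -sM !exprMn -mulrA [M ^+ 2 * _]mulrC lexx.
Qed.

Lemma a_priori_L2 : (norm_LT T 2 l <= (K * delta)%:E)%E.
Proof. by rewrite -[K * delta]mul1r; apply: L2_le => // t tT; rewrite mul1r; exact: ln. Qed.

Lemma a_priori_vorticity : (norm_LT T 2 w <= (6 * (K * delta))%:E)%E.
Proof. by apply: L2_le => // t tT; apply: wn; exact: Tin. Qed.

Lemma a_priori_pressure :
  (norm_LT T 2 p <= (pressure_const a b beta nu D c2 c3 K * (delta + delta ^+ 2 + delta `^ r))%:E)%E.
Proof.
have [r2 r3] := andP r23; have r0 : 0 <= r by apply: le_trans r2.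
have [kp kpE] : {x | x = (1 + a * b) / beta} by eexists.
have kp0 : 0 <= kp by rewrite kpE divr_ge0 ?(ltW beta0)// addr_ge0// mulr_ge0.
have [D' D'E] : {x | x = D + 36 * nu} by eexists.
have D'0 : 0 <= D' by rewrite D'E addr_ge0// mulr_ge0.
have [A AE] : {x | x = 1 + D' * K + c2 * K ^+ 2 + c3 * (1 + K) ^+ 3} by eexists.
have -> : pressure_const a b beta nu D c2 c3 K * (delta + delta ^+ 2 + delta `^ r) =
    2 * kp * (A * (delta + delta ^+ 2 + delta `^ r)) by rewrite /pressure_const -D'E -kpE -AE mulrA.
(* A continuous majorant of [p t ^+ 2]: four terms are squared at the cost of a factor 4, and
   [n t ^+ 2] is replaced by [expR t * M ^+ 2], so only exponentials with exponents 1, 2 and [r]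
   remain besides [Gam]. *)
pose psi t := (4 * kp ^+ 2) * (Gam t + (D' ^+ 2 * M ^+ 2) * expR t `^ 1
  + (c2 ^+ 2 * M ^+ 4) * expR t `^ 2 + (c3 ^+ 2 * (M `^ r) ^+ 2) * expR t `^ r).
have dr0 : 0 <= delta `^ r by exact: powR_ge0.
have K10 : 0 <= 1 + K by rewrite addr_ge0.
have A0 : 0 <= A.
  rewrite AE; apply: addr_ge0; [apply: addr_ge0; [apply: addr_ge0 => //|]|]; rewrite mulr_ge0 ?sqr_ge0 ?exprn_ge0//.
have B0 : 0 <= 2 * kp * (A * (delta + delta ^+ 2 + delta `^ r)).
  by rewrite !mulr_ge0// ?addr_ge0// sqr_ge0.
have sqp (x : R) : 0 <= x -> (x `^ r) ^+ 2 = (x ^+ 2) `^ r.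
  by move=> x0; rewrite -(powR_mulrn 2 (powR_ge0 x r)) -(powR_mulrn 2 x0) -!powRrM mulrC.
apply: (@norm_LT2_le _ _ _ psi _ B0) => [t tT|].
  have tT' := Tin tT; have nn := n2 tT'; have n0t := n0 t; have e0 := expR_ge0 t.
  have ple : p t <= kp * (Num.sqrt (Gam t) + D' * n t + c2 * n t ^+ 2 + c3 * n t `^ r).
    have rateE : Num.sqrt (Gam t) + rate 6 nu D c2 c3 r (n t) = Num.sqrt (Gam t) + D' * n t + c2 * n t ^+ 2 + c3 * n t `^ r.
      by rewrite /rate /growth D'E; move: (Num.sqrt _) (n t `^ r) (n t) => *; ring.
    have := pn tT'; rewrite rateE mulrC -ler_pdivlMr// => /le_trans; apply.
    by rewrite mulrAC -kpE lexx.
  apply: (@le_trans _ _ ((kp * (Num.sqrt (Gam t) + D' * n t + c2 * n t ^+ 2 + c3 * n t `^ r)) ^+ 2)).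
    by rewrite ler_sqr ?nnegrE// (le_trans (p0 t)).
  rewrite exprMn /psi [4 * _]mulrC -[leRHS]mulrA; apply: ler_wpM2l; first exact: sqr_ge0.
  apply: le_trans (sqr_sum4 _ _ _ _) _; apply: ler_wpM2l => //.
  rewrite sqr_sqrtr ?Gam0// [(D' * _) ^+ 2]exprMn [(c2 * _) ^+ 2]exprMn [(c3 * _) ^+ 2]exprMn powRr1// powR_mulrn//.
  apply: lerD; [apply: lerD; [apply: lerD|]|].
  - exact: lexx.
  - by rewrite -[leRHS]mulrA; apply: ler_wpM2l; [exact: sqr_ge0|rewrite mulrC].
  - rewrite -[leRHS]mulrA; apply: ler_wpM2l; first exact: sqr_ge0.
    have -> : M ^+ 4 * expR t ^+ 2 = (expR t * M ^+ 2) ^+ 2 by rewrite exprMn -exprM mulrC.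
    by rewrite ler_sqr ?nnegrE// ?sqr_ge0// mulr_ge0// sqr_ge0.
  - rewrite -[leRHS]mulrA; apply: ler_wpM2l; first exact: sqr_ge0.
    rewrite !sqp// mulrC -powRM ?sqr_ge0//.
    apply: ge0_ler_powR => //; rewrite nnegrE; first exact: sqr_ge0.
    by rewrite mulr_ge0// sqr_ge0.
have kk : 0 <= 4 * kp ^+ 2 by rewrite mulr_ge0// sqr_ge0.
have q1 : 0 <= D' ^+ 2 * M ^+ 2 by rewrite mulr_ge0// sqr_ge0.
have q2 : 0 <= c2 ^+ 2 * M ^+ 4 by rewrite mulr_ge0// ?sqr_ge0// exprn_ge0.
have q3 : 0 <= c3 ^+ 2 * (M `^ r) ^+ 2 by rewrite mulr_ge0// sqr_ge0.
have r1 : 1 <= r by apply: le_trans r2; rewrite ler1n.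
have two : 1 <= 2 :> R by rewrite ler1n.
have [_ _ H] := int_leZ kk (int_leD (int_leD (int_leD GamI (int_leZ q1 (int_le_expR T0 (lexx 1))))
  (int_leZ q2 (int_le_expR T0 two))) (int_leZ q3 (int_le_expR T0 r1))).
apply: le_trans H _; rewrite lee_fin powRr1 ?expR_ge0// powR_mulrn ?expR_ge0//.
have -> : expR T `^ r = (s `^ r) ^+ 2 by rewrite sqp// s2.
rewrite -s2.
have -> : X ^+ 2 + D' ^+ 2 * M ^+ 2 * s ^+ 2 + c2 ^+ 2 * M ^+ 4 * (s ^+ 2) ^+ 2 + c3 ^+ 2 * (M `^ r) ^+ 2 * (s `^ r) ^+ 2
  = X ^+ 2 + (D' * (s * M)) ^+ 2 + (c2 * (s * M) ^+ 2) ^+ 2 + (c3 * (s `^ r * M `^ r)) ^+ 2.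
  by clear; move: (s `^ r) (M `^ r) => *; ring.
rewrite -powRM// sM [leRHS]exprMn (_ : 4 * kp ^+ 2 = (2 * kp) ^+ 2); last by rewrite exprMn -natrX.
apply: ler_wpM2l; first exact: sqr_ge0.
rewrite AE; apply: pressure_arith => //; first by rewrite r0.
rewrite deltaE; apply: (@le_trans _ _ (X + S)); first by rewrite lerDl.
by rewrite ler_peMl.
Qed.

End a_priori.

Theorem theorem4p3 (R : realType) :
  exists (CKVr : R -> R -> R -> R -> R -> R -> R -> R)
         (CKVp : R -> R -> R -> R -> R -> R -> R -> R -> R),
  (forall vol irho i4 nu D F kappa, 0 < CKVr vol irho i4 nu D F kappa) /\
  (forall vol irho i4 nu D F kappa beta,
     0 < CKVp vol irho i4 nu D F kappa beta) /\
  forall (d : nat) (Omega : set 'rV[R]_d) (T kappa nu D F rho : R)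
         (irho i4 : R) (Th : seq (vertices R d)) (sigma : R) (k : nat)
         (beta : R) (u0 uh0 : field R d)
         (wh0 : 'rV[R]_d -> 'rV[R]_(nvort d)) (ph0 : 'rV[R]_d -> R)
         (f : R -> functional R d),
  d = 2%N \/ d = 3%N ->
  bounded_lipschitz_domain Omega ->
  0 < T -> 0 < kappa -> 0 < nu -> 0 < D -> 0 < F -> 3 <= rho <= 4 ->
  injection_norm Omega rho = irho%:E ->
  injection_norm Omega 4 = i4%:E ->
  triangulation Omega Th -> shape_regular sigma Th ->
  (1 <= k)%N ->
  0 < beta -> inf_sup Omega Th k beta ->
  solenoidal Omega u0 ->
  compatible_data Omega nu D F rho Th k u0 uh0 wh0 ph0 ->
  W1q T (Hm1 Omega) (norm_Hm1 Omega) 1%:E f ->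
  exists (u : R -> field R d) (w : R -> 'rV[R]_d -> 'rV[R]_(nvort d))
         (p : R -> 'rV[R]_d -> R),
  [/\ solution Omega kappa nu D F rho Th k T f uh0 wh0 u w p,
      forall u' w' p',
        solution Omega kappa nu D F rho Th k T f uh0 wh0 u' w' p' ->
        same_solution Omega T u w p u' w' p',
      (norm_LT T +oo (fun t => norm_H1 Omega (u t))
       + norm_LT T 2%:E (fun t => norm_L2 Omega (u t))
       + norm_LT T 2%:E (fun t => norm_L2 Omega (w t))
       <= (CKVr (volume Omega) irho i4 nu D F kappa)%:E
          * data_size Omega rho T f u0)%E &
      (norm_LT T 2%:E (fun t => norm_L2s Omega (p t))
       <= (CKVp (volume Omega) irho i4 nu D F kappa beta)%:E
          * \sum_(j <- [:: 2; 3; rho]%R)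
              data_size Omega rho T f u0 `^ (j - 1))%E].
Proof.
pose aK (kappa : R) : R := 1 + kappa; pose bK (kappa : R) : R := 1 + kappa^-1.
pose KK irho i4 nu D F kappa := energy_const (aK kappa) (bK kappa) (init_const nu D F irho i4).
pose PP irho i4 nu D F kappa beta := pressure_const (aK kappa) (bK kappa) beta nu D (18 * i4 ^+ 2)
  (2 * F * (1 + irho) ^+ 4) (KK irho i4 nu D F kappa).
(* Adding 1 to an absolute value makes the constants positive for all arguments, including those
   without physical meaning. *)
exists (fun vol irho i4 nu D F kappa => 1 + `|8 * KK irho i4 nu D F kappa|).
exists (fun vol irho i4 nu D F kappa beta => 1 + `|PP irho i4 nu D F kappa beta|).
split; first by move=> *; rewrite ltr_wpDr.
split; first by move=> *; rewrite ltr_wpDr.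
move=> d Omega T kappa nu D F rho irho i4 Th sigma k beta u0 uh0 wh0 ph0 f d23 [oO _ _ bO _] T0 kappa0 nu0 D0 F0 rho34
  Ir I4 tT _ _ beta0 IS su compat Wf.
have d3 : (d <= 3)%N by case: d23 => ->.
have fO := bounded_open_fin oO bO.
have [u [w [p [Gam [sl uq [cG G0 Gae] en [wb pb]]]]]] :=
  discrete_well_posed oO bO tT d3 T0 kappa0 nu0 D0 F0 rho34 Ir I4 beta0 IS compat Wf.
exists u, w, p.
have [r3 r4] := andP rho34.
have r23 : 2 <= rho - 1 <= 3 by apply/andP; split; lra.
set S := norm_H1 Omega u0 + norm_H1 Omega u0 ^+ 2 + norm_H1 Omega u0 `^ (rho - 1).
have S0 : 0 <= S.
  by apply: addr_ge0; [apply: addr_ge0; [exact: (norm_H1_ge0 oO fO)|exact: sqr_ge0]|exact: powR_ge0].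
have sT0 : 0 < Num.sqrt (expR T) by rewrite sqrtr_gt0 expR_gt0.
have N2 := norm_LT2_ge0 T (fun t => norm_Hm1 Omega (f t)).
(* If the norm of [f] is infinite, so is [data_size], and both estimates hold because positive
   multiples and positive powers of [+oo] are [+oo]. *)
case X : (norm_LT T 2%:E (fun t => norm_Hm1 Omega (f t))) N2 => [x| |] // N2; last first.
  have dsE : data_size Omega rho T f u0 = +oo%E.
    by rewrite /data_size X addye// gt0_muley// lte_fin.
  split=> //; rewrite dsE.
    by rewrite gt0_muley ?leey// lte_fin ltr_wpDr.
  have n1 : 2 - 1 != 0 :> R by rewrite gt_eqF//; lra.
  have n2 : 3 - 1 != 0 :> R by rewrite gt_eqF//; lra.
  have n3 : rho - 1 != 0 by rewrite gt_eqF//; lra.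
  by rewrite !big_cons big_nil !poweRyr// adde0 !addye// gt0_muley ?leey// lte_fin ltr_wpDr.
have [delta dE] : {y | y = Num.sqrt (expR T) * (x + S)} by eexists.
have dsE : data_size Omega rho T f u0 = delta%:E by rewrite /data_size X -EFinD -EFinM dE.
have x0 : 0 <= x by rewrite -lee_fin.
have d0 : 0 <= delta by rewrite dE mulr_ge0 ?(ltW sT0)// addr_ge0.
have [sp _ _ _ _] := sl.
have aK0 : 0 <= 1 + kappa by rewrite addr_ge0// ltW.
have bK0 : 0 <= 1 + kappa^-1 by rewrite addr_ge0// invr_ge0 ltW.
have ir0 : 0 <= irho.
  have r0 : 0 < rho by apply: lt_le_trans r3.
  exact: (injection_ge0 oO fO r0 Ir).
have c30 : 0 <= 2 * F * (1 + irho) ^+ 4.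
  by apply: mulr_ge0; [rewrite mulr_ge0// ltW|rewrite exprn_ge0// addr_ge0].
have c20 : 0 <= 18 * i4 ^+ 2 by rewrite mulr_ge0// sqr_ge0.
have C00 : 0 <= init_const nu D F irho i4.
  rewrite /init_const; apply: mulr_ge0; first by rewrite addr_ge0// invr_ge0 ltW.
  apply: addr_ge0 => //; apply: addr_ge0 => //; apply: addr_ge0; last exact: ltW.
  by apply: addr_ge0 => //; exact: ltW.
have Huh0 : Hu Omega Th k uh0 by case: compat => -[].
have Hh := Hu_H1 oO bO Huh0.
have E0le : Eop Omega kappa uh0 uh0 <= ((1 + kappa) * init_const nu D F irho i4 * S) ^+ 2.
  have e1 := snormE_le oO bO kappa0 Huh0; rewrite -(norm_HuE oO bO Huh0) in e1.
  have e2 := init_bound oO bO d3 nu0 D0 F0 rho34 Ir I4 su compat.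
  have e3 := le_trans e1 (ler_wpM2l aK0 e2); rewrite mulrA in e3.
  have e4 : snorm (@eH R d Omega (kappa ^+ 2) d) uh0 ^+ 2 = Eop Omega kappa uh0 uh0.
    exact: (snorm2 (sip_eH oO fO d (sqr_ge0 kappa)) Hh).
  rewrite -e4 ler_sqr ?nnegrE//; first exact: sqrtr_ge0.
  by rewrite mulr_ge0// mulr_ge0.
have n0 t : 0 <= norm_H1 Omega (u t) by exact: (norm_H1_ge0 oO fO).
have l0 t : 0 <= norm_L2 Omega (u t) by exact: sqrtr_ge0.
have w0 t : 0 <= norm_L2 Omega (w t) by exact: sqrtr_ge0.
have p0 t : 0 <= norm_L2s Omega (p t) by exact: sqrtr_ge0.
have ln t : 0 < t < T -> norm_L2 Omega (u t) <= norm_H1 Omega (u t).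
  move=> tT'; have [Ut _ _] : [/\ Hu Omega Th k (u t), Hw Omega Th k (w t) & Hp Omega Th k (p t)].
    by apply: sp; have /andP[/ltW -> /ltW ->] := tT'.
  exact: (norm_L2_le_H1 oO fO (Hu_H1 oO bO Ut)).
have KE : KK irho i4 nu D F kappa = energy_const (1 + kappa) (1 + kappa^-1) (init_const nu D F irho i4) by [].
have K0 : 0 <= KK irho i4 nu D F kappa by rewrite KE /energy_const mulr_ge0// addr_ge0// mulr_ge0.
have B1 := a_priori_Loo aK0 bK0 C00 S0 E0le cG G0 Gae X n0 en KE erefl dE erefl.
have B2 := a_priori_L2 T0 aK0 bK0 C00 S0 E0le cG G0 Gae X n0 en l0 ln KE erefl dE erefl.
have B3 := a_priori_vorticity T0 aK0 bK0 C00 S0 E0le cG G0 Gae X n0 en w0 wb KE erefl dE erefl.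
have B4 := a_priori_pressure T0 aK0 bK0 C00 beta0 (ltW nu0) (ltW D0) c20 c30 r23 S0 E0le cG G0 Gae X n0 en p0 pb KE erefl dE erefl.
split=> //; rewrite dsE.
  apply: le_trans (leeD (leeD B1 B2) B3) _; rewrite -!EFinD -EFinM lee_fin.
  (* 8 = 1 + 1 + 6: the uniform norm, the L2 norm of the velocity, and the vorticity with its curl
     constant. *)
  rewrite (_ : _ + _ + _ = 8 * KK irho i4 nu D F kappa * delta); last by move: (KK _ _ _ _ _ _) => K; ring.
  by apply: ler_wpM2r => //; apply: le_trans (ler_norm _) _; rewrite lerDr.
apply: le_trans B4 _.
rewrite !big_cons big_nil adde0 !poweR_EFin -!EFinD -EFinM lee_fin.
have -> : delta `^ (2 - 1) + (delta `^ (3 - 1) + delta `^ (rho - 1)) = delta + delta ^+ 2 + delta `^ (rho - 1).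
  have -> : 2 - 1 = 1 :> R by ring.
  have -> : 3 - 1 = 2 :> R by ring.
  by rewrite powRr1// powR_mulrn// addrA.
apply: ler_wpM2r; first by rewrite !addr_ge0// ?sqr_ge0// powR_ge0.
by apply: le_trans (ler_norm _) _; rewrite lerDr.
Qed.
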